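(* Let $I$ be an open interval. (1) For a generic curve $\gamma : I \to \mathbb{R}P^3$ in the $C^\infty$-topology, the curve $\gamma$ is of finite type at each point of $I$, and the tangent variety $\mathrm{Tan}(\gamma)$ to $\gamma$ at each point of $I$ is locally diffeomorphic to the cuspidal edge or to the folded umbrella (cuspidal cross cap). (2) Let $N+1 \geq 4$. For a generic curve $\gamma : I \to \mathbb{R}P^{N+1}$ in the $C^\infty$-topology, the curve $\gamma$ is of finite type at each point of $I$, and the tangent variety $\mathrm{Tan}(\gamma)$ to $\gamma$ at each point of $I$ is locally diffeomorphic to the cuspidal edge.
   Context: All manifolds and maps are $C^\infty$. ''For a generic curve'' means: there is an open dense subset $\mathcal{O} \subset C^\infty(I, \mathbb{R}P^{N+1})$, in the (Whitney) $C^\infty$-topology, such that every $\gamma\in\mathcal{O}$ has the stated property. Finite type and type. Write a curve $\gamma$ in $\mathbb{R}P^m$ near $t_0$ in projective (affine) local coordinates centred at $\gamma(t_0)$, and let $W_k(t) = (\gamma'(t),\dots,\gamma^{(k)}(t))$, an $m\times k$ matrix, $1\le k\le\infty$. The curve is of finite type at $t_0$ if $W_\infty(t_0)$ has rank $m$; then with $a_i = \min\{k : \mathrm{rank}\, W_k(t_0) = i\}$ it is said to be of type $(a_1,\dots,a_m)$ at $t_0$. Tangent variety. If $\gamma$ is of type $(a_1,\dots,a_m)$ at $t_0$, the tangent variety at $t_0$ is the parametrised variety given by the map-germ at $(s,t) = (0,t_0)$, $\mathrm{Tan}(\gamma)(s,t) = \gamma(t) + s\,\dfrac{1}{(t-t_0)^{a_1-1}}\gamma'(t)$,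 in these coordinates. Diffeomorphism of germs. Map-germs $f:(N,a)\to(M,b)$ and $f':(N',a')\to(M',b')$ are diffeomorphic (right-left equivalent) if there are diffeomorphism-germs $\sigma:(N,a)\to(N',a')$ and $\tau:(M,b)\to(M',b')$ with $f'\circ\sigma=\tau\circ f$. ''Locally diffeomorphic'' refers to this relation between the tangent map-germ and the model. Models. Cuspidal edge $(\mathbb{R}^2,0)\to(\mathbb{R}^{N+1},0)$, $N+1\ge 3$: $(u,x)\mapsto(u,x^2,x^3,0,\dots,0)$. Folded umbrella $(\mathbb{R}^2,0)\to(\mathbb{R}^3,0)$: $(t,s)\mapsto(t+s,\ t^2+2st,\ t^4+4st^3)$. *)

(* Defs.v *)
From HB Require Import structures.
From mathcomp Require Import all_boot all_order all_algebra.
From mathcomp Require Import all_classical all_reals all_analysis.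

Set Implicit Arguments.
Unset Strict Implicit.
Unset Printing Implicit Defensive.

Import Order.TTheory GRing.Theory Num.Theory.
Import numFieldNormedType.Exports.

Local Open Scope classical_set_scope.
Local Open Scope ring_scope.

(* [class_on k U f]: f is C^k on U; U is meant to be open and V, W finite
   dimensional, where continuity of all iterated directional derivatives is the
   usual notion. *)
Fixpoint class_on (R : realType) (V W : normedModType R) (k : nat)
    (U : set V) (f : V -> W) : Prop :=
  match k with
  | 0 => forall x, U x -> {for x, continuous f}
  | k'.+1 => (forall x, U x -> differentiable f x) /\
             (forall v, class_on k' U ('D_v f))
  end.

Definition smooth_on (R : realType) (V W : normedModType R)
    (U : set V) (f : V -> W) : Prop :=
  forall k, class_on k U f.

(* s represents a diffeomorphism-germ (V, a) -> (V', a'). *)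
Definition diffeo_germ (R : realType) (V V' : normedModType R)
    (s : V -> V') (a : V) (a' : V') : Prop :=
  exists (s' : V' -> V) (U : set V) (U' : set V'),
    [/\ [/\ open U, U a, open U', U' a' & s a = a'],
        (forall x, U x -> U' (s x) /\ s' (s x) = x),
        (forall y, U' y -> U (s' y) /\ s (s' y) = y),
        smooth_on U s & smooth_on U' s'].

(* The map-germs of f at a and of f' at a' are right-left equivalent. *)
Definition germ_diffeomorphic (R : realType) (V W V' W' : normedModType R)
    (f : V -> W) (a : V) (f' : V' -> W') (a' : V') : Prop :=
  exists (s : V -> V') (t : W -> W'),
    [/\ diffeo_germ s a a', diffeo_germ t (f a) (f' a') &
        \forall x \near a, f' (s x) = t (f x)].

(* Real projective m-space, as the set of lines through the origin of
   R^(m+1). *)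
Definition RP (R : realType) (m : nat) : Type :=
  {L : {vspace 'rV[R]_m.+1} | \dim L == 1%N}.

(* An invertible matrix A gives homogeneous coordinates
   [w_0 : ... : w_m] = v *m A, where v spans the line, and affine coordinates
   (w_1/w_0, ..., w_m/w_0) on the set w_0 <> 0; neither depends on the choice
   of v. *)
Definition hom_coord (R : realType) (m : nat) (A : 'M[R]_m.+1) (L : RP R m) :
  'rV[R]_m.+1 := vpick (sval L) *m A.

Definition chart_dom (R : realType) (m : nat) (A : 'M[R]_m.+1) :
  set (RP R m) := [set L | hom_coord A L 0 0 != 0].

Definition chart (R : realType) (m : nat) (A : 'M[R]_m.+1) (L : RP R m) :
  'rV[R]_m := \row_(j < m) (hom_coord A L 0 (lift ord0 j) / hom_coord A L 0 0).

Definition centred_chart (R : realType) (m : nat) (A : 'M[R]_m.+1)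
    (L : RP R m) : Prop :=
  [/\ A \in unitmx, chart_dom A L & chart A L = 0].

(* The coordinate expression of c, extended by 0 outside I. *)
Definition coords (R : realType) (I : set R) (m : nat) (A : 'M[R]_m.+1)
    (c : I -> RP R m) : R -> 'rV[R]_m :=
  'valL_0 (fun t : I => chart A (c t)).

Definition coords_dom (R : realType) (I : set R) (m : nat) (A : 'M[R]_m.+1)
    (c : I -> RP R m) : set R :=
  [set set_val t | t in [set t : I | chart_dom A (c t)]].

Definition smooth_to_RP (R : realType) (I : set R) (m : nat)
    (c : I -> RP R m) : Prop :=
  forall t0, I t0 -> exists (A : 'M[R]_m.+1) (U : set R),
    [/\ A \in unitmx, open U, U t0, U `<=` coords_dom A c &
        smooth_on U (coords A c)].

Record smooth_curve (R : realType) (I : set R) (m : nat) := SmoothCurve {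
  curve_fun :> I -> RP R m ;
  curve_smooth : smooth_to_RP curve_fun }.

HB.instance Definition _ (R : realType) (I : set R) (m : nat) :=
  gen_eqMixin (smooth_curve I m).
HB.instance Definition _ (R : realType) (I : set R) (m : nat) :=
  gen_choiceMixin (smooth_curve I m).

(* The sets N^r(c; (K_i), (A_i), (e_i)) of the Whitney (strong) C^oo topology:
   the curves whose coordinate expressions are e_i-close to that of c on K_i
   together with all derivatives of order at most r, where (K_i) is a locally
   finite family of compact subsets of I. They generate the topology, and
   countable families suffice because I is sigma-compact. *)
Definition whitney_basic (R : realType) (I : set R) (m : nat) :
    set (set (smooth_curve I m)) :=
  [set B | exists (c : smooth_curve I m) (r : nat) (K : nat -> set R)
      (A : nat -> 'M[R]_m.+1) (e : nat -> R),
    [/\ (forall i, compact (K i) /\ K i `<=` I),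
        (forall t, I t -> exists2 U, nbhs t U &
           finite_set [set i | K i `&` U !=set0]),
        (forall i, A i \in unitmx /\ K i `<=` coords_dom (A i) c),
        (forall i, 0 < e i) &
        B = [set g : smooth_curve I m | forall i,
               K i `<=` coords_dom (A i) g /\
               forall k t, (k <= r)%N -> K i t ->
                 `|derive1n k (coords (A i) g) t -
                   derive1n k (coords (A i) c) t| < e i]]].

HB.instance Definition _ (R : realType) (I : set R) (m : nat) :=
  @isSubBaseTopological.Build (smooth_curve I m) (set (smooth_curve I m))
    (@whitney_basic R I m) id.

Definition generic (R : realType) (I : set R) (m : nat)
    (P : set (smooth_curve I m)) : Prop :=
  exists O : set (smooth_curve I m), [/\ open O, dense O & O `<=` P].

(* The matrix W_k(t) = (f'(t), ..., f^(k)(t)). *)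
Definition deriv_mx (R : realType) (m : nat) (f : R -> 'rV[R]_m) (k : nat)
    (t : R) : 'M[R]_(m, k) :=
  \matrix_(i < m, j < k) (derive1n j.+1 f t) 0 i.

(* W_oo(t0) has rank m iff some W_k(t0) does. *)
Definition finite_type_at (R : realType) (m : nat) (f : R -> 'rV[R]_m)
    (t0 : R) : Prop :=
  exists k, \rank (deriv_mx f k t0) = m.

Definition type_at (R : realType) (m : nat) (f : R -> 'rV[R]_m) (t0 : R)
    (a : m.-tuple nat) : Prop :=
  finite_type_at f t0 /\
  forall i : 'I_m,
    \rank (deriv_mx f (tnth a i) t0) = i.+1 /\
    forall k, \rank (deriv_mx f k t0) = i.+1 -> (tnth a i <= k)%N.

Definition vec2 (R : realType) (x y : R) : 'rV[R]_2 :=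
  \row_(i < 2) (if i == 0 then x else y).

(* The direction f'(t) / (t - t0)^(a1 - 1), with its limit value at t0. *)
Definition tan_dir (R : realType) (m : nat) (f : R -> 'rV[R]_m) (t0 : R)
    (a1 : nat) (t : R) : 'rV[R]_m :=
  let q u := (u - t0) ^- a1.-1 *: derive1 f u in
  if t == t0 then lim (q u @[u --> t0^']) else q t.

(* p = (s, t); only the germ at (0, t0) matters. *)
Definition tan_map (R : realType) (m : nat) (f : R -> 'rV[R]_m) (t0 : R)
    (a : m.-tuple nat) (p : 'rV[R]_2) : 'rV[R]_m :=
  f (p 0 1) + p 0 0 *: tan_dir f t0 (nth 0%N a 0) (p 0 1).

Definition cuspidal_edge (R : realType) (m : nat) (p : 'rV[R]_2) : 'rV[R]_m :=
  \row_(j < m) match val j with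
               | 0 => p 0 0
               | 1 => p 0 1 ^+ 2
               | 2 => p 0 1 ^+ 3
               | _ => 0
               end.

Definition folded_umbrella (R : realType) (p : 'rV[R]_2) : 'rV[R]_3 :=
  let t := p 0 0 in let s := p 0 1 in
  \row_(j < 3) match val j with
               | 0 => t + s
               | 1 => t ^+ 2 + 2 * s * t
               | _ => t ^+ 4 + 4 * s * t ^+ 3
               end.

Definition finite_type (R : realType) (I : set R) (m : nat)
    (c : smooth_curve I m) (t0 : I) : Prop :=
  forall A, centred_chart A (c t0) -> finite_type_at (coords A c) (set_val t0).

(* The tangent variety of c at t0 is locally diffeomorphic to the germ at the
   origin of M. *)
Definition tan_diffeomorphic (R : realType) (I : set R) (m : nat)
    (c : smooth_curve I m) (t0 : I) (M : 'rV[R]_2 -> 'rV[R]_m) : Prop :=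
  forall A, centred_chart A (c t0) -> exists a : m.-tuple nat,
    type_at (coords A c) (set_val t0) a /\
    germ_diffeomorphic (tan_map (coords A c) (set_val t0) a)
      (vec2 0 (set_val t0)) M 0.

Lemma centred_chart_exists (R : realType) (m : nat) (L : RP R m) :
  exists A, centred_chart A L.
Proof.
have v0 : vpick (sval L) != 0.
  by rewrite vpick0 -dimv_eq0 (eqP (svalP L)).
set v := vpick (sval L) in v0 *.
have [B Bu vB] : exists2 B : 'M[R]_m.+1, B \in unitmx & v *m B = delta_mx 0 0.
  exists (invmx (row_ebase v) *m (col_ebase v 0 0)^-1%:M).
    rewrite unitmx_mul unitmx_inv row_ebase_unit /=.
    have := col_ebase_unit v; rewrite unitmxE det_mx11 unitfE => c0.
    by rewrite unitmxE det_scalar unitrX // unitrV unitfE.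
  have := mulmx_ebase v; rewrite rank_rV v0 => {1}<-.
  have := col_ebase_unit v; rewrite unitmxE det_mx11 unitfE => c0.
  rewrite mulmxA mulmxK ?row_ebase_unit // mul_mx_scalar.
  apply/matrixP => i j; rewrite !mxE big_ord1 !mxE !ord1 andbT ?eqxx /=.
  have -> : (0%N == j) = (j == 0) by rewrite eq_sym.
  by case: eqP => _; rewrite ?mulr1 ?mulr0 ?mulVf.
have cB : hom_coord B L = delta_mx 0 0 by rewrite -vB.
exists B; split=> //; first by rewrite /chart_dom /= cB mxE !eqxx oner_eq0.
by apply/rowP => j; rewrite /chart cB !mxE /= mul0r.
Qed.

(* Main.v *)
(* Call a curve good at t if the Wronskian of a local lift to R^(m+1) \ 0 has at most a
   simple zero at t; the type is then (1, .., m) or (1, .., m-1, m+1).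

   Good curves form an open set, because goodness is the non-vanishing of one of two
   determinants in the (m+1)-jet. They are dense: a lift v is perturbed to
   v + h(t) C(t) v, where h > 0 is smooth and small and C is a matrix of polynomials
   with bounded coefficients. The components are treated one after the other. Each
   replaces a Wronskian F by F + sum_s c_s g_s, where the g_s have no common zero, and by
   Sard's theorem in dimension 1 this has only simple zeros for almost all c.

   For the normal forms, take u = f_0(t) + s f_0'(t) as a coordinate. The other
   components H_j(u, s) of f + s f' satisfy dH_j/ds = s w_j, so that in a suitable
   coordinate x, by Whitney's theorem on even functions and a change of coordinates in
   the target, the map becomes (u, x^2, x^3 B_j(u, x^2)), where B_j(u, 0) is a
   combination of a minor of (f', f'') and of its derivative. If some B_j(0) <> 0, this
   is a cuspidal edge. In the remaining case m = 3 and dB/du(0) <> 0; both this germ and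
   the folded umbrella are then equivalent to (u, x^2, u x^3). *)

Require Import Defs.
From HB Require Import structures.
From mathcomp Require Import all_boot all_order all_algebra.
From mathcomp Require Import all_classical all_reals all_analysis.
From mathcomp Require Import ring lra zify.
Import Order.TTheory GRing.Theory Num.Theory.
Import numFieldNormedType.Exports.
Local Open Scope classical_set_scope.
Local Open Scope ring_scope.
Set Implicit Arguments.
Unset Strict Implicit.
Unset Printing Implicit Defensive.

(** * Smooth maps *)

(** The coefficients of C are found after h, by a measure argument that controls nothing but their
    bound 1; so h must be small enough for all such coefficients at once, and every estimate is
    uniform in C. One choice of C must also serve the whole interval. Hence the perturbation is
    linear in v, so that it acts on lines, and m + 1 global sections replace an atlas, so that
    finitely many Wronskians occur.

    Polynomials, not constants, are needed because (s - t)^j v(s) has its jet at t concentrated in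
    order j, which isolates a cofactor of the last column of a Wronskian. A simple zero of the
    Wronskian of the first components says that one of the last two cofactors of the next Wronskian
    is non-zero: this is why the g_s have no common zero.

    The nonlinear changes of coordinates alter one coordinate or have explicit inverses, so inverse
    functions reduce to one scalar equation. For even functions e(u, x), the point is to extend e(u,
    sqrt y) smoothly to y < 0; an explicit functional imitating evaluation at imaginary x does this
    with the parameter u. *)

Lemma differentiable_epsP (R : realType) (V W : normedModType R) (f : V -> W) x :
  differentiable f x ->
  forall e, 0 < e -> \forall h \near (0 : V),
    `|f (h + x) - f x - 'd f x h| <= e * `|h|.
Proof.
move=> /diff_locally dfx; move: (dfx) => /eqaddoP dfx' e e0.
have := dfx' e e0; apply: filter_app; near=> h.
by rewrite /= !fctE opprD addrA.
Unshelve. all: by end_near. Qed.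

Lemma is_diff_eps (R : realType) (V W : normedModType R) (f : V -> W)
    (L : {linear V -> W}) x :
  continuous L ->
  (forall e, 0 < e -> \forall h \near (0 : V),
    `|f (h + x) - f x - L h| <= e * `|h|) ->
  is_diff x f L.
Proof.
move=> Lc fL.
have fo : f \o shift x = cst (f x) + L +o_ 0 id.
  apply/eqaddoP => e e0; have := fL e e0; apply: filter_app; near=> h.
  by rewrite /= !fctE opprD addrA.
have dE := diff_unique Lc fo.
apply: DiffDef; last exact: dE.
by apply/diff_locallyP; rewrite dE.
Unshelve. all: by end_near. Qed.

Lemma near_eq_differentiable (R : realType) (V W : normedModType R)
    (f g : V -> W) x :
  (\forall y \near x, f y = g y) -> differentiable f x -> differentiable g x.
Proof.
move=> fg df; suff H : is_diff x g ('d f x) by exact: ex_diff.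
apply: (is_diff_eps (diff_continuous df)) => e e0; have := differentiable_epsP df e0; apply: filter_app.
have fgx : f x = g x by exact: nbhs_singleton fg.
have : \forall h \near (0 : V), f (h + x) = g (h + x).
  by move: fg; rewrite (near_shift 0) /= subr0.
by apply: filter_app; near=> h => ->; rewrite fgx.
Unshelve. all: by end_near. Qed.

Section ClassOn.
Variables (R : realType).
Implicit Types (V W : normedModType R).

Lemma class_on_ext V W (U : set V) (f g : V -> W) k : open U ->
  {in U, f =1 g} -> class_on k U f -> class_on k U g.
Proof.
move=> oU; elim: k f g => [|k IH] f g fg /=.
  move=> fc x Ux; have nfg : \forall y \near x, f y = g y.
    by have := open_nbhs_nbhs (conj oU Ux); apply: filterS => y Uy; apply: fg; rewrite inE.
  rewrite /prop_for /continuous_at -(nbhs_singleton nfg).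
  by apply: cvg_trans (fc x Ux); apply: near_eq_cvg.
move=> [df Df]; split=> [x Ux|v].
  apply: near_eq_differentiable (df x Ux).
  by have := open_nbhs_nbhs (conj oU Ux); apply: filterS => y Uy; apply: fg; rewrite inE.
apply: IH (Df v) => x /set_mem Ux; apply: near_eq_derive.
by have := open_nbhs_nbhs (conj oU Ux); apply: filterS => y Uy; apply: fg; rewrite inE.
Qed.

Lemma smooth_on_ext V W (U : set V) (f g : V -> W) : open U ->
  {in U, f =1 g} -> smooth_on U f -> smooth_on U g.
Proof. by move=> oU fg sf k; apply: class_on_ext (sf k). Qed.

Lemma class_on_sub V W (U U' : set V) (f : V -> W) k : U' `<=` U ->
  class_on k U f -> class_on k U' f.
Proof.
move=> UU; elim: k f => [|k IH] f /=; first by move=> fc x /UU; exact: fc.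
by move=> [df Df]; split=> [x /UU/df//|v]; apply: IH.
Qed.

Lemma smooth_on_sub V W (U U' : set V) (f : V -> W) : U' `<=` U ->
  smooth_on U f -> smooth_on U' f.
Proof. by move=> UU sf k; apply: class_on_sub (sf k). Qed.

Lemma class_onW V W (U : set V) (f : V -> W) k :
  class_on k.+1 U f -> class_on k U f.
Proof.
elim: k f => [|k IH] f; first by move=> [df _] x /df; exact: differentiable_continuous.
by move=> [df Df]; split=> // v; apply: IH.
Qed.

Lemma smooth_on_differentiable V W (U : set V) (f : V -> W) x :
  smooth_on U f -> U x -> differentiable f x.
Proof. by move=> /(_ 1%N)[+ _]; exact. Qed.

Lemma smooth_on_continuous V W (U : set V) (f : V -> W) x :
  smooth_on U f -> U x -> {for x, continuous f}.
Proof. by move=> /(_ 0%N); exact. Qed.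

Lemma smooth_on_derive V W (U : set V) (f : V -> W) v :
  smooth_on U f -> smooth_on U ('D_v f).
Proof. by move=> sf k; have [_] := sf k.+1; exact. Qed.

Lemma smooth_on_bigcup V W I (U : I -> set V) (f : V -> W) :
  (forall i, smooth_on (U i) f) -> smooth_on (\bigcup_i U i) f.
Proof.
move=> sf k; have {sf} : forall i, class_on k (U i) f by move=> i; exact: sf.
elim: k f => [|k IH] f sf /=; first by move=> x [i _ Uix]; exact: (sf i).
split=> [x [i _ Ux]|v]; first by have [df _] := sf i; exact: df.
by apply: IH => i; have [_ Df] := sf i; exact: Df.
Qed.

Lemma smooth_on_cst V W (U : set V) (a : W) : smooth_on U (cst a).
Proof.
move=> k; elim: k a => [|k IH] a /=; first by move=> x _; exact: cst_continuous.
split=> [x _|v]; first exact: differentiable_cst.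
have -> : 'D_v (cst a : V -> W) = cst 0 by apply/funext => x; rewrite derive_cst.
exact: IH.
Qed.

Lemma smooth_on_id V (U : set V) : smooth_on U (@id V).
Proof.
move=> [|k]; first by move=> x _; exact: cvg_id.
split=> [x _|v]; first exact: ex_diff.
have -> : 'D_v id = (cst v : V -> V) by apply/funext => x; rewrite derive_id.
exact: smooth_on_cst.
Qed.

Lemma class_onD V W (U : set V) (f g : V -> W) k : open U ->
  class_on k U f -> class_on k U g -> class_on k U (f + g).
Proof.
move=> oU; elim: k f g => [|k IH] f g /=.
  by move=> fc gc x Ux; apply: continuousD; [exact: fc|exact: gc].
move=> [df Df] [dg Dg]; split=> [x Ux|v].
  by apply: differentiableD; [exact: df|exact: dg].
apply: class_on_ext (IH _ _ (Df v) (Dg v)) => // x /set_mem Ux.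
by rewrite deriveD //; apply: diff_derivable; [exact: df|exact: dg].
Qed.

Lemma smooth_onD V W (U : set V) (f g : V -> W) : open U ->
  smooth_on U f -> smooth_on U g -> smooth_on U (f + g).
Proof. by move=> oU sf sg k; apply: class_onD. Qed.

Lemma class_onM V (U : set V) (f g : V -> R) k : open U ->
  class_on k U f -> class_on k U g -> class_on k U (fun x => f x * g x).
Proof.
move=> oU; elim: k f g => [|k IH] f g /=.
  by move=> ac fc x Ux; apply: continuousM; [exact: ac|exact: fc].
move=> [df Df] [dg Dg]; split=> [x Ux|v].
  by apply: differentiableM; [exact: df|exact: dg].
have Df' := class_onW (conj df Df : class_on k.+1 U f).
have Dg' := class_onW (conj dg Dg : class_on k.+1 U g).
apply: class_on_ext (class_onD oU (IH _ _ Df' (Dg v)) (IH _ _ Dg' (Df v))) => //.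
move=> x /set_mem Ux; rewrite deriveM //; apply: diff_derivable; [exact: df|exact: dg].
Qed.

Lemma smooth_onM V (U : set V) (f g : V -> R) : open U ->
  smooth_on U f -> smooth_on U g -> smooth_on U (fun x => f x * g x).
Proof. by move=> oU sf sg k; apply: class_onM. Qed.

Lemma smooth_onZ V W (U : set V) (a : R) (f : V -> W) : open U ->
  smooth_on U f -> smooth_on U (fun x => a *: f x).
Proof.
move=> oU sf k; have {sf} := sf k; elim: k f => [|k IH] f /=.
  by move=> fc x Ux; apply: continuousZl_tmp; exact: fc.
move=> [df Df]; split=> [x Ux|v]; first by apply: differentiableZ; exact: df.
apply: class_on_ext (IH _ (Df v)) => // x /set_mem Ux.
by rewrite deriveZ //; apply: diff_derivable; exact: df.
Qed.

Lemma smooth_onN V W (U : set V) (f : V -> W) : open U ->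
  smooth_on U f -> smooth_on U (- f).
Proof.
move=> oU /(smooth_onZ (-1) oU); apply: smooth_on_ext => // x _ /=.
by rewrite scaleN1r.
Qed.

Lemma smooth_onB V W (U : set V) (f g : V -> W) : open U ->
  smooth_on U f -> smooth_on U g -> smooth_on U (f - g).
Proof. by move=> oU sf sg; apply: smooth_onD => //; exact: smooth_onN. Qed.

Lemma class_on_sum V W (I : Type) (r : seq I) (P : pred I) (U : set V)
    (f : I -> V -> W) k : open U ->
  (forall i, P i -> class_on k U (f i)) ->
  class_on k U (fun x => \sum_(i <- r | P i) f i x).
Proof.
move=> oU sf; elim: r => [|i r IH].
  by apply: class_on_ext (@smooth_on_cst _ _ U 0 k) => // x _; rewrite big_nil.
case Pi : (P i); last first.
  by apply: class_on_ext IH => // x _; rewrite big_cons Pi.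
by apply: class_on_ext (class_onD oU (sf i Pi) IH) => // x _; rewrite big_cons Pi.
Qed.

Lemma smooth_on_sum V W (I : Type) (r : seq I) (P : pred I) (U : set V)
    (f : I -> V -> W) : open U ->
  (forall i, P i -> smooth_on U (f i)) ->
  smooth_on U (fun x => \sum_(i <- r | P i) f i x).
Proof. by move=> oU sf k; apply: class_on_sum => // i Pi; exact: sf. Qed.

Lemma smooth_on_prod V (I : Type) (r : seq I) (P : pred I) (U : set V)
    (f : I -> V -> R) : open U ->
  (forall i, P i -> smooth_on U (f i)) ->
  smooth_on U (fun x => \prod_(i <- r | P i) f i x).
Proof.
move=> oU sf; elim: r => [|i r IH].
  apply: (@smooth_on_ext _ _ _ (cst (1 : R))) => //; last exact: smooth_on_cst.
  by move=> x _; rewrite big_nil.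
case Pi : (P i); last first.
  by apply: smooth_on_ext IH => // x _; rewrite big_cons Pi.
by apply: smooth_on_ext (smooth_onM oU (sf i Pi) IH) => // x _; rewrite big_cons Pi.
Qed.

Lemma smooth_onX V (U : set V) (f : V -> R) n : open U ->
  smooth_on U f -> smooth_on U (fun x => f x ^+ n).
Proof.
move=> oU sf; elim: n => [|n IH].
  exact: (@smooth_on_cst _ _ U (1 : R)).
by apply: smooth_on_ext (smooth_onM oU sf IH) => // x _; rewrite exprS.
Qed.

Lemma smooth_onV V (U : set V) (f : V -> R) : open U ->
  smooth_on U f -> (forall x, U x -> f x != 0) -> smooth_on U (fun x => (f x)^-1).
Proof.
move=> oU sf f0 k; elim: k => [|k IH].
  by move=> x Ux; apply: continuousV; [exact: f0|exact: (smooth_on_continuous sf)].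
split=> [x Ux|v].
  by apply: differentiableV; [exact: (smooth_on_differentiable sf)|exact: f0].
have sfv := smooth_onN oU (smooth_on_derive v sf).
apply: class_on_ext (class_onM oU (class_onM oU IH IH) (sfv k)) => // x /set_mem Ux.
rewrite (@deriveV R _ f) //; last 2 first.
- exact: f0.
- exact/diff_derivable/(smooth_on_differentiable sf).
by rewrite fctE -[- _ *: _]/(- _ * _) -invfM -expr2 mulrN mulNr.
Qed.

Lemma smooth_on_div V (U : set V) (f g : V -> R) : open U ->
  smooth_on U f -> smooth_on U g -> (forall x, U x -> g x != 0) ->
  smooth_on U (fun x => f x / g x).
Proof. by move=> oU sf sg g0; apply: smooth_onM => //; exact: smooth_onV. Qed.

Lemma rV_coordE V n (f : V -> 'rV[R]_n) x :
  f x = \sum_(i < n) f x 0 i *: delta_mx 0 i.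
Proof. exact: row_sum_delta. Qed.

Lemma derive_coord V n (f : V -> 'rV[R]_n) x v i : differentiable f x ->
  'D_v (fun y => f y 0 i) x = 'D_v f x 0 i.
Proof. by move=> /diff_derivable df; rewrite derive_mx // mxE. Qed.

Lemma class_on_coord V n (U : set V) (f : V -> 'rV[R]_n) i k : open U ->
  class_on k U f -> class_on k U (fun x => f x 0 i).
Proof.
move=> oU; elim: k f => [|k IH] f /=.
  move=> fc x Ux; apply: (@continuous_comp _ _ _ f (fun M : 'rV[R]_n => M 0 i)).
    exact: fc.
  exact: coord_continuous.
move=> [df Df]; split=> [x Ux|v].
  apply: (@differentiable_comp _ _ _ _ f (fun M : 'rV[R]_n => M 0 i)); first exact: df.
  exact: differentiable_coord.
apply: class_on_ext (IH _ (Df v)) => // x /set_mem Ux.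
by rewrite derive_coord //; exact: df.
Qed.

Lemma smooth_on_coord V n (U : set V) (f : V -> 'rV[R]_n) i : open U ->
  smooth_on U f -> smooth_on U (fun x => f x 0 i).
Proof. by move=> oU sf k; exact: class_on_coord oU (sf k). Qed.

Lemma class_on_scalel V W (U : set V) (f : V -> R) (a : W) k : open U ->
  class_on k U f -> class_on k U (fun x => f x *: a).
Proof.
move=> oU; elim: k f => [|k IH] f /=.
  by move=> fc x Ux; apply: continuousZr_tmp; exact: fc.
move=> [df Df]; split=> [x Ux|v]; first by apply: differentiableZl; exact: df.
apply: class_on_ext (IH _ (Df v)) => // x /set_mem Ux.
rewrite [RHS]deriveE; last by apply: differentiableZl; exact: df.
by rewrite diffZl ?deriveE //; exact: df.
Qed.

Lemma smooth_on_scalel V W (U : set V) (f : V -> R) (a : W) : open U ->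
  smooth_on U f -> smooth_on U (fun x => f x *: a).
Proof. by move=> oU sf k; exact: class_on_scalel oU (sf k). Qed.

Lemma smooth_on_row V n (U : set V) (f : V -> 'rV[R]_n) : open U ->
  (forall i, smooth_on U (fun x => f x 0 i)) -> smooth_on U f.
Proof.
move=> oU sf; apply: (@smooth_on_ext _ _ _
    (fun x => \sum_(i < n) f x 0 i *: delta_mx 0 i)) => //.
  by move=> x _; rewrite -rV_coordE.
by apply: smooth_on_sum => // i _; exact: smooth_on_scalel.
Qed.

Lemma derive_delta W n (g : 'rV[R]_n -> W) y w : differentiable g y ->
  'D_w g y = \sum_(i < n) w 0 i *: 'D_(delta_mx 0 i) g y.
Proof.
move=> dg; rewrite deriveE // {1}[w]row_sum_delta linear_sum /=.
by apply: eq_bigr => i _; rewrite linearZ /= deriveE.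
Qed.

Lemma derive_chain V W W' (f : V -> W) (g : W -> W') x v :
  differentiable f x -> differentiable g (f x) ->
  'D_v (g \o f) x = 'D_('D_v f x) g (f x).
Proof.
move=> df dg; rewrite (deriveE v (differentiable_comp df dg)) diff_comp //.
by rewrite (deriveE _ dg) (deriveE v df).
Qed.

(** The chain rule expresses D_v (g \o f) through the coordinates of D_v f and the partial
    derivatives of [g], so the induction varies [g]. The inner map is only C^k: inverse maps are
    bootstrapped this way, from C^k to C^(k+1). *)
Lemma class_on_comp V n (U : set V) (U' : set 'rV[R]_n) (f : V -> 'rV[R]_n)
    (g : 'rV[R]_n -> R) k : open U -> (forall x, U x -> U' (f x)) ->
  class_on k U f -> smooth_on U' g -> class_on k U (g \o f).
Proof.
move=> oU fU + sg; elim: k g sg => [|k IH] g sg.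
  move=> sf x Ux; apply: continuous_comp; first exact: sf.
  exact: (smooth_on_continuous sg) (fU _ Ux).
move=> cf; have cf' := class_onW cf; case: cf => [df Df].
split=> [x Ux|v].
  apply: differentiable_comp; first exact: df.
  exact: (smooth_on_differentiable sg) (fU _ Ux).
have H i : class_on k U (fun x => 'D_v f x 0 i * ('D_(delta_mx 0 i) g \o f) x).
  apply: class_onM => //; last exact: IH (smooth_on_derive _ sg) _.
  exact: class_on_coord oU (Df v).
have Hs (r : seq 'I_n) : class_on k U
    (fun x => \sum_(i <- r) 'D_v f x 0 i * ('D_(delta_mx 0 i) g \o f) x).
  elim: r => [|i r IHr].
    by apply: class_on_ext (@smooth_on_cst _ _ U 0 k) => // x _; rewrite big_nil.
  by apply: class_on_ext (class_onD oU (H i) IHr) => // x _; rewrite big_cons.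
apply: class_on_ext (Hs _) => // x /set_mem Ux.
rewrite [RHS]derive_chain; last 2 first.
- exact: df.
- exact: (smooth_on_differentiable sg) (fU _ Ux).
by rewrite [RHS]derive_delta //; exact: (smooth_on_differentiable sg) (fU _ Ux).
Qed.

Lemma smooth_on_comp V n (U : set V) (U' : set 'rV[R]_n) (f : V -> 'rV[R]_n)
    (g : 'rV[R]_n -> R) : open U -> (forall x, U x -> U' (f x)) ->
  smooth_on U f -> smooth_on U' g -> smooth_on U (g \o f).
Proof. by move=> oU fU sf sg k; exact: class_on_comp oU fU (sf k) sg. Qed.

Lemma smooth_on_comp_rV V n m (U : set V) (U' : set 'rV[R]_n) (f : V -> 'rV[R]_n)
    (g : 'rV[R]_n -> 'rV[R]_m) : open U -> open U' -> (forall x, U x -> U' (f x)) ->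
  smooth_on U f -> smooth_on U' g -> smooth_on U (g \o f).
Proof.
move=> oU oU' fU sf sg; apply: smooth_on_row => // i.
apply: (@smooth_on_comp _ _ U U' f (fun y => g y 0 i)) => //.
exact: smooth_on_coord.
Qed.

Lemma smooth_on_comp1 V (U : set V) (U' : set R) (f : V -> R)
    (g : R -> R) : open U -> (forall x, U x -> U' (f x)) ->
  smooth_on U f -> smooth_on U' g -> smooth_on U (g \o f).
Proof.
move=> oU fU sf sg k; elim: k g sg => [|k IH] g sg.
  move=> x Ux; apply: continuous_comp; first exact: (smooth_on_continuous sf).
  exact: (smooth_on_continuous sg) (fU _ Ux).
split=> [x Ux|v].
  apply: differentiable_comp; first exact: (smooth_on_differentiable sf).
  exact: (smooth_on_differentiable sg) (fU _ Ux).
have H : class_on k U (fun x => 'D_v f x * ('D_1 g \o f) x).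
  apply: class_onM => //; first exact: smooth_on_derive.
  exact: IH (smooth_on_derive _ sg).
apply: class_on_ext H => // x /set_mem Ux.
rewrite [RHS]derive_chain; last 2 first.
- exact: (smooth_on_differentiable sf).
- exact: (smooth_on_differentiable sg) (fU _ Ux).
have dg : differentiable g (f x) by exact: (smooth_on_differentiable sg) (fU _ Ux).
rewrite !deriveE //; last exact: (smooth_on_differentiable sf).
by rewrite /= -[in RHS](mulr1 ('d f x v)) -[in RHS]/(_ *: _) [in RHS]linearZ /= deriveE.
Qed.

End ClassOn.

Lemma is_derive_line (R : realType) (V W : normedModType R) (f : V -> W) x v (s : R) :
  differentiable f (x + s *: v) ->
  is_derive s 1 (fun s : R => f (x + s *: v)) ('D_v f (x + s *: v)).
Proof.
move=> df.
have dl : is_derive s 1 (fun s : R => x + s *: v) v.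
  have H : is_diff s (fun s : R => x + s *: v) (0 + ( *:%R ^~ v)) by exact: is_diffD.
  apply: DeriveDef; first exact/diff_derivable/ex_diff.
  by rewrite deriveE ?diff_val /= ?fctE ?add0r ?scale1r.
have dl' : differentiable (fun s : R => x + s *: v) s.
  by apply/derivable1_diffP; apply: ex_derive.
have -> : (fun s : R => f (x + s *: v)) = f \o (fun s : R => x + s *: v) by [].
apply: DeriveDef; first exact/diff_derivable/differentiable_comp.
by rewrite derive_chain // derive_val.
Qed.

Lemma MVT_line (R : realType) (V : normedModType R) (f : V -> R) x v :
  (forall s : R, 0 <= s <= 1 -> differentiable f (x + s *: v)) ->
  exists2 s : R, 0 < s < 1 & f (x + v) - f x = 'D_v f (x + s *: v).
Proof.
move=> df; have dg (s : R) : 0 <= s <= 1 -> is_derive s 1 (fun s : R => f (x + s *: v))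
    ('D_v f (x + s *: v)) by move=> /df; exact: is_derive_line.
have [] := @MVT R (fun s : R => f (x + s *: v)) (fun s => 'D_v f (x + s *: v)) 0 1 ltr01.
- by move=> s; rewrite in_itv /= => /andP[s0 s1]; apply: dg; rewrite !ltW.
- apply: continuous_in_subspaceT => s; rewrite inE /= in_itv /= => s01.
  by apply/differentiable_continuous/derivable1_diffP/ex_derive/dg.
move=> s; rewrite in_itv /= => s01; rewrite scale1r scale0r addr0 subr0 mulr1 => E.
by exists s.
Qed.

Lemma is_diff_eps_fun (R : realType) (V W : normedModType R) (f L : V -> W) x :
  linear L -> continuous L ->
  (forall e, 0 < e -> \forall h \near (0 : V),
    `|f (h + x) - f x - L h| <= e * `|h|) ->
  is_diff x f L.
Proof.
move=> lL cL H.
pose L' : {linear V -> W} := HB.pack L (GRing.isLinear.Build _ _ _ _ L lL).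
exact: (@is_diff_eps _ _ _ f L').
Qed.

Lemma mx_normr_entry (R : realType) m n (M : 'M[R]_(m, n)) i j : `|M i j| <= `|M|.
Proof. by rewrite [leRHS]mx_normrE; apply: (le_bigmax _ _ (i, j)). Qed.

Lemma mx_normr_leP (R : realType) m n (M : 'M[R]_(m, n)) e : 0 <= e ->
  (forall i j, `|M i j| <= e) -> `|M| <= e.
Proof. by move=> e0 Me; rewrite [leLHS]mx_normrE; apply: bigmax_le => // -[i j] _; exact: Me. Qed.

Lemma mx_normr_ltP (R : realType) m n (M : 'M[R]_(m, n)) e : 0 < e ->
  (forall i j, `|M i j| < e) -> `|M| < e.
Proof. by move=> e0 Me; rewrite [ltLHS]mx_normrE; apply: bigmax_lt => // -[i j] _; exact: Me. Qed.

Lemma diffeo_germ_comp (R : realType) m n p (s : 'rV[R]_m -> 'rV[R]_n)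
    (t : 'rV[R]_n -> 'rV[R]_p) a b c :
  diffeo_germ s a b -> diffeo_germ t b c -> diffeo_germ (t \o s) a c.
Proof.
move=> [s' [U [U' [[oU Ua oU' U'b sa] sU s'U' ss ss']]]].
move=> [t' [W [W' [[oW Wa oW' W'b ta] tW t'W' st st']]]].
have oUW : open (U `&` s @^-1` W).
  rewrite openE => x [Ux Wx]; apply: filterI; first by apply: open_nbhs_nbhs.
  by apply: (smooth_on_continuous ss Ux); apply: open_nbhs_nbhs.
have oUW' : open (W' `&` t' @^-1` U').
  rewrite openE => x [Ux Wx]; apply: filterI; first by apply: open_nbhs_nbhs.
  by apply: (smooth_on_continuous st' Ux); apply: open_nbhs_nbhs.
have tb : t' c = b by have [_] := tW _ Wa; rewrite ta.
exists (s' \o t'), (U `&` s @^-1` W), (W' `&` t' @^-1` U').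
split.
- by split=> //=; rewrite ?sa ?ta; split=> //; rewrite /= ?sa ?tb.
- move=> x [/= Ux Wx]; have [W'x tx] := tW _ Wx; have [U'x sx] := sU _ Ux.
  by rewrite /= tx; split.
- move=> x [/= Ux Wx]; have [W'x tx] := t'W' _ Ux; have [U'x sx] := s'U' _ Wx.
  by rewrite /= sx; split.
- apply: (smooth_on_comp_rV (U' := W)) => //; first by move=> x [].
  by apply: smooth_on_sub ss => x [].
- apply: (smooth_on_comp_rV (U' := U')) => //; first by move=> x [].
  by apply: smooth_on_sub st' => x [].
Qed.

Lemma diffeo_germ_eq (R : realType) (V V' : normedModType R) (s : V -> V') a b b' :
  diffeo_germ s a b -> b = b' -> diffeo_germ s a b'.
Proof. by move=> + <-. Qed.

Lemma germ_diffeomorphic_trans (R : realType) m1 m2 m3 n1 n2 n3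
    (f1 : 'rV[R]_m1 -> 'rV[R]_n1) (f2 : 'rV[R]_m2 -> 'rV[R]_n2)
    (f3 : 'rV[R]_m3 -> 'rV[R]_n3) a1 a2 a3 :
  germ_diffeomorphic f1 a1 f2 a2 -> germ_diffeomorphic f2 a2 f3 a3 ->
  germ_diffeomorphic f1 a1 f3 a3.
Proof.
move=> [s [t [ds dt st]]] [s' [t' [ds' dt' st']]].
exists (s' \o s), (t' \o t); split; [exact: diffeo_germ_comp ds ds'|exact: diffeo_germ_comp dt dt'|].
have sc : s x @[x --> a1] --> a2.
  move: ds => [_ [U [_ [[oU Ua _ _ <-] _ _ ss _]]]].
  exact: (smooth_on_continuous ss Ua).
have := sc _ st'; rewrite nbhs_simpl /=; move: st; apply: filterS2 => x /= E E'.
by rewrite E' E.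
Qed.

(** Continuity of [f1] keeps its values in the domain where [t'] inverts [t]. *)
Lemma germ_diffeomorphic_sym (R : realType) m1 m2 n1 n2
    (f1 : 'rV[R]_m1 -> 'rV[R]_n1) (f2 : 'rV[R]_m2 -> 'rV[R]_n2) a1 a2 :
  {for a1, continuous f1} ->
  germ_diffeomorphic f1 a1 f2 a2 -> germ_diffeomorphic f2 a2 f1 a1.
Proof.
move=> cf [s [t [[s' [U [U' [[oU Ua oU' U'b sa] sU s'U' ss ss']]]] [t' [W [W' [[oW Wa oW' W'b ta] tW t'W' st st']]]] fst]]].
have sb : s' a2 = a1 by have [_] := sU _ Ua; rewrite sa.
have tb : t' (f2 a2) = f1 a1 by have [_] := tW _ Wa; rewrite ta.
exists s', t'; split.
- by exists s, U', U; split.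
- by exists t, W', W; split.
- have sc : s' x @[x --> a2] --> a1.
    by have := smooth_on_continuous ss' U'b; rewrite /prop_for /continuous_at sb.
  have fW : \forall x \near a1, W (f1 x).
    by apply: cf; apply: open_nbhs_nbhs.
  have nU : \forall x \near a2, U' x by apply: open_nbhs_nbhs.
  apply: filterS2 nU (sc _ (filterI fst fW)) => x Ux /= [E Wx].
  have [_ sx] := s'U' _ Ux; have [_ tx] := tW _ Wx.
  by rewrite -{2}sx E tx.
Qed.

Lemma diffeo_germ_near_eq (R : realType) (V V' : normedModType R)
   (s t : V -> V') a b :
  (\forall x \near a, s x = t x) -> diffeo_germ s a b -> diffeo_germ t a b.
Proof.
move=> st [s' [U [U' [[oU Ua oU' U'b sa] sU s'U' ss ss']]]].
have [G [[oG Ga] GE]] : exists G, open_nbhs a G /\ G `<=` [set x | s x = t x].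
  by have : nbhs a [set x | s x = t x] := st; rewrite nbhsE => -[G ? ?]; exists G.
have s'b : s' b = a by have [_] := sU _ Ua; rewrite sa.
exists s', (U `&` G), (U' `&` s' @^-1` G); split.
- split=> //; first exact: openI.
  + rewrite openE => x [Ux Wx]; apply: filterI; first by apply: open_nbhs_nbhs.
    by apply: (smooth_on_continuous ss' Ux); apply: open_nbhs_nbhs.
  + by split=> //=; rewrite s'b.
  + by rewrite -(GE _ Ga).
- move=> x [Ux Gx]; rewrite -(GE _ Gx); have [Usx sx] := sU _ Ux.
  by rewrite sx; split=> //; split=> //=; rewrite sx.
- move=> y [Uy Gy]; have [Usy sy] := s'U' _ Uy.
  by split; [split|rewrite -(GE _ Gy)].
- apply: (@smooth_on_ext _ _ _ _ s); first exact: openI.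
    by move=> x /set_mem[_ Gx]; rewrite (GE _ Gx).
  by apply: smooth_on_sub ss => x [].
- by apply: smooth_on_sub ss' => x [].
Qed.

Lemma near_lt_continuous (R : realType) (V : topologicalType) (f g : V -> R) x :
  {for x, continuous f} -> {for x, continuous g} -> f x < g x ->
  \forall y \near x, f y < g y.
Proof.
move=> fc gc fg; have /cvgr_gt : (g y - f y) @[y --> x] --> g x - f x by exact: cvgB.
move=> /(_ 0); rewrite subr_gt0 => /(_ fg); apply: filterS => y /=.
by rewrite subr_gt0.
Qed.

(** * Shears: the inverse function theorem in one coordinate *)

Section Shear.
Variables (R : realType) (n : nat) (i : 'I_n).
Local Notation V := ('rV[R]_n).
Local Notation e_ := (delta_mx 0 i : V).

Definition set_coord (p : V) (z : R) : V := p + (z - p 0 i) *: e_.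

Definition shear (phi : V -> R) (p : V) : V := set_coord p (phi p).

Lemma set_coordE p z j : set_coord p z 0 j = if j == i then z else p 0 j.
Proof.
rewrite !mxE eqxx /=; case: eqVneq => [->|_]; last by rewrite mulr0 addr0.
by rewrite mulr1 addrC subrK.
Qed.

Lemma shearE phi p j : shear phi p 0 j = if j == i then phi p else p 0 j.
Proof. exact: set_coordE. Qed.

Lemma set_coordK p z w : set_coord (set_coord p z) w = set_coord p w.
Proof. by apply/rowP => j; rewrite !set_coordE; case: ifP => // ->. Qed.

Lemma set_coord_id p : set_coord p (p 0 i) = p.
Proof. by rewrite /set_coord subrr scale0r addr0. Qed.

Lemma set_coordD p z w : set_coord p z = set_coord p w + (z - w) *: e_.
Proof.
apply/rowP => j; rewrite [RHS]mxE !set_coordE !mxE eqxx /=.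
by case: eqVneq => _; rewrite ?mulr1 ?mulr0 ?addr0 // addrC subrK.
Qed.

Lemma norm_scale_delta (x : R) : `|x *: e_| <= `|x|.
Proof.
apply: mx_normr_leP => // k j; rewrite !mxE; case: (_ && _); by rewrite ?mulr1 ?mulr0 ?normr0.
Qed.

Lemma smooth_on_shear (U : set V) phi : open U -> smooth_on U phi ->
  smooth_on U (shear phi).
Proof.
move=> oU sphi; apply: smooth_on_row => // j.
apply: (@smooth_on_ext _ _ _ _ (if j == i then phi else fun p => p 0 j)) => //.
  by move=> p _; rewrite shearE; case: ifP.
case: ifP => _ //; apply: smooth_on_coord => //; exact: smooth_on_id.
Qed.

(* The inverse of a shear solves one scalar equation, by the intermediate value
   theorem; its differential is then computed from that of [phi]. *)
Lemma shear_diffeo_pos (U : set V) (phi : V -> R) a : open U -> U a -> smooth_on U phi ->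
  0 < ('D_e_ phi a : R) -> diffeo_germ (shear phi) a (shear phi a).
Proof.
move=> oU Ua sphi.
set m : R := 'D_e_ phi a => m0.
have sD : smooth_on U ('D_e_ phi) := smooth_on_derive e_ sphi.
(* The norm is the sup norm, so this ball is a box; on it the slope in direction i exceeds m / 2. *)
have [r r0 rB] : exists2 r : R, 0 < r & forall p, `|p - a| <= r -> U p /\ m / 2 < ('D_e_ phi p : R).
  have m2 : m / 2 < m by rewrite ltr_pdivrMr // mulrDr mulr1 ltrDl.
  have H : \forall p \near a, U p /\ m / 2 < ('D_e_ phi p : R).
    apply: filterI; first by apply: open_nbhs_nbhs.
    by have /cvgr_gt := smooth_on_continuous sD Ua; apply.
  have [r /= r0 rH] := (proj1 (nbhs_normP _ _)) H.
  exists (r / 2); first by rewrite divr_gt0.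
  move=> p pr; apply: rH => /=; rewrite distrC (le_lt_trans pr) //.
  by rewrite ltr_pdivrMr // mulrDr mulr1 ltrDl.
have m20 : 0 < m / 2 by rewrite divr_gt0.
have dphi p : `|p - a| <= r -> differentiable phi p.
  by move=> /rB[Up _]; exact: (smooth_on_differentiable sphi).
have seg (p q : V) (s : R) : `|p - a| <= r -> `|q - a| <= r -> 0 <= s <= 1 ->
    `|p + s *: (q - p) - a| <= r.
  move=> pr qr /andP[s0 s1].
  have -> : p + s *: (q - p) - a = (1 - s) *: (p - a) + s *: (q - a).
    by apply/rowP => j; rewrite !mxE; ring.
  rewrite (le_trans (ler_normD _ _)) // !normrZ (ger0_norm s0) ger0_norm ?subr_ge0 //.
  have : (1 - s) * `|p - a| <= (1 - s) * r by rewrite ler_wpM2l // subr_ge0.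
  have : s * `|q - a| <= s * r by rewrite ler_wpM2l.
  by move=> ? ?; lra.
have incr p (z w : R) : `|set_coord p z - a| <= r -> `|set_coord p w - a| <= r -> z < w ->
    m / 2 * (w - z) < phi (set_coord p w) - phi (set_coord p z).
  move=> zr wr zw.
  have E : set_coord p w = set_coord p z + (w - z) *: e_ by exact: set_coordD.
  have E' : (w - z) *: e_ = set_coord p w - set_coord p z by rewrite E [RHS]addrC addKr.
  have [s s01 ->] : exists2 s : R, 0 < s < 1 & phi (set_coord p w) - phi (set_coord p z) =
      'D_((w - z) *: e_) phi (set_coord p z + s *: ((w - z) *: e_)).
    by rewrite {1}E; apply: MVT_line => s s01; apply: dphi; rewrite E'; exact: seg.
  have sr : `|set_coord p z + s *: ((w - z) *: e_) - a| <= r.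
    by rewrite E'; apply: seg => //; case/andP: s01 => ? ?; rewrite !ltW.
  rewrite deriveE; last exact: dphi.
  rewrite linearZ /= -deriveE; last exact: dphi.
  rewrite -[_ *: _]/(_ * _) mulrC ltr_pM2l ?subr_gt0 //.
  by have [] := rB _ sr.
pose B := [set q : V | `|set_coord q (a 0 i) - a| < r].
have Bj q : B q -> forall j, j != i -> `|q 0 j - a 0 j| < r.
  move=> Bq j ji; apply: le_lt_trans Bq.
  have := mx_normr_entry (set_coord q (a 0 i) - a) 0 j.
  by rewrite mxE set_coordE (negbTE ji) mxE.
have near_aP (q : V) (z : R) : B q -> `|z - a 0 i| <= r -> `|set_coord q z - a| <= r.
  move=> /Bj qj zr; apply: mx_normr_leP => [|k j]; first exact: ltW.
  rewrite ord1 mxE set_coordE [X in _ + X]mxE.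
  by case: (eqVneq j i) => [->//|/qj/ltW].
have near_aPlt (q : V) (z : R) : B q -> `|z - a 0 i| < r -> `|set_coord q z - a| < r.
  move=> /Bj qj zr; apply: mx_normr_ltP => // k j.
  rewrite ord1 mxE set_coordE [X in _ + X]mxE.
  by case: (eqVneq j i) => [->//|/qj].
have sset c : smooth_on setT (set_coord ^~ c).
  by apply: (@smooth_on_shear setT (cst c)) => //; [exact: openT|exact: smooth_on_cst].
have setc (c : R) q : {for q, continuous (set_coord ^~ c)}.
  by apply: (smooth_on_continuous (sset c)).
have ar1 : `|a 0 i - r - a 0 i| <= r by rewrite addrAC subrr sub0r normrN gtr0_norm.
have ar2 : `|a 0 i + r - a 0 i| <= r by rewrite addrAC subrr add0r gtr0_norm.
pose lo (q : V) : R := phi (set_coord q (a 0 i - r)).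
pose hi (q : V) : R := phi (set_coord q (a 0 i + r)).
pose U1 := [set p : V | `|p - a| < r].
(* The image of the box: the other coordinates of [q] stay in the box, and q_i lies between the
   values of [phi] at the ends of the segment in direction i. *)
pose U2 := [set q : V | B q /\ lo q < q 0 i < hi q].
have U1B p : U1 p -> B p /\ `|p 0 i - a 0 i| < r.
  move=> U1p; have H j : `|p 0 j - a 0 j| < r.
    by apply: le_lt_trans U1p; have := mx_normr_entry (p - a) 0 j; rewrite mxE [X in _ + X]mxE.
  split=> //; apply: mx_normr_ltP => // k j; rewrite ord1 mxE set_coordE [X in _ + X]mxE.
  by case: (eqVneq j i) => [->|//]; rewrite subrr normr0.
have oU1 : open U1.
  have -> : U1 = ball a r by apply/seteqP; split=> x; rewrite /U1 -ball_normE /= distrC.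
  exact: ball_open.
have oB : open B.
  rewrite openE => q Bq; have H : nbhs (set_coord q (a 0 i)) U1 by apply: open_nbhs_nbhs.
  exact: (setc (a 0 i) q _ H).
have lo_cont c q : `|c - a 0 i| <= r -> B q -> {for q, continuous (fun q => phi (set_coord q c))}.
  move=> cr Bq; apply: (@continuous_comp _ _ _ (set_coord ^~ c) phi); first exact: setc.
  by apply/differentiable_continuous/dphi/near_aP.
have oU2 : open U2.
  rewrite openE => q [Bq /andP[lq qh]].
  have coordc : {for q, continuous (fun q : V => q 0 i)}.
    by apply: (@coord_continuous R 1 n 0 i).
  apply: filterI; first by apply: open_nbhs_nbhs.
  have H1 : \forall q' \near q, lo q' < (q' : V) 0 i.
    by apply: near_lt_continuous => //; exact: lo_cont.
  have H2 : \forall q' \near q, (q' : V) 0 i < hi q'.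
    by apply: near_lt_continuous => //; exact: lo_cont.
  by apply: filterS2 H1 H2 => q' /= -> ->.
pose zf (q : V) : R := xget 0 [set z | `|z - a 0 i| < r /\ phi (set_coord q z) = q 0 i].
have zfP q : U2 q -> `|zf q - a 0 i| < r /\ phi (set_coord q (zf q)) = q 0 i.
  move=> [Bq /andP[lq qh]].
  suff [z zP] : exists z : R, `|z - a 0 i| < r /\ phi (set_coord q z) = q 0 i.
    by rewrite /zf; case: xgetP => [_ -> //|/(_ z)].
  have ar : a 0 i - r <= a 0 i + r by lra.
  have [] := @IVT R (fun z => phi (set_coord q z)) _ _ (q 0 i) ar.
  - apply: continuous_in_subspaceT => z; rewrite inE /= in_itv /= => /andP[z1 z2].
    have zr : `|z - a 0 i| <= r by rewrite ler_norml; lra.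
    apply: differentiable_continuous; apply/derivable1_diffP.
    have H := @is_derive_line R V R phi (set_coord q 0) e_ z.
    have E : (fun s : R => phi (set_coord q 0 + s *: e_)) = (fun z => phi (set_coord q z)).
      by apply/funext => s; rewrite (set_coordD q s 0) subr0.
    rewrite E in H; suff K : differentiable phi (set_coord q 0 + z *: e_) by case: (H K).
    by have := set_coordD q z 0; rewrite subr0 => <-; exact/dphi/near_aP.
  - rewrite -/(lo q) -/(hi q); have lh := lt_trans lq qh.
    by rewrite /Num.min /Num.max lh !ltW.
  move=> z; rewrite in_itv /= => /andP[z1 z2] E; exists z; split=> //.
  have zl : z != a 0 i - r by apply/eqP => zE; move: lq; rewrite /lo -zE E ltxx.
  have zh : z != a 0 i + r by apply/eqP => zE; move: qh; rewrite /hi -zE E ltxx.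
  by rewrite ltr_norml; move: z1 z2; rewrite !le_eqVlt eq_sym (negbTE zl) (negbTE zh) /=; lra.
have inj q (z w : R) : B q -> `|z - a 0 i| < r -> `|w - a 0 i| < r ->
    phi (set_coord q z) = phi (set_coord q w) -> z = w.
  move=> Bq zr wr E.
  have H (x y : R) : `|x - a 0 i| < r -> `|y - a 0 i| < r -> x < y ->
      phi (set_coord q x) != phi (set_coord q y).
    move=> xr yr xy; have := incr q x y (near_aP _ _ Bq (ltW xr)) (near_aP _ _ Bq (ltW yr)) xy.
    move=> H1; apply/eqP => H2; rewrite H2 subrr in H1.
    by rewrite ltNge ltW ?mulr_gt0 ?subr_gt0 in H1.
  by case: (ltgtP z w) => // /H H'; [have := H' zr wr|have := H' wr zr]; rewrite E eqxx.
pose s' q := set_coord q (zf q).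
have U2U1 q : U2 q -> U1 (s' q).
  by move=> U2q; have [zr _] := zfP _ U2q; apply: near_aPlt => //; case: U2q.
have U1U2 p : U1 p -> U2 (shear phi p).
  move=> U1p; have [Bp pr] := U1B _ U1p; split; first by rewrite /B /= /shear set_coordK.
  rewrite /lo /hi /shear !set_coordK set_coordE eqxx.
  have := incr p (a 0 i - r) (p 0 i); have := incr p (p 0 i) (a 0 i + r).
  rewrite set_coord_id; move: pr; rewrite ltr_norml => /andP[p1 p2].
  move=> /(_ (ltW U1p) (near_aP _ _ Bp ar2)) H1 /(_ (near_aP _ _ Bp ar1) (ltW U1p)) H2.
  have p3 : p 0 i < a 0 i + r by lra.
  have p4 : a 0 i - r < p 0 i by lra.
  have {}H1 : 0 < phi (set_coord p (a 0 i + r)) - phi p.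
    by apply: lt_trans (H1 p3); rewrite mulr_gt0 ?subr_gt0.
  have {}H2 : 0 < phi p - phi (set_coord p (a 0 i - r)).
    by apply: lt_trans (H2 p4); rewrite mulr_gt0 ?subr_gt0.
  by rewrite subr_gt0 in H1; rewrite subr_gt0 in H2; rewrite H1 H2.
have s'S p : U1 p -> s' (shear phi p) = p.
  move=> U1p; have [Bp pr] := U1B _ U1p; have [zr zE] := zfP _ (U1U2 _ U1p).
  move: zE; rewrite /s'; set z := zf _; rewrite /shear !set_coordK set_coordE eqxx => zE.
  rewrite (inj p z (p 0 i)) ?set_coord_id //.
have Ss' q : U2 q -> shear phi (s' q) = q.
  by move=> /zfP[_ zE]; rewrite /shear /s' set_coordK zE set_coord_id.
have U1a : U1 a by rewrite /U1 /= subrr normr0.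
have U1U : U1 `<=` U by move=> p /ltW/rB[].
exists s', U1, U2; split => //.
- by split=> //; exact: U1U2.
- by move=> p U1p; split; [exact: U1U2|exact: s'S].
- by move=> p U2p; split; [exact: U2U1|exact: Ss'].
- exact: smooth_on_sub (smooth_on_shear oU sphi).
have Dpos p : U1 p -> 0 < ('D_e_ phi p : R) by move=> /ltW/rB[_]; exact: lt_trans.
(* As [s'] changes only the coordinate i, its differential is w + mu e_i, where mu solves d phi (w +
   mu e_i) = w_i. *)
have ds' q : U2 q -> is_diff q s'
    (fun w => w + ((w 0 i - 'd phi (s' q) w) / 'D_e_ phi (s' q)) *: e_).
  move=> U2q.
  set p0 := s' q; set c : R := 'D_e_ phi p0.
  have U1p0 : U1 p0 by exact: U2U1.
  have c0 : 0 < c by exact: Dpos.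
  have dp0 : differentiable phi p0 by exact/dphi/ltW.
  have [M M0 HM] : exists2 M : R, 0 < M & forall x, `|'d phi p0 x| <= M * `|x|.
    exact: (linear_lipschitz (diff_continuous dp0)).
  apply: is_diff_eps_fun.
  - move=> b x y; apply/rowP => j; rewrite linearP /= !mxE /=.
    by rewrite -[_ *: 'd phi p0 x]/(b * _); ring.
  - move=> w; apply: (@continuousD _ _ _ id); first exact: cvg_id.
    apply: continuousZr_tmp.
    apply: (@continuousM _ _ (fun w : V => w 0 i - 'd phi p0 w) (cst c^-1)); last exact: cst_continuous.
    apply: continuousB; first exact: (@coord_continuous R 1 n 0 i).
    exact: diff_continuous.
  move=> e e0.
  (* A Lipschitz constant of [zf] at [q]: 2 / m inverts the least slope; in M + 2, M bounds the
     differential of [phi], 1 its error term, and 1 the change of q_i. The choice of [eps] below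
     makes the final error e |w|. *)
  pose C1 : R := 2 / m * (M + 2).
  have C10 : 0 <= C1 by rewrite mulr_ge0 ?divr_ge0 ?addr_ge0 // ltW.
  pose eps : R := e * c / (1 + C1).
  have C11 : 0 < 1 + C1 by rewrite ltr_wpDr.
  have eps0 : 0 < eps by rewrite !mulr_gt0 ?invr_gt0.
  have [d1 /= d10 H1] := (proj1 (nbhs_normP _ _)) (differentiable_epsP dp0 ltr01).
  have [d2 /= d20 H2] := (proj1 (nbhs_normP _ _)) (differentiable_epsP dp0 eps0).
  have [d3 /= d30 H3] : exists2 d3 : R, 0 < d3 & forall x, `|x| < d3 -> U2 (x + q).
    have : \forall x \near q, U2 x by apply: open_nbhs_nbhs.
    move=> /(proj1 (nbhs_normP _ _))[d3 /= d30 H3]; exists d3 => // x xd.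
    by apply: H3; rewrite /ball_ /= opprD addrCA subrr addr0 normrN.
  have nw (d : R) : 0 < d -> \forall w \near (0 : V), `|w| < d.
    move=> d0; apply/nbhs_normP; exists d => // w; by rewrite /ball_ /= sub0r normrN.
  have d20' : 0 < d2 / (1 + C1) by rewrite divr_gt0.
  have : \forall w \near (0 : V), [/\ `|w| < d1, `|w| < d2 / (1 + C1) & `|w| < d3].
    by near=> w; split; near: w; exact: nw.
  apply: filterS => w [wd1 wd2 wd3].
  have U2w : U2 (w + q) by exact: H3.
  have [zr zE] := zfP _ U2w; have [z0r z0E] := zfP _ U2q.
  have phip : phi (s' (w + q)) = (w + q) 0 i by [].
  have phip0 : phi p0 = q 0 i by [].
  have [Bw _] := U2w; have [Bq _] := U2q.
  pose u := set_coord w 0.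
  have ule : `|u| <= `|w|.
    apply: mx_normr_leP => // k j; rewrite ord1 set_coordE; case: ifP => _.
      by rewrite normr0.
    exact: mx_normr_entry.
  have wle : `|w 0 i| <= `|w| by exact: mx_normr_entry.
  have uE : set_coord (w + q) (zf q) = u + p0.
    apply/rowP => j; rewrite set_coordE [RHS]mxE !set_coordE.
    by case: ifP => _; rewrite ?add0r // mxE.
  have phiu : `|phi (u + p0) - phi p0| <= (M + 1) * `|w|.
    have : `|phi (u + p0) - phi p0 - 'd phi p0 u| <= 1 * `|u|.
      by apply: H1; rewrite /ball_ /= sub0r normrN (le_lt_trans ule).
    have := HM u; have : M * `|u| <= M * `|w| by rewrite ler_pM2l.
    have := ler_normD (phi (u + p0) - phi p0 - 'd phi p0 u) ('d phi p0 u).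
    rewrite subrK; lra.
  have zle : `|zf (w + q) - zf q| <= C1 * `|w|.
    have H : m / 2 * `|zf (w + q) - zf q| <= `|phi (set_coord (w + q) (zf (w + q))) - phi (set_coord (w + q) (zf q))|.
      have [zz|zz|->] := ltgtP (zf (w + q)) (zf q); last by rewrite subrr normr0 mulr0.
      - have := incr (w + q) _ _ (near_aP _ _ Bw (ltW zr)) (near_aP _ _ Bw (ltW z0r)) zz.
        move=> H; rewrite distrC gtr0_norm ?subr_gt0 // ltW // (lt_le_trans H) //.
        by rewrite distrC ler_norm.
      - have := incr (w + q) _ _ (near_aP _ _ Bw (ltW z0r)) (near_aP _ _ Bw (ltW zr)) zz.
        move=> H; rewrite gtr0_norm ?subr_gt0 // ltW // (lt_le_trans H) //.
        by rewrite ler_norm.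
    have : m / 2 * `|zf (w + q) - zf q| <= (M + 2) * `|w|.
      apply: (le_trans H); rewrite zE uE mxE -phip0.
      have -> : w 0 i + phi p0 - phi (u + p0) = w 0 i - (phi (u + p0) - phi p0) by ring.
      apply: (le_trans (ler_normB _ _)); lra.
    rewrite -(ler_pM2l (x := 2 / m)) ?divr_gt0 //.
    have -> : 2 / m * (m / 2 * `|zf (w + q) - zf q|) = `|zf (w + q) - zf q|.
      by field; rewrite gt_eqF.
    by rewrite mulrA.
  have pE : s' (w + q) = (u + (zf (w + q) - zf q) *: e_) + p0.
    by rewrite /s' (set_coordD (w + q) _ (zf q)) uE addrAC.
  have ple : `|u + (zf (w + q) - zf q) *: e_| <= (1 + C1) * `|w|.
    rewrite mulrDl mul1r (le_trans (ler_normD _ _)) // lerD // (le_trans (norm_scale_delta _)) //.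
  have := H2 (u + (zf (w + q) - zf q) *: e_).
  rewrite -pE phip phip0 /ball_ /= sub0r normrN => H.
  have {}H : `|(w + q) 0 i - q 0 i - 'd phi p0 (u + (zf (w + q) - zf q) *: e_)| <= eps * ((1 + C1) * `|w|).
    apply: le_trans (H _) _; last by rewrite ler_pM2l.
    by apply: le_lt_trans ple _; rewrite -ltr_pdivlMl // mulrC.
  have -> : s' (w + q) - p0 - (w + ((w 0 i - 'd phi p0 w) / c) *: e_) =
      (('d phi p0 (u + (zf (w + q) - zf q) *: e_) - w 0 i) / c) *: e_.
    have uw : u = w - w 0 i *: e_ by rewrite /u /set_coord sub0r scaleNr.
    rewrite pE addrK uw !linearD linearN !linearZ /= -(deriveE e_ dp0) -/c.
    have sE (x y : R) : x *: y = x * y by [].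
    rewrite !sE.
    by apply/rowP => j; rewrite !mxE; field; rewrite gt_eqF.
  apply: le_trans (norm_scale_delta _) _.
  rewrite normrM normfV (gtr0_norm c0) ler_pdivrMr // distrC.
  move: H; rewrite mxE addrK => H; apply: (le_trans H).
  rewrite /eps mulrA divfK ?gt_eqF // mulrAC //.
move=> k; elim: k => [|k IH].
  by move=> q /ds' ?; apply: differentiable_continuous.
split=> [q /ds' ?|v]; first exact: ex_diff.
(* The differential of [s'] is a smooth function of [s'] itself, so class C^k of [s'] gives class
   C^(k+1). *)
pose G (v p : V) : R := (v 0 i - 'D_v phi p) / 'D_e_ phi p.
have sG : smooth_on U1 (G v).
  apply: smooth_on_div => //.
  - apply: smooth_onB => //; first exact: smooth_on_cst.
    by apply: smooth_on_sub (smooth_on_derive v sphi).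
  - exact: smooth_on_sub sD.
  - by move=> p /Dpos/gt_eqF ->.
have := class_onD oU2 (@smooth_on_cst _ _ _ U2 v k) (class_on_scalel e_ oU2 (class_on_comp oU2 U2U1 IH sG)).
apply: class_on_ext => // q /set_mem U2q; have ? := ds' q U2q.
rewrite [RHS]deriveE; last exact: ex_diff.
rewrite diff_val /= fctE /G /=; congr (_ + (_ - _) / _ *: _).
by rewrite deriveE //; apply/dphi/ltW/U2U1.
Unshelve. all: by end_near. Qed.
End Shear.

(** * Smooth functions of compact support *)

Section CSmooth.
Variables (R : realType) (n : nat).
Implicit Types g : 'rV[R]_n -> R.

(** Germs are cut off to such functions because their derivatives are bounded everywhere, which
    makes second-order remainders uniform along all dilations. *)
Definition csmooth g :=
  smooth_on setT g /\ exists2 M : R, 0 < M & forall p, M < `|p| -> g p = 0.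

Lemma csmooth_differentiable g p : csmooth g -> differentiable g p.
Proof. by move=> [sg _]; exact: smooth_on_differentiable sg _. Qed.

Lemma csmooth_continuous g : csmooth g -> continuous g.
Proof. by move=> [sg _] p; exact: smooth_on_continuous sg _. Qed.

Lemma csmooth_derive g v : csmooth g -> csmooth ('D_v g).
Proof.
move=> [sg [M M0 gM]]; split; first exact: smooth_on_derive.
exists M => // p Mp.
rewrite (@near_eq_derive _ _ _ g (cst 0)) ?derive_cst //.
have H : \forall q \near p, M < `|q|.
  have /cvgr_gt : `|q| @[q --> p] --> `|p| by exact: norm_continuous.
  exact.
by apply: filterS H => q; exact: gM.
Qed.

Lemma csmoothD f g : csmooth f -> csmooth g -> csmooth (fun p => f p + g p).
Proof.
move=> [sf [M M0 fM]] [sg [N N0 gN]]; split; first by apply: smooth_onD => //; exact: openT.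
exists (Num.max M N); first by rewrite lt_max M0.
by move=> p; rewrite gt_max => /andP[/fM -> /gN ->]; rewrite addr0.
Qed.

Lemma csmoothM (f : 'rV[R]_n -> R) g : smooth_on setT f -> csmooth g -> csmooth (fun p => f p * g p).
Proof.
move=> sf [sg [N N0 gN]]; split; first by apply: smooth_onM => //; exact: openT.
by exists N => // p /gN ->; rewrite mulr0.
Qed.

Lemma csmooth_bounded g : csmooth g -> exists2 M, 0 <= M & forall p, `|g p| <= M.
Proof.
move=> cg; have [sg [M M0 gM]] := cg.
pose A := [set v : 'rV[R]_n | forall i, `[- M, M]%classic (v ord0 i)].
have cA : compact A.
  by apply: (@rV_compact _ _ (fun=> `[- M, M]%classic)) => i; exact: segment_compact.
have A0 : A !=set0.
  by exists 0 => i; rewrite mxE /= in_itv /= oppr_le0 ltW.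
have gc : {within A, continuous (fun p => `|g p|)}.
  apply: continuous_subspaceT => p; apply: continuous_comp; first exact: csmooth_continuous.
  exact: norm_continuous.
have [c _ cmax] := compact_EVT_max A0 cA gc.
exists `|g c| => // p; have [pM|Mp] := lerP `|p| M.
  apply: cmax; rewrite inE => i /=; rewrite in_itv /= -ler_norml.
  by apply: le_trans pM; exact: mx_normr_entry.
by rewrite gM // normr0.
Qed.

Lemma csmooth_derive2_bound g : csmooth g ->
  exists2 C, 0 <= C & forall q w, `|'D_w ('D_w g) q| <= C * `|w| ^+ 2.
Proof.
move=> cg.
have H (ij : 'I_n * 'I_n) : exists M : R, 0 <= M /\
    forall p, `|'D_(delta_mx 0 ij.1) ('D_(delta_mx 0 ij.2) g) p| <= M.
  have [M M0 HM] := csmooth_bounded (csmooth_derive (delta_mx 0 ij.1) (csmooth_derive (delta_mx 0 ij.2) cg)).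
  by exists M.
have [M HM] := fin_all_exists H.
exists (\sum_ij M ij); first by apply: sumr_ge0 => ij _; have [] := HM ij.
move=> q w.
have E1 : 'D_w g = fun p => \sum_(i < n) w 0 i *: 'D_(delta_mx 0 i) g p.
  by apply/funext => p; rewrite derive_delta //; exact: csmooth_differentiable.
have E2 : 'D_w ('D_w g) q = \sum_(j < n) \sum_(i < n) w 0 j * (w 0 i * 'D_(delta_mx 0 j) ('D_(delta_mx 0 i) g) q).
  rewrite derive_delta; last exact/csmooth_differentiable/csmooth_derive.
  apply: eq_bigr => j _; rewrite E1.
  have -> : (fun p => \sum_(i < n) w 0 i *: 'D_(delta_mx 0 i) g p) =
      \sum_(i < n) (fun p => w 0 i *: 'D_(delta_mx 0 i) g p).
    by apply/funext => p; rewrite fct_sumE.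
  have dd i : derivable ('D_(delta_mx 0 i) g) q (delta_mx 0 j).
    by apply/diff_derivable/csmooth_differentiable/csmooth_derive.
  rewrite derive_sum; last by move=> i; apply: derivableZ.
  by rewrite scaler_sumr; apply: eq_bigr => i _; rewrite deriveZ.
rewrite E2 pair_big /= (le_trans (ler_norm_sum _ _ _)) // mulr_suml.
apply: ler_sum => -[j i] _ /=; rewrite !normrM mulrA expr2 [leRHS]mulrC.
apply: ler_pM => //; last by have [_] := HM (j, i); exact.
by apply: ler_pM => //; exact: mx_normr_entry.
Qed.

Lemma csmooth_taylor g : csmooth g ->
  exists2 C, 0 <= C & forall q w, `|g (q + w) - g q - 'D_w g q| <= C * `|w| ^+ 2.
Proof.
move=> cg; have [C C0 HC] := csmooth_derive2_bound cg.
exists C => // q w.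
have [s /andP[s0 s1] ->] : exists2 s : R, 0 < s < 1 & g (q + w) - g q = 'D_w g (q + s *: w).
  by apply: MVT_line => s _; exact: csmooth_differentiable.
have cw := csmooth_derive w cg.
have [s' _ ->] : exists2 s' : R, 0 < s' < 1 & 'D_w g (q + s *: w) - 'D_w g q =
    'D_(s *: w) ('D_w g) (q + s' *: (s *: w)).
  by apply: (@MVT_line R _ ('D_w g) q (s *: w)) => s' _; exact: csmooth_differentiable cw.
have dd := csmooth_differentiable (q + s' *: (s *: w)) cw.
rewrite (deriveE _ dd) linearZ /= -(deriveE _ dd) normrZ gtr0_norm //.
apply: le_trans (HC (q + s' *: (s *: w)) w); apply: ler_piMl => //; exact: ltW.
Qed.
End CSmooth.

(** * Functionals acting on dilations in the plane *)

Section Row2.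
Variable R : realType.
Local Notation e0 := (delta_mx 0 0 : 'rV[R]_2).
Local Notation e1 := (delta_mx 0 1 : 'rV[R]_2).

Lemma vec2_0 (x y : R) : vec2 x y 0 0 = x. Proof. by rewrite mxE. Qed.
Lemma vec2_1 (x y : R) : vec2 x y 0 1 = y. Proof. by rewrite mxE. Qed.
Definition vec2E := (vec2_0, vec2_1).

Lemma ord2P (i : 'I_2) : i = 0 \/ i = 1.
Proof. by case: i => -[|[|//]] ?; [left|right]; exact: val_inj. Qed.

Lemma row2P (p q : 'rV[R]_2) : p 0 0 = q 0 0 -> p 0 1 = q 0 1 -> p = q.
Proof. by move=> h0 h1; apply/rowP => i; case: (ord2P i) => ->. Qed.

Lemma vec2_eta (p : 'rV[R]_2) : vec2 (p 0 0) (p 0 1) = p.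
Proof. by apply: row2P; rewrite vec2E. Qed.

Lemma vec2_00 : vec2 0 0 = 0 :> 'rV[R]_2.
Proof. by apply: row2P; rewrite vec2E mxE. Qed.

Lemma norm_row2_le (p : 'rV[R]_2) M : `|p 0 0| <= M -> `|p 0 1| <= M -> `|p| <= M.
Proof.
move=> h0 h1; apply: mx_normr_leP; first exact: le_trans h0.
by move=> i j; rewrite ord1; case: (ord2P j) => ->.
Qed.

Lemma norm_row2_lt (p : 'rV[R]_2) M : `|p 0 0| < M -> `|p 0 1| < M -> `|p| < M.
Proof.
move=> h0 h1; apply: mx_normr_ltP; first exact: le_lt_trans h0.
by move=> i j; rewrite ord1; case: (ord2P j) => ->.
Qed.

Lemma smooth_on_vec2 (V : normedModType R) (U : set V) (f g : V -> R) : open U ->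
  smooth_on U f -> smooth_on U g -> smooth_on U (fun x => vec2 (f x) (g x)).
Proof.
move=> oU sf sg; apply: smooth_on_row => // i; case: (ord2P i) => ->.
  by apply: smooth_on_ext sf => // x _; rewrite vec2E.
by apply: smooth_on_ext sg => // x _; rewrite vec2E.
Qed.

Definition scale1 (a : R) (p : 'rV[R]_2) : 'rV[R]_2 := vec2 (p 0 0) (a * p 0 1).

Lemma scale1D a p q : scale1 a (p + q) = scale1 a p + scale1 a q.
Proof. by apply: row2P; rewrite !mxE //= mulrDr. Qed.

Lemma norm_scale1 a p : `|scale1 a p| <= (1 + `|a|) * `|p|.
Proof.
apply: norm_row2_le; rewrite vec2E.
  by rewrite (le_trans (mx_normr_entry p 0 0)) // ler_peMl // lerDl.
by rewrite normrM; apply: ler_pM => //; [rewrite lerDr|exact: mx_normr_entry].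
Qed.

Lemma row2_delta (v : 'rV[R]_2) : v = v 0 0 *: e0 + v 0 1 *: e1.
Proof. by apply: row2P; rewrite !mxE /=; rewrite !(mulr0, mulr1, addr0, add0r). Qed.

Lemma derive_row2 (W : normedModType R) (g : 'rV[R]_2 -> W) q v : differentiable g q ->
  'D_v g q = v 0 0 *: 'D_e0 g q + v 0 1 *: 'D_e1 g q.
Proof.
by move=> dg; rewrite !deriveE // {1}[v]row2_delta linearD !linearZ.
Qed.

(* A linear functional [L] on continuous functions of polynomial growth gives an
   operator on functions of [(u, x)], by acting on the dilations of [x]. It
   specializes to Hadamard division and to the Seeley extension. *)
Definition tame (phi : R -> R) :=
  continuous phi /\ exists N M, forall a, `|phi a| <= M * (1 + `|a|) ^+ N.

Definition tame_functional (L : (R -> R) -> R) :=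
  (forall c phi psi, tame phi -> tame psi ->
     L (fun a => c * phi a + psi a) = c * L phi + L psi) /\
  (forall N, exists2 C, 0 <= C & forall phi M, continuous phi ->
     (forall a, `|phi a| <= M * (1 + `|a|) ^+ N) -> `|L phi| <= C * M).

Lemma one_norm_ge1 (a : R) N : 1 <= (1 + `|a|) ^+ N.
Proof. by rewrite exprn_ege1 // lerDl. Qed.

Lemma tameD c phi psi : tame phi -> tame psi -> tame (fun a => c * phi a + psi a).
Proof.
move=> [cphi [N [M HM]]] [cpsi [N' [M' HM']]]; split.
  move=> x; apply: cvgD; last exact: cpsi.
  by apply: cvgM; [exact: cvg_cst|exact: cphi].
exists (N + N')%N, (`|c| * M + M') => a.
have h1 := one_norm_ge1 a N; have h2 := one_norm_ge1 a N'.
have M0 : 0 <= M.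
  by have := le_trans (normr_ge0 _) (HM 0); rewrite normr0 addr0 expr1n mulr1.
have M'0 : 0 <= M'.
  by have := le_trans (normr_ge0 _) (HM' 0); rewrite normr0 addr0 expr1n mulr1.
rewrite (le_trans (ler_normD _ _)) // mulrDl lerD //.
  rewrite normrM -mulrA ler_wpM2l // (le_trans (HM a)) // ler_wpM2l //.
  by rewrite exprD ler_peMr // (le_trans ler01).
rewrite (le_trans (HM' a)) // ler_wpM2l //.
by rewrite exprD ler_peMl // (le_trans ler01).
Qed.

Lemma lin2_continuous (A B : R) : continuous (fun v : 'rV[R]_2 => v 0 0 * A + v 0 1 * B).
Proof.
have oT : open [set: 'rV[R]_2] by exact: openT.
have H i (C : R) : smooth_on setT (fun v : 'rV[R]_2 => v 0 i * C).
  apply: smooth_onM => //; last exact: smooth_on_cst.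
  by apply: smooth_on_coord => //; exact: smooth_on_id.
by move=> v; exact: smooth_on_continuous (smooth_onD oT (H 0 A) (H 1 B)) _.
Qed.

Section Dilate.
Variable L : (R -> R) -> R.
Hypothesis HL : tame_functional L.

(** Derivation in x brings out a factor a; with the weight a^k the family is closed under
    derivation: g_u comes with the same k and g_x with k + 1. *)
Definition dilate k (g : 'rV[R]_2 -> R) (p : 'rV[R]_2) : R :=
  L (fun a => a ^+ k * g (scale1 a p)).

Lemma scale1_continuous p : continuous (scale1 ^~ p).
Proof.
have : smooth_on setT (scale1 ^~ p).
  apply: smooth_on_vec2; first exact: openT.
    exact: smooth_on_cst.
  apply: smooth_onM; first exact: openT.
    exact: smooth_on_id.
  exact: smooth_on_cst.
by move=> s a; exact: smooth_on_continuous s _.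
Qed.

Lemma dilate_continuous_arg k g p : csmooth g -> continuous (fun a : R => a ^+ k * g (scale1 a p)).
Proof.
move=> cg a; apply: cvgM; first exact: exprn_continuous.
apply: (@continuous_comp _ _ _ (scale1 ^~ p) g); first exact: scale1_continuous.
exact: csmooth_continuous.
Qed.

Lemma tame_dilate k g p : csmooth g -> tame (fun a => a ^+ k * g (scale1 a p)).
Proof.
move=> cg; split; first exact: dilate_continuous_arg.
have [M M0 HM] := csmooth_bounded cg.
exists k, M => a; rewrite normrM mulrC ler_pM // normrX lerXn2r ?nnegrE //.
by rewrite lerDr.
Qed.

(** The functional is applied to the Taylor remainder of [g] at the dilated points, which,
    multiplied by a^k, is at most C (1 + |a|)^(k+2) |h|^2. Boundedness on such functions gives an
    error O(|h|^2), without any exchange of limits. *)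
Lemma is_diff_dilate k g p : csmooth g -> is_diff p (dilate k g)
  (fun v => v 0 0 * dilate k ('D_e0 g) p + v 0 1 * dilate k.+1 ('D_e1 g) p).
Proof.
move=> cg; have [C C0 HC] := csmooth_taylor cg.
have [K K0 HK] := proj2 HL k.+2.
apply: is_diff_eps_fun.
- move=> b x y; move: (dilate k _ p) (dilate k.+1 _ p) => A B; rewrite !mxE.
  rewrite -[RHS]/(b * (x 0 0 * A + x 0 1 * B) + (y 0 0 * A + y 0 1 * B)); ring.
- exact: lin2_continuous.
move=> e e0_.
have d0 : 0 < e / (K * C + 1) by rewrite divr_gt0 // ltr_wpDl // mulr_ge0.
have : \forall h \near (0 : 'rV[R]_2), `|h| < e / (K * C + 1).
  by apply/nbhs_normP; exists (e / (K * C + 1)) => // h; rewrite /ball_ /= sub0r normrN.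
apply: filterS => h hd.
have cd0 := csmooth_derive e0 cg; have cd1 := csmooth_derive e1 cg.
pose psi (a : R) : R := a ^+ k * (g (scale1 a p + scale1 a h) - g (scale1 a p) - 'D_(scale1 a h) g (scale1 a p)).
have psiE : psi = (fun a => (- h 0 0) * (a ^+ k * 'D_e0 g (scale1 a p)) +
    ((- h 0 1) * (a ^+ k.+1 * 'D_e1 g (scale1 a p)) +
     (-1 * (a ^+ k * g (scale1 a p)) + a ^+ k * g (scale1 a (h + p))))).
  apply/funext => a; rewrite /psi derive_row2; last exact: csmooth_differentiable.
  have sE (x y : R) : x *: y = x * y by [].
  rewrite !sE !vec2E [h + p]addrC scale1D exprS.
  move: ('D_e0 g _) ('D_e1 g _) (g _) (g _) => d0' d1' ga gb; ring.
have t1 := tame_dilate k p cd0; have t2 := tame_dilate k.+1 p cd1.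
have t3 := tame_dilate k p cg; have t4 := tame_dilate k (h + p) cg.
have t5 := tameD (-1) t3 t4; have t6 := tameD (- h 0 1) t2 t5.
have Lpsi : L psi = dilate k g (h + p) - dilate k g p -
    (h 0 0 * dilate k ('D_e0 g) p + h 0 1 * dilate k.+1 ('D_e1 g) p).
  rewrite psiE (proj1 HL _ _ _ t1 t6) (proj1 HL _ _ _ t2 t5) (proj1 HL _ _ _ t3 t4) /dilate.
  move: (h 0 0) (h 0 1) (L _) (L _) (L _) (L _) => x y A B C' D; ring.
have cpsi : continuous psi.
  by have [c _] := tameD (- h 0 0) t1 t6; rewrite psiE.
rewrite -Lpsi.
have : `|L psi| <= K * (C * `|h| ^+ 2).
  apply: HK => // a; rewrite /psi normrM.
  have : `|a ^+ k| <= (1 + `|a|) ^+ k.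
    by rewrite normrX lerXn2r ?nnegrE ?addr_ge0 // lerDr.
  have -> : (1 + `|a|) ^+ k.+2 = (1 + `|a|) ^+ k * (1 + `|a|) ^+ 2 by rewrite -exprD addn2.
  move=> ak; rewrite mulrCA; apply: ler_pM => //.
  apply: (le_trans (HC _ _)); rewrite -mulrA ler_wpM2l // -exprMn mulrC.
  by rewrite lerXn2r ?nnegrE ?mulr_ge0 ?addr_ge0 // norm_scale1.
move=> /le_trans; apply; rewrite expr2 !mulrA ler_wpM2r //.
have : `|h| * (K * C + 1) < e by rewrite -ltr_pdivlMr // ltr_wpDl // mulr_ge0.
have := normr_ge0 h; have := mulr_ge0 K0 C0; move: (K * C) `|h| => q n h1 h2 h3; clear -h1 h2 h3; nra.
Qed.

Lemma dilate_smooth k g : csmooth g -> smooth_on setT (dilate k g).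
Proof.
move=> cg n; elim: n k g cg => [|n IH] k g cg.
  by move=> p _; have ? := is_diff_dilate k p cg; exact: differentiable_continuous.
split=> [p _|v]; first by have ? := is_diff_dilate k p cg; exact: ex_diff.
have H0 := IH k _ (csmooth_derive e0 cg); have H1 := IH k.+1 _ (csmooth_derive e1 cg).
have oT : open [set: 'rV[R]_2] by exact: openT.
have := class_onD oT (class_onM oT (@smooth_on_cst R _ R setT (v 0 0) n) H0)
  (class_onM oT (@smooth_on_cst R _ R setT (v 0 1) n) H1).
apply: class_on_ext => // p _; have ? := is_diff_dilate k p cg.
by rewrite deriveE // diff_val fctE.
Qed.

Lemma derive_dilate k g p v : csmooth g -> 'D_v (dilate k g) p =
  v 0 0 * dilate k ('D_e0 g) p + v 0 1 * dilate k.+1 ('D_e1 g) p.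
Proof. by move=> cg; have ? := is_diff_dilate k p cg; rewrite deriveE // diff_val. Qed.

End Dilate.
End Row2.

(** * Hadamard division *)

Section Int01.
Variable R : realType.
Local Notation e1 := (delta_mx 0 1 : 'rV[R]_2).

Definition int01 (phi : R -> R) : R := \int[lebesgue_measure]_(a in `[0%R, 1%R]) phi a.

Lemma integrable01 (phi : R -> R) : continuous phi ->
  lebesgue_measure.-integrable `[0%R, 1%R] (EFin \o phi).
Proof.
move=> cphi; apply: continuous_compact_integrable; first exact: segment_compact.
exact: continuous_subspaceT.
Qed.

Lemma int01_tame : tame_functional int01.
Proof.
split=> [c phi psi [cphi _] [cpsi _]|N].
  have ccphi : continuous (fun a => c * phi a).
    by move=> x; apply: cvgM; [exact: cvg_cst|exact: cphi].
  rewrite /int01 RintegralD //; try exact: integrable01.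
  by rewrite RintegralZl //; exact: integrable01.
exists (2 ^+ N) => [|phi M cphi HM]; first exact: exprn_ge0.
have M0 : 0 <= M.
  by have := le_trans (normr_ge0 _) (HM 0); rewrite normr0 addr0 expr1n mulr1.
have cn : continuous (fun a => `|phi a|).
  by move=> x; apply: (continuous_comp (cphi x)); exact: norm_continuous.
apply: (le_trans (le_normr_Rintegral _ (integrable01 cphi))) => //.
have ic := integrable01 (@cst_continuous _ _ (M * 2 ^+ N)).
apply: (le_trans (le_Rintegral _ (integrable01 cn) ic _)) => //.
  move=> x /=; rewrite in_itv /= => /andP[x0 x1]; apply: (le_trans (HM x)).
  rewrite ler_wpM2l // lerXn2r ?nnegrE ?addr_ge0 //.
  by rewrite ger0_norm //; lra.
by rewrite Rintegral_cst //= lebesgue_measure_itv /= lte_fin ltr01 /= subr0 mulr1 mulrC.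
Qed.

Lemma scale1_line a (p : 'rV[R]_2) : scale1 a p = scale1 0 p + a *: (p 0 1 *: e1).
Proof. by apply: row2P; rewrite !mxE /= ?(mulr0, mulr1, addr0, mul0r, add0r). Qed.

Lemma scale1_1 (p : 'rV[R]_2) : scale1 1 p = p.
Proof. by rewrite /scale1 mul1r vec2_eta. Qed.

Lemma hadamard (g : 'rV[R]_2 -> R) p : csmooth g ->
  g p - g (scale1 0 p) = p 0 1 * dilate int01 0 ('D_e1 g) p.
Proof.
move=> cg; have cd := csmooth_derive e1 cg.
have sE (x y : R) : x *: y = x * y by [].
have dF (a : R) : is_derive a 1 (fun a : R => g (scale1 a p)) (p 0 1 * 'D_e1 g (scale1 a p)).
  have := @is_derive_line R _ _ g (scale1 0 p) (p 0 1 *: e1) a (csmooth_differentiable _ cg).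
  have -> : (fun s : R => g (scale1 0 p + s *: (p 0 1 *: e1))) = (fun a => g (scale1 a p)).
    by apply/funext => s; rewrite -scale1_line.
  rewrite -scale1_line [X in is_derive _ _ _ X]deriveE; last exact: csmooth_differentiable.
  by rewrite linearZ /= -deriveE //; exact: csmooth_differentiable.
have c1 : continuous (fun a : R => p 0 1 * 'D_e1 g (scale1 a p)).
  have := dilate_continuous_arg (k := 0) (p := p) cd.
  move=> c a; apply: cvgM; first exact: cvg_cst.
  by have := c a; under eq_fun do rewrite expr0 mul1r.
have c2 : continuous (fun a : R => 'D_e1 g (scale1 a p)).
  by have := dilate_continuous_arg (k := 0) (p := p) cd; under eq_fun do rewrite expr0 mul1r.
have cF : continuous (fun a : R => g (scale1 a p)).
  by have := dilate_continuous_arg (k := 0) (p := p) cg; under eq_fun do rewrite expr0 mul1r.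
have -> : dilate int01 0 ('D_e1 g) p = int01 (fun a => 'D_e1 g (scale1 a p)).
  by rewrite /dilate; congr int01; apply/funext => a; rewrite expr0 mul1r.
rewrite /int01 -RintegralZl //; last exact: integrable01.
rewrite /Rintegral (@continuous_FTC2 _ _ (fun a => g (scale1 a p))) //=.
- by rewrite scale1_1.
- exact: continuous_subspaceT.
- split.
  + by move=> x _; case: (dF x).
  + by apply: cvg_at_right_filter; exact: cF.
  + by apply: cvg_at_left_filter; exact: cF.
- by move=> x _; rewrite derive1E; have ? := dF x; rewrite derive_val.
Qed.

(** The relation is assumed only along the segment to [p], because after a cut-off it survives only
    near the origin. *)
Lemma hadamard2 (g w : 'rV[R]_2 -> R) p : csmooth g -> csmooth w ->
  (forall a, 0 <= a <= 1 -> 'D_e1 g (scale1 a p) = a * p 0 1 * w (scale1 a p)) ->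
  g p - g (scale1 0 p) = p 0 1 ^+ 2 * dilate int01 1 w p.
Proof.
move=> cg cw E; rewrite hadamard // expr2 -mulrA; congr (_ * _).
rewrite /dilate /int01 -RintegralZl //; last first.
  by apply: integrable01; exact: dilate_continuous_arg.
apply: eq_Rintegral => a; rewrite inE /= in_itv /= => a01; rewrite E //; ring.
Qed.

Lemma int01_0 c : int01 (fun a => a ^+ 0 * c) = c.
Proof.
rewrite /int01; under eq_Rintegral do rewrite expr0 mul1r.
by rewrite Rintegral_cst //= lebesgue_measure_itv /= lte_fin ltr01 /= subr0 mulr1.
Qed.

Lemma int01_X n : int01 (fun a => a ^+ n) = n.+1%:R^-1.
Proof.
rewrite /int01 /Rintegral (@continuous_FTC2 _ _ (fun a => n.+1%:R^-1 * a ^+ n.+1)) //=.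
- by rewrite expr1n expr0n /= mulr0 subr0 mulr1.
- by apply: continuous_subspaceT => x; exact: exprn_continuous.
- have c : continuous (fun a : R => n.+1%:R^-1 * a ^+ n.+1).
    by move=> x; apply: cvgM; [exact: cvg_cst|exact: exprn_continuous].
  split.
  + by move=> x _; apply: derivableM => //; exact: exprn_derivable.
  + by apply: cvg_at_right_filter; exact: c.
  + by apply: cvg_at_left_filter; exact: c.
- move=> x _; rewrite derive1Ml; last exact: exprn_derivable.
  by rewrite exp_derive1 /= mulrA mulVf ?pnatr_eq0 // mul1r.
Qed.

End Int01.

(** * A functional with alternating even moments *)

Section Seeley.
Variable R : realType.
Implicit Types phi psi : R -> R.

(* The nodes are the powers of 4; without the factors [1 / (1 + b)] the weights
   annihilate every power of [b] (a theta function vanishes at the powers of its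
   nome), so that with them consecutive moments are opposite. *)
Definition seeley_term phi n : R := (- 1) ^+ n * 4^-1 ^+ (n * n.+1) *
  (phi (4 ^+ n) / (1 + 16 ^+ n) - phi (4^-1 ^+ n.+1) / (1 + 16^-1 ^+ n.+1)).

Definition seeley_raw phi : R := limn (series (seeley_term phi)).

(** The weight 4^(-n (n + 1)) beats the growth 4^(n N): since n N <= n^2 + N^2, a factor 4^(-n)
    remains. *)
Lemma seeley_term_bound N phi M n : (forall a, `|phi a| <= M * (1 + `|a|) ^+ N) ->
  `|seeley_term phi n| <= geometric (2 ^+ N.+1 * 4 ^+ (N * N) * M) 4^-1 n.
Proof.
move=> HM.
have M0 : 0 <= M.
  by have := le_trans (normr_ge0 _) (HM 0); rewrite normr0 addr0 expr1n mulr1.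
have p4 k : 1 <= 4 ^+ k :> R by rewrite exprn_ege1 // ler1n.
have le_div (x y : R) : 0 <= y -> `|x / (1 + y)| <= `|x|.
  move=> y0; have y1 : 0 < 1 + y by rewrite ltr_wpDr.
  by rewrite normrM normfV (gtr0_norm y1) ler_pdivrMr // ler_peMr // lerDl.
have h1 : `|phi (4 ^+ n) / (1 + 16 ^+ n)| <= M * 2 ^+ N * 4 ^+ (n * N).
  apply: (le_trans (le_div _ _ (exprn_ge0 _ _))) => //; apply: (le_trans (HM _)).
  rewrite -mulrA ler_wpM2l // exprM -exprMn lerXn2r ?nnegrE ?addr_ge0 ?mulr_ge0 ?exprn_ge0 //.
  by rewrite ger0_norm ?exprn_ge0 // mulrDl mul1r lerD2r.
have h2 : `|phi (4^-1 ^+ n.+1) / (1 + 16^-1 ^+ n.+1)| <= M * 2 ^+ N * 4 ^+ (n * N).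
  apply: (le_trans (le_div _ _ (exprn_ge0 _ _))); first by rewrite invr_ge0.
  apply: (le_trans (HM _)); rewrite -mulrA ler_wpM2l //.
  have p1 : 4^-1 ^+ n.+1 <= 1 :> R by rewrite exprn_ile1 // ?invf_le1 ?ler1n ?invr_ge0.
  have -> : 2 ^+ N * 4 ^+ (n * N) = (2 * 4 ^+ n) ^+ N :> R by rewrite exprMn exprM.
  rewrite lerXn2r ?nnegrE ?addr_ge0 ?mulr_ge0 ?exprn_ge0 //.
  rewrite ger0_norm ?exprn_ge0 ?invr_ge0 // mulrDl mul1r lerD // (le_trans p1) //.
rewrite /seeley_term normrM normrM normrX normrN1 expr1n mul1r.
rewrite ger0_norm ?exprn_ge0 ?invr_ge0 //.
apply: (@le_trans _ _ (4^-1 ^+ (n * n.+1) * (2 * (M * 2 ^+ N * 4 ^+ (n * N))))).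
  rewrite ler_wpM2l ?exprn_ge0 ?invr_ge0 // (le_trans (ler_normB _ _)) //.
  by rewrite mulrDl mul1r lerD.
have -> : 4^-1 ^+ (n * n.+1) * (2 * (M * 2 ^+ N * 4 ^+ (n * N))) =
    2 ^+ N.+1 * M * (4^-1 ^+ (n * n) * 4 ^+ (n * N)) * 4^-1 ^+ n :> R.
  by rewrite mulnS exprD exprS; ring.
rewrite /geometric /=; have -> : 2 ^+ N.+1 * 4 ^+ (N * N) * M * 4^-1 ^+ n =
   2 ^+ N.+1 * M * 4 ^+ (N * N) * 4^-1 ^+ n :> R by ring.
rewrite ler_wpM2r ?exprn_ge0 ?invr_ge0 // ler_wpM2l ?mulr_ge0 ?exprn_ge0 //.
rewrite exprVn ler_pdivrMl ?exprn_gt0 // -exprD ler_weXn2l ?ler1n //.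
nia.
Qed.

Lemma seeley_cvg phi N M : (forall a, `|phi a| <= M * (1 + `|a|) ^+ N) ->
  cvgn [normed series (seeley_term phi)].
Proof.
move=> HM; pose v := geometric (2 ^+ N.+1 * 4 ^+ (N * N) * M) (4^-1 : R).
have le n : `|seeley_term phi n| <= v n by exact: seeley_term_bound.
apply: (@series_le_cvg R (fun n => `|seeley_term phi n|) v) => // [n|].
  exact: le_trans (le n).
by apply: is_cvg_geometric_series; rewrite ger0_norm ?invr_ge0 // invf_lt1 // ltr1n.
Qed.

Lemma seeley_raw_bound phi N M : (forall a, `|phi a| <= M * (1 + `|a|) ^+ N) ->
  `|seeley_raw phi| <= 2 ^+ N.+1 * 4 ^+ (N * N) * (1 - 4^-1)^-1 * M.
Proof.
move=> HM; have c := seeley_cvg HM.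
have r1 : `|4^-1| < 1 :> R by rewrite ger0_norm ?invr_ge0 // invf_lt1 // ltr1n.
apply: (le_trans (lim_series_norm c)).
have cg := @cvg_geometric_series R (2 ^+ N.+1 * 4 ^+ (N * N) * M) _ r1.
apply: (le_trans (lim_series_le c (cvgP _ cg) _)).
  by move=> n; exact: seeley_term_bound.
by rewrite (cvg_lim _ cg) // mulrAC.
Qed.

Lemma seeley_raw_lin c phi psi : tame phi -> tame psi ->
  seeley_raw (fun a => c * phi a + psi a) = c * seeley_raw phi + seeley_raw psi.
Proof.
move=> [_ [N [M HM]]] [_ [N' [M' HM']]].
have c1 := normed_cvg (seeley_cvg HM); have c2 := normed_cvg (seeley_cvg HM').
rewrite /seeley_raw -[c * _]/(c *: _) -lim_seriesZ // -lim_seriesD //; last exact: is_cvg_seriesZ.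
congr (limn (series _)); apply/funext => n; rewrite !fctE /seeley_term /=.
by rewrite -[_ *: _]/(_ * _); ring.
Qed.

Lemma lim_series_recl (u : R^nat) : cvgn (series u) ->
  limn (series u) = u 0%N + limn (series (fun n => u n.+1)).
Proof.
move=> cu; have E n : series u n.+1 = u 0%N + series (fun n => u n.+1) n.
  by rewrite !seriesEord /= big_ord_recl.
have c' : series (fun n => u n.+1) @ \oo --> limn (series u) - u 0%N.
  have -> : series (fun n => u n.+1) = (fun n => series u n.+1 - u 0%N).
    by apply/funext => n; rewrite E addrAC subrr add0r.
  apply: cvgB; last exact: cvg_cst.
  by rewrite (cvg_shiftS (series u)).
by rewrite (cvg_lim _ c') // addrC subrK.
Qed.

(** The two halves of the moment of a^(2 k) without the denominators, b = a^2 being 16^n or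
    16^(-n-1). *)
Let P k n : R := (- 1) ^+ n * 4^-1 ^+ (n * n.+1) * 16 ^+ (n * k).
Let Q k n : R := (- 1) ^+ n * 4^-1 ^+ (n * n.+1) * 16^-1 ^+ (n.+1 * k).

Let r4 : `|4^-1| < 1 :> R.
Proof. by rewrite ger0_norm ?invr_ge0 // invf_lt1 // ltr1n. Qed.

Let geo_cvg (u : R^nat) a : (forall n, `|u n| <= geometric a 4^-1 n) -> cvgn (series u).
Proof.
move=> ua; apply: normed_cvg.
apply: (@series_le_cvg R (fun n => `|u n|) (geometric a (4^-1 : R))) => // [n|].
  exact: le_trans (ua n).
exact: is_cvg_geometric_series.
Qed.

Let E16 : 16 = 4 ^+ 2 :> R. Proof. by rewrite expr2 -natrM. Qed.

Let V4 m n p : (m + p <= n)%N -> 4^-1 ^+ n * 4 ^+ m <= 4^-1 ^+ p :> R.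
Proof.
move=> mpn; rewrite !exprVn ler_pdivrMl ?exprn_gt0 // ler_pdivlMr ?exprn_gt0 //.
by rewrite -exprD ler_weXn2l // ler1n.
Qed.

Let P_cvg k : cvgn (series (P k)).
Proof.
apply: (@geo_cvg _ (4 ^+ (k * k))) => n; rewrite /P /geometric /=.
rewrite normrM normrM normrX normrN1 expr1n mul1r !ger0_norm ?exprn_ge0 ?invr_ge0 //.
rewrite E16 -exprM mulrC -[leRHS]mulrC !exprVn.
rewrite ler_pdivrMr ?exprn_gt0 // -mulrA ler_pdivlMl ?exprn_gt0 // -!exprD ler_weXn2l ?ler1n //.
by have [+ _] := nat_Cauchy n k; rewrite mulnS -!mulnn; lia.
Qed.

Let Q_cvg k : cvgn (series (Q k)).
Proof.
apply: (@geo_cvg _ 1) => n; rewrite /Q /geometric /=.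
rewrite normrM normrM normrX normrN1 expr1n !mul1r !ger0_norm ?exprn_ge0 ?invr_ge0 //.
have i4 : 4^-1 <= 1 :> R by rewrite invf_le1 ?ler1n.
have h1 : 4^-1 ^+ (n * n.+1) <= 4^-1 ^+ n :> R.
  by rewrite ler_wiXn2l ?invr_ge0 // mulnS leq_addr.
have h2 : 16^-1 ^+ (n.+1 * k) <= 1 :> R.
  by rewrite exprn_ile1 ?invr_ge0 // invf_le1 ?ler1n.
rewrite -[leRHS]mulr1 ler_pM ?exprn_ge0 ?invr_ge0 //.
Qed.

Let PS k n : P k.+1 n.+1 = - 16 ^+ k * P k n.
Proof.
rewrite /P E16 -!exprM exprS.
have -> : (n.+1 * n.+2 = n * n.+1 + 2 * n.+1)%N by ring.
have -> : (2 * (n.+1 * k.+1) = 2 * k + 2 * (n * k) + 2 * n.+1)%N by ring.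
have E : 4^-1 ^+ (2 * n.+1) * 4 ^+ (2 * n.+1) = 1 :> R.
  by rewrite -exprMn mulVf ?expr1n.
by rewrite !exprD -[RHS]mulr1 -[X in _ = _ * X]E; ring.
Qed.

Let QS k n : Q k n.+1 = - 16^-1 ^+ k * Q k.+1 n.
Proof.
rewrite /Q E16 -!exprVn -!exprM exprS.
have -> : (n.+1 * n.+2 = n * n.+1 + 2 * n.+1)%N by ring.
have -> : (2 * (n.+2 * k) = 2 * k + 2 * (n.+1 * k))%N by ring.
have -> : (2 * (n.+1 * k.+1) = 2 * n.+1 + 2 * (n.+1 * k))%N by ring.
by rewrite !exprD; ring.
Qed.

Let P0 k : P k 0%N = 1.
Proof. by rewrite /P !mul0n !expr0 !mulr1. Qed.

Let Q0 k : Q k 0%N = 16^-1 ^+ k.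
Proof. by rewrite /Q mul0n !expr0 !mul1r mul1n. Qed.

(** Shifting the index gives sum P_(k+1) = 1 - 16^k sum P_k and sum Q_k = 16^(-k) (1 - sum Q_(k+1)),
    so the equality propagates from k = 0, where the terms coincide. *)
Let PQ k : limn (series (P k)) = limn (series (Q k)).
Proof.
elim: k => [|k IH].
  by congr (limn (series _)); apply/funext => n; rewrite /P /Q !muln0 !expr0.
have hP : limn (series (P k.+1)) = 1 - 16 ^+ k * limn (series (P k)).
  rewrite lim_series_recl // P0; congr (_ + _).
  have -> : (fun n => P k.+1 n.+1) = (- 16 ^+ k) *: P k by apply/funext => n; rewrite PS.
  by rewrite lim_seriesZ // scaleNr.
have hQ : limn (series (Q k)) = 16^-1 ^+ k - 16^-1 ^+ k * limn (series (Q k.+1)).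
  rewrite lim_series_recl // Q0; congr (_ + _).
  have -> : (fun n => Q k n.+1) = (- 16^-1 ^+ k) *: Q k.+1 by apply/funext => n; rewrite QS.
  by rewrite lim_seriesZ // scaleNr.
rewrite hP IH hQ exprVn mulrBr mulrA mulfV ?expf_neq0 // mul1r; ring.
Qed.

Let even_bound k (a : R) : `|a ^+ (2 * k)| <= 1 * (1 + `|a|) ^+ (2 * k).
Proof. by rewrite mul1r normrX lerXn2r ?nnegrE ?addr_ge0 // lerDr. Qed.

Let even_cvg k : cvgn (series (seeley_term (fun a => a ^+ (2 * k)))).
Proof. exact/normed_cvg/(seeley_cvg (@even_bound k)). Qed.

(** The identity b^(k+1) + b^k = b^k (1 + b) cancels the denominators, and [PQ] annihilates what is
    left. *)
Let moment_step k : seeley_raw (fun a => a ^+ (2 * k.+1)) = - seeley_raw (fun a => a ^+ (2 * k)).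
Proof.
apply/eqP; rewrite -addr_eq0 /seeley_raw -lim_seriesD //.
have -> : seeley_term (fun a => a ^+ (2 * k.+1)) + seeley_term (fun a => a ^+ (2 * k)) = P k - Q k.
  apply/funext => n; rewrite !fctE /seeley_term /P /Q.
  have h1 : (4 ^+ n : R) ^+ (2 * k) = 16 ^+ (n * k) by rewrite E16 -!exprM; congr (_ ^+ _); ring.
  have h2 : (4^-1 ^+ n.+1 : R) ^+ (2 * k) = 16^-1 ^+ (n.+1 * k).
    by rewrite E16 -exprVn -!exprM; congr (_ ^+ _); ring.
  have h3 : (4 ^+ n : R) ^+ (2 * k.+1) = 16 ^+ (n * k) * 16 ^+ n.
    by rewrite E16 -!exprM -exprD; congr (_ ^+ _); ring.
  have h4 : (4^-1 ^+ n.+1 : R) ^+ (2 * k.+1) = 16^-1 ^+ (n.+1 * k) * 16^-1 ^+ n.+1.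
    by rewrite E16 -exprVn -!exprM -exprD; congr (_ ^+ _); ring.
  rewrite h1 h2 h3 h4.
  have p1 : 1 + 16 ^+ n != 0 :> R by rewrite gt_eqF // ltr_wpDr ?exprn_ge0.
  have p2 : 1 + 16^-1 ^+ n.+1 != 0 :> R by rewrite gt_eqF // ltr_wpDr ?exprn_ge0 ?invr_ge0.
  move: p1 p2; set A := 16 ^+ n; set B := 16^-1 ^+ n.+1 => p1 p2.
  by field; rewrite p1 p2.
rewrite lim_seriesB; [|exact: P_cvg|exact: Q_cvg].
by rewrite (PQ k); apply/eqP; exact: subrr.
Qed.

Let s0 : R := seeley_raw (fun a => a ^+ 0).

(** The term n = 0 is 1/2 - 16/17 = -15/34, while the others are dominated by a geometric series of
    sum 1/15. *)
Let s0_neq0 : s0 != 0.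
Proof.
have c0 := @even_cvg 0; rewrite muln0 in c0.
rewrite /s0 /seeley_raw lim_series_recl //.
set t := limn _; have tb : `|t| <= 16^-1 / (1 - 16^-1).
  have r16 : `|16^-1| < 1 :> R by rewrite ger0_norm ?invr_ge0 // invf_lt1 // ltr1n.
  have le n : `|seeley_term (fun a : R => a ^+ 0) n.+1| <= geometric 16^-1 16^-1 n.
    rewrite /seeley_term !expr0 !div1r normrM normrM normrX normrN1 expr1n mul1r.
    rewrite ger0_norm ?exprn_ge0 ?invr_ge0 // /geometric /= -exprS.
    have inv01 (y : R) : 0 <= y -> 0 <= (1 + y)^-1 <= 1.
      by move=> y0; rewrite invr_ge0 addr_ge0 //= invf_le1 ?ltr_wpDr // lerDl.
    have H1 : 0 <= (1 + 16 ^+ n.+1 : R)^-1 <= 1 by rewrite inv01 ?exprn_ge0.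
    have H2 : 0 <= (1 + 16^-1 ^+ n.+2 : R)^-1 <= 1 by rewrite inv01 ?exprn_ge0 ?invr_ge0.
    have H3 : `|(1 + 16 ^+ n.+1)^-1 - (1 + 16^-1 ^+ n.+2)^-1| <= 1 :> R.
      by rewrite ler_norml; move: H1 H2; lra.
    rewrite -[leRHS]mulr1 ler_pM ?exprn_ge0 ?invr_ge0 //.
    rewrite E16 -exprVn -exprM ler_wiXn2l ?invr_ge0 ?invf_le1 ?ler1n //.
    by nia.
  have cn : cvgn [normed series (fun n => seeley_term (fun a : R => a ^+ 0) n.+1)].
    apply: (@series_le_cvg R _ (geometric 16^-1 (16^-1 : R))) => [n|n|n|].
    - exact: normr_ge0.
    - exact: le_trans (normr_ge0 _) (le n).
    - exact: le.
    - exact: is_cvg_geometric_series.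
  apply: (le_trans (lim_series_norm cn)).
  have cg := @cvg_geometric_series R 16^-1 _ r16.
  by apply: (le_trans (lim_series_le cn (cvgP _ cg) le)); rewrite (cvg_lim _ cg).
have t0E : seeley_term (fun a : R => a ^+ 0) 0%N = - (15 / 34).
  by rewrite /seeley_term !expr0 expr1; field.
rewrite t0E; apply/eqP => H; have : t = 15 / 34 by move: H; lra.
move=> tE; move: tb; rewrite tE ger0_norm; last by lra.
have -> : 16^-1 / (1 - 16^-1) = 15^-1 :> R by field.
lra.
Qed.

(** A substitute for evaluation at a = sqrt(-1), with which it agrees on even powers of a. Applied
    to the dilations of g(u, x) = F(u, x^2), it plays the role of F(u, -x^2). *)
Definition seeley phi : R := s0^-1 * seeley_raw phi.

Lemma seeley_moment k : seeley (fun a => a ^+ (2 * k)) = (- 1) ^+ k.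
Proof.
rewrite /seeley; elim: k => [|k IH]; first by rewrite muln0 -/s0 mulVf.
by rewrite moment_step mulrN IH exprS mulN1r.
Qed.

Lemma seeley_tame : tame_functional seeley.
Proof.
split=> [c phi psi tphi tpsi|N].
  by rewrite /seeley seeley_raw_lin //; ring.
exists (`|s0^-1| * (2 ^+ N.+1 * 4 ^+ (N * N) * (1 - 4^-1)^-1)) => [|phi M _ HM].
  have : 0 <= (1 - 4^-1 : R)^-1 by rewrite invr_ge0; lra.
  by move=> h; rewrite !mulr_ge0 ?exprn_ge0.
by rewrite /seeley normrM -[leRHS]mulrA; apply: ler_wpM2l => //; exact: seeley_raw_bound.
Qed.

End Seeley.

(** * Bump functions *)

Section Flat.
Variable R : realType.

(* [flat k x = x^-k exp(-1/x)] for [x > 0]; the family is closed under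
   derivation up to linear combinations. *)
Definition flat k (x : R) : R := if 0 < x then x ^- k * expR (- x^-1) else 0.

(** The term of degree k + 2 in the series of exp(1/x) suffices; the bound by a multiple of x^2
    yields the derivative 0 at the origin. *)
Lemma flat_le k (x : R) : 0 < x -> flat k x <= (k.+2)`!%:R * x ^+ 2.
Proof.
move=> x0; rewrite /flat x0.
have xi0 : 0 <= x^-1 by rewrite invr_ge0 ltW.
have h := @expR_ge1Dxn R x^-1 k.+1 xi0.
have h2 : x^-1 ^+ k.+2 / (k.+2)`!%:R <= expR x^-1.
  by apply: le_trans h; rewrite lerDr.
have f0 : 0 < (k.+2)`!%:R :> R by rewrite ltr0n fact_gt0.
rewrite expRN ler_pdivrMr ?expR_gt0 //.
rewrite ler_pdivrMr // in h2.
apply: (@le_trans _ _ (x ^+ 2 * x^-1 ^+ k.+2)).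
  have xn : x != 0 by rewrite gt_eqF.
  have k2 : k.+2 = (k + 2)%N by rewrite addn2.
  rewrite exprVn k2 exprD invfM mulrCA mulfV ?mulr1 //.
  by rewrite expf_neq0.
by rewrite [leRHS]mulrAC [leRHS]mulrC ler_wpM2l ?sqr_ge0 // [leRHS]mulrC.
Qed.

Lemma flat_ge0 k (x : R) : 0 <= flat k x.
Proof.
rewrite /flat; case: ifPn => // x0.
by rewrite mulr_ge0 ?invr_ge0 ?exprn_ge0 ?expR_ge0 // ltW.
Qed.

Lemma is_derive_flat k (x : R) :
  is_derive x 1 (flat k) (- k%:R * flat k.+1 x + flat k.+2 x).
Proof.
have [x0|x0|x0] := ltgtP 0 x.
- have nE : \forall y \near x, y ^- k * expR (- y^-1) = flat k y.
    have : \forall y \near x, 0 < y by exact: lt_nbhsr.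
    by apply: filterS => y y0; rewrite /flat y0.
  apply: (near_eq_is_derive nE).
  have xn : x != 0 by rewrite gt_eqF.
  rewrite /flat x0.
  have dV : is_derive x 1 (fun y : R => y^-1) (- x ^- 2).
    apply: DeriveDef; first exact: (@derivableV _ _ id).
    by rewrite (@deriveV _ _ id) // derive_id -[_ *: _]/(_ * _) mulr1.
  have dX := is_deriveX k dV.
  have dN := is_deriveN dV.
  have dE := @is_derive1_comp R (@expR R) (- (fun y : R => y^-1)) x _ _ (is_derive_expR (- x^-1)) dN.
  have -> : (fun y : R => y ^- k * expR (- y^-1)) =
      (fun y : R => y^-1) ^+ k * (expR \o (- (fun y : R => y^-1))).
    by apply/funext => y; rewrite /= !fctE exprVn.
  apply: is_derive_eq (is_deriveM dX dE) _.
  rewrite !fctE -![_ *: _]/(_ * _) /=; case: k {nE dX} => [|k].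
    by rewrite /= -!exprVn !expr0 mul1r !mul0r mulr0 addr0 oppr0 mul0r add0r opprK mulrC.
  by rewrite /= opprK -!exprVn !exprS; ring.
- have nE : \forall y \near x, 0 = flat k y.
    have : \forall y \near x, y < 0.
      by apply: (@near_lt_continuous _ _ id (cst 0)) => //; exact: cst_continuous.
    by apply: filterS => y y0; rewrite /flat ltNge ltW.
  apply: (near_eq_is_derive nE).
  rewrite /flat ltNge (ltW x0) /= mulr0 addr0.
  exact: is_derive_cst.
- rewrite -x0 /flat ltxx /= mulr0 addr0.
  suff H : is_diff 0 (flat k) (fun=> 0 : R).
    by apply: DeriveDef; [apply/derivable1_diffP|rewrite deriveE // diff_val].
  apply: is_diff_eps_fun.
  + by move=> b y z; rewrite scaler0 addr0.
  + by move=> y; exact: cvg_cst.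
  move=> e e0; set C : R := (k.+2)`!%:R.
  have C0 : 0 < C by rewrite ltr0n fact_gt0.
  have : \forall h \near (0 : R), `|h| < e / C.
    apply/nbhs_normP; exists (e / C); first by rewrite /= divr_gt0.
    by move=> h; rewrite /ball_ /= sub0r normrN.
  apply: filterS => h hd; rewrite addr0 {2}/flat ltxx !subr0.
  rewrite ger0_norm ?flat_ge0 //; have [h0|h0] := ltP 0 h; last first.
    by rewrite /flat ltNge h0 /= mulr_ge0 // ltW.
  apply: (le_trans (flat_le _ h0)); rewrite -/C expr2 mulrA (gtr0_norm h0).
  by rewrite ler_wpM2r ?(ltW h0) // mulrC -ler_pdivlMr // -(gtr0_norm h0) ltW.
Qed.

Lemma smooth_flat k : smooth_on setT (flat k).
Proof.
move=> n; elim: n k => [|n IH] k.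
  move=> x _; apply: differentiable_continuous; apply/derivable1_diffP.
  by case: (is_derive_flat k x).
split=> [x _|v]; first by apply/derivable1_diffP; case: (is_derive_flat k x).
have oT : open [set: R] by exact: openT.
have H := class_onD oT (class_onM oT (@smooth_on_cst _ _ R setT (- k%:R) n) (IH k.+1)) (IH k.+2).
have := class_onM oT (@smooth_on_cst _ _ R setT v n) H.
apply: class_on_ext => // x _; rewrite !fctE.
have dx : differentiable (flat k) x by apply/derivable1_diffP; case: (is_derive_flat k x).
have ? := is_derive_flat k x.
have D1 : 'd (flat k) x 1 = - k%:R * flat k.+1 x + flat k.+2 x.
  by rewrite -deriveE // derive_val.
by rewrite deriveE // -D1 -[v in RHS]mulr1 -[v * 1]/(v *: 1) linearZ.
Qed.

(* equal to 1 on [-1, 1] and to 0 outside ]-2, 2[ *)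
Definition bump (x : R) : R :=
  let f := flat 0 in let d y := f y / (f y + f (1 - y)) in d (2 - x) * d (2 + x).

Lemma flat0_gt0 x : 0 < x -> 0 < flat 0 x.
Proof. by move=> x0; rewrite /flat x0 mulr_gt0 ?invr_gt0 ?exprn_gt0 ?expR_gt0. Qed.

Lemma flat0_den x : 0 < flat 0 x + flat 0 (1 - x).
Proof.
have [x0|x0] := ltP 0 x; first by rewrite ltr_pwDl ?flat0_gt0 ?flat_ge0.
by rewrite ltr_wpDl ?flat_ge0 // flat0_gt0 //; lra.
Qed.

Lemma smooth_bump : smooth_on setT bump.
Proof.
have oT : open [set: R] by exact: openT.
have comp (g : R -> R) : smooth_on setT g -> smooth_on setT (fun x => flat 0 (g x)).
  by move=> sg; apply: (@smooth_on_comp1 _ _ setT setT g (flat 0)) => //; exact: smooth_flat.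
have sd (g : R -> R) : smooth_on setT g ->
    smooth_on setT (fun x => flat 0 (g x) / (flat 0 (g x) + flat 0 (1 - g x))).
  move=> sg; apply: smooth_on_div => //; first exact: comp.
    apply: smooth_onD => //; first exact: comp.
    by apply: comp; apply: smooth_onB => //; exact: smooth_on_cst.
  by move=> x _; rewrite gt_eqF // flat0_den.
apply: smooth_onM => //; apply: sd.
  by apply: smooth_onB => //; [exact: smooth_on_cst|exact: smooth_on_id].
by apply: smooth_onD => //; [exact: smooth_on_cst|exact: smooth_on_id].
Qed.

Lemma bump_ge0 x : 0 <= bump x.
Proof.
by rewrite /bump mulr_ge0 ?divr_ge0 ?flat_ge0 ?ltW ?flat0_den.
Qed.

Lemma bump_gt0 x : `|x| < 2 -> 0 < bump x.
Proof.
rewrite ltr_norml => /andP[x1 x2].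
by rewrite /bump mulr_gt0 ?divr_gt0 ?flat0_gt0 ?flat0_den //; lra.
Qed.

Lemma bump_out x : 2 <= `|x| -> bump x = 0.
Proof.
have F y : y <= 0 -> flat 0 y = 0 by move=> y0; rewrite /flat ltNge y0.
rewrite ler_normr /bump => /orP[x2|x2]; first by rewrite [flat 0 (2 - x)]F ?mul0r //; lra.
by rewrite [flat 0 (2 + x)]F ?mul0r ?mulr0 //; lra.
Qed.

Lemma bump_in x : `|x| <= 1 -> bump x = 1.
Proof.
have F y : y <= 0 -> flat 0 y = 0 by move=> y0; rewrite /flat ltNge y0.
rewrite ler_norml => /andP[x1 x2]; rewrite /bump.
rewrite [flat 0 (1 - (2 - x))]F; last by lra.
rewrite [flat 0 (1 - (2 + x))]F; last by lra.
by rewrite !addr0 !mulfV ?mulr1 // gt_eqF // flat0_gt0 //; lra.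
Qed.

End Flat.

Lemma csmooth_cutoff (R : realType) n (U : set 'rV[R]_n) (f : 'rV[R]_n -> R) :
  open U -> U 0 -> smooth_on U f ->
  exists2 g : 'rV[R]_n -> R, csmooth g & \forall p \near (0 : 'rV[R]_n), g p = f p.
Proof.
move=> oU U0 sf.
have [r /= r0 rU] : exists2 r : R, 0 < r & forall p, `|p| < r -> U p.
  have : nbhs (0 : 'rV[R]_n) U by apply: open_nbhs_nbhs.
  move=> /(proj1 (nbhs_normP _ _))[r /= r0 rU]; exists r => // p pr.
  by apply: rU; rewrite /ball_ /= sub0r normrN.
(* This scale makes the cut-off equal to 1 for |p| <= r / 4 and to 0 for |p| >= r / 2. *)
pose k := 4 / r; have k0 : 0 < k by rewrite divr_gt0.
pose chi (p : 'rV[R]_n) : R := \prod_(j < n) bump (k * p 0 j).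
have oT : open [set: 'rV[R]_n] by exact: openT.
have schi : smooth_on setT chi.
  apply: smooth_on_prod => // j _.
  apply: (@smooth_on_comp1 _ _ setT setT (fun p : 'rV[R]_n => k * p 0 j) (@bump R)) => //.
    apply: smooth_onM => //; first exact: smooth_on_cst.
    by apply: smooth_on_coord => //; exact: smooth_on_id.
  exact: smooth_bump.
have chi0 p : r / 2 <= `|p| -> chi p = 0.
  move=> rp; have [j rj] : exists j, r / 2 <= `|p 0 j|.
    apply: contrapT => H; have : `|p| < r / 2.
      apply: mx_normr_ltP; first by rewrite divr_gt0.
      by move=> i j; rewrite ord1 ltNge; apply/negP => ?; apply: H; exists j.
    by rewrite ltNge rp.
  rewrite /chi (bigD1 j) //= bump_out ?mul0r // normrM (gtr0_norm k0).
  rewrite /k mulrAC ler_pdivlMr //; lra.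
exists (fun p => if `|p| < r then chi p * f p else 0).
  split.
    pose A b : set 'rV[R]_n := if b then [set p | `|p| < r] else [set p | r / 2 < `|p|].
    have -> : setT = \bigcup_b A b.
      apply/seteqP; split=> // p _; have [h|h] := ltP `|p| r; first by exists true.
      by exists false => //=; apply: lt_le_trans h; lra.
    have nc : continuous (fun p : 'rV[R]_n => `|p|) by exact: norm_continuous.
    have oA b : open (A b).
      case: b; rewrite openE => p /= pr.
        by have /cvgr_lt := nc p; apply.
      by have /cvgr_gt := nc p; apply.
    apply: smooth_on_bigcup => -[].
      apply: (@smooth_on_ext _ _ _ _ (fun p => chi p * f p)) => //.
        by move=> p /set_mem /= ->.
      apply: smooth_onM => //; first exact: smooth_on_sub schi.
      by apply: smooth_on_sub sf => p; exact: rU.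
    apply: (@smooth_on_ext _ _ _ _ (cst (0 : R))) => //; last exact: smooth_on_cst.
    by move=> p /set_mem /= /ltW/chi0 ->; rewrite mul0r if_same.
  by exists r => // p rp; rewrite ltNge ltW.
have : \forall p \near (0 : 'rV[R]_n), `|p| < r / 4.
  by apply/nbhs_normP; exists (r / 4); [rewrite /= divr_gt0|move=> h; rewrite /ball_ /= sub0r normrN].
apply: filterS => p pr; rewrite ifT; last by lra.
suff -> : chi p = 1 by rewrite mul1r.
rewrite /chi big1 // => j _; apply: bump_in; rewrite normrM (gtr0_norm k0).
have := mx_normr_entry p 0 j; rewrite /k mulrAC ler_pdivrMr //; lra.
Qed.

(** * Whitney's theorem on even functions, with a parameter *)

Lemma derive_dir1 (R : realType) (W : normedModType R) (f : R -> W) x w :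
  differentiable f x -> 'D_w f x = w *: 'D_1 f x.
Proof.
move=> df; rewrite (deriveE w df) (deriveE (1 : R) df).
have -> : 'd f x w = 'd f x (w *: (1 : R)) by rewrite -[w *: 1]/(w * 1) mulr1.
by rewrite linearZ.
Qed.

Lemma near_eq_is_diff (R : realType) (V W : normedModType R) (f g L : V -> W) x :
  (\forall y \near x, f y = g y) -> is_diff x f L -> is_diff x g L.
Proof.
move=> fg df; have df' : differentiable f x by exact: ex_diff.
have dg : differentiable g x := near_eq_differentiable fg df'.
apply: DiffDef => //; apply/funext => v; rewrite -(deriveE v dg) -(near_eq_derive _ fg).
by rewrite (deriveE v df') diff_val.
Qed.

(** Written as sqrt x / (2 x), the derivative is a smooth multiple of the function itself, so the
    class increases by induction. *)
Lemma smooth_sqrt (R : realType) : smooth_on [set x : R | 0 < x] Num.sqrt.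
Proof.
have oU : open [set x : R | 0 < x] by exact: open_gt.
have D (x : R) : 0 < x -> is_derive x 1 Num.sqrt ((2 * Num.sqrt x)^-1).
  exact: is_derive1_sqrt.
move=> k; elim: k => [|k IH].
  by move=> x /D H; apply/differentiable_continuous/derivable1_diffP; case: H.
split=> [x /D H|v]; first by apply/derivable1_diffP; case: H.
have s2 : smooth_on [set x : R | 0 < x] (fun x => v * (2 * x)^-1).
  apply: smooth_onM => //; first exact: smooth_on_cst.
  apply: smooth_onV => //; last by move=> x /= x0; rewrite gt_eqF // mulr_gt0.
  by apply: smooth_onM => //; [exact: smooth_on_cst|exact: smooth_on_id].
apply: class_on_ext (class_onM oU (s2 k) IH) => // x /set_mem /= x0.
have H := D x x0; have dx : differentiable Num.sqrt x by apply/derivable1_diffP; case: H.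
have E : 'd Num.sqrt x 1 = (2 * Num.sqrt x)^-1 by rewrite -deriveE // derive_val.
rewrite [RHS]deriveE // -[v in RHS]mulr1 -[v * 1]/(v *: 1) [RHS]linearZ /= E -[_ *: _]/(_ * _).
rewrite -mulrA; congr (_ * _); rewrite -{1}(sqr_sqrtr (ltW x0)).
have s0 : Num.sqrt x != 0 by rewrite gt_eqF // sqrtr_gt0.
by field.
Qed.

Section Whitney.
Variable R : realType.
Local Notation e0 := (delta_mx 0 0 : 'rV[R]_2).
Local Notation e1 := (delta_mx 0 1 : 'rV[R]_2).
Implicit Types (g e : 'rV[R]_2 -> R) (p q v : 'rV[R]_2).

(** Evaluation being a tame functional, the rules for [dilate] contain those for composition with
    [scale1]. *)
Lemma eval_tame (a : R) : tame_functional (fun phi : R -> R => phi a).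
Proof.
split=> // N; exists ((1 + `|a|) ^+ N); first by rewrite exprn_ge0 // addr_ge0.
by move=> phi M _ /(_ a); rewrite mulrC.
Qed.

Lemma e0E : (e0 0 0 = 1) * (e0 0 1 = 0). Proof. by rewrite !mxE. Qed.
Lemma e1E : (e1 0 0 = 0) * (e1 0 1 = 1). Proof. by rewrite !mxE. Qed.

Lemma derive_scale1 a g p v : csmooth g ->
  'D_v (fun q => g (scale1 a q)) p =
  v 0 0 * 'D_e0 g (scale1 a p) + v 0 1 * (a * 'D_e1 g (scale1 a p)).
Proof.
move=> cg; have := derive_dilate (eval_tame a) 0 p v cg.
have -> : dilate (fun phi : R -> R => phi a) 0 g = (fun q => g (scale1 a q)).
  by apply/funext => q; rewrite /dilate expr0 mul1r.
by rewrite /dilate expr0 mul1r expr1.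
Qed.

Lemma smooth_scale1 a g : csmooth g -> smooth_on setT (fun q => g (scale1 a q)).
Proof.
move=> cg; have := dilate_smooth (eval_tame a) 0 cg.
congr (smooth_on setT); apply/funext => q; by rewrite /dilate expr0 mul1r.
Qed.

Lemma scale1_scale1 a b p : scale1 a (scale1 b p) = scale1 (a * b) p.
Proof. by apply: row2P; rewrite !vec2E ?mulrA. Qed.

Lemma scale1_axis a u : scale1 a (vec2 u 0) = vec2 u 0 :> 'rV[R]_2.
Proof. by apply: row2P; rewrite !vec2E ?mulr0. Qed.

Lemma scale1_0 p : scale1 0 p = vec2 (p 0 0) 0.
Proof. by rewrite /scale1 mul0r. Qed.

Definition divx g : 'rV[R]_2 -> R := dilate (@int01 R) 0 ('D_e1 g).

Lemma divxE g p : csmooth g -> g (vec2 (p 0 0) 0) = 0 -> g p = p 0 1 * divx g p.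
Proof. by move=> cg g0; rewrite -hadamard // scale1_0 g0 subr0. Qed.

(** Far from the origin either x <> 0 and the quotient is g / x = 0, or |u| is large and the whole
    segment to the axis avoids the support of g_x. *)
Lemma csmooth_divx g : csmooth g -> (forall u, g (vec2 u 0) = 0) -> csmooth (divx g).
Proof.
move=> cg g0; split; first exact/(dilate_smooth (@int01_tame R))/csmooth_derive.
have [_ [M M0 gM]] := csmooth_derive e1 cg; have [_ [M' M'0 gM']] := cg.
exists (Num.max M M'); first by rewrite lt_max M0.
move=> p; rewrite gt_max => /andP[pM pM'].
have [uM|uM] := lerP `|p 0 0| M.
  have x0 : p 0 1 != 0.
    apply: contraTneq pM => x0; rewrite -leNgt; apply: norm_row2_le => //.
    by rewrite x0 normr0 ltW.
  have /esym/eqP := divxE cg (g0 (p 0 0)).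
  by rewrite gM' // mulf_eq0 (negbTE x0) => /eqP.
rewrite /divx /dilate -[RHS](int01_0 0); congr (@int01 R); apply/funext => a.
rewrite gM //; apply: lt_le_trans uM _.
by have := mx_normr_entry (scale1 a p) 0 0; rewrite vec2E.
Qed.

Lemma divx_axis g u : divx g (vec2 u 0) = 'D_e1 g (vec2 u 0).
Proof.
rewrite /divx /dilate -[RHS]int01_0; congr (@int01 R); apply/funext => a.
by rewrite scale1_axis.
Qed.

Definition even1 g := forall p, g (scale1 (- 1) p) = g p.
Definition odd1 g := forall p, g (scale1 (- 1) p) = - g p.

Lemma odd1_axis g u : odd1 g -> g (vec2 u 0) = 0.
Proof. by move=> /(_ (vec2 u 0)); rewrite scale1_axis; lra. Qed.

Lemma derive_even1 g : csmooth g -> even1 g -> odd1 ('D_e1 g) /\ even1 ('D_e0 g).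
Proof.
move=> cg eg; have E : (fun q => g (scale1 (- 1) q)) = g by apply/funext.
split=> p.
  have := derive_scale1 (- 1) p e1 cg; rewrite E !e1E => ->; ring.
by have := derive_scale1 (- 1) p e0 cg; rewrite E !e0E => ->; ring.
Qed.

Lemma derive_odd1 g : csmooth g -> odd1 g -> even1 ('D_e1 g).
Proof.
move=> cg og p; have E : (fun q => g (scale1 (- 1) q)) = - g.
  by apply/funext => q; rewrite og.
have := derive_scale1 (- 1) p e1 cg; rewrite E !e1E deriveN; last first.
  by apply/diff_derivable/csmooth_differentiable.
by move=> H; move: H; lra.
Qed.

Lemma divx_even1 g : csmooth g -> odd1 g -> even1 (divx g).
Proof.
move=> cg og p; rewrite /divx /dilate; congr (@int01 R); apply/funext => a.
have -> : scale1 a (scale1 (- 1) p) = scale1 (- 1) (scale1 a p) by rewrite !scale1_scale1 mulrC.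
by rewrite (derive_odd1 cg og).
Qed.

(* [half e = e_x / (2 x)] *)
Definition half e : 'rV[R]_2 -> R := fun p => 2^-1 * divx ('D_e1 e) p.

Lemma csmooth_half e : csmooth e -> even1 e -> csmooth (half e).
Proof.
move=> ce ee; have [oe _] := derive_even1 ce ee.
apply: csmoothM; first exact: smooth_on_cst.
by apply: csmooth_divx => [|u]; [exact: csmooth_derive|apply: odd1_axis oe].
Qed.

Lemma halfE e p : csmooth e -> even1 e -> 'D_e1 e p = 2 * p 0 1 * half e p.
Proof.
move=> ce ee; have [oe _] := derive_even1 ce ee.
rewrite (divxE (csmooth_derive e1 ce)); last exact: odd1_axis oe.
rewrite /half.
by rewrite mulrACA mulfV ?mul1r.
Qed.

Lemma half_even1 e : csmooth e -> even1 e -> even1 (half e).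
Proof.
move=> ce ee p; have [oe _] := derive_even1 ce ee.
by rewrite /half divx_even1 //; exact: csmooth_derive.
Qed.

(** The value at (u, -x^2) of the extension to be built, after k derivations in y: each of them
    contributes the factor -a^2 and replaces [e] by [half e]. *)
Let neg k e : 'rV[R]_2 -> R := fun q => (- 1) ^+ k * dilate (@seeley R) (2 * k) e q.

Let neg_diff k e q : csmooth e -> even1 e -> is_diff q (neg k e)
  (fun v => v 0 0 * neg k ('D_e0 e) q + v 0 1 * (- 2 * q 0 1 * neg k.+1 (half e) q)).
Proof.
move=> ce ee; have D := is_diff_dilate (@seeley_tame R) (2 * k) q ce.
have D' := is_diffZ ((- 1) ^+ k) D.
have -> : neg k e = (- 1) ^+ k *: dilate (@seeley R) (2 * k) e.
  by apply/funext => p; rewrite fctE.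
have -> : (fun v : 'rV[R]_2 => v 0 0 * neg k ('D_e0 e) q + v 0 1 * (- 2 * q 0 1 * neg k.+1 (half e) q)) =
   (- 1) ^+ k *: (fun v : 'rV[R]_2 => v 0 0 * dilate (@seeley R) (2 * k) ('D_e0 e) q +
      v 0 1 * dilate (@seeley R) (2 * k).+1 ('D_e1 e) q); last exact: D'.
apply/funext => v; rewrite fctE -[RHS]/(_ * _).
have -> : dilate (@seeley R) (2 * k).+1 ('D_e1 e) q = 2 * q 0 1 * dilate (@seeley R) (2 * k.+1) (half e) q.
  have ch := csmooth_half ce ee.
  have z : tame (fun=> 0 : R).
    by split; [exact: cst_continuous|exists 0%N, 0 => a; rewrite normr0 mul0r].
  have := (proj1 (@seeley_tame R)) (2 * q 0 1) _ _ (tame_dilate (2 * k.+1) q ch) z.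
  have -> : seeley (fun=> 0 : R) = 0.
    have := (proj1 (@seeley_tame R)) 1 _ _ z z; under eq_fun do rewrite mulr0 addr0.
    by move: (seeley _) => x; lra.
  rewrite addr0 => <-; rewrite /dilate; congr (@seeley R); apply/funext => a.
  rewrite halfE // vec2E mulnS !exprS addr0; ring.
by rewrite /neg exprS; ring.
Qed.

Let neg_axis k e u : neg k e (vec2 u 0) = e (vec2 u 0).
Proof.
rewrite /neg /dilate.
have z : tame (fun=> 0 : R).
  by split; [exact: cst_continuous|exists 0%N, 0 => a; rewrite normr0 mul0r].
have t : tame (fun a : R => a ^+ (2 * k)).
  split; first exact: exprn_continuous.
  exists (2 * k)%N, 1 => a; rewrite mul1r normrX lerXn2r ?nnegrE ?addr_ge0 //.
  by rewrite lerDr.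
have z0 : seeley (fun=> 0 : R) = 0.
  have := (proj1 (@seeley_tame R)) 1 _ _ z z; under eq_fun do rewrite mulr0 addr0.
  by move: (seeley _) => x; lra.
have := (proj1 (@seeley_tame R)) (e (vec2 u 0)) _ _ t z.
rewrite z0 addr0 seeley_moment.
have -> : (fun a : R => e (vec2 u 0) * a ^+ (2 * k) + 0) =
   (fun a => a ^+ (2 * k) * e (scale1 a (vec2 u 0))).
  by apply/funext => a; rewrite addr0 mulrC scale1_axis.
move=> ->; rewrite mulrCA -exprD addnn -mul2n exprM sqrrN expr1n expr1n mulr1 //.
Qed.

(** The extension of e(u, sqrt y) to y < 0. Derivation in y takes (k, e) to (k + 1, half e) on both
    sides, and the moments of [seeley] make the two sides agree at y = 0 for every k. Smoothness
    thus reduces to the continuity of this family. *)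
Definition whitney_ext k e p : R :=
  if 0 <= p 0 1 then e (vec2 (p 0 0) (Num.sqrt (p 0 1)))
  else neg k e (vec2 (p 0 0) (Num.sqrt (- p 0 1))).

Let coord_cont i : continuous (fun p : 'rV[R]_2 => p 0 i).
Proof. by move=> p; exact: coord_continuous. Qed.

Let vec2_cont (f g : 'rV[R]_2 -> R) : continuous f -> continuous g ->
  continuous (fun p => vec2 (f p) (g p)).
Proof.
move=> cf cg.
have -> : (fun p => vec2 (f p) (g p)) = (fun p => f p *: e0) + (fun p => g p *: e1).
  by apply/funext => p; rewrite fctE; apply: row2P; rewrite !mxE /= ?(mulr0, mulr1, addr0, add0r).
by move=> p; apply: continuousD; apply: continuousZr_tmp; [exact: cf|exact: cg].
Qed.

Lemma whitney_ext_continuous k e : csmooth e -> even1 e -> continuous (whitney_ext k e).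
Proof.
move=> ce ee p.
pose cp p := e (vec2 (p 0 0) (Num.sqrt (p 0 1))).
pose cm p := neg k e (vec2 (p 0 0) (Num.sqrt (- p 0 1))).
have ccp : continuous cp.
  move=> q; apply: (@continuous_comp _ _ _ (fun p => vec2 (p 0 0) (Num.sqrt (p 0 1))) e).
    apply: vec2_cont => [|x]; first exact: coord_cont.
    apply: (@continuous_comp _ _ _ (fun p : 'rV[R]_2 => p 0 1)); first exact: coord_cont.
    exact: sqrt_continuous.
  exact: csmooth_continuous.
have ccm : continuous cm.
  move=> q; apply: (@continuous_comp _ _ _ (fun p => vec2 (p 0 0) (Num.sqrt (- p 0 1))) (neg k e)).
    apply: vec2_cont => [|x]; first exact: coord_cont.
    apply: (@continuous_comp _ _ _ (fun p : 'rV[R]_2 => - p 0 1)).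
      by apply: continuousN; exact: coord_cont.
    exact: sqrt_continuous.
  have ? := neg_diff k (vec2 (q 0 0) (Num.sqrt (- q 0 1))) ce ee.
  exact: differentiable_continuous.
have [y0|y0|y0] := ltgtP 0 (p 0 1).
- have H : \forall q \near p, cp q = whitney_ext k e q.
    have : \forall q \near p, 0 < (q : 'rV[R]_2) 0 1.
      apply: (@near_lt_continuous _ _ (cst 0)) => //; first exact: cst_continuous.
      exact: coord_cont.
    by apply: filterS => q q0; rewrite /whitney_ext ltW.
  rewrite /continuous_at -(nbhs_singleton H).
  by apply: cvg_trans (ccp p); exact: near_eq_cvg H.
- have H : \forall q \near p, cm q = whitney_ext k e q.
    have : \forall q \near p, (q : 'rV[R]_2) 0 1 < 0.
      apply: (@near_lt_continuous _ _ _ (cst 0)) => //; last exact: cst_continuous.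
      exact: coord_cont.
    by apply: filterS => q q0; rewrite /whitney_ext leNgt q0.
  rewrite /continuous_at -(nbhs_singleton H).
  by apply: cvg_trans (ccm p); exact: near_eq_cvg H.
- have E1 : cp p = whitney_ext k e p by rewrite /whitney_ext -y0 lexx /cp -y0.
  have E2 : cm p = whitney_ext k e p.
    by rewrite -E1 /cm /cp -y0 oppr0 sqrtr0 neg_axis.
  move=> A nA; have nA1 : nbhs (cp p) A by rewrite E1.
  have nA2 : nbhs (cm p) A by rewrite E2.
  have N1 : \forall q \near p, A (cp q) by exact: ccp nA1.
  have N2 : \forall q \near p, A (cm q) by exact: ccm nA2.
  apply: filterS2 N1 N2 => q /= A1 A2; rewrite /whitney_ext; case: ifP => _; [exact: A1|exact: A2].
Qed.

Let is_diff_chain (S : 'rV[R]_2 -> 'rV[R]_2) (f : 'rV[R]_2 -> R) (L dS : 'rV[R]_2 -> 'rV[R]_2) (M N : 'rV[R]_2 -> R) p :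
  is_diff p S dS -> is_diff (S p) f M -> (forall v, M (dS v) = N v) -> is_diff p (f \o S) N.
Proof. by move=> ? ? MN; apply: is_diff_eq (is_diff_comp _ _) _; apply/funext. Qed.

Let is_diff_sqrt_arg (c : R) p : 0 < c * p 0 1 ->
  is_diff p (fun q : 'rV[R]_2 => vec2 (q 0 0) (Num.sqrt (c * q 0 1)))
    (fun v => vec2 (v 0 0) (c * v 0 1 / (2 * Num.sqrt (c * p 0 1)))).
Proof.
move=> cp0; pose U := [set q : 'rV[R]_2 | 0 < c * q 0 1].
have oT : open [set: 'rV[R]_2] by exact: openT.
have sl : smooth_on setT (fun q : 'rV[R]_2 => c * q 0 1).
  apply: smooth_onM => //; first exact: smooth_on_cst.
  by apply: smooth_on_coord => //; exact: smooth_on_id.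
have oU : open U.
  rewrite openE => q q0; have H : \forall y \near q, 0 < c * (y : 'rV[R]_2) 0 1.
    apply: (@near_lt_continuous _ _ (cst 0)) => //; first exact: cst_continuous.
    exact: (smooth_on_continuous sl).
  exact: H.
have sU : smooth_on U (fun q : 'rV[R]_2 => Num.sqrt (c * q 0 1)).
  apply: (@smooth_on_comp1 _ _ U [set x : R | 0 < x] (fun q : 'rV[R]_2 => c * q 0 1) Num.sqrt) => //.
    exact: smooth_on_sub sl.
  exact: smooth_sqrt.
have s0 : smooth_on U (fun q : 'rV[R]_2 => q 0 0).
  by apply: smooth_on_coord => //; exact: smooth_on_id.
have sS := smooth_on_vec2 oU s0 sU.
have dS := smooth_on_differentiable sS (cp0 : U p).
apply: DiffDef => //; apply/funext => v; rewrite -deriveE //.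
apply: row2P; rewrite -derive_coord //.
  have -> : (fun y : 'rV[R]_2 => vec2 (y 0 0) (Num.sqrt (c * y 0 1)) 0 0) = (fun y => (id y) 0 0).
    by apply/funext => y; rewrite vec2E.
  by rewrite derive_coord ?derive_id ?vec2E.
have -> : (fun y : 'rV[R]_2 => vec2 (y 0 0) (Num.sqrt (c * y 0 1)) 0 1) = Num.sqrt \o (fun y => c * y 0 1).
  by apply/funext => y; rewrite vec2E.
have dl := smooth_on_differentiable sl (I : setT p).
have H := is_derive1_sqrt cp0.
have ds : differentiable Num.sqrt (c * p 0 1) by apply/derivable1_diffP; case: H.
rewrite derive_chain // vec2E.
have E : 'd Num.sqrt (c * p 0 1) 1 = (2 * Num.sqrt (c * p 0 1))^-1 by rewrite -deriveE // derive_val.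
have -> : 'D_v (fun y : 'rV[R]_2 => c * y 0 1) p = c * v 0 1.
  have -> : (fun y : 'rV[R]_2 => c * y 0 1) = c *: (fun y : 'rV[R]_2 => (id y) 0 1) by apply/funext.
  have d1 : differentiable (fun y : 'rV[R]_2 => (id y) 0 1) p by exact: differentiable_coord.
  by rewrite deriveZ ?derive_coord ?derive_id //; exact: diff_derivable.
by rewrite derive_dir1 // deriveE // E.
Qed.

Let whitney_ext_off k e p : csmooth e -> even1 e -> p 0 1 != 0 ->
  is_diff p (whitney_ext k e)
    (fun v => v 0 0 * whitney_ext k ('D_e0 e) p + v 0 1 * whitney_ext k.+1 (half e) p).
Proof.
move=> ce ee; rewrite neq_lt => /orP[y0|y0].
- pose S (q : 'rV[R]_2) := vec2 (q 0 0) (Num.sqrt (- 1 * q 0 1)).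
  have np : 0 < -1 * p 0 1 by rewrite mulN1r oppr_gt0.
  have H : is_diff p (neg k e \o S) (fun v => v 0 0 * whitney_ext k ('D_e0 e) p + v 0 1 * whitney_ext k.+1 (half e) p).
    apply: (is_diff_chain id (is_diff_sqrt_arg np) (neg_diff k _ ce ee)) => v.
    rewrite /whitney_ext leNgt y0 /= !vec2E mulN1r.
    have s0 : Num.sqrt (- p 0 1) != 0 by rewrite gt_eqF // sqrtr_gt0 oppr_gt0.
    congr (_ + _); rewrite mulrA; congr (_ * _); by field.
  have nE : \forall q \near p, (neg k e \o S) q = whitney_ext k e q.
    have : \forall q \near p, (q : 'rV[R]_2) 0 1 < 0.
      apply: (@near_lt_continuous _ _ _ (cst 0)) => //; last exact: cst_continuous.
      exact: coord_cont.
    by apply: filterS => q q0; rewrite /whitney_ext leNgt q0 /S /= mulN1r.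
  exact: near_eq_is_diff nE H.
- pose S (q : 'rV[R]_2) := vec2 (q 0 0) (Num.sqrt (1 * q 0 1)).
  have np : 0 < 1 * p 0 1 by rewrite mul1r.
  have De : is_diff (S p) e (fun v => v 0 0 * 'D_e0 e (S p) + v 0 1 * 'D_e1 e (S p)).
    have de := csmooth_differentiable (S p) ce.
    by apply: DiffDef => //; apply/funext => v; rewrite -(deriveE v de) (derive_row2 v de).
  have H : is_diff p (e \o S) (fun v => v 0 0 * whitney_ext k ('D_e0 e) p + v 0 1 * whitney_ext k.+1 (half e) p).
    apply: (is_diff_chain id (is_diff_sqrt_arg np) De) => v.
    rewrite /whitney_ext (ltW y0) halfE // /S !vec2E !mul1r.
    have s0 : Num.sqrt (p 0 1) != 0 by rewrite gt_eqF // sqrtr_gt0.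
    congr (_ + _); rewrite !mulrA; congr (_ * _); by field.
  have nE : \forall q \near p, (e \o S) q = whitney_ext k e q.
    have : \forall q \near p, 0 < (q : 'rV[R]_2) 0 1.
      apply: (@near_lt_continuous _ _ (cst 0)) => //; first exact: cst_continuous.
      exact: coord_cont.
    by apply: filterS => q q0; rewrite /whitney_ext ltW // /S /= mul1r.
  exact: near_eq_is_diff nE H.
Qed.

Lemma is_diff_whitney_ext k e p : csmooth e -> even1 e -> is_diff p (whitney_ext k e)
  (fun v => v 0 0 * whitney_ext k ('D_e0 e) p + v 0 1 * whitney_ext k.+1 (half e) p).
Proof.
move=> ce ee; have [y0|y0] := eqVneq (p 0 1) 0; last exact: whitney_ext_off.
pose F := whitney_ext k e; pose G0 := whitney_ext k ('D_e0 e); pose G1 := whitney_ext k.+1 (half e).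
have cF : continuous F by exact: whitney_ext_continuous.
have cG0 : continuous G0.
  by apply: whitney_ext_continuous; [exact: csmooth_derive|exact: (derive_even1 ce ee).2].
have cG1 : continuous G1.
  by apply: whitney_ext_continuous; [exact: csmooth_half|exact: half_even1].
have axis g j u : whitney_ext j g (vec2 u 0) = g (vec2 u 0).
  by rewrite /whitney_ext !vec2E lexx sqrtr0.
(* A segment starting on the axis either leaves it at once or stays in it. The mean value theorem
   then uses the derivative of [F] off the axis only, or along it, where [F] is [e]. *)
have MV h : exists2 s : R, 0 < s < 1 &
    F (p + h) - F p = h 0 0 * G0 (p + s *: h) + h 0 1 * G1 (p + s *: h).
  have [h1|h1] := eqVneq (h 0 1) 0.
    have ax (s : R) : p + s *: h = vec2 (p 0 0 + s * h 0 0) 0.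
      by apply: row2P; rewrite !mxE // y0 h1 mulr0 addr0.
    have [s s01 E] : exists2 s : R, 0 < s < 1 & e (p + h) - e p = 'D_h e (p + s *: h).
      by apply: MVT_line => s _; exact: csmooth_differentiable.
    exists s => //; rewrite h1 mul0r addr0.
    have := ax 1; have := ax 0; rewrite scale0r scale1r mul0r mul1r addr0 => E0 E1.
    rewrite /F /G0 E1 [in X in _ - X]E0 !axis ax axis -E1 -[in X in _ - X]E0 E -ax.
    by rewrite derive_row2 ?h1 ?scale0r ?addr0 //; exact: csmooth_differentiable.
  have dg (s : R) : s \in `]0, 1[ -> is_derive s 1 (fun s : R => F (p + s *: h))
      (h 0 0 * G0 (p + s *: h) + h 0 1 * G1 (p + s *: h)).
    rewrite in_itv /= => /andP[s0 _].
    have ps : (p + s *: h) 0 1 != 0 by rewrite !mxE y0 add0r mulf_neq0 // gt_eqF.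
    have D := whitney_ext_off k ce ee ps.
    have dD : differentiable (whitney_ext k e) (p + s *: h) by exact: ex_diff.
    by have := is_derive_line dD; rewrite (deriveE h dD) diff_val.
  have [] := @MVT R (fun s : R => F (p + s *: h)) _ 0 1 ltr01 dg.
    apply: continuous_subspaceT => s.
    apply: (@continuous_comp _ _ _ (fun s : R => p + s *: h) F); last exact: cF.
    apply: continuousD; first exact: cst_continuous.
    by apply: continuousZr_tmp; exact: cvg_id.
  move=> s; rewrite in_itv /= => s01; rewrite scale1r scale0r addr0 subr0 mulr1 => E.
  by exists s.
apply: is_diff_eps_fun.
- move=> b x y; move: (whitney_ext _ _ p) (whitney_ext _ _ p) => A B; rewrite !mxE.
  rewrite -[b *: _]/(b * _); ring.
- exact: lin2_continuous.
move=> eps eps0; rewrite -/F -/G0 -/G1.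
have eps2 : 0 < eps / 2 by rewrite divr_gt0.
have [d0 /= d00 H0] := (proj1 (nbhs_normP _ _)) (proj1 (@cvgrPdist_lt R R _ _ _ _ _) (cG0 p) _ eps2).
have [d1 /= d10 H1] := (proj1 (nbhs_normP _ _)) (proj1 (@cvgrPdist_lt R R _ _ _ _ _) (cG1 p) _ eps2).
apply/nbhs_normP; exists (Num.min d0 d1); first by rewrite /= lt_min d00.
move=> h; rewrite /ball_ /= sub0r normrN lt_min => /andP[hd0 hd1].
have [s /andP[s0 s1] E] := MV h; rewrite [h + p]addrC E.
have sh : `|s *: h| <= `|h| by rewrite normrZ gtr0_norm // ler_piMl // ltW.
have close (G : 'rV[R]_2 -> R) (d : R) : (forall y, `|p - y| < d -> `|G p - G y| < eps / 2) ->
    `|h| < d -> `|G (p + s *: h) - G p| <= eps / 2.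
  move=> H hd; rewrite distrC ltW // H // opprD addrA subrr sub0r normrN.
  exact: le_lt_trans hd.
have {}H0 := close G0 d0 H0 hd0; have {}H1 := close G1 d1 H1 hd1.
move: (G0 _) (G0 p) (G1 _) (G1 p) H0 H1 => a0 b0 a1 b1 H0 H1.
have -> : h 0 0 * a0 + h 0 1 * a1 - (h 0 0 * b0 + h 0 1 * b1) = h 0 0 * (a0 - b0) + h 0 1 * (a1 - b1).
  by ring.
have K (x y : R) : `|x| <= `|h| -> `|y| <= eps / 2 -> `|x * y| <= eps / 2 * `|h|.
  by move=> xh ye; rewrite normrM mulrC; apply: ler_pM.
apply: (le_trans (ler_normD _ _)).
have -> : eps * `|h| = eps / 2 * `|h| + eps / 2 * `|h| by lra.
by apply: lerD; apply: K => //; exact: mx_normr_entry.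
Qed.

Lemma smooth_whitney_ext k e : csmooth e -> even1 e -> smooth_on setT (whitney_ext k e).
Proof.
move=> + + n; elim: n k e => [|n IH] k e ce ee.
  by move=> p _; exact: whitney_ext_continuous.
split=> [p _|v]; first by have ? := is_diff_whitney_ext k p ce ee; exact: ex_diff.
have H0 := IH k _ (csmooth_derive e0 ce) (derive_even1 ce ee).2.
have H1 := IH k.+1 _ (csmooth_half ce ee) (half_even1 ce ee).
have oT : open [set: 'rV[R]_2] by exact: openT.
have := class_onD oT (class_onM oT (@smooth_on_cst R _ R setT (v 0 0) n) H0)
  (class_onM oT (@smooth_on_cst R _ R setT (v 0 1) n) H1).
apply: class_on_ext => // p _; have D := is_diff_whitney_ext k p ce ee.
have dD : differentiable (whitney_ext k e) p by exact: ex_diff.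
by rewrite (deriveE v dD) diff_val fctE.
Qed.

Lemma whitney_even e : csmooth e -> even1 e -> exists G : 'rV[R]_2 -> R,
  smooth_on setT G /\ forall p, G (vec2 (p 0 0) (p 0 1 ^+ 2)) = e p.
Proof.
move=> ce ee; exists (whitney_ext 0 e); split; first exact: smooth_whitney_ext.
move=> p; rewrite /whitney_ext !vec2E sqr_ge0 sqrtr_sqr.
have [x0|x0] := ger0P (p 0 1); first by rewrite vec2_eta.
rewrite -[RHS]ee /scale1; congr e; apply: row2P; rewrite !vec2E //; ring.
Qed.

(** The even part, and the odd part divided by x, are both even in x. Only the odd part contributes
    to g_x on the axis. *)
Lemma whitney_decomposition g : csmooth g -> exists A B : 'rV[R]_2 -> R,
  [/\ smooth_on setT A, smooth_on setT B,
      forall p, g p = A (vec2 (p 0 0) (p 0 1 ^+ 2)) + p 0 1 * B (vec2 (p 0 0) (p 0 1 ^+ 2)) &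
      forall u, B (vec2 u 0) = 'D_e1 g (vec2 u 0)].
Proof.
move=> cg; pose gN p := g (scale1 (- 1) p).
have cgN : csmooth gN.
  split; first exact: smooth_scale1.
  have [_ [M M0 gM]] := cg; exists M => // p pM; rewrite /gN gM //.
  apply: (lt_le_trans pM); apply: norm_row2_le.
    by have := mx_normr_entry (scale1 (-1) p) 0 0; rewrite vec2E.
  by have := mx_normr_entry (scale1 (-1) p) 0 1; rewrite vec2E mulN1r normrN.
have gNN p : gN (scale1 (- 1) p) = g p.
  by rewrite /gN scale1_scale1 mulrNN mulr1 scale1_1.
pose ge p := 2^-1 * (g p + gN p); pose go p := 2^-1 * (g p + -1 * gN p).
have cst_s (c : R) : smooth_on setT (cst c : 'rV[R]_2 -> R) by exact: smooth_on_cst.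
have cge : csmooth ge by exact: (csmoothM (cst_s 2^-1) (csmoothD cg cgN)).
have cgo : csmooth go.
  exact: (csmoothM (cst_s 2^-1) (csmoothD cg (csmoothM (cst_s (-1)) cgN))).
have ege : even1 ge by move=> p; rewrite /ge gNN -/(gN p) addrC.
have ogo : odd1 go by move=> p; rewrite /go gNN -/(gN p); ring.
have go0 u := odd1_axis u ogo.
have [A [sA EA]] := whitney_even cge ege.
have [B [sB EB]] := whitney_even (csmooth_divx cgo go0) (divx_even1 cgo ogo).
exists A, B; split=> // [p|u].
  by rewrite EA EB -divxE // /ge /go; lra.
have := EB (vec2 u 0); rewrite !vec2E expr0n /= => ->; rewrite divx_axis.
have dg := csmooth_differentiable (vec2 u 0) cg; have dgN := csmooth_differentiable (vec2 u 0) cgN.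
have -> : go = 2^-1 *: (g - gN).
  by apply/funext => p; rewrite !fctE /go mulN1r.
rewrite deriveZ; last by apply: derivableB; exact: diff_derivable.
rewrite deriveB; [|exact: diff_derivable|exact: diff_derivable].
rewrite [in X in _ *: (_ - X)]/gN derive_scale1 // !e1E scale1_axis -[_ *: _]/(_ * _).
by move: ('D_e1 g _) => x; lra.
Qed.

End Whitney.

(** * Normal form of a fold with extra components *)

Lemma shear_diffeo (R : realType) n (i : 'I_n) (U : set 'rV[R]_n) (phi : 'rV[R]_n -> R) a :
  open U -> U a -> smooth_on U phi -> ('D_(delta_mx 0 i) phi a : R) != 0 ->
  diffeo_germ (shear i phi) a (shear i phi a).
Proof.
move=> oU Ua sphi; rewrite neq_lt => /orP[c0|c0]; last exact: shear_diffeo_pos oU Ua sphi c0.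
have dphi := smooth_on_differentiable sphi Ua.
have c0' : 0 < ('D_(delta_mx 0 i) (- phi) a : R).
  by rewrite deriveN ?oppr_gt0 //; exact: diff_derivable.
have D := shear_diffeo_pos oU Ua (smooth_onN oU sphi) c0'.
pose N := shear i (fun p : 'rV[R]_n => - p 0 i).
have oT : open [set: 'rV[R]_n] by exact: openT.
have sN : smooth_on setT N.
  apply: smooth_on_shear => //; apply: smooth_onN => //.
  by apply: smooth_on_coord => //; exact: smooth_on_id.
have NN p : N (N p) = p.
  by apply/rowP => j; rewrite !shearE eqxx; case: eqP => // ->; rewrite opprK.
have DN b : diffeo_germ N b (N b) by exists N, setT, setT; split.
apply: (diffeo_germ_eq (b := N (shear i (- phi) a))); last first.
  by apply/rowP => j; rewrite !shearE eqxx; case: eqP => // _; rewrite fctE opprK.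
apply: diffeo_germ_near_eq (diffeo_germ_comp D (DN _)).
near=> p; apply/rowP => j; rewrite /= !shearE eqxx; case: eqP => // _; by rewrite fctE opprK.
Unshelve. all: by end_near. Qed.

Lemma diffeo_germ_global (R : realType) (V V' : normedModType R) (s : V -> V') (s' : V' -> V) a :
  smooth_on setT s -> smooth_on setT s' -> cancel s s' -> cancel s' s ->
  diffeo_germ s a (s a).
Proof. by move=> ss ss' h h'; exists s', setT, setT; split=> //; split=> //; exact: openT. Qed.

Lemma near_norm (R : realType) (V : normedModType R) (P : V -> Prop) :
  (\forall p \near (0 : V), P p) -> exists2 r : R, 0 < r & forall p, `|p| < r -> P p.
Proof.
move=> /(proj1 (nbhs_normP _ _))[r /= r0 rU]; exists r => // p pr.
by apply: rU; rewrite /ball_ /= sub0r normrN.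
Qed.

Lemma norm_near (R : realType) (V : normedModType R) (r : R) : 0 < r ->
  \forall p \near (0 : V), `|p| < r.
Proof.
by move=> r0; apply/nbhs_normP; exists r => // p; rewrite /ball_ /= sub0r normrN.
Qed.

Lemma open_norm_lt (R : realType) (V : normedModType R) (r : R) : open [set p : V | `|p| < r].
Proof.
rewrite openE => p /= pr; have H : \forall q \near p, `|q| < r.
  by have /cvgr_lt := @norm_continuous _ V p; apply.
exact: H.
Qed.

Lemma near_open_norm (R : realType) (V : normedModType R) (r : R) (p : V) : `|p| < r ->
  \forall q \near p, `|q| < r.
Proof.
move=> pr; have H : nbhs p [set q : V | `|q| < r].
  by apply: open_nbhs_nbhs; split=> //; exact: open_norm_lt.
exact: H.
Qed.

Lemma derive_ratio (R : realType) (V : normedModType R) (f g : V -> R) x v :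
  differentiable f x -> differentiable g x -> g x != 0 ->
  'D_v (fun y => f y / g y) x = 'D_v f x / g x - f x * 'D_v g x / g x ^+ 2.
Proof.
move=> /(@diff_derivable _ _ _ _ _ v) df /(@diff_derivable _ _ _ _ _ v) dg gx.
have E : 'D_v (fun y => f y / g y) x = f x *: 'D_v (fun y => (g y)^-1) x + (g x)^-1 *: 'D_v f x.
  exact: deriveM df (derivableV gx dg).
rewrite E deriveV // -[_ *: _]/(_ * _) -[_ *: _]/(_ * _) -[_ *: _]/(_ * _).
by field.
Qed.

Lemma derive_scale_dir (R : realType) (V W : normedModType R) (f : V -> W) x v a :
  differentiable f x -> 'D_(a *: v) f x = a *: 'D_v f x.
Proof. by move=> df; rewrite !deriveE // linearZ. Qed.

Section Opening.
Variables (R : realType) (n : nat).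
Local Notation e0 := (delta_mx 0 0 : 'rV[R]_2).
Local Notation e1 := (delta_mx 0 1 : 'rV[R]_2).

Definition j0 : 'I_n.+3 := @Ordinal n.+3 0 isT.
Definition j1 : 'I_n.+3 := @Ordinal n.+3 1 isT.
Definition j2 : 'I_n.+3 := @Ordinal n.+3 2 isT.

(** An opening of the fold (u, x^2): the differentials of the further components are combinations of
    du and d(x^2). *)
Definition opening (B : 'I_n.+3 -> 'rV[R]_2 -> R) (p : 'rV[R]_2) : 'rV[R]_n.+3 :=
  \row_j if j == j0 then p 0 0 else if j == j1 then p 0 1 ^+ 2
         else p 0 1 ^+ 3 * B j (vec2 (p 0 0) (p 0 1 ^+ 2)).

Lemma dilate_int01_axis k (w : 'rV[R]_2 -> R) u :
  dilate (@int01 R) k w (vec2 u 0) = w (vec2 u 0) / k.+1%:R.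
Proof.
rewrite /dilate; have -> : (fun a => a ^+ k * w (scale1 a (vec2 u 0))) =
    (fun a : R => w (vec2 u 0) * a ^+ k).
  by apply/funext => a; rewrite scale1_axis mulrC.
rewrite /int01 RintegralZl //; last exact/integrable01/exprn_continuous.
by rewrite -/(int01 _) int01_X.
Qed.

Lemma derive_dilate_axis k (w : 'rV[R]_2 -> R) u : csmooth w ->
  'D_e1 (dilate (@int01 R) k w) (vec2 u 0) = 'D_e1 w (vec2 u 0) / k.+2%:R.
Proof.
move=> cw; rewrite (derive_dilate (@int01_tame R)) // !e1E mul0r mul1r add0r.
exact: dilate_int01_axis.
Qed.

(** Hadamard division gives H_j(u, s) = h_j(u) + s^2 g_j(u, s), where g_j is the integral of a
    w_j(u, a s) over [0, 1]. With x = s sqrt |g_1| and g_j / |g_1| = A_j(u, x^2) + x B_j(u, x^2),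
    this reads h_j + x^2 A_j + x^3 B_j, whose first two terms are functions of the first two
    components. B_j(u, 0) is the s-derivative of g_j / |g_1| divided by that of x, hence [alpha] and
    [beta], the same for all j. *)
Lemma opening_normal_form (U : set 'rV[R]_2) (H : 'rV[R]_2 -> 'rV[R]_n.+3)
    (W : 'I_n.+3 -> 'rV[R]_2 -> R) :
  open U -> U 0 -> smooth_on U H -> (forall p, U p -> H p 0 j0 = p 0 0) ->
  (forall j, smooth_on U (W j)) ->
  (forall j p, U p -> 'D_e1 (fun q => H q 0 j) p = p 0 1 * W j p) ->
  W j1 0 != 0 ->
  exists (B : 'I_n.+3 -> 'rV[R]_2 -> R) (alpha beta : 'rV[R]_2 -> R) (r : R),
    [/\ forall j, smooth_on setT (B j), 0 < r,
        smooth_on [set p | `|p| < r] alpha /\ smooth_on [set p | `|p| < r] beta,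
        alpha 0 != 0 /\ forall j (u : R), `|u| < r -> B j (vec2 u 0) =
         alpha (vec2 u 0) * 'D_e1 (W j) (vec2 u 0) + beta (vec2 u 0) * W j (vec2 u 0) &
        germ_diffeomorphic H 0 (opening B) 0].
Proof.
move=> oU U0 sH H0 sW DH W1.
have cut (f : 'rV[R]_2 -> R) : smooth_on U f -> exists g : 'rV[R]_2 -> R,
    csmooth g /\ \forall p \near (0 : 'rV[R]_2), g p = f p.
  by move=> sf; have [g] := csmooth_cutoff oU U0 sf; exists g.
have [Ht HtP] := fin_all_exists (fun j => cut _ (smooth_on_coord j oU sH)).
have [Wt WtP] := fin_all_exists (fun j => cut _ (sW j)).
have [r r0 rP] : exists2 r : R, 0 < r & forall p : 'rV[R]_2, `|p| < r ->
    [/\ U p, forall j, Ht j p = H p 0 j & forall j, Wt j p = W j p].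
  apply: near_norm; have nU : \forall p \near (0 : 'rV[R]_2), U p by apply: open_nbhs_nbhs.
  have n1 : \forall p \near (0 : 'rV[R]_2), forall j, Ht j p = H p 0 j.
    by apply: (@filter_forall _ _ (fun j p => Ht j p = H p 0 j) (nbhs (0 : 'rV[R]_2))) => j; exact: (HtP j).2.
  have n2 : \forall p \near (0 : 'rV[R]_2), forall j, Wt j p = W j p.
    by apply: (@filter_forall _ _ (fun j p => Wt j p = W j p) (nbhs (0 : 'rV[R]_2))) => j; exact: (WtP j).2.
  by apply: filterS3 nU n1 n2.
pose g j := dilate (@int01 R) 1 (Wt j).
have sg j : smooth_on setT (g j) by exact/(dilate_smooth (@int01_tame R))/(WtP j).1.
have vec0 : vec2 0 0 = 0 :> 'rV[R]_2 by exact: vec2_00.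
have nvec u : `|u| < r -> `|vec2 u 0 : 'rV[R]_2| < r.
  by move=> ur; apply: norm_row2_lt; rewrite vec2E // normr0.
have HE j p : `|p| < r -> H p 0 j = Ht j (vec2 (p 0 0) 0) + p 0 1 ^+ 2 * g j p.
  move=> pr; have [_ <- _] := rP p pr.
  suff E : Ht j p - Ht j (scale1 0 p) = p 0 1 ^+ 2 * g j p by rewrite -E scale1_0 addrC subrK.
  apply: hadamard2; [exact: (HtP j).1|exact: (WtP j).1|].
  move=> a /andP[a0 a1].
  have ar : `|scale1 a p| < r.
    apply: norm_row2_lt; rewrite vec2E.
      by apply: le_lt_trans pr; exact: mx_normr_entry.
    rewrite normrM ger0_norm //; apply: le_lt_trans pr.
    apply: (le_trans _ (mx_normr_entry p 0 1)); exact: ler_piMl.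
  have [Ua _ ->] := rP _ ar.
  rewrite (near_eq_derive (g := fun q => H q 0 j)); last first.
    by apply: filterS (near_open_norm ar) => q /rP[].
  by rewrite DH // vec2E.
have g10 : g j1 0 != 0.
  rewrite -vec0 /g dilate_int01_axis mulf_neq0 // ?invr_eq0 ?pnatr_eq0 // vec0.
  by have [] := rP 0; rewrite ?normr0 // => _ _ ->.
(* The sign makes [G] positive near 0, so that its square root is smooth there. *)
pose eps : R := Num.sg (g j1 0).
have eps2 : eps * eps = 1 by rewrite -expr2 sqr_sg g10.
pose G p : R := eps * g j1 p.
have oT : open [set: 'rV[R]_2] by exact: openT.
have sG : smooth_on setT G by apply: smooth_onM => //; exact: smooth_on_cst.
have G0 : 0 < G 0 by rewrite /G /eps -normrEsg normr_gt0.
have [r1 r10 r1P] : exists2 r1 : R, 0 < r1 & forall p : 'rV[R]_2, `|p| < r1 -> `|p| < r /\ 0 < G p.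
  apply: near_norm; have n1 : \forall p \near (0 : 'rV[R]_2), `|p| < r by exact: norm_near.
  apply: filterI n1 _.
  have cG : G x @[x --> (0 : 'rV[R]_2)] --> G 0 := smooth_on_continuous sG I.
  by have /cvgr_gt := cG; apply.
pose V1 := [set p : 'rV[R]_2 | `|p| < r1].
have oV1 : open V1 by exact: open_norm_lt.
have V10 : V1 0 by rewrite /V1 /= normr0.
have sqG : smooth_on V1 (fun p => Num.sqrt (G p)).
  apply: (@smooth_on_comp1 _ _ V1 [set x : R | 0 < x] G Num.sqrt) => //.
  - by move=> p /r1P[].
  - exact: smooth_on_sub sG.
  - exact: smooth_sqrt.
pose phi (p : 'rV[R]_2) : R := p 0 1 * Num.sqrt (G p).
have sphi : smooth_on V1 phi.
  by apply: smooth_onM => //; apply: smooth_on_coord => //; exact: smooth_on_id.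
have d1 q : differentiable (fun p : 'rV[R]_2 => p 0 1) q by exact: differentiable_coord.
have Dphi u : `|u| < r1 -> 'D_e1 phi (vec2 u 0) = Num.sqrt (G (vec2 u 0)).
  move=> ur; have Vu : V1 (vec2 u 0) by apply: norm_row2_lt; rewrite vec2E // normr0.
  rewrite deriveM; [|exact: diff_derivable|exact/diff_derivable/(smooth_on_differentiable sqG)].
  rewrite vec2E scale0r add0r.
  have -> : 'D_e1 (fun p : 'rV[R]_2 => p 0 1) (vec2 u 0) = 1.
    by rewrite (@derive_coord _ _ _ id) ?derive_id ?e1E //; exact: ex_diff.
  by rewrite -[_ *: _]/(_ * _) mulr1.
pose S := shear 1 phi.
have S0 : S 0 = 0.
  by apply: row2P; rewrite shearE /= /phi !mxE ?mul0r.
have DS : diffeo_germ S 0 0.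
  apply: diffeo_germ_eq (shear_diffeo oV1 V10 sphi _) S0.
  rewrite -vec0 Dphi ?normr0 // vec0 gt_eqF // sqrtr_gt0 //.
have [T [X [Y [[oX X0 oY Y0 _] SX TY sS sT]]]] := DS.
have T0 : T 0 = 0 by rewrite -{1}S0; exact: (SX _ X0).2.
have [V2 [oV2 V20] V2P] : exists2 V2 : set 'rV[R]_2, open V2 /\ V2 0 & V2 `<=` Y `&` T @^-1` V1.
  exists (Y `&` T @^-1` V1) => //; split.
    rewrite openE => q [Yq Vq]; have H1 : nbhs q Y by apply: open_nbhs_nbhs.
    have H2 : nbhs (T q) V1 by apply: open_nbhs_nbhs.
    have cT : T x @[x --> q] --> T q := smooth_on_continuous sT Yq.
    exact: filterI H1 (cT _ H2).
  by split => //=; rewrite T0.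
have sGV : smooth_on V1 G by exact: smooth_on_sub sG.
have sk j : smooth_on V2 (fun q => g j (T q) / G (T q)).
  apply: (@smooth_on_comp _ _ _ V2 V1 T (fun p => g j p / G p)) => //.
  - by move=> q /V2P[].
  - by apply: smooth_on_sub sT => q /V2P[].
  - apply: smooth_on_div => //; first exact: smooth_on_sub (sg j).
    by move=> p /r1P[_ Gp]; rewrite gt_eqF.
have cut2 j : exists kt : 'rV[R]_2 -> R, csmooth kt /\
    \forall q \near (0 : 'rV[R]_2), kt q = g j (T q) / G (T q).
  by have [kt] := csmooth_cutoff oV2 V20 (sk j); exists kt.
have [kt ktP] := fin_all_exists cut2.
have wd j : exists AB : ('rV[R]_2 -> R) * ('rV[R]_2 -> R),
      [/\ smooth_on setT AB.1, smooth_on setT AB.2,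
      forall p, kt j p = AB.1 (vec2 (p 0 0) (p 0 1 ^+ 2)) + p 0 1 * AB.2 (vec2 (p 0 0) (p 0 1 ^+ 2)) &
      forall u, AB.2 (vec2 u 0) = 'D_e1 (kt j) (vec2 u 0)].
  by have [A [B ABP]] := whitney_decomposition (ktP j).1; exists (A, B).
have [AB ABP] := fin_all_exists wd.
have ktS : \forall p \near (0 : 'rV[R]_2), forall j, kt j (S p) = g j p / G p.
  have n1 : \forall q \near (0 : 'rV[R]_2), forall j, kt j q = g j (T q) / G (T q).
    by apply: (@filter_forall _ _ (fun j q => kt j q = g j (T q) / G (T q)) (nbhs (0 : 'rV[R]_2))) => j; exact: (ktP j).2.
  have cS : S p @[p --> (0 : 'rV[R]_2)] --> S 0 := smooth_on_continuous sS X0.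
  rewrite S0 in cS.
  have nX : \forall p \near (0 : 'rV[R]_2), X p by apply: open_nbhs_nbhs.
  by apply: filterS2 nX (cS _ n1) => p Xp /= E j; rewrite E (SX _ Xp).2.
have [r2 r20 r2P] := near_norm (filterI ktS (@norm_near _ 'rV[R]_2 _ r10)).
(* The constants 3 and 2 come from the integrals of a^2 and a: at s = 0, g_j is w_j / 2 and its
   s-derivative is a third of that of w_j. *)
pose alpha (p : 'rV[R]_2) : R := (3 * G p * Num.sqrt (G p))^-1.
pose beta (p : 'rV[R]_2) : R := - 'D_e1 G p / (2 * G p ^+ 2 * Num.sqrt (G p)).
have V2sub : [set p : 'rV[R]_2 | `|p| < r2] `<=` V1 by move=> p /r2P[].
have sq0 p : V1 p -> Num.sqrt (G p) != 0 by move=> /r1P[_ Gp]; rewrite gt_eqF ?sqrtr_gt0.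
have G0' p : V1 p -> G p != 0 by move=> /r1P[_ Gp]; rewrite gt_eqF.
have n3' : (3 : R) != 0 by rewrite pnatr_eq0.
have n2' : (2 : R) != 0 by rewrite pnatr_eq0.
have cstV (c : R) : smooth_on V1 (cst c : 'rV[R]_2 -> R) by exact: smooth_on_cst.
exists (fun j => (AB j).2), alpha, beta, r2; split => //.
- by move=> j; have [] := ABP j.
- split.
    apply: smooth_on_sub V2sub _; apply: smooth_onV => //; last first.
      by move=> p Vp; exact: mulf_neq0 (mulf_neq0 n3' (G0' _ Vp)) (sq0 _ Vp).
    apply: (@smooth_onM _ _ _ (fun p => 3 * G p)) => //.
    exact: (@smooth_onM _ _ _ (cst 3)).
  apply: smooth_on_sub V2sub _; apply: smooth_on_div => //; last first.
    by move=> p Vp; exact: mulf_neq0 (mulf_neq0 n2' (expf_neq0 _ (G0' _ Vp))) (sq0 _ Vp).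
    apply: (@smooth_onM _ _ _ (fun p => 2 * G p ^+ 2)) => //.
    apply: (@smooth_onM _ _ _ (cst 2)) => //; exact: smooth_onX.
  apply: smooth_onN => //; exact: smooth_on_sub (smooth_on_derive e1 sG).
- split; first by rewrite /alpha invr_eq0; exact: mulf_neq0 (mulf_neq0 n3' (G0' _ V10)) (sq0 _ V10).
  move=> j u ur; have Vu : `|vec2 u 0 : 'rV[R]_2| < r2 by apply: norm_row2_lt; rewrite vec2E // normr0.
  have V1u := V2sub _ Vu; have [_ _ _ ->] := ABP j.
  have ur1 : `|u| < r1 by have := mx_normr_entry (vec2 u 0 : 'rV[R]_2) 0 0; rewrite vec2E => /le_lt_trans; apply.
  have sSV : smooth_on V1 S by exact: smooth_on_shear.
  have dS := smooth_on_differentiable sSV V1u.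
  have dg := smooth_on_differentiable (sg j) (I : setT (vec2 u 0)).
  have dG := smooth_on_differentiable sG (I : setT (vec2 u 0)).
  have Su : S (vec2 u 0) = vec2 u 0.
    by apply: row2P; rewrite shearE /= ?vec2E // /phi vec2E mul0r.
  have dk : differentiable (kt j) (S (vec2 u 0)) by exact: csmooth_differentiable (ktP j).1.
  have E1 : 'D_e1 (kt j \o S) (vec2 u 0) = 'D_e1 (fun p => g j p / G p) (vec2 u 0).
    by apply: near_eq_derive; apply: filterS (near_open_norm Vu) => p /r2P[kS _]; exact: kS.
  rewrite (derive_chain _ dS dk) (derive_ratio _ dg dG (G0' _ V1u)) in E1.
  have ES : 'D_e1 S (vec2 u 0) = Num.sqrt (G (vec2 u 0)) *: e1.
    apply: row2P; rewrite -derive_coord // [RHS]mxE ?e1E.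
      have -> : (fun q => S q 0 0) = (fun q : 'rV[R]_2 => q 0 0).
        by apply/funext => q; rewrite shearE.
      by rewrite (@derive_coord _ _ _ id) ?derive_id ?e1E ?mulr0 //; exact: ex_diff.
    have -> : (fun q => S q 0 1) = phi by apply/funext => q; rewrite shearE.
    by rewrite Dphi // mulr1.
  rewrite ES derive_scale_dir // Su in E1.
  rewrite /g derive_dilate_axis ?dilate_int01_axis in E1; last exact: (WtP j).1.
  have EW : 'D_e1 (Wt j) (vec2 u 0) = 'D_e1 (W j) (vec2 u 0).
    by apply: near_eq_derive; apply: filterS (near_open_norm (r1P _ V1u).1) => p /rP[].
  have [_ _ EW2] := rP _ (r1P _ V1u).1.
  rewrite EW EW2 in E1.
  move: (sq0 _ V1u) (G0' _ V1u) E1; rewrite /alpha /beta.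
  move: (Num.sqrt (G (vec2 u 0))) ('D_e1 G (vec2 u 0)) (G (vec2 u 0)) ('D_e1 (kt j) _) ('D_e1 (W j) _) (W j _) => a f b c d e a0 b0.
  rewrite -[_ *: _]/(_ * _) => E.
  apply: (mulfI a0); rewrite E; field.
  by rewrite a0 b0.
- pose h j (z : 'rV[R]_n.+3) : R := Ht j (vec2 (z 0 j0) 0).
  pose y (z : 'rV[R]_n.+3) : R := eps * (z 0 j1 - h j1 z).
  pose A j (z : 'rV[R]_n.+3) x : R := x * (AB j).1 (vec2 (z 0 j0) x).
  pose P (z : 'rV[R]_n.+3) : 'rV[R]_n.+3 := \row_j if j == j0 then z 0 j0 else
    if j == j1 then h j1 z + eps * z 0 j1 else h j z + A j z (z 0 j1) + z 0 j.
  (* [P'] recovers x^2 as [y z] and subtracts h_j and x^2 A_j. These depend on z_0 and x^2 alone, so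
     the inverse [P] is explicit. *)
  pose P' (z : 'rV[R]_n.+3) : 'rV[R]_n.+3 := \row_j if j == j0 then z 0 j0 else
    if j == j1 then y z else z 0 j - h j z - A j z (y z).
  have oTn : open [set: 'rV[R]_n.+3] by exact: openT.
  have sc j : smooth_on setT (fun z : 'rV[R]_n.+3 => z 0 j).
    by apply: smooth_on_coord => //; exact: smooth_on_id.
  have sh j : smooth_on setT (h j).
    apply: (@smooth_on_comp _ _ _ setT setT (fun z : 'rV[R]_n.+3 => vec2 (z 0 j0) 0) (Ht j)) => //.
      by apply: smooth_on_vec2 => //; exact: smooth_on_cst.
    exact: (HtP j).1.1.
  have sy : smooth_on setT y.
    apply: smooth_onM => //; first exact: smooth_on_cst.
    exact: smooth_onB.
  have sA j (x : 'rV[R]_n.+3 -> R) : smooth_on setT x -> smooth_on setT (fun z => A j z (x z)).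
    move=> sx; apply: smooth_onM => //.
    apply: (@smooth_on_comp _ _ _ setT setT (fun z : 'rV[R]_n.+3 => vec2 (z 0 j0) (x z)) (AB j).1) => //.
      exact: smooth_on_vec2.
    by have [] := ABP j.
  have sP : smooth_on setT P.
    apply: smooth_on_row => // j; apply: (@smooth_on_ext _ _ _ _ (fun z : 'rV[R]_n.+3 => if j == j0 then z 0 j0 else
      if j == j1 then h j1 z + eps * z 0 j1 else h j z + A j z (z 0 j1) + z 0 j)) => //.
      by move=> z _; rewrite mxE.
    case: (j == j0) => //; case: (j == j1); apply: smooth_onD => //.
      by apply: smooth_onM => //; exact: smooth_on_cst.
    by apply: smooth_onD => //; exact: sA.
  have sP' : smooth_on setT P'.
    apply: smooth_on_row => // j; apply: (@smooth_on_ext _ _ _ _ (fun z : 'rV[R]_n.+3 => if j == j0 then z 0 j0 else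
      if j == j1 then y z else z 0 j - h j z - A j z (y z))) => //.
      by move=> z _; rewrite mxE.
    case: (j == j0) => //; case: (j == j1) => //; apply: smooth_onB => //; last exact: sA.
    exact: smooth_onB.
  have P0 z : P z 0 j0 = z 0 j0 by rewrite mxE eqxx.
  have P'0 z : P' z 0 j0 = z 0 j0 by rewrite mxE eqxx.
  have hP j z : h j (P z) = h j z by rewrite /h P0.
  have hP' j z : h j (P' z) = h j z by rewrite /h P'0.
  have AP j z x : A j (P z) x = A j z x by rewrite /A P0.
  have AP' j z x : A j (P' z) x = A j z x by rewrite /A P'0.
  have yP z : y (P z) = z 0 j1.
    by rewrite /y hP [P z 0 j1]mxE /= addrC addKr mulrA eps2 mul1r.
  have PK : cancel P' P.
    move=> z; apply/rowP => j; rewrite mxE; case: eqP => [->|n0]; first exact: P'0.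
    case: eqP => [->|n1].
      by rewrite hP' [P' z 0 j1]mxE /= /y mulrA eps2 mul1r addrC subrK.
    have -> : P' z 0 j1 = y z by rewrite mxE.
    by rewrite hP' AP' [P' z 0 j]mxE (introF eqP n0) (introF eqP n1); ring.
  have P'K : cancel P P'.
    move=> z; apply/rowP => j; rewrite mxE; case: eqP => [->|n0]; first exact: P0.
    case: eqP => [->|n1]; first exact: yP.
    by rewrite yP hP AP [P z 0 j]mxE (introF eqP n0) (introF eqP n1); ring.
  have key p : `|p| < r2 -> opening (fun j => (AB j).2) (S p) = P' (H p).
    move=> pr; have [kS p1] := r2P p pr; have [p_r Gp] := r1P _ p1.
    have [Up _ _] := rP _ p_r.
    have S0p : S p 0 0 = p 0 0 by rewrite shearE.
    have S1p : S p 0 1 = phi p by rewrite shearE.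
    have phi2 : phi p ^+ 2 = p 0 1 ^+ 2 * G p by rewrite /phi exprMn sqr_sqrtr // ltW.
    have H0p : H p 0 j0 = p 0 0 by exact: H0.
    have yH : y (H p) = phi p ^+ 2.
      rewrite /y /h H0p HE // phi2 /G; ring.
    apply/rowP => j; rewrite [LHS]mxE [RHS]mxE S0p S1p yH H0p.
    case: eqP => // _; case: eqP => // _.
    have [_ _ ABk _] := ABP j; have := kS j; rewrite ABk S0p S1p /A H0p /h H0p HE //.
    have -> : p 0 1 ^+ 2 * g j p = phi p ^+ 2 * (g j p / G p).
      by rewrite phi2; field; rewrite gt_eqF.
    by move=> <-; ring.
  exists S, P'; split=> //.
    apply: diffeo_germ_eq (diffeo_germ_global _ sP' sP PK P'K) _.
    by rewrite -key ?normr0 // S0.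
  have n2 : \forall p \near (0 : 'rV[R]_2), `|p| < r2 by exact: norm_near.
  by apply: filterS n2 => p /key.
Qed.

End Opening.

(** * Jets of maps of one variable *)

Section Jets.
Context {R : realType}.
Implicit Types W : normedModType R.

Lemma differentiable1 W (f : R -> W) t : derivable f t 1 -> differentiable f t.
Proof. by move/derivable1_diffP. Qed.

Lemma smooth_on_derive1n W (U : set R) (f : R -> W) k : open U ->
  smooth_on U f -> smooth_on U (derive1n k f).
Proof.
move=> oU sf; elim: k => [//|k IH].
rewrite derive1nS; have -> : derive1 (derive1n k f) = 'D_1 (derive1n k f).
  by apply/funext => x; rewrite derive1E.
exact: smooth_on_derive.
Qed.

Lemma is_derive_derive1n W (U : set R) (f : R -> W) k t : open U -> smooth_on U f -> U t ->
  is_derive t 1 (derive1n k f) (derive1n k.+1 f t).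
Proof.
move=> oU sf Ut; rewrite derive1nS derive1E; apply/derivableP/diff_derivable.
exact: smooth_on_differentiable (smooth_on_derive1n k oU sf) Ut.
Qed.

Lemma near_derive1n W (f g : R -> W) k t : (\forall s \near t, f s = g s) ->
  derive1n k f t = derive1n k g t.
Proof.
move=> fg; suff : \forall s \near t, derive1n k f s = derive1n k g s by exact: nbhs_singleton.
elim: k => [//|k IH].
have IH2 : \forall s \near t, \forall s' \near s, derive1n k f s' = derive1n k g s'.
  by apply/near_join: IH.
by apply: filterS IH2 => s; rewrite !derive1nS !derive1E; exact: near_eq_derive.
Qed.

Lemma class_onZ (V W : normedModType R) (U : set V) (a : R) (f : V -> W) k : open U ->
  class_on k U f -> class_on k U (fun x => a *: f x).
Proof.
move=> oU; elim: k f => [|k IH] f /=.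
  by move=> fc x Ux; apply: continuousZl_tmp; exact: fc.
move=> [df Df]; split=> [x Ux|v]; first by apply: differentiableZ; exact: df.
apply: class_on_ext (IH _ (Df v)) => // x /set_mem Ux.
by rewrite deriveZ //; apply: diff_derivable; exact: df.
Qed.

(** Rules for iterated derivatives are obtained by guessing the whole sequence and checking a single
    derivation step; smoothness comes along with them. *)
Lemma derive1n_family W (U : set R) (X : nat -> R -> W) : open U ->
  (forall k t, U t -> is_derive t 1 (X k) (X k.+1 t)) ->
  smooth_on U (X 0%N) /\ forall k t, U t -> derive1n k (X 0%N) t = X k t.
Proof.
move=> oU dX; split; last first.
  elim=> [//|k IH] t Ut; rewrite derive1nS derive1E.
  rewrite (near_eq_derive (g := X k)); first by have [] := dX k t Ut.
  by apply: filterS (open_nbhs_nbhs (conj oU Ut)) => s; exact: IH.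
move=> k; suff : forall j, class_on k U (X j) by apply.
elim: k => [|k IH] j /=.
  move=> t Ut; apply/differentiable_continuous/differentiable1.
  by have [] := dX j t Ut.
split=> [t Ut|v]; first by apply: differentiable1; have [] := dX j t Ut.
apply: (@class_on_ext _ _ _ _ (fun t => v *: X j.+1 t)) => //.
  move=> t /set_mem Ut; have [dXt <-] := dX j t Ut.
    exact/esym/derive_dir1/differentiable1.
exact: class_onZ.
Qed.

Lemma derive1n_coord n (U : set R) (f : R -> 'rV[R]_n) i k t : open U -> smooth_on U f -> U t ->
  derive1n k (fun s => f s 0 i) t = derive1n k f t 0 i.
Proof.
move=> oU sf; pose X k t := derive1n k f t 0 i.
have dX l s : U s -> is_derive s 1 (X l) (X l.+1 s).
  move=> Us; have H := is_derive_derive1n l oU sf Us.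
  have dd : differentiable (derive1n l f) s := smooth_on_differentiable (smooth_on_derive1n l oU sf) Us.
  have E : 'D_1 (X l) s = 'D_1 (derive1n l f) s 0 i by exact: derive_coord.
  case: H => _ H; rewrite H in E.
  apply: DeriveDef E.
  have /diff_derivable := differentiable_comp dd (@differentiable_coord _ _ _ _ 0 i).
  exact.
exact: (derive1n_family oU dX).2.
Qed.

Lemma derive_coord_id n (x v : 'rV[R]_n) i : 'D_v (fun q : 'rV[R]_n => q 0 i) x = v 0 i.
Proof. by rewrite (@derive_coord _ _ _ id) ?derive_id //; exact: ex_diff. Qed.

Lemma is_derive_chain (V : normedModType R) W (tau : V -> R) (h : R -> W) q v d e :
  differentiable tau q -> is_derive q v tau d -> is_derive (tau q) 1 h e ->
  is_derive q v (h \o tau) (d *: e).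
Proof.
move=> dt Ht Hh; have dh : differentiable h (tau q) by apply: differentiable1; case: Hh.
apply: DeriveDef; first exact/diff_derivable/differentiable_comp.
rewrite derive_chain //.
have -> : 'D_v tau q = d by exact: derive_val.
by rewrite derive_dir1 //; case: Hh => _ ->.
Qed.

End Jets.

(** The column factor of the rank decomposition, enlarged by an identity block, times the row factor
    completes the rows to a basis. *)
Lemma row_free_complete (F : fieldType) r n (A : 'M[F]_(r, r + n)) : row_free A ->
  exists2 M : 'M[F]_(r + n), M \in unitmx & A *m M = pid_mx r.
Proof.
move=> /eqP rA; pose E := block_mx (col_ebase A) 0 0 1%:M *m row_ebase A.
have Eu : E \in unitmx.
  rewrite unitmx_mul row_ebase_unit andbT unitmxE det_ublock det1 mulr1 -unitmxE.
  exact: col_ebase_unit.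
exists (invmx E); first by rewrite unitmx_inv.
have -> : A = usubmx E.
  rewrite -mul_usub_mx -{1}(mulmx_ebase A) rA pid_mx_row.
  by rewrite /block_mx col_mxKu mul_mx_row mulmx1 mulmx0.
by rewrite mul_usub_mx mulmxV // pid_mx_row scalar_mx_block /block_mx col_mxKu.
Qed.

(** * Openings and the model germs *)

Section Models.
Variables (R : realType) (n : nat).
Local Notation e0 := (delta_mx 0 0 : 'rV[R]_2).
Local Notation e1 := (delta_mx 0 1 : 'rV[R]_2).
Local Notation j0 := (@j0 n).
Local Notation j1 := (@j1 n).
Local Notation j2 := (@j2 n).

Lemma smooth_opening (B : 'I_n.+3 -> 'rV[R]_2 -> R) : (forall j, smooth_on setT (B j)) ->
  smooth_on setT (opening B).
Proof.
move=> sB; have oT : open [set: 'rV[R]_2] by exact: openT.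
have sc j : smooth_on setT (fun z : 'rV[R]_2 => z 0 j).
  by apply: smooth_on_coord => //; exact: smooth_on_id.
apply: smooth_on_row => // j; apply: (@smooth_on_ext _ _ _ _ (fun p : 'rV[R]_2 =>
  if j == j0 then p 0 0 else if j == j1 then p 0 1 ^+ 2
         else p 0 1 ^+ 3 * B j (vec2 (p 0 0) (p 0 1 ^+ 2)))) => //.
  by move=> p _; rewrite mxE.
have s2 : smooth_on setT (fun p : 'rV[R]_2 => p 0 1 ^+ 2) by exact: smooth_onX.
case: (j == j0) => //; case: (j == j1) => //; apply: smooth_onM => //; first exact: smooth_onX.
apply: (@smooth_on_comp _ _ _ setT setT (fun p : 'rV[R]_2 => vec2 (p 0 0) (p 0 1 ^+ 2)) (B j)) => //.
exact: smooth_on_vec2.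
Qed.

(** Since B_2(0) <> 0, x^3 is the third component divided by a function of the first two, and
    multiples of it clear the remaining components. The divisor depends only on coordinates that
    this change fixes, so the change is explicitly invertible. *)
Lemma opening_edge (B : 'I_n.+3 -> 'rV[R]_2 -> R) : (forall j, smooth_on setT (B j)) ->
  B j2 0 != 0 -> germ_diffeomorphic (opening B) 0 (@cuspidal_edge R n.+3) 0.
Proof.
move=> sB B0.
have oT : open [set: 'rV[R]_2] by exact: openT.
have oTn : open [set: 'rV[R]_n.+3] by exact: openT.
pose c j (z : 'rV[R]_n.+3) : R := B j (vec2 (z 0 j0) (z 0 j1)).
have sz j : smooth_on setT (fun z : 'rV[R]_n.+3 => z 0 j).
  by apply: smooth_on_coord => //; exact: smooth_on_id.
have sc j : smooth_on setT (c j).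
  apply: (@smooth_on_comp _ _ _ setT setT (fun z : 'rV[R]_n.+3 => vec2 (z 0 j0) (z 0 j1)) (B j)) => //.
  exact: smooth_on_vec2.
pose Q := [set z : 'rV[R]_n.+3 | c j2 z != 0].
have oQ : open Q.
  have -> : Q = c j2 @^-1` [set x | x != 0] by [].
  apply: open_comp; first by move=> z _; exact: (smooth_on_continuous (sc j2)).
  exact: open_neq.
pose t (z : 'rV[R]_n.+3) : 'rV[R]_n.+3 := \row_j if j == j0 then z 0 j else if j == j1 then z 0 j
  else if j == j2 then z 0 j / c j2 z else z 0 j - z 0 j2 / c j2 z * c j z.
pose t' (z : 'rV[R]_n.+3) : 'rV[R]_n.+3 := \row_j if j == j0 then z 0 j else if j == j1 then z 0 j
  else if j == j2 then z 0 j * c j2 z else z 0 j + z 0 j2 * c j z.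
have szQ j : smooth_on Q (fun z : 'rV[R]_n.+3 => z 0 j) by exact: smooth_on_sub (sz j).
have scQ j : smooth_on Q (c j) by exact: smooth_on_sub (sc j).
have st : smooth_on Q t.
  apply: smooth_on_row => // j; apply: (@smooth_on_ext _ _ _ _ (fun z : 'rV[R]_n.+3 =>
    if j == j0 then z 0 j else if j == j1 then z 0 j
    else if j == j2 then z 0 j / c j2 z else z 0 j - z 0 j2 / c j2 z * c j z)) => //.
    by move=> z _; rewrite mxE.
  have sd i : smooth_on Q (fun z : 'rV[R]_n.+3 => z 0 i / c j2 z) by exact: smooth_on_div.
  case: (j == j0) => //; case: (j == j1) => //; case: (j == j2) => //.
  by apply: smooth_onB => //; exact: (@smooth_onM _ _ _ (fun z : 'rV[R]_n.+3 => z 0 j2 / c j2 z)).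
have st' : smooth_on Q t'.
  apply: smooth_on_row => // j; apply: (@smooth_on_ext _ _ _ _ (fun z : 'rV[R]_n.+3 =>
    if j == j0 then z 0 j else if j == j1 then z 0 j
    else if j == j2 then z 0 j * c j2 z else z 0 j + z 0 j2 * c j z)) => //.
    by move=> z _; rewrite mxE.
  case: (j == j0) => //; case: (j == j1) => //; case: (j == j2) => //.
    exact: smooth_onM.
  by apply: smooth_onD => //; exact: smooth_onM.
have ct z j : c j (t z) = c j z by rewrite /c; congr (B j (vec2 _ _)); rewrite mxE.
have ct' z j : c j (t' z) = c j z by rewrite /c; congr (B j (vec2 _ _)); rewrite mxE.
have t2 z : t z 0 j2 = z 0 j2 / c j2 z by rewrite mxE.
have t'2 z : t' z 0 j2 = z 0 j2 * c j2 z by rewrite mxE.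
have tK z : Q z -> t' (t z) = z.
  move=> Qz; apply/rowP => j; rewrite mxE ct t2 ct [t z 0 j]mxE.
  by case: (j == j0) => //; case: (j == j1) => //; case: eqP => [->|_]; rewrite ?divfK // subrK.
have t'K z : Q z -> t (t' z) = z.
  move=> Qz; apply/rowP => j; rewrite mxE ct' t'2 ct' [t' z 0 j]mxE.
  by case: (j == j0) => //; case: (j == j1) => //; case: eqP => [->|_]; rewrite ?mulfK // addrK.
have o0 : opening B 0 = 0.
  by apply/rowP => j; rewrite !mxE; case: (j == j0) => //; case: (j == j1); rewrite expr0n ?mul0r.
have key p : Q (opening B p) -> cuspidal_edge n.+3 p = t (opening B p).
  have cB j : c j (opening B p) = B j (vec2 (p 0 0) (p 0 1 ^+ 2)) by rewrite /c !mxE.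
  move=> Qp; apply/rowP => j; rewrite [LHS]mxE [RHS]mxE !cB.
  have q2 : opening B p 0 j2 = p 0 1 ^+ 3 * B j2 (vec2 (p 0 0) (p 0 1 ^+ 2)) by rewrite mxE.
  rewrite /Q /= cB in Qp; rewrite q2 mulfK // mxE.
  case: eqP => [->//|n0]; case: eqP => [->//|n1]; case: eqP => [->|n2]; first by rewrite mulfK.
  rewrite subrr; case: j n0 n1 n2 => -[|[|[|j]]] hj // n0 n1 n2.
  - by case: n0; exact: val_inj.
  - by case: n1; exact: val_inj.
  - by case: n2; exact: val_inj.
have Q0 : Q 0 by rewrite /Q /= /c mxE -(vec2_00 R) in B0 *; rewrite mxE.
exists id, t; split.
- exact: (diffeo_germ_global (s := id) (s' := id) _ (smooth_on_id _) (smooth_on_id _)).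
- exists t', Q, Q; split=> //.
  + have k0 := key 0; rewrite o0 in k0.
    split=> //; rewrite ?o0 ?(k0 Q0) // /Q /= ct //.
  + by move=> z Qz; split; [rewrite /Q /= ct|exact: tK].
  + by move=> z Qz; split; [rewrite /Q /= ct'|exact: t'K].
- apply: (filterS key); apply: (@open_nbhs_nbhs _ (0 : 'rV[R]_2) (opening B @^-1` Q)).
  split; last by rewrite /= o0.
  apply: open_comp => // p _.
  have so : smooth_on setT (opening B) by exact: smooth_opening.
  exact: (smooth_on_continuous so).
Qed.

(** The new u is B_2(u, x^2), in the source and in the target alike: it is a function of the first
    two components, and it is a coordinate because its u-derivative is non-zero. *)
Lemma opening_umbrella (B : 'I_n.+3 -> 'rV[R]_2 -> R) : n = 0%N -> (forall j, smooth_on setT (B j)) ->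
  B j2 0 = 0 -> 'D_e0 (B j2) 0 != 0 :> R ->
  germ_diffeomorphic (opening B) 0 (@opening R n (fun _ p => p 0 0)) 0.
Proof.
move=> n0 sB B0 DB.
have oT : open [set: 'rV[R]_2] by exact: openT.
have oTn : open [set: 'rV[R]_n.+3] by exact: openT.
have sc m j : smooth_on setT (fun z : 'rV[R]_m => z 0 j).
  by apply: smooth_on_coord; [exact: openT|exact: smooth_on_id].
pose b (p : 'rV[R]_2) := B j2 (vec2 (p 0 0) (p 0 1 ^+ 2)).
have sv : smooth_on setT (fun p : 'rV[R]_2 => vec2 (p 0 0) (p 0 1 ^+ 2)).
  by apply: smooth_on_vec2 => //; exact: smooth_onX.
have sb : smooth_on setT b by apply: (@smooth_on_comp _ _ _ setT setT _ (B j2)).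
pose c (z : 'rV[R]_n.+3) := B j2 (vec2 (z 0 j0) (z 0 j1)).
have svc : smooth_on setT (fun z : 'rV[R]_n.+3 => vec2 (z 0 j0) (z 0 j1) : 'rV[R]_2).
  exact: smooth_on_vec2.
have scc : smooth_on setT c.
  exact: (@smooth_on_comp _ _ _ setT setT (fun z : 'rV[R]_n.+3 => vec2 (z 0 j0) (z 0 j1) : 'rV[R]_2) (B j2)).
have o0 (C : 'I_n.+3 -> 'rV[R]_2 -> R) : opening C 0 = 0.
  by apply/rowP => j; rewrite !mxE; case: (j == j0) => //; case: (j == j1); rewrite expr0n ?mul0r.
have d0 : forall m (v : 'rV[R]_m) (phi psi : 'rV[R]_m -> R), smooth_on setT phi -> smooth_on setT psi ->
    phi 0 = 0 -> psi 0 = 0 -> 'D_v phi 0 = 1 -> 'D_v psi 0 = 0 ->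
    'D_v (fun p => B j2 (vec2 (phi p) (psi p))) 0 = 'D_e0 (B j2) 0.
  move=> m v phi psi sphi spsi phi0 psi0 D1 D2.
  have dv : differentiable (fun x => vec2 (phi x) (psi x)) 0.
    exact: (smooth_on_differentiable (smooth_on_vec2 openT sphi spsi) I).
  have -> : (fun p => B j2 (vec2 (phi p) (psi p))) = B j2 \o (fun p => vec2 (phi p) (psi p)) by [].
  rewrite (derive_chain _ dv) ?phi0 ?psi0 ?vec2_00; last exact: (smooth_on_differentiable (sB j2)).
  have -> // : 'D_v (fun p => vec2 (phi p) (psi p)) 0 = e0.
  apply: row2P; rewrite -derive_coord ?e0E //.
    by rewrite -[RHS]D1; congr ('D_ _ _ _); apply/funext => q; rewrite vec2E.
  by rewrite -[RHS]D2; congr ('D_ _ _ _); apply/funext => q; rewrite vec2E.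
have D0 : 'D_e0 b 0 = 'D_e0 (B j2) 0.
  apply: d0 => //; rewrite ?mxE ?expr0n ?derive_coord_id ?e0E //; first exact: smooth_onX.
  have /derivableP H : derivable (fun p : 'rV[R]_2 => p 0 1) 0 e0.
    exact/diff_derivable/differentiable_coord.
  have [_ ->] := is_deriveX 2 H.
  by rewrite mxE expr1 mulr0 scale0r.
exists (shear 0 b), (shear j0 c); split.
- apply: diffeo_germ_eq (shear_diffeo oT I sb _) _; first by rewrite D0.
  by apply: row2P; rewrite shearE /= /b !mxE ?expr0n ?vec2_00.
- rewrite !o0.
  apply: diffeo_germ_eq (shear_diffeo oTn I scc _) _.
    by rewrite d0 ?derive_coord_id ?mxE ?eqxx.
  by apply/rowP => j; rewrite shearE /c !mxE vec2_00 B0; case: (j == j0).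
- apply: (@nearW _ (nbhs (0 : 'rV[R]_2))) => p; apply/rowP => j; rewrite shearE [LHS]mxE !shearE /= /c.
  have -> : opening B p 0 j0 = p 0 0 by rewrite mxE.
  have -> : opening B p 0 j1 = p 0 1 ^+ 2 by rewrite mxE.
  case: eqP => // nj0; case: eqP => [->|nj1]; first by rewrite mxE.
  have -> : j = j2.
    apply: val_inj => /=; case: j nj0 nj1 => -[|[|[|j]]] hj // nj0 nj1.
    - by case: nj0; exact: val_inj.
    - by case: nj1; exact: val_inj.
    - by have h : (j.+3 < n.+3)%N := hj; rewrite n0 in h.
  by rewrite vec2E mxE.
Qed.

End Models.

(** * Germs of tangent surfaces *)

Lemma open_preimage (R : realType) (V W : normedModType R) (T : V -> W) (Y : set V) (Z : set W) :
  open Y -> open Z -> smooth_on Y T -> open (Y `&` T @^-1` Z).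
Proof.
move=> oY oZ sT; rewrite openE => q [Yq Zq].
have H1 : nbhs q Y by apply: open_nbhs_nbhs.
have H2 : nbhs (T q) Z by apply: open_nbhs_nbhs.
have cT : T x @[x --> q] --> T q := smooth_on_continuous sT Yq.
exact: filterI H1 (cT _ H2).
Qed.

Lemma derive_axis (R : realType) (u : R) :
  'D_1 (fun u => vec2 u 0 : 'rV[R]_2) u = delta_mx 0 0.
Proof.
have sax : smooth_on setT (fun u : R => vec2 u 0 : 'rV[R]_2).
  by apply: smooth_on_vec2; [exact: openT|exact: smooth_on_id|exact: smooth_on_cst].
have d0 := smooth_on_differentiable sax (I : setT u).
apply: row2P; rewrite -derive_coord // e0E.
  have -> : (fun y : R => vec2 y 0 0 0) = id by apply/funext => v; rewrite vec2E.
  exact: derive_id.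
have -> : (fun y : R => vec2 y 0 0 1) = cst 0 by apply/funext => v; rewrite vec2E.
exact: derive_cst.
Qed.

Section Tangent.
Variables (R : realType) (n : nat).
Local Notation e0 := (delta_mx 0 0 : 'rV[R]_2).
Local Notation e1 := (delta_mx 0 1 : 'rV[R]_2).
Local Notation j0 := (@j0 n).
Local Notation j1 := (@j1 n).
Local Notation j2 := (@j2 n).

Variables (U : set R) (X : nat -> 'I_n.+3 -> R -> R) (t0 : R).
Hypotheses (oU : open U) (Ut0 : U t0) (sX : forall k j, smooth_on U (X k j)).
Hypothesis dX : forall k j t, U t -> is_derive t 1 (X k j) (X k.+1 j t).

Definition tangent (p : 'rV[R]_2) : 'rV[R]_n.+3 :=
  \row_j (X 0 j (p 0 1) + p 0 0 * X 1 j (p 0 1)).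

(* Up to sign, the minor of (f', f'') on the coordinates 0 and j. *)
Definition tmin j t : R := X 1 j t * X 2 j0 t - X 2 j t * X 1 j0 t.
Definition tmin' j t : R := X 1 j t * X 3 j0 t - X 3 j t * X 1 j0 t.

Let stmin j : smooth_on U (tmin j).
Proof. by apply: smooth_onB => //; apply: smooth_onM. Qed.

Let stmin' j : smooth_on U (tmin' j).
Proof. by apply: smooth_onB => //; apply: smooth_onM. Qed.

Lemma is_derive_tmin j t : U t -> is_derive t 1 (tmin j) (tmin' j t).
Proof.
move=> Ut; have H := is_deriveB (is_deriveM (dX 1 j Ut) (dX 2 j0 Ut)) (is_deriveM (dX 2 j Ut) (dX 1 j0 Ut)).
apply: is_derive_eq H _; rewrite /tmin'.
move: (X 1 j t) (X 1 j0 t) (X 2 j t) (X 2 j0 t) (X 3 j t) (X 3 j0 t) => a b c d e g.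
rewrite -![_ *: _]/(_ * _); ring.
Qed.

(** For fixed u = f_0 + s f_0', dt/ds = -f_0' / (f_0' + s f_0''), so the s-derivative of f_j + s
    f_j' is s w_j with w_j = [tmin j] / (f_0' + s f_0''). On s = 0, u is f_0(t), so [q] is a local
    inverse of f_0. *)
Lemma tangent_opening : X 0 j0 t0 = 0 -> X 1 j0 t0 != 0 -> tmin j1 t0 != 0 ->
  exists (B : 'I_n.+3 -> 'rV[R]_2 -> R) (alpha beta q : R -> R) (r : R),
    [/\ forall j, smooth_on setT (B j), 0 < r,
        [/\ derivable alpha 0 1, derivable beta 0 1 & is_derive (0 : R) (1 : R) q (X 1 j0 t0)^-1],
        [/\ alpha 0 != 0, q 0 = t0 & forall j u, `|u| < r -> U (q u) /\ B j (vec2 u 0) =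
         (beta u * tmin j (q u) - alpha u * tmin' j (q u)) / X 1 j0 (q u)] &
        germ_diffeomorphic tangent (vec2 0 t0) (opening B) 0].
Proof.
move=> f0 X1 N1.
have oT : open [set: 'rV[R]_2] by exact: openT.
pose a := vec2 0 t0 : 'rV[R]_2.
have sc m (i : 'I_m) : smooth_on setT (fun z : 'rV[R]_m => z 0 i).
  by apply: smooth_on_coord; [exact: openT|exact: smooth_on_id].
pose V1 : set 'rV[R]_2 := [set: 'rV[R]_2] `&` (fun p => p 0 1) @^-1` U.
have oV1 : open V1 by apply: open_preimage => //; exact: sc.
have sc1 i : smooth_on V1 (fun z : 'rV[R]_2 => z 0 i) by exact: smooth_on_sub (sc _ i).
have sX2 k j : smooth_on V1 (fun p : 'rV[R]_2 => X k j (p 0 1)).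
  by apply: (@smooth_on_comp1 _ _ V1 U (fun p : 'rV[R]_2 => p 0 1) (X k j)) => //; move=> p [].
pose F j (p : 'rV[R]_2) : R := X 0 j (p 0 1) + p 0 0 * X 1 j (p 0 1).
have sF j : smooth_on V1 (F j) by apply: smooth_onD => //; exact: smooth_onM.
pose den (p : 'rV[R]_2) : R := X 1 j0 (p 0 1) + p 0 0 * X 2 j0 (p 0 1).
have sden : smooth_on V1 den by apply: smooth_onD => //; exact: smooth_onM.
have [V2 [oV2 V2a V2P]] : exists V2, [/\ open V2, V2 a & forall p, V2 p -> V1 p /\ den p != 0].
  exists (V1 `&` den @^-1` [set x | x != 0]); split; first by apply: open_preimage sden; [|exact: open_neq].
    by split; [split; rewrite //= vec2E|rewrite /= /den /a !vec2E mul0r addr0].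
  by move=> p [].
have V1a : V1 a := (V2P _ V2a).1.
have dFe j p v : V1 p -> is_derive p v (F j)
    (v 0 1 * X 1 j (p 0 1) + (v 0 0 * X 1 j (p 0 1) + p 0 0 * (v 0 1 * X 2 j (p 0 1)))).
  move=> [_ Vp]; have dc i : is_derive p v (fun z : 'rV[R]_2 => z 0 i) (v 0 i).
    apply: DeriveDef; last exact: derive_coord_id.
    exact/diff_derivable/differentiable_coord.
  have dk k : is_derive p v (X k j \o (fun z : 'rV[R]_2 => z 0 1)) (v 0 1 *: X k.+1 j (p 0 1)).
    by apply: is_derive_chain => //; [exact: differentiable_coord|exact: dX].
  have H := is_deriveD (dk 0%N) (is_deriveM (dc 0) (dk 1%N)).
  apply: is_derive_eq H _; rewrite /=.
  move: (X 1 j _) (X 2 j _) (p 0 0) (v 0 0) (v 0 1) => x y b c d.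
  rewrite -![_ *: _]/(_ * _); ring.
have D0 : 'D_e1 (F j0) a = X 1 j0 t0.
  by have [_ ->] := dFe j0 a e1 V1a; rewrite !e1E /a !vec2E !mul0r !mul1r !addr0.
pose swap (p : 'rV[R]_2) : 'rV[R]_2 := vec2 (p 0 1) (p 0 0).
have sswap : smooth_on setT swap by exact: smooth_on_vec2.
have swapK : cancel swap swap by move=> p; apply: row2P; rewrite !vec2E.
have F0a : F j0 a = 0 by rewrite /F /a !vec2E mul0r addr0.
(* The new coordinates are (u, s); [T] recovers (s, t) from them. *)
pose S := swap \o shear 1 (F j0).
have SE p : S p = vec2 (F j0 p) (p 0 0) by apply: row2P; rewrite /S /swap /= !vec2E shearE.
have Sa : S a = 0 by rewrite SE F0a !vec2E vec2_00.
have DS : diffeo_germ S a 0.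
  apply: diffeo_germ_eq (diffeo_germ_comp (shear_diffeo oV1 V1a (sF j0) _) (diffeo_germ_global _ sswap sswap swapK swapK)) Sa.
  by rewrite D0.
have [T [Z [Y [[oZ Za oY Y0 _] SZ TY sS sT]]]] := DS.
have T0 : T 0 = a by rewrite -Sa; exact: (SZ _ Za).2.
have [Y' [oY' Y'0 Y'P]] : exists Y', [/\ open Y', Y' 0 & forall q, Y' q -> Y q /\ V2 (T q)].
  exists (Y `&` T @^-1` V2); split; first exact: open_preimage sT.
    by split; rewrite /= ?T0.
  by move=> q [].
have Y'Y q : Y' q -> Y q by move=> /Y'P[].
have Y'V q : Y' q -> V1 (T q) by move=> /Y'P[_ /V2P[]].
have Y'U q : Y' q -> U (T q 0 1) by move=> /Y'V[].
have den0 q : Y' q -> den (T q) != 0 by move=> /Y'P[_ /V2P[]].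
have sTY : smooth_on Y' T by exact: smooth_on_sub Y'Y sT.
have T_0 q : Y q -> T q 0 0 = q 0 1 by move=> /TY[_ E]; rewrite -{2}E SE vec2E.
have FT q : Y q -> F j0 (T q) = q 0 0 by move=> /TY[_ E]; rewrite -{2}E SE vec2E.
pose tau q : R := T q 0 1.
have stau : smooth_on Y' tau by apply: smooth_on_coord.
pose H q : 'rV[R]_n.+3 := \row_j F j (T q).
pose W j q : R := tmin j (tau q) / den (T q).
have sFT (G : 'rV[R]_2 -> R) : smooth_on V1 G -> smooth_on Y' (G \o T).
  by move=> sG; exact: smooth_on_comp oY' Y'V sTY sG.
have sH : smooth_on Y' H.
  apply: smooth_on_row => // j; apply: (@smooth_on_ext _ _ _ _ (F j \o T)) => //; last exact: sFT.
  by move=> q _; rewrite mxE.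
have sW j : smooth_on Y' (W j).
  apply: (smooth_on_div oY' _ (sFT _ sden) den0).
  exact: (@smooth_on_comp1 _ _ Y' U tau (tmin j)).
have dT q : Y' q -> differentiable T q by move=> Yq; exact: (smooth_on_differentiable sTY Yq).
have dT0 q (v : 'rV[R]_2) : Y' q -> 'D_v T q 0 0 = v 0 1.
  move=> Yq; rewrite -derive_coord; last exact: dT.
  rewrite -(derive_coord_id q v 1); apply: near_eq_derive.
  by apply: filterS (open_nbhs_nbhs (conj oY' Yq)) => p Yp; exact/T_0/Y'Y.
have dFT j q (v : 'rV[R]_2) : Y' q -> 'D_v (F j \o T) q =
    'D_v tau q * X 1 j (tau q) + (v 0 1 * X 1 j (tau q) + q 0 1 * ('D_v tau q * X 2 j (tau q))).
  move=> Yq; have dF : differentiable (F j) (T q).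
    exact: smooth_on_differentiable (sF j) (Y'V _ Yq).
  rewrite derive_chain //; last exact: dT.
  have [_ ->] := dFe j (T q) ('D_v T q) (Y'V _ Yq).
  rewrite dT0 // T_0; last exact: Y'Y.
  by rewrite -(derive_coord _ _ (dT _ Yq)).
have dtau q (v : 'rV[R]_2) : Y' q -> v 0 0 = 'D_v tau q * den (T q) + v 0 1 * X 1 j0 (tau q).
  move=> Yq; have : 'D_v (F j0 \o T) q = v 0 0.
    rewrite -(derive_coord_id q v 0); apply: near_eq_derive.
    by apply: filterS (open_nbhs_nbhs (conj oY' Yq)) => p Yp; exact/FT/Y'Y.
  rewrite dFT // => <-; rewrite /den T_0; last exact: Y'Y.
  by rewrite -/(tau q); ring.
have denE q : Y' q -> den (T q) = X 1 j0 (tau q) + q 0 1 * X 2 j0 (tau q).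
  by move=> Yq; rewrite /den T_0 //; exact: Y'Y.
have DH j q : Y' q -> 'D_e1 (fun q => H q 0 j) q = q 0 1 * W j q.
  move=> Yq; have -> : (fun q => H q 0 j) = F j \o T by apply/funext => p; rewrite mxE.
  rewrite dFT //; have := dtau q e1 Yq; have := den0 _ Yq; rewrite /W denE // /tmin !e1E.
  move: (X 1 j0 _) (X 1 j _) (X 2 j _) (X 2 j0 _) (q 0 1) ('D_e1 tau q) => x0 x y y0 s d D.
  move=> /esym E; have -> : d = - x0 / (x0 + s * y0) by apply: (mulIf D); rewrite divfK //; lra.
  by field.
have W1 : W j1 0 != 0 by rewrite /W mulf_neq0 // ?invr_eq0 ?den0 // /tau T0 /a vec2E.
have H0 p : Y' p -> H p 0 j0 = p 0 0 by move=> Yp; rewrite mxE FT //; exact: Y'Y.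
have [B [al [be [r [sB r0 [sal sbe] [al0 BE] gB]]]]] := opening_normal_form oY' Y'0 sH H0 sW DH W1.
pose ax u := vec2 u 0 : 'rV[R]_2.
have sax : smooth_on setT ax by apply: smooth_on_vec2; [exact: openT|exact: smooth_on_id|exact: smooth_on_cst].
have ax0 : ax 0 = 0 by exact: vec2_00.
have dax : 'D_1 ax 0 = e0 by exact: derive_axis.
have dcomp (g : 'rV[R]_2 -> R) : differentiable g 0 -> is_derive (0 : R) 1 (g \o ax) ('D_e0 g 0).
  move=> dg; have d0 : differentiable ax (0 : R) := smooth_on_differentiable sax I.
  apply: DeriveDef; first by apply/diff_derivable/differentiable_comp => //; rewrite ax0.
  by rewrite derive_chain ?ax0 // dax.
have [r1 r10 r1P] : exists2 r1 : R, 0 < r1 & forall p : 'rV[R]_2, `|p| < r1 -> Y' p /\ `|p| < r.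
  apply: near_norm; have n1 : \forall p \near (0 : 'rV[R]_2), Y' p by apply: open_nbhs_nbhs.
  have n2 : \forall p \near (0 : 'rV[R]_2), `|p| < r by exact: norm_near.
  exact: filterI n1 n2.
have d1 (g : 'rV[R]_2 -> R) : smooth_on [set p | `|p| < r] g -> differentiable g 0.
  by move=> sg; apply: (smooth_on_differentiable sg); rewrite /= normr0.
exists B, (al \o ax), (be \o ax), (tau \o ax), r1; split=> //.
- split; [by case: (dcomp al (d1 _ sal))|by case: (dcomp be (d1 _ sbe))|].
  have := dcomp tau (smooth_on_differentiable stau Y'0).
  have := dtau 0 e0 Y'0; rewrite !e0E mul0r addr0 denE // mxE mul0r addr0 /tau T0 vec2E => E.
  suff -> : 'D_e0 tau 0 = (X 1 j0 t0)^-1 by [].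
  by apply: (mulIf X1); rewrite -E mulVf.
- split=> [||j u ur]; rewrite /= ?ax0 // /tau ?T0 ?vec2E //.
  have nu : `|ax u| < r1 by apply: norm_row2_lt; rewrite vec2E // normr0.
  have [Yu nr] := r1P _ nu; split; first exact: Y'U.
  have ur' : `|u| < r by have := mx_normr_entry (ax u) 0 0; rewrite vec2E => /le_lt_trans; apply.
  have dW : 'D_e1 (W j) (ax u) = - tmin' j (tau (ax u)) / X 1 j0 (tau (ax u)).
    have dtu : differentiable tau (ax u) := smooth_on_differentiable stau Yu.
    have denu : den (T (ax u)) = X 1 j0 (tau (ax u)) by rewrite denE // /ax vec2E mul0r addr0.
    have X1u : X 1 j0 (tau (ax u)) != 0 by rewrite -denu den0.
    have dtu1 : 'D_e1 tau (ax u) = -1.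
      have := dtau _ e1 Yu; rewrite !e1E denu mul1r => /esym /eqP.
      by rewrite addr_eq0 => /eqP E; apply: (mulIf X1u); rewrite E mulN1r.
    have cch (h : R -> R) (dh : R) : is_derive (tau (ax u)) 1 h dh -> is_derive (ax u) e1 (h \o tau) (-1 *: dh).
      move=> Hh; apply: is_derive_chain Hh => //.
      by rewrite -dtu1; apply: DeriveDef => //; exact: diff_derivable.
    have Uu := Y'U _ Yu.
    have d01 : is_derive (ax u) e1 (fun q : 'rV[R]_2 => q 0 1) 1.
      apply: DeriveDef; last by rewrite derive_coord_id e1E.
      exact/diff_derivable/differentiable_coord.
    (* At s = 0, dt/ds is -1, and the contributions -f_0'' and f_0'' of t and of s to the derivative
       of the denominator cancel. *)
    have dden : 'D_e1 (den \o T) (ax u) = 0.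
      rewrite (near_eq_derive (g := fun q : 'rV[R]_2 => X 1 j0 (tau q) + q 0 1 * X 2 j0 (tau q))); last first.
        by apply: filterS (open_nbhs_nbhs (conj oY' Yu)) => p Yp; rewrite /= denE.
      have [_ E] := is_deriveD (cch _ _ (dX 1 j0 Uu)) (is_deriveM d01 (cch _ _ (dX 2 j0 Uu))).
      rewrite [LHS]E /= /ax vec2E scale0r add0r.
      move: (X 2 j0 _) => x; rewrite -![_ *: _]/(_ * _); ring.
    have dN : 'D_e1 (tmin j \o tau) (ax u) = - tmin' j (tau (ax u)).
      have [_ ->] := cch (tmin j) _ (is_derive_tmin j Uu).
      by rewrite scaleN1r.
    have sNt : smooth_on Y' (tmin j \o tau) by exact: (@smooth_on_comp1 _ _ Y' U tau (tmin j)).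
    have E := derive_ratio e1 (smooth_on_differentiable sNt Yu)
      (smooth_on_differentiable (sFT _ sden) Yu) (den0 _ Yu).
    by rewrite [LHS]E dden dN mulr0 mul0r subr0 /= denu.
  rewrite BE // -/(ax u) dW /W denE // /ax vec2E mul0r addr0.
  by move: (tmin _ _) (tmin' _ _) (X 1 _ _)^-1 (al _) (be _) => *; ring.
- have HS p : Z p -> H (S p) = tangent p.
    by move=> Zp; apply/rowP => j; rewrite !mxE (SZ _ Zp).2.
  apply: (germ_diffeomorphic_trans _ gB); exists S, id; split=> //.
    rewrite -/a -(HS _ Za) Sa.
    exact: (diffeo_germ_global (s := id) (s' := id) _ (smooth_on_id _) (smooth_on_id _)).
  by apply: filterS (open_nbhs_nbhs (conj oZ Za)) => p; exact: HS.
Qed.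

Definition tmin'' j t : R := X 2 j t * X 3 j0 t + X 1 j t * X 4 j0 t - X 4 j t * X 1 j0 t - X 3 j t * X 2 j0 t.

Lemma is_derive_tmin' j t : U t -> is_derive t 1 (tmin' j) (tmin'' j t).
Proof.
move=> Ut; have H := is_deriveB (is_deriveM (dX 1 j Ut) (dX 3 j0 Ut)) (is_deriveM (dX 3 j Ut) (dX 1 j0 Ut)).
apply: is_derive_eq H _; rewrite /tmin''.
move: (X 1 j t) (X 1 j0 t) (X 2 j t) (X 2 j0 t) (X 3 j t) (X 3 j0 t) (X 4 j t) (X 4 j0 t) => a b c d e g h k.
rewrite -![_ *: _]/(_ * _); ring.
Qed.

(** Where [tmin j2] vanishes, B_2(0) is a non-zero multiple of [tmin' j2]. *)
Lemma tangent_edge : X 0 j0 t0 = 0 -> X 1 j0 t0 != 0 -> tmin j1 t0 != 0 ->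
  tmin j2 t0 = 0 -> tmin' j2 t0 != 0 ->
  germ_diffeomorphic tangent (vec2 0 t0) (@cuspidal_edge R n.+3) 0.
Proof.
move=> X0 X1 N1 N2 N2'.
have [B [al [be [q [r [sB r0 _ [al0 q0 BE] gB]]]]]] := tangent_opening X0 X1 N1.
apply: germ_diffeomorphic_trans gB (opening_edge sB _).
have r0' : `|0 : R| < r by rewrite normr0.
have [_] := BE j2 0 r0'; rewrite vec2_00 => ->.
by rewrite q0 N2 mulr0 sub0r mulf_neq0 ?invr_eq0 // oppr_eq0 mulf_neq0.
Qed.

(** As [tmin j2] and [tmin' j2] vanish at [t0] and q' = 1 / f_0' there, the only surviving term of
    dB_2/du is -alpha [tmin'' j2] / f_0'^2. *)
Lemma tangent_umbrella : n = 0%N -> X 0 j0 t0 = 0 -> X 1 j0 t0 != 0 -> tmin j1 t0 != 0 ->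
  tmin j2 t0 = 0 -> tmin' j2 t0 = 0 -> tmin'' j2 t0 != 0 ->
  germ_diffeomorphic tangent (vec2 0 t0) (@opening R n (fun _ p => p 0 0)) 0.
Proof.
move=> n0 X0 X1 N1 N2 N2' N2''.
have [B [al [be [q [r [sB r0 [dal dbe dq] [al0 q0 BE] gB]]]]]] := tangent_opening X0 X1 N1.
have r0' : `|0 : R| < r by rewrite normr0.
apply: germ_diffeomorphic_trans gB (opening_umbrella n0 sB _ _).
  have [_] := BE j2 0 r0'; rewrite vec2_00 => ->.
  by rewrite q0 N2 N2' !mulr0 subr0 mul0r.
pose ax u := vec2 u 0 : 'rV[R]_2.
have sax : smooth_on setT ax by apply: smooth_on_vec2; [exact: openT|exact: smooth_on_id|exact: smooth_on_cst].
have ax0 : ax 0 = 0 by exact: vec2_00.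
have d0 : differentiable ax (0 : R) := smooth_on_differentiable sax I.
have dax : 'D_1 ax 0 = e0 by exact: derive_axis.
have dB : differentiable (B j2) (ax 0) by exact: (smooth_on_differentiable (sB j2)).
have E : 'D_1 (B j2 \o ax) 0 = 'D_e0 (B j2) 0 by rewrite derive_chain // ax0 dax.
rewrite -E.
have dd (c : R) : is_derive (0 : R) (1 : R) (tmin j2 \o q) (tmin' j2 t0 * (X 1 j0 t0)^-1).
  by apply: is_derive1_comp; rewrite q0; exact: is_derive_tmin.
have dd' : is_derive (0 : R) (1 : R) (tmin' j2 \o q) (tmin'' j2 t0 * (X 1 j0 t0)^-1).
  by apply: is_derive1_comp; rewrite q0; exact: is_derive_tmin'.
have dX1 : is_derive (0 : R) (1 : R) (fun u => (X 1 j0 (q u))^-1) (- (X 1 j0 (q 0)) ^- 2 *: (X 2 j0 t0 * (X 1 j0 t0)^-1)).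
  have dXq : is_derive (0 : R) (1 : R) (X 1 j0 \o q) (X 2 j0 t0 * (X 1 j0 t0)^-1).
    by apply: is_derive1_comp; rewrite q0; exact: dX.
  have Xq0 : (X 1 j0 \o q) 0 != 0 by rewrite /= q0.
  exact: (is_deriveV Xq0 dXq).
have H := is_deriveM (is_deriveB (is_deriveM (derivableP dbe) (dd 0)) (is_deriveM (derivableP dal) dd')) dX1.
rewrite (near_eq_derive (g := fun u => (be u * tmin j2 (q u) - al u * tmin' j2 (q u)) * (X 1 j0 (q u))^-1)); last first.
  have n1 : \forall u \near (0 : R), `|u| < r by exact: norm_near.
  by apply: filterS n1 => u ur; have [_] := BE j2 u ur.
have [_ HE] := H; 
have z0 : (be * (tmin j2 \o q) - al * (tmin' j2 \o q)) 0 = 0.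
  by rewrite !fctE /= q0 N2 N2' !mulr0 subr0.
rewrite [X in X != _]HE z0 /= q0 N2 N2'.
move: ('D_1 be 0) ('D_1 al 0) (be 0) (al 0) al0 X1 N2'' => b' a' b a a0 X1 N2''.
rewrite -![_ *: _]/(_ * _).
set z := (X in X != _); have -> : z = - (a * tmin'' j2 t0 / X 1 j0 t0 ^+ 2).
  by rewrite /z; field.
by rewrite oppr_eq0 !mulf_neq0 // invr_eq0 expf_neq0.
Qed.

End Tangent.

Lemma diffeo_germ_id (R : realType) (V : normedModType R) (a : V) : diffeo_germ id a a.
Proof. exact: (diffeo_germ_global (s := id) (s' := id) _ (smooth_on_id _) (smooth_on_id _)). Qed.

Lemma smooth_on_mulmx (R : realType) (V : normedModType R) m n (U : set V) (f : V -> 'rV[R]_m) (M : 'M[R]_(m, n)) :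
  open U -> smooth_on U f -> smooth_on U (fun x => f x *m M).
Proof.
move=> oU sf; apply: smooth_on_row => // j.
apply: (@smooth_on_ext _ _ _ _ (fun x => \sum_i f x 0 i * M i j)) => //.
  by move=> x _; rewrite mxE.
apply: smooth_on_sum => // i _; apply: smooth_onM => //; last exact: smooth_on_cst.
exact: smooth_on_coord.
Qed.

Lemma derive1n_mulmx (R : realType) m n (U : set R) (f : R -> 'rV[R]_m) (M : 'M[R]_(m, n)) k t :
  open U -> smooth_on U f -> U t ->
  derive1n k (fun s => f s *m M) t = derive1n k f t *m M.
Proof.
move=> oU sf Ut; pose X l s := derive1n l f s *m M.
have dX l s : U s -> is_derive s 1 (X l) (X l.+1 s).
  move=> Us; have sl := smooth_on_derive1n l oU sf.
  have sX : smooth_on U (X l) by exact: smooth_on_mulmx.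
  have dl := smooth_on_differentiable sl Us.
  apply: DeriveDef; first exact/diff_derivable/(smooth_on_differentiable sX).
  have [_ D] := is_derive_derive1n l oU sf Us; rewrite [RHS]/X -D.
  apply/rowP => j; rewrite -derive_coord; last exact: (smooth_on_differentiable sX).
  rewrite [RHS]mxE.
  have -> : (fun y => X l y 0 j) = \sum_i (fun y => derive1n l f y 0 i * M i j).
    by apply/funext => y; rewrite fct_sumE mxE.
  have dc i : derivable (fun y => derive1n l f y 0 i) s 1.
    exact/diff_derivable/(smooth_on_differentiable (smooth_on_coord i oU sl)).
  rewrite derive_sum => [|i]; last by apply: derivableM.
  apply: eq_bigr => i _; rewrite deriveM // derive_cst scaler0 add0r -derive_coord // mulrC.
  by [].
exact: (derive1n_family oU dX).2.
Qed.

(** A type that begins with 1 needs no division, and the limit at [t0] is the value of the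
    continuous function f'. *)
Lemma tan_dir1 (R : realType) m (U : set R) (f : R -> 'rV[R]_m) t0 t : open U -> U t0 ->
  smooth_on U f -> tan_dir f t0 1 t = derive1n 1 f t.
Proof.
move=> oU Ut0 sf; have -> : derive1n 1 f = derive1 f by exact: derive1n1.
rewrite /tan_dir /=.
have E : (fun u : R => (u - t0) ^- 0 *: derive1 f u) = derive1 f.
  by apply/funext => u; rewrite expr0 invr1 scale1r.
case: eqP => [->|_]; last by rewrite expr0 invr1 scale1r.
rewrite E; apply: cvg_lim => //.
have := smooth_on_continuous (smooth_on_derive1n 1 oU sf) Ut0.
exact: cvg_within_filter.
Qed.

(** * From jets of curves to normal forms *)

Section CurveGerms.
Variables (R : realType) (n : nat) (U : set R) (f : R -> 'rV[R]_n.+3) (t0 : R).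
Hypotheses (oU : open U) (Ut0 : U t0) (sf : smooth_on U f) (f0 : f t0 = 0).

Let T (g : R -> 'rV[R]_n.+3) := tangent (fun k j t => derive1n k g t 0 j).

Lemma tan_map_tangent (a : n.+3.-tuple nat) : nth 0%N a 0 = 1%N -> tan_map f t0 a = T f.
Proof.
move=> a1; apply/funext => p; rewrite /tan_map a1 (tan_dir1 _ oU Ut0 sf).
by apply/rowP => j; rewrite !mxE.
Qed.

(** A linear change in the target commutes with derivation, hence with passing to the tangent
    surface. *)
Lemma tangent_linear (M : 'M[R]_n.+3) (P : 'rV[R]_2 -> 'rV[R]_n.+3) : M \in unitmx ->
  germ_diffeomorphic (T (fun t => f t *m M)) (vec2 0 t0) P 0 ->
  germ_diffeomorphic (T f) (vec2 0 t0) P 0.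
Proof.
move=> Mu; apply: germ_diffeomorphic_trans.
have TM (p : 'rV[R]_2) : U (p 0 1) -> T f p *m M = T (fun t => f t *m M) p.
  move=> Up; have -> : T f p = derive1n 0 f (p 0 1) + p 0 0 *: derive1n 1 f (p 0 1).
    by apply/rowP => j; rewrite !mxE.
  rewrite mulmxDl -scalemxAl -!(derive1n_mulmx _ _ oU sf Up).
  by apply/rowP => j; rewrite !mxE.
have sM (N : 'M[R]_n.+3) : smooth_on setT (mulmx^~ N : 'rV[R]_n.+3 -> 'rV[R]_n.+3).
  by apply: smooth_on_mulmx => //; [exact: openT|exact: smooth_on_id].
exists id, (mulmx^~ M); split.
- exact: diffeo_germ_id.
- apply: (diffeo_germ_eq (diffeo_germ_global _ (sM M) (sM (invmx M)) _ _)).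
  + by move=> v; rewrite mulmxK.
  + by move=> v; rewrite mulmxKV.
  + by apply: TM; rewrite vec2E.
- have V1 : open ([set: 'rV[R]_2] `&` (fun p => p 0 1) @^-1` U).
    apply: open_preimage => //; first exact: openT.
    by apply: smooth_on_coord; [exact: openT|exact: smooth_on_id].
  have H : nbhs (vec2 0 t0 : 'rV[R]_2) ([set: 'rV[R]_2] `&` (fun p => p 0 1) @^-1` U).
    by apply: open_nbhs_nbhs; split=> //; split=> //=; rewrite vec2E.
  by apply: filterS H => p [_ Up]; rewrite /= TM.
Qed.

Let X (M : 'M[R]_n.+3) k j t := derive1n k (fun t => f t *m M) t 0 j.

Let sX M k j : smooth_on U (X M k j).
Proof. by apply/smooth_on_coord/smooth_on_derive1n/smooth_on_mulmx. Qed.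

Let dX M k j t : U t -> is_derive t 1 (X M k j) (X M k.+1 j t).
Proof.
move=> Ut; have sg := smooth_on_mulmx M oU sf.
have [_ D] := is_derive_derive1n k oU sg Ut.
have dd := smooth_on_differentiable (smooth_on_derive1n k oU sg) Ut.
have E : 'D_1 (X M k j) t = 'D_1 (derive1n k (fun t => f t *m M)) t 0 j by exact: derive_coord.
rewrite D in E; apply: DeriveDef E; exact/diff_derivable/(smooth_on_differentiable (sX M k j)).
Qed.

Let XE M k j : X M k j t0 = (derive1n k f t0 *m M) 0 j.
Proof. by rewrite /X (derive1n_mulmx _ _ oU sf Ut0). Qed.

Let F0 : derive1n 0 f t0 = 0 := f0.

(** Linear coordinates in which the minors tested by [tangent_edge] and [tangent_umbrella] take the
    values 0 or -1 at [t0]. *)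
Lemma jet_basis (i1 i2 i3 : nat) :
  row_free (\matrix_(i < 3) derive1n (nth 0%N [:: i1; i2; i3] i) f t0 : 'M[R]_(3, 3 + n)) ->
  exists2 M : 'M[R]_n.+3, M \in unitmx &
    [/\ derive1n i1 f t0 *m M = delta_mx 0 (j0 n), derive1n i2 f t0 *m M = delta_mx 0 (j1 n) &
        derive1n i3 f t0 *m M = delta_mx 0 (j2 n)].
Proof.
move=> /row_free_complete[M Mu ME]; exists M => //.
have E (i : 'I_3) (j : 'I_n.+3) : val i = val j ->
    derive1n (nth 0%N [:: i1; i2; i3] i) f t0 *m M = delta_mx 0 j.
  move=> ij; have := congr1 (row i) ME; rewrite row_mul rowK => ->.
  apply/rowP => l; rewrite !mxE eqxx /= ij.
  have -> : (l == j) = (val l == val j) by [].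
  by rewrite -ij ltn_ord andbT eq_sym.
by split; [exact: (E (@Ordinal 3 0 isT))|exact: (E (@Ordinal 3 1 isT))|exact: (E (@Ordinal 3 2 isT))].
Qed.

Lemma curve_edge (a : n.+3.-tuple nat) : nth 0%N a 0 = 1%N ->
  row_free (\matrix_(i < 3) derive1n (nth 0%N [:: 1; 2; 3]%N i) f t0 : 'M[R]_(3, 3 + n)) ->
  germ_diffeomorphic (tan_map f t0 a) (vec2 0 t0) (@cuspidal_edge R n.+3) 0.
Proof.
move=> a1 /jet_basis[M Mu [M1 M2 M3]]; rewrite tan_map_tangent //.
apply: (tangent_linear Mu); apply: (tangent_edge oU Ut0 (sX M) (@dX M)).
- by rewrite -/(X M 0 _ _) XE F0 mul0mx mxE.
- by rewrite -/(X M 1 _ _) XE M1 mxE !eqxx oner_eq0.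
- by rewrite /tmin !XE M1 M2 !mxE /= mul0r sub0r mulr1 oppr_eq0 oner_eq0.
- by rewrite /tmin !XE M1 M2 !mxE /= mul0r mul0r subr0.
- by rewrite /tmin' !XE M1 M3 !mxE /= mul0r sub0r mulr1 oppr_eq0 oner_eq0.
Qed.

Lemma curve_umbrella (a : n.+3.-tuple nat) c1 c2 : n = 0%N -> nth 0%N a 0 = 1%N ->
  derive1n 3 f t0 = c1 *: derive1n 1 f t0 + c2 *: derive1n 2 f t0 ->
  row_free (\matrix_(i < 3) derive1n (nth 0%N [:: 1; 2; 4]%N i) f t0 : 'M[R]_(3, 3 + n)) ->
  germ_diffeomorphic (tan_map f t0 a) (vec2 0 t0) (@opening R n (fun _ p => p 0 0)) 0.
Proof.
move=> n0 a1 f3 /jet_basis[M Mu [M1 M2 M4]]; rewrite tan_map_tangent //.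
have M3 : derive1n 3 f t0 *m M = c1 *: delta_mx 0 (j0 n) + c2 *: delta_mx 0 (j1 n).
  by rewrite f3 mulmxDl -!scalemxAl M1 M2.
apply: (tangent_linear Mu); apply: (tangent_umbrella oU Ut0 (sX M) (@dX M) n0).
- by rewrite -/(X M 0 _ _) XE F0 mul0mx mxE.
- by rewrite -/(X M 1 _ _) XE M1 mxE !eqxx oner_eq0.
- by rewrite /tmin !XE M1 M2 !mxE /= mul0r sub0r mulr1 oppr_eq0 oner_eq0.
- by rewrite /tmin !XE M1 M2 !mxE /= mul0r mul0r subr0.
- by rewrite /tmin' !XE M1 M3 !mxE /= !mulr0 mul0r addr0 mul0r subr0.
- have v M' k v j : derive1n k f t0 *m M' = v -> X M' k j t0 = v 0 j by move=> <-; exact: XE.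
  have e i j : (delta_mx 0 i : 'rV[R]_n.+3) 0 j = (j == i)%:R by rewrite mxE.
  have v3 j : X M 3 j t0 = c1 * (j == j0 n)%:R + c2 * (j == j1 n)%:R by rewrite (v _ _ _ _ M3) !mxE.
  rewrite /tmin'' !v3 !(v _ _ _ _ M1) !(v _ _ _ _ M2) !(v _ _ _ _ M4) !e /=.
  by rewrite !(mulr0, mul0r, addr0, add0r, mulr1, subr0) oppr_eq0 oner_eq0.
Qed.

End CurveGerms.

(** Up to swapping s and t, the folded umbrella is the tangent surface of (t, t^2, t^4) at the
    origin, so it is itself an instance of [tangent_umbrella]. *)
Lemma folded_umbrella_opening (R : realType) :
  germ_diffeomorphic (@folded_umbrella R) 0 (@opening R 0 (fun _ p => p 0 0)) 0.
Proof.
pose d (j : 'I_3) := match val j with 0 => 1 | 1 => 2 | _ => 4 end%N.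
pose P j : {poly R} := 'X^(d j).
pose X k j t := (derivn k (P j)).[t].
have dX k j t : [set: R] t -> is_derive t 1 (X k j) (X k.+1 j t).
  by move=> _; rewrite /X derivnS; exact: is_derive_poly.
have sX k j : smooth_on setT (X k j).
  by have [] := @derive1n_family R R setT (fun i => X (i + k)%N j) openT (fun i t => dX (i + k)%N j t).
have vX k j : X k j 0 = (k == d j)%:R *+ k`!.
  by rewrite /X horner_coef0 coef_derivn addn0 ffactnn coefXn.
have E := tangent_umbrella (n := 0%N) openT (I : setT (0 : R)) sX dX erefl.
have : germ_diffeomorphic (@folded_umbrella R) 0 (tangent X) (vec2 0 0).
  pose swap (p : 'rV[R]_2) : 'rV[R]_2 := vec2 (p 0 1) (p 0 0).
  have sswap : smooth_on setT swap.
    by apply: smooth_on_vec2; [exact: openT| |]; apply: smooth_on_coord; (try exact: openT); exact: smooth_on_id.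
  have swapK : cancel swap swap by move=> p; apply: row2P; rewrite !vec2E.
  have key p : tangent X (swap p) = folded_umbrella p.
    apply/rowP => j; rewrite !mxE /X /P; case: j => -[|[|[|//]]] hj /=.
    - by rewrite /d /= derivXn !hornerE /= ?expr0 ?expr1 ?mulr1n ?mulr1.
    - by rewrite /d /= derivXn !hornerE /=; ring.
    - by rewrite /d /= derivXn !hornerE /=; ring.
  exists swap, id; split.
  - by apply: diffeo_germ_eq (diffeo_germ_global _ sswap sswap swapK swapK) _; rewrite /swap !mxE.
  - apply: diffeo_germ_eq (diffeo_germ_id _) _.
    by rewrite -key; congr tangent; apply: row2P; rewrite !vec2E mxE.
  - by apply: (@nearW _ (nbhs (0 : 'rV[R]_2))) => p; rewrite key.
move/germ_diffeomorphic_trans; apply; apply: E.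
all: rewrite ?/tmin ?/tmin' ?/tmin'' !vX /d /= ?(mul0rn, mulr0, mul0r, subr0, sub0r, addr0, mulr1n) ?oppr0 //.
Qed.

Lemma smooth_folded_umbrella (R : realType) : smooth_on setT (@folded_umbrella R).
Proof.
have oT : open [set: 'rV[R]_2] by exact: openT.
have sc i : smooth_on setT (fun z : 'rV[R]_2 => z 0 i).
  by apply: smooth_on_coord => //; exact: smooth_on_id.
have sX i k : smooth_on setT (fun z : 'rV[R]_2 => z 0 i ^+ k) by exact: smooth_onX.
have sM (k : R) l : smooth_on setT (fun z : 'rV[R]_2 => k * z 0 1 * z 0 0 ^+ l).
  apply: (@smooth_onM _ _ _ (fun z : 'rV[R]_2 => k * z 0 1) (fun z : 'rV[R]_2 => z 0 0 ^+ l)) => //.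
  by apply: (@smooth_onM _ _ _ (cst k)) => //; exact: smooth_on_cst.
apply: smooth_on_row => // -[[|[|[|//]]] hj].
- apply: (smooth_on_ext oT _ (smooth_onD oT (sc 0) (sc 1))) => p _.
  by rewrite mxE.
- apply: (smooth_on_ext oT _ (smooth_onD oT (sX 0 2%N) (sM 2 1%N))) => p _.
  by rewrite mxE.
- apply: (smooth_on_ext oT _ (smooth_onD oT (sX 0 4%N) (sM 4 3%N))) => p _.
  by rewrite mxE.
Qed.

Lemma opening_folded_umbrella (R : realType) :
  germ_diffeomorphic (@opening R 0 (fun _ p => p 0 0)) 0 (@folded_umbrella R) 0.
Proof.
apply: germ_diffeomorphic_sym (folded_umbrella_opening R).
exact: smooth_on_continuous (@smooth_folded_umbrella R) I.
Qed.

(** * Wronskians *)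

Lemma smooth_on_derivable (R : realType) (V W : normedModType R) (U : set V) (f : V -> W) x v :
  smooth_on U f -> U x -> derivable f x v.
Proof. by move=> sf Ux; exact/diff_derivable/(smooth_on_differentiable sf Ux). Qed.

Lemma is_derive_bigsum (R : realType) (V W : normedModType R) n (h : 'I_n -> V -> W) x v (dh : 'I_n -> W) :
  (forall i, is_derive x v (h i) (dh i)) ->
  is_derive x v (fun y => \sum_(i < n) h i y) (\sum_(i < n) dh i).
Proof. by move=> H; have := is_derive_sum H; rewrite fct_sumE. Qed.

Lemma is_derive_mul (R : realType) (V : normedModType R) (f g : V -> R) x v df dg :
  is_derive x v f df -> is_derive x v g dg ->
  is_derive x v (fun y => f y * g y) (df * g x + f x * dg).
Proof.
move=> Hf Hg; have H := is_deriveM Hf Hg; apply: is_derive_eq H _.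
by rewrite -![_ *: _]/(_ * _) addrC [g x * _]mulrC.
Qed.

Lemma is_derive_cstmul (R : realType) (V : normedModType R) (c : R) (f : V -> R) x v df :
  is_derive x v f df -> is_derive x v (fun y => c * f y) (c * df).
Proof. exact: is_deriveZ. Qed.

Lemma leibniz_step (A : comPzRingType) (F G : nat -> A) l :
  \sum_(i < l.+1) 'C(l, i)%:R * (F i.+1 * G (l - i)%N + F i * G (l - i).+1) =
  \sum_(i < l.+2) 'C(l.+1, i)%:R * (F i * G (l.+1 - i)%N).
Proof.
under eq_bigr do rewrite mulrDr.
rewrite big_split /= [X in _ + X]big_ord_recl [RHS]big_ord_recl /= !bin0 !subn0 addrCA; congr (_ + _).
under [in RHS]eq_bigr => i _.
  rewrite /fintype.bump /= add1n binS natrD mulrDl subSS; over.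
rewrite big_split /= addrC; congr (_ + _).
rewrite [RHS]big_ord_recr /= bin_small // mul0r addr0.
apply: eq_bigr => i _; rewrite /fintype.bump /= add1n.
by have -> : ((l - i.+1).+1 = l - i)%N by rewrite subnSK.
Qed.

Lemma derive1n_mul (R : realType) (U : set R) (f g : R -> R) k t : open U ->
  smooth_on U f -> smooth_on U g -> U t -> derive1n k (fun x => f x * g x) t =
  \sum_(i < k.+1) 'C(k, i)%:R * (derive1n i f t * derive1n (k - i) g t).
Proof.
move=> oU sf sg Ut.
pose X k t := \sum_(i < k.+1) 'C(k, i)%:R * (derive1n i f t * derive1n (k - i) g t).
have dX l s : U s -> is_derive s 1 (X l) (X l.+1 s).
  move=> Us; have dF i : is_derive s 1 (derive1n i f) (derive1n i.+1 f s).
    exact: (is_derive_derive1n i oU sf Us).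
  have dG i : is_derive s 1 (derive1n i g) (derive1n i.+1 g s).
    exact: (is_derive_derive1n i oU sg Us).
  have H := is_derive_bigsum (fun i : 'I_l.+1 => is_derive_cstmul 'C(l, i)%:R (is_derive_mul (dF i) (dG (l - i)%N))).
  apply: is_derive_eq H _.
  exact: (leibniz_step (fun i => derive1n i f s) (fun i => derive1n i g s)).
have [_ /(_ k t Ut) H] := derive1n_family oU dX; rewrite -[RHS]/(X k t) -H; congr (derive1n k _ t).
by apply/funext => s; rewrite /X big_ord1 /= mul1r.
Qed.

Definition repl (R : Type) n (a : 'I_n) (A B : 'M[R]_n) : 'M[R]_n :=
  \matrix_(i, j) if i == a then B i j else A i j.

Lemma is_derive_det (R : realType) (V : normedModType R) n (M : V -> 'M[R]_n) (M' : 'M[R]_n) t v :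
  (forall i j, is_derive t v (fun s => M s i j) (M' i j)) ->
  is_derive t v (fun s => \det (M s)) (\sum_a \det (repl a (M t) M')).
Proof.
elim: n M M' => [|n IH] M M' dM.
  have -> : (fun s => \det (M s)) = cst 1 by apply/funext => s; rewrite det_mx00.
  by rewrite big_ord0; exact: is_derive_cst.
have -> : (fun s => \det (M s)) = (fun s => \sum_j M s ord0 j * ((-1) ^+ (@ord0 n + j) * \det (row' ord0 (col' j (M s))))).
  by apply/funext => s; rewrite (expand_det_row _ ord0); apply: eq_bigr => j _.
have dm j : is_derive t v (fun s => \det (row' ord0 (col' j (M s))))
    (\sum_a \det (repl a (row' ord0 (col' j (M t))) (row' ord0 (col' j M')))).
  apply: (IH (fun s => row' ord0 (col' j (M s)))) => i k.
  have -> : (fun s => row' ord0 (col' j (M s)) i k) = (fun s => M s (lift ord0 i) (lift j k)).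
    by apply/funext => s; rewrite !mxE.
  by rewrite !mxE.
have H := is_derive_bigsum (fun j => is_derive_mul (dM ord0 j) (is_derive_cstmul ((-1) ^+ (@ord0 n + j)) (dm j))).
apply: is_derive_eq H _; rewrite big_split /= [RHS]big_ord_recl; congr (_ + _).
  rewrite (expand_det_row _ ord0); apply: eq_bigr => j _.
  rewrite !mxE eqxx /cofactor; congr (_ * (_ * \det _)).
  by apply/matrixP => i k; rewrite !mxE.
under eq_bigr do rewrite mulr_sumr mulr_sumr.
rewrite exchange_big; apply: eq_bigr => a _ /=.
rewrite (expand_det_row _ ord0); apply: eq_bigr => j _.
rewrite [in RHS]mxE /cofactor; congr (_ * (_ * \det _)).
by apply/matrixP => i k; rewrite !mxE (inj_eq lift_inj).
Qed.

Section Wronskian.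
Variables (R : realType).
Implicit Types (y : nat -> R -> R) (U : set R).

Definition wron k y t : R := \det (\matrix_(a < k, b < k) derive1n a (y b) t).

Definition wron' k y t : R :=
  \det (\matrix_(a < k, b < k) derive1n (if a.+1 == k then k else a) (y b) t).

(** Differentiating a row other than the last makes it equal to the next one; only the determinant
    with the last row differentiated survives. *)
Lemma is_derive_wron k y U t : open U -> (forall b, (b < k.+1)%N -> smooth_on U (y b)) -> U t ->
  is_derive t 1 (wron k.+1 y) (wron' k.+1 y t).
Proof.
move=> oU sy Ut; pose M s : 'M[R]_k.+1 := \matrix_(a, b) derive1n a (y b) s.
pose M' : 'M[R]_k.+1 := \matrix_(a, b) derive1n a.+1 (y b) t.
have dM i j : is_derive t 1 (fun s => M s i j) (M' i j).
  have -> : (fun s => M s i j) = derive1n i (y j) by apply/funext => s; rewrite mxE.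
  by rewrite mxE; exact: (is_derive_derive1n i oU (sy j (ltn_ord j)) Ut).
apply: is_derive_eq (is_derive_det dM) _.
rewrite big_ord_recr /= big1 => [|a _]; rewrite ?add0r.
  congr (\det _); apply/matrixP => i j; rewrite !mxE -val_eqE /= eqSS.
  by case: eqP => [->|].
apply: (@determinant_alternate _ _ _ (widen_ord (leqnSn k) a) (lift ord0 a)).
  by rewrite -val_eqE /= /bump /= neq_ltn ltnSn.
by move=> j; rewrite !mxE eqxx -val_eqE /= /bump /= gtn_eqF.
Qed.

Lemma smooth_wron k y U : open U -> (forall b, (b < k)%N -> smooth_on U (y b)) -> smooth_on U (wron k y).
Proof.
move=> oU sy; rewrite /wron /determinant; apply: smooth_on_sum => // s _.
apply: smooth_onM => //; first exact: smooth_on_cst.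
apply: smooth_on_prod => // i _.
have -> : (fun t => (\matrix_(a < k, b < k) derive1n a (y b) t) i (perm.fun_of_perm s i)) = derive1n i (y (perm.fun_of_perm s i)).
  by apply/funext => t; rewrite mxE.
by apply: smooth_on_derive1n => //; exact: sy.
Qed.

Lemma wron_ext k y z U t : open U -> U t -> (forall b s, (b < k)%N -> U s -> y b s = z b s) ->
  wron k y t = wron k z t /\ wron' k y t = wron' k z t.
Proof.
move=> oU Ut yz; have E a (b : 'I_k) : derive1n a (y b) t = derive1n a (z b) t.
  by apply: near_derive1n; apply: filterS (open_nbhs_nbhs (conj oU Ut)) => s; exact: yz.
by split; congr (\det _); apply/matrixP => i j; rewrite !mxE E.
Qed.

(** These cofactors do not involve the function [y k], in which the Wronskian is therefore
    linear. *)
Definition wcof k y (a : 'I_k.+1) t : R :=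
  cofactor (\matrix_(i < k.+1, j < k.+1) derive1n i (y j) t) a ord_max.

Lemma wron_expand k y t : wron k.+1 y t = \sum_(a < k.+1) wcof y a t * derive1n a (y k) t.
Proof.
rewrite /wron (expand_det_col _ ord_max); apply: eq_bigr => a _.
by rewrite mxE mulrC.
Qed.

Lemma wcof_ext k y z (a : 'I_k.+1) t : (forall b, (b < k)%N -> y b = z b) -> wcof y a t = wcof z a t.
Proof.
move=> yz; congr (_ * \det _); apply/matrixP => i j; rewrite !mxE yz //.
by rewrite lift_max.
Qed.

Lemma wcof_max k y t : wcof y (@ord_max k) t = wron k y t.
Proof.
rewrite /wcof /cofactor /= -signr_odd addnn odd_double mul1r; congr (\det _).
by apply/matrixP => i j; rewrite !mxE !lift_max.
Qed.

(** Deleting the row of order k leaves the orders 0, .., k - 1, k + 1, as in the derivative of the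
    Wronskian. So the last two cofactors vanish together only at a multiple zero of the Wronskian of
    the preceding functions. *)
Lemma wcof_pred k y t : wcof y (widen_ord (leqnSn _) (@ord_max k)) t = - wron' k.+1 y t.
Proof.
rewrite /wcof /cofactor /= -signr_odd addnS oddS addnn odd_double /= mulN1r; congr (- \det _).
apply/matrixP => i j; rewrite !mxE lift_max.
suff -> : val (lift (widen_ord (leqnSn k.+1) ord_max) i) = if i.+1 == k.+1 then k.+1 else i by [].
rewrite /= /fintype.bump eqSS; have := ltn_ord i; rewrite ltnS leq_eqVlt => /orP[/eqP ->|ik].
  by rewrite leqnn eqxx.
by rewrite (ltn_eqF ik) leqNgt ik.
Qed.

(** By the Leibniz rule the jet matrix is multiplied by a lower triangular matrix with [lam t] on
    the diagonal. *)
Lemma wron_scale k (lam : R -> R) y U t : open U -> U t -> smooth_on U lam ->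
  (forall b, (b < k)%N -> smooth_on U (y b)) ->
  wron k (fun b s => lam s * y b s) t = lam t ^+ k * wron k y t.
Proof.
move=> oU Ut sl sy.
pose L : 'M[R]_k := \matrix_(a, c) ('C(a, c)%:R * derive1n (a - c) lam t).
have LT : is_trig_mx L.
  by apply/is_trig_mxP => i j ij; rewrite mxE bin_small // mul0r.
have dL : \det L = lam t ^+ k.
  rewrite det_trig //; under eq_bigr do rewrite mxE binn subnn mul1r.
  by rewrite prodr_const card_ord.
rewrite -dL -det_mulmx; congr (\det _); apply/matrixP => a b; rewrite !mxE.
have -> : (fun s => lam s * y b s) = (fun s => y b s * lam s) by apply/funext => s; rewrite mulrC.
rewrite (derive1n_mul a oU (sy b (ltn_ord b)) sl Ut).
rewrite (big_ord_widen k (fun i => 'C(a, i)%:R * (derive1n i (y b) t * derive1n (a - i) lam t))) //.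
rewrite big_mkcond; apply: eq_bigr => c _; rewrite !mxE.
case: ltnP => [_|ca]; first by rewrite -mulrA [X in _ = _ * X]mulrC.
by rewrite bin_small // !mul0r.
Qed.

Lemma wron_affine k y t : (y 0%N =1 cst 1) ->
  wron k.+1 y t = \det (\matrix_(a < k, b < k) derive1n a.+1 (y b.+1) t).
Proof.
move=> y0; have D a : derive1n a (y 0%N) t = (a == 0%N)%:R.
  have -> : y 0%N = cst 1 by apply/funext.
  have [_ H] := @derive1n_family R R setT (fun n => cst (n == 0%N)%:R) openT
    (fun n s _ => is_derive_cst ((n == 0%N)%:R : R) s (1 : R)).
  exact: H.
rewrite /wron (expand_det_col _ ord0) big_ord_recl big1 ?addr0 => [|i _]; last first.
  by rewrite mxE D mul0r.
rewrite mxE D mul1r /cofactor expr0 mul1r; congr (\det _).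
by apply/matrixP => i j; rewrite !mxE.
Qed.

End Wronskian.

(** * Lifts of projective curves *)

Section Lifts.
Variables (R : realType) (m : nat).
Implicit Types (I : set R) (L : RP R m) (v : 'rV[R]_m.+1) (A : 'M[R]_m.+1).

Lemma RP_vpick L : vpick (sval L) != 0.
Proof. by rewrite vpick0 -dimv_eq0 (eqP (svalP L)). Qed.

Lemma RP_span L v : v != 0 -> v \in sval L -> exists2 k : R, k != 0 & vpick (sval L) = k *: v.
Proof.
move=> v0 vL; have LE : (<[v]> = sval L)%VS.
  by apply/eqP; rewrite eqEdim -memvE vL dim_vline v0 (eqP (svalP L)).
have := memv_pick (sval L); rewrite -{2}LE => /vlineP[k kE].
exists k => //; apply/eqP => k0; have := RP_vpick L.
by rewrite kE k0 scale0r eqxx.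
Qed.

Lemma line_subproof v : \dim <[if v == 0%R then delta_mx 0%R 0%R else v]>%VS == 1%N.
Proof.
rewrite dim_vline; case: ifP => [_|->] //.
suff -> : (delta_mx 0 0 : 'rV[R]_m.+1) != 0 by [].
by apply/eqP => /matrixP/(_ 0 0); rewrite !mxE eqxx => /eqP; rewrite oner_eq0.
Qed.

Definition line v : RP R m := exist _ <[if v == 0%R then delta_mx 0%R 0%R else v]>%VS (line_subproof v).

Lemma mem_line v : v \in sval (line v).
Proof. by rewrite /line /=; case: eqP => [->|_]; [exact: mem0v|exact: memv_line]. Qed.

Definition affine v : 'rV[R]_m := \row_j (v 0 (lift ord0 j) / v 0 0).

Lemma affineE v j : affine v 0 j = v 0 (lift ord0 j) / v 0 0.
Proof. by rewrite mxE. Qed.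

Lemma hom_coord_mem A L v : v != 0 -> v \in sval L ->
  exists2 k : R, k != 0 & hom_coord A L = k *: (v *m A).
Proof. by move=> v0 /(RP_span v0)[k k0 E]; exists k => //; rewrite /hom_coord E scalemxAl. Qed.

Lemma chart_mem A L v : v != 0 -> v \in sval L ->
  (chart_dom A L <-> (v *m A) 0 0 != 0) /\ chart A L = affine (v *m A).
Proof.
move=> v0 /(hom_coord_mem A v0)[k k0 E]; rewrite /chart_dom /chart /= E; split.
  by rewrite mxE mulf_eq0 (negbTE k0).
by apply/rowP => j; rewrite !mxE; rewrite -mulf_div divff // mul1r.
Qed.

Lemma coords_val I A (c : I -> RP R m) (t : I) : coords A c (set_val t) = chart A (c t).
Proof. exact: (congr1 (fun F => F (fun t : I => chart A (c t)) t) (@sigL_valL R 'rV[R]_m 0 I)). Qed.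

Lemma coords_domP I A (c : I -> RP R m) (t : I) : coords_dom A c (set_val t) <-> chart_dom A (c t).
Proof. by split=> [[s sA /val_inj <-]|tA] //; exists t. Qed.

Lemma ex_set_val I r : I r -> exists t : I, set_val t = r.
Proof. by move=> Ir; exists (SigSub (mem_set Ir)). Qed.

Definition is_lift I (c : I -> RP R m) (U : set R) (w : R -> 'rV[R]_m.+1) : Prop :=
  [/\ open U, U `<=` I, smooth_on U w &
      forall t : I, U (set_val t) -> w (set_val t) != 0 /\ w (set_val t) \in sval (c t)].

Section OneLift.
Variables (I : set R) (c : I -> RP R m) (U : set R) (w : R -> 'rV[R]_m.+1).
Hypothesis lw : is_lift c U w.

Lemma lift_coords A r : U r ->
  (coords_dom A c r <-> (w r *m A) 0 0 != 0) /\ coords A c r = affine (w r *m A).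
Proof.
move: lw => [_ UI _ H] Ur; have [t tr] := ex_set_val (UI _ Ur); rewrite -tr in Ur *.
by have [w0 wL] := H t Ur; rewrite coords_domP coords_val; exact: chart_mem.
Qed.

Lemma open_lift_dom A : open (U `&` [set r | (w r *m A) 0 0 != 0]).
Proof.
move: lw => [oU _ sw _].
have sf : smooth_on U (fun r => (w r *m A) 0 0).
  by apply: smooth_on_coord => //; exact: smooth_on_mulmx.
exact: open_preimage oU (@open_neq R 0) sf.
Qed.

Lemma smooth_lift_coords A : smooth_on (U `&` [set r | (w r *m A) 0 0 != 0]) (coords A c).
Proof.
have oV := @open_lift_dom A; move: (lw) => [oU _ sw _].
apply: (@smooth_on_ext _ _ _ _ (fun r => affine (w r *m A))) => //.
  by move=> r /set_mem[Ur _]; rewrite (lift_coords A Ur).2.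
have sc i : smooth_on (U `&` [set r | (w r *m A) 0 0 != 0]) (fun r => (w r *m A) 0 i).
  by apply: (@smooth_on_sub _ _ _ U) => [r []|] //; apply: smooth_on_coord => //; exact: smooth_on_mulmx.
apply: smooth_on_row => // j; have := smooth_on_div oV (sc (lift ord0 j)) (sc 0).
move=> H; apply: smooth_on_ext oV _ (H _) => [r _|r []] //.
by rewrite [RHS]mxE.
Qed.

End OneLift.

(** The lift has homogeneous coordinates 1 and the chart coordinates, brought back by the inverse
    matrix of the chart. *)
Lemma lift_exists I (c : I -> RP R m) r : smooth_to_RP c -> I r ->
  exists U w, is_lift c U w /\ U r.
Proof.
move=> sc Ir; have [A [U [Au oU Ur Udom sU]]] := sc r Ir.
pose w0 s : 'rV[R]_m.+1 := \row_i if unlift ord0 i is Some j then coords A c s 0 j else 1.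
pose w s := w0 s *m invmx A.
have UI : U `<=` I by move=> s /Udom[t _ <-]; exact: set_valP.
exists U, w; split=> //; split=> //.
  apply: smooth_on_mulmx => //; apply: smooth_on_row => // i.
  have -> : (fun s => w0 s 0 i) = if unlift ord0 i is Some j then (fun s => coords A c s 0 j) else cst 1.
    by apply/funext => s; rewrite mxE; case: (unlift _ _).
  by case: (unlift _ _) => [j|]; [exact: smooth_on_coord|exact: smooth_on_cst].
move=> t Ut; have /coords_domP h0 := Udom _ Ut.
have E : w (set_val t) = (hom_coord A (c t) 0 0)^-1 *: vpick (sval (c t)).
  apply: (can_inj (mulmxK Au)); rewrite mulmxKV // -scalemxAl -/(hom_coord A (c t)).
  apply/rowP => i; rewrite [RHS]mxE mxE; case: unliftP => [k ->|->]; last by rewrite mulVf.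
  by rewrite coords_val mxE mulrC.
rewrite E scaler_eq0 invr_eq0 negb_or h0 RP_vpick; split=> //.
by apply: memvZ; exact: memv_pick.
Qed.

Lemma smooth_of_lifts I (c : I -> RP R m) :
  (forall r, I r -> exists U w, is_lift c U w /\ U r) -> smooth_to_RP c.
Proof.
move=> H r Ir; have [U [w [lw Ur]]] := H r Ir; have [t tr] := ex_set_val Ir.
have [A [Au dA _]] := centred_chart_exists (c t).
exists A, (U `&` [set r | (w r *m A) 0 0 != 0]); split=> //.
- exact: open_lift_dom lw A.
- by split=> //=; apply/(lift_coords lw A Ur).1; rewrite -tr; exact/coords_domP.
- by move=> s [Us ws]; apply/(lift_coords lw A Us).1.
- exact: smooth_lift_coords lw A.
Qed.

(** * Non-degenerate points *)

Definition comps k (w : R -> 'rV[R]_k.+1) (b : nat) (t : R) : R := w t 0 (inord b).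

Definition nondeg k (y : nat -> R -> R) t : bool := (wron k y t != 0) || (wron' k y t != 0).

End Lifts.

(** At a zero of [G] the derivative of mu G is mu G'. *)
Lemma nondeg_mul (R : realType) (F G mu : R -> R) (r : R) (F' G' : R) :
  is_derive r 1 F F' -> is_derive r 1 G G' -> derivable mu r 1 -> mu r != 0 ->
  (\forall s \near r, F s = mu s * G s) ->
  ((F r != 0) || (F' != 0)) = ((G r != 0) || (G' != 0)).
Proof.
move=> dF dG dmu mu0 FG; have Fr : F r = mu r * G r by exact: nbhs_singleton FG.
have [_ H] := is_derive_mul (derivableP dmu) dG.
have : F' = 'D_1 mu r * G r + mu r * G'.
  by rewrite -H -(near_eq_derive _ FG); case: dF.
rewrite Fr mulf_eq0 (negbTE mu0) /= => ->.
by case: (eqVneq (G r) 0) => //= ->; rewrite mulr0 add0r mulf_eq0 (negbTE mu0).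
Qed.

(* Indices b >= m give the junk value 0. *)
Definition affj (R : realType) m (f : R -> 'rV[R]_m) (b : nat) (t : R) : R :=
  if insub b is Some i then f t 0 i else 0.

Lemma affjE (R : realType) m (f : R -> 'rV[R]_m) (i : 'I_m) : affj f i = (fun t => f t 0 i).
Proof. by apply/funext => t; rewrite /affj valK. Qed.

Lemma wron_mulmx (R : realType) k (U : set R) (w : R -> 'rV[R]_k.+1) (A : 'M[R]_k.+1) t :
  open U -> smooth_on U w -> U t ->
  wron k.+1 (comps (fun s => w s *m A)) t = wron k.+1 (comps w) t * \det A.
Proof.
move=> oU sw Ut; rewrite -det_mulmx; congr (\det _); apply/matrixP => a b; rewrite !mxE.
have -> : derive1n a (comps (fun s => w s *m A) b) t = (derive1n a w t *m A) 0 b.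
  rewrite -(derive1n_mulmx A a oU sw Ut).
  rewrite -(derive1n_coord b a oU (smooth_on_mulmx A oU sw) Ut); congr (derive1n a _ t).
  by apply/funext => s; rewrite /comps inord_val.
rewrite mxE; apply: eq_bigr => i _; rewrite mxE; congr (_ * _).
rewrite -(derive1n_coord i a oU sw Ut); congr (derive1n a _ t).
by apply/funext => s; rewrite /comps inord_val.
Qed.

(** A chart multiplies the Wronskian by a determinant, normalizing the lift to (1, coordinates)
    changes it by a power of a non-vanishing function, and the constant component leaves the
    Wronskian of the derivatives of the coordinates. Hence goodness does not depend on the lift and
    can be read in any chart. *)
Lemma nondeg_coords (R : realType) (I : set R) k (c : I -> RP R k.+1) U w (A : 'M[R]_k.+2) r :
  is_lift c U w -> A \in unitmx -> U r -> (w r *m A) 0 0 != 0 ->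
  (wron k.+2 (comps w) r != 0) = (wron k.+1 (fun b => derive1 (affj (coords A c) b)) r != 0) /\
  nondeg k.+2 (comps w) r = nondeg k.+1 (fun b => derive1 (affj (coords A c) b)) r.
Proof.
move=> lw Au Ur w0; pose V := U `&` [set s | (w s *m A) 0 0 != 0].
have oV : open V := open_lift_dom lw (A := A).
have Vr : V r by [].
have sf : smooth_on V (coords A c) := smooth_lift_coords lw A.
move: (lw) => [oU UI sw _].
have swA : smooth_on U (fun s => w s *m A) by exact: smooth_on_mulmx.
pose lam s := (w s *m A) 0 0.
have sl : smooth_on V lam.
  by apply: (@smooth_on_sub _ _ _ U) => [s []|] //; exact: smooth_on_coord.
pose y b s : R := if b is b'.+1 then affj (coords A c) b' s else 1.
have saf b : smooth_on V (affj (coords A c) b).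
  rewrite /affj; case: insub => [i|]; last exact: smooth_on_cst.
  exact: smooth_on_coord.
have sy b : smooth_on V (y b) by case: b => [|b]; [exact: smooth_on_cst|exact: saf].
have sz b : smooth_on V (derive1 (affj (coords A c) b)) by exact: (smooth_on_derive1n 1 oV).
have key s : V s -> wron k.+2 (comps w) s =
    lam s ^+ k.+2 / \det A * wron k.+1 (fun b => derive1 (affj (coords A c) b)) s.
  move=> Vs; have dA : \det A != 0 by rewrite -unitfE -unitmxE.
  apply: (mulIf dA); rewrite -(wron_mulmx A oU sw Vs.1) mulrAC divfK //.
  have E b x : (b < k.+2)%N -> V x -> comps (fun s => w s *m A) b x = lam x * y b x.
    case: b => [_ Vx|b bk Vx]; rewrite /comps /y /lam.
      by rewrite mulr1; congr (_ 0 _); apply: val_inj; rewrite /= inordK.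
    have Ux : U x by case: Vx.
    have bk' : (b < k.+1)%N by [].
    have -> : affj (coords A c) b = (fun t => coords A c t 0 (Ordinal bk')) by rewrite -affjE.
    rewrite (lift_coords lw A Ux).2 affineE mulrCA divff ?mulr1; last by case: Vx.
    by congr (_ 0 _); apply: val_inj; rewrite /= inordK.
  have [-> _] := wron_ext oV Vs E.
  rewrite (wron_scale oV Vs sl) => [|b _]; last exact: sy.
  rewrite wron_affine //; congr (_ * \det _); apply/matrixP => i j.
  by rewrite !mxE derive1Sn.
have mu0 : lam r ^+ k.+2 / \det A != 0.
  by rewrite mulf_neq0 ?expf_neq0 // invr_eq0 -unitfE -unitmxE.
split; first by rewrite key // mulf_eq0 (negbTE mu0).
rewrite /nondeg; apply: (nondeg_mul (mu := fun s => lam s ^+ k.+2 / \det A)).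
- apply: (is_derive_wron oU _ Ur) => b _; exact: smooth_on_coord.
- by apply: (is_derive_wron oV _ Vr) => b _.
- apply: (@smooth_on_derivable _ _ _ V) => //.
  by apply: (@smooth_onM _ _ _ (fun s => lam s ^+ k.+2)) => //; [exact: smooth_onX|exact: smooth_on_cst].
- exact: mu0.
- by apply: filterS (open_nbhs_nbhs (conj oV Vr)) => s; exact: key.
Qed.

(** * Types at non-degenerate points *)

Section RowRanks.
Variables (F : fieldType) (m : nat) (D : nat -> 'rV[F]_m).

Definition rows l : 'M[F]_(l, m) := \matrix_(i < l) D i.

Lemma row_rows l l' (i : 'I_l) (ll' : (i < l')%N) : row i (rows l) = row (Ordinal ll') (rows l').
Proof. by rewrite !rowK. Qed.

Lemma rows_sub l l' : (l <= l')%N -> (rows l <= rows l')%MS.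
Proof.
move=> ll; apply/row_subP => i.
by rewrite (row_rows (leq_trans (ltn_ord i) ll)) row_sub.
Qed.

Lemma rows_subS l : (rows l.+1 <= rows l + D l)%MS.
Proof.
apply/row_subP => i; case: (ltnP i l) => [il|li].
  by rewrite (row_rows il); apply: submx_trans (row_sub _ _) (addsmxSl _ _).
by rewrite rowK (_ : val i = l) ?addsmxSr //; apply/eqP; rewrite eqn_leq li -ltnS ltn_ord.
Qed.

Lemma rank_adds_row n (A : 'M[F]_(n, m)) (d : 'rV[F]_m) : (\rank (A + d)%MS <= (\rank A).+1)%N.
Proof.
apply: leq_trans (mxrank_adds_leqif _ _) _; rewrite -[X in (_ <= X)%N]addn1 leq_add2l; exact: rank_leq_row.
Qed.

Lemma rank_rowsS l : (\rank (rows l.+1) <= (\rank (rows l)).+1)%N.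
Proof. exact: leq_trans (mxrankS (rows_subS l)) (rank_adds_row _ _). Qed.

(** Each row adds at most 1 to the rank, so a deficit among the first rows is never made up. *)
Lemma rank_rows_full l l' : (l <= l')%N -> \rank (rows l') = l' -> \rank (rows l) = l.
Proof.
move=> ll E; apply/eqP; rewrite eqn_leq rank_leq_row /=.
have H d : (\rank (rows (l + d)) <= \rank (rows l) + d)%N.
  elim: d => [|d IH]; first by rewrite !addn0.
  by rewrite !addnS; apply: leq_trans (rank_rowsS _) _; rewrite ltnS.
by have := H (l' - l)%N; rewrite subnKC // E; lia.
Qed.

End RowRanks.

Section Types.
Variables (R : realType) (m : nat) (f : R -> 'rV[R]_m) (t0 : R).

Let D i := derive1n i.+1 f t0.
Let rho l := \rank (rows D l).

Lemma rank_deriv_mx l : \rank (deriv_mx f l t0) = rho l.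
Proof. by rewrite -mxrank_tr; congr (\rank _); apply/matrixP => i j; rewrite !mxE. Qed.

Lemma type_of_ranks (a : m.-tuple nat) :
  (forall i : 'I_m, (0 < tnth a i)%N /\ rho (tnth a i) = i.+1 /\ (rho (tnth a i).-1 <= i)%N) ->
  (0 < m)%N -> type_at f t0 a.
Proof.
move=> H m0; split.
  have hm : (m.-1 < m)%N by rewrite prednK.
  exists (tnth a (Ordinal hm)); have [_ [E _]] := H (Ordinal hm).
  by rewrite rank_deriv_mx E /= prednK.
move=> i; have [a0 [E1 E2]] := H i; rewrite rank_deriv_mx; split=> // l.
rewrite rank_deriv_mx => El; rewrite leqNgt; apply/negP => la.
have : (rho l <= rho (tnth a i).-1)%N by apply/mxrankS/rows_sub; rewrite -ltnS prednK.
by rewrite El => /leq_trans/(_ E2); rewrite ltnn.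
Qed.

(** The types of good curves: (1, .., m) for [false] and (1, .., m-1, m+1) for [true]. *)
Definition extra_type (b : bool) : m.-tuple nat := [tuple (i.+1 + (b && (i.+1 == m)))%N | i < m].

Lemma type_regular : (0 < m)%N -> rho m = m -> type_at f t0 (extra_type false).
Proof.
move=> m0 E; apply: type_of_ranks => // i; rewrite tnth_mktuple addn0; split=> //=.
have r l : (l <= m)%N -> rho l = l by move=> lm; exact: rank_rows_full lm E.
by rewrite !r //= ltnW.
Qed.

Lemma type_extra : (0 < m)%N -> rho m.-1 = m.-1 -> rho m = m.-1 -> rho m.+1 = m ->
  type_at f t0 (extra_type true).
Proof.
move=> m0 E1 E2 E3; apply: type_of_ranks => // i; rewrite tnth_mktuple /=.
case: eqP => [E|/eqP ne]; first by rewrite /= !addn1 E E3 E2; split=> //; split=> //; lia.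
rewrite addn0; split=> //; have im : (i.+1 < m)%N by rewrite ltn_neqAle ne ltn_ord.
have r l : (l <= m.-1)%N -> rho l = l by move=> lm; exact: rank_rows_full lm E1.
by rewrite addn0 !r //; lia.
Qed.

End Types.

Section NondegTypes.
Variables (R : realType) (m : nat) (f : R -> 'rV[R]_m.+1) (U : set R) (t0 : R).
Hypotheses (oU : open U) (Ut0 : U t0) (sf : smooth_on U f).
Let z b := derive1 (affj f b).
Let D i := derive1n i.+1 f t0.
Let rho l := \rank (rows D l).

Let zE a (b : 'I_m.+1) : derive1n a (z b) t0 = derive1n a.+1 f t0 0 b.
Proof. by rewrite /z -derive1Sn affjE (derive1n_coord b a.+1 oU sf Ut0). Qed.

Lemma wron_rank : wron m.+1 z t0 != 0 <-> rho m.+1 = m.+1.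
Proof.
have -> : wron m.+1 z t0 = \det (rows D m.+1).
  congr (\det _); apply/matrixP => a b; rewrite !mxE; exact: zE.
rewrite -unitfE -unitmxE -row_free_unit /row_free; split=> [/eqP //|E].
by apply/eqP.
Qed.

Lemma wron'_rows : wron' m.+1 z t0 != 0 ->
  row_free (\matrix_(a < m.+1) derive1n (if a.+1 == m.+1 then m.+2 else a.+1) f t0).
Proof.
rewrite -unitfE -unitmxE -row_free_unit => H.
suff <- : \matrix_(a < m.+1, b < m.+1) derive1n (if a.+1 == m.+1 then m.+1 else a) (z b) t0 =
  \matrix_(a < m.+1) derive1n (if a.+1 == m.+1 then m.+2 else a.+1) f t0 by [].
by apply/matrixP => a b; rewrite !mxE zE; case: eqP.
Qed.

(** If the Wronskian vanishes, the derivatives of orders 1, .., m, m + 2 are independent while those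
    of orders 1, .., m + 1 are not, which determines all the ranks. *)
Lemma nondeg_type : nondeg m.+1 z t0 ->
  (rho m.+1 = m.+1 /\ type_at f t0 (extra_type m.+1 false)) \/
  [/\ rho m = m, rho m.+1 = m, row_free (\matrix_(a < m.+1) derive1n (if a.+1 == m.+1 then m.+2 else a.+1) f t0) &
      type_at f t0 (extra_type m.+1 true)].
Proof.
case: (eqVneq (wron m.+1 z t0) 0) => [W0|W1 _]; last first.
  by left; have E := wron_rank.1 W1; split=> //; exact: type_regular.
rewrite /nondeg W0 eqxx /= => W'; right.
have fr := wron'_rows W'; set Q := (\matrix_(a < m.+1) _) in fr *.
have rQ : \rank Q = m.+1 by apply/eqP.
have rowQ a : row a Q = derive1n (if a.+1 == m.+1 then m.+2 else a.+1) f t0 by rewrite rowK.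
have r2 : rho m.+2 = m.+1.
  apply/eqP; rewrite eqn_leq [(rho _ <= _)%N]rank_leq_col /= -{1}rQ; apply: mxrankS.
  apply/row_subP => a; rewrite rowQ; case: eqP => _.
    by have := row_sub (@ord_max m.+1) (rows D m.+2); rewrite rowK.
  by have := row_sub (widen_ord (leqnSn _) a) (rows D m.+2); rewrite rowK.
have r0 : rho m = m.
  apply/eqP; rewrite eqn_leq rank_leq_row /= -ltnS -{1}rQ.
  apply: (leq_trans _ (rank_adds_row (rows D m) (row ord_max Q))); apply: mxrankS.
  apply/row_subP => a; case: (ltnP a m) => [am|ma].
    have S : (D a <= rows D m)%MS by have := row_sub (Ordinal am) (rows D m); rewrite rowK.
    by rewrite (rowQ a) eqSS (ltn_eqF am); exact: submx_trans S (addsmxSl _ _).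
  have -> : a = ord_max by apply: val_inj; apply/eqP; rewrite eqn_leq ma -ltnS ltn_ord.
  exact: addsmxSr.
have r1 : rho m.+1 = m.
  have : rho m.+1 != m.+1 by apply/eqP => /wron_rank; rewrite W0 eqxx.
  have := rank_leq_row (rows D m.+1); rewrite -/(rho _) leq_eqVlt => /orP[->//|].
  rewrite ltnS => h _; apply/eqP; rewrite eqn_leq h /= -{1}r0; exact/mxrankS/rows_sub.
by split=> //; exact: type_extra.
Qed.

End NondegTypes.

Lemma jet3 (R : realType) n (f : R -> 'rV[R]_n.+3) t0 :
  \rank (rows (fun i => derive1n i.+1 f t0) 3) = 3%N ->
  row_free (\matrix_(i < 3) derive1n (nth 0%N [:: 1; 2; 3]%N i) f t0 : 'M[R]_(3, 3 + n)).
Proof.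
rewrite /row_free => /eqP; congr (\rank _ == _).
by apply/matrixP => -[[|[|[|//]]] hi] j; rewrite !mxE.
Qed.

Definition good (R : realType) (I : set R) m (c : I -> RP R m) (t0 : R) : Prop :=
  exists U w, [/\ is_lift c U w, U t0 & nondeg m.+1 (comps w) t0].

(** * Tangent surfaces of good curves *)

Section Conclusions.
Variables (R : realType) (I : set R).

Lemma good_centred m (c : smooth_curve I m.+1) (t0 : I) (A : 'M[R]_m.+2) :
  good c (set_val t0) -> centred_chart A (c t0) ->
  exists U, [/\ open U, U (set_val t0), smooth_on U (coords A c), coords A c (set_val t0) = 0 &
    nondeg m.+1 (fun b => derive1 (affj (coords A c) b)) (set_val t0)].
Proof.
move=> [U [w [lw Ut nd]]] [Au dA cA].
have w0 : (w (set_val t0) *m A) 0 0 != 0.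
  by apply/(lift_coords lw A Ut).1; exact/coords_domP.
exists (U `&` [set r | (w r *m A) 0 0 != 0]); split=> //.
- exact: open_lift_dom lw A.
- exact: smooth_lift_coords lw A.
- by rewrite coords_val.
- by rewrite -(nondeg_coords lw Au Ut w0).2.
Qed.

Lemma nth_extra_type m b : nth 0%N (extra_type m.+2 b) 0 = 1%N.
Proof.
by rewrite -(tnth_nth 0%N (extra_type m.+2 b) ord0) tnth_mktuple /= andbF.
Qed.

Lemma good_finite_type m (c : smooth_curve I m.+1) (t0 : I) :
  good c (set_val t0) -> finite_type c t0.
Proof.
move=> gc A /(good_centred gc)[U [oU Ut sf _ nd]].
by have [[_ []]|[_ _ _ []]] := nondeg_type oU Ut sf nd.
Qed.

(** In dimension at least 4 the exceptional type only affects the last entry, so f', f'', f''' are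
    independent at every good point. *)
Lemma good_cuspidal_edge n (c : smooth_curve I n.+4) (t0 : I) :
  good c (set_val t0) -> tan_diffeomorphic c t0 (@cuspidal_edge R n.+4).
Proof.
move=> gc A /(good_centred gc)[U [oU Ut sf f0 nd]].
have [[E T]|[E _ _ T]] := nondeg_type oU Ut sf nd.
  exists (extra_type n.+4 false); split=> //.
  apply: (curve_edge oU Ut sf f0) (nth_extra_type _ _) (jet3 _).
  exact: rank_rows_full E.
exists (extra_type n.+4 true); split=> //.
apply: (curve_edge oU Ut sf f0) (nth_extra_type _ _) (jet3 _).
exact: rank_rows_full E.
Qed.

(** Each alternative quantifies over all centred charts, so the same one must hold in all of them.
    The choice is therefore made by the Wronskian of a lift, to which [regE] relates the rank in
    every chart. *)
Lemma good_space_curve (c : smooth_curve I 3) (t0 : I) : good c (set_val t0) ->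
  tan_diffeomorphic c t0 (@cuspidal_edge R 3) \/ tan_diffeomorphic c t0 (@folded_umbrella R).
Proof.
move=> gc; have [A0 cA0] := centred_chart_exists (c t0).
have [U0 [w0 [lw0 Ut0 nd0]]] := gc.
have dich A : centred_chart A (c t0) ->
    (\rank (rows (fun i => derive1n i.+1 (coords A c) (set_val t0)) 3) = 3%N ->
      exists a : 3.-tuple nat, type_at (coords A c) (set_val t0) a /\
       germ_diffeomorphic (tan_map (coords A c) (set_val t0) a) (vec2 0 (set_val t0)) (@cuspidal_edge R 3) 0) /\
    (\rank (rows (fun i => derive1n i.+1 (coords A c) (set_val t0)) 3) != 3%N ->
      exists a : 3.-tuple nat, type_at (coords A c) (set_val t0) a /\
       germ_diffeomorphic (tan_map (coords A c) (set_val t0) a) (vec2 0 (set_val t0)) (@folded_umbrella R) 0).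
  move=> /(good_centred gc)[U [oU Ut sf f0 nd]].
  have [[E T]|[E1 E2 E3 T]] := nondeg_type oU Ut sf nd.
    split=> [_|]; last by rewrite E.
    exists (extra_type 3 false); split=> //.
    exact: (curve_edge oU Ut sf f0) (nth_extra_type _ _) (jet3 _).
  split=> [|_]; first by rewrite E2.
  exists (extra_type 3 true); split=> //.
  set D := (fun i => derive1n i.+1 (coords A c) (set_val t0)) in E1 E2.
  (* Equal ranks of (f', f'') and (f', f'', f''') put f''' in the span of f' and f''. *)
  have /andP[_ S32] : (rows D 2 == rows D 3)%MS.
    by rewrite -(geq_leqif (mxrank_leqif_eq (rows_sub D (leqnSn 2)))) E1 E2.
  have : (D 2%N <= rows D 2)%MS.
    by apply: submx_trans S32; have := row_sub (@ord_max 2) (rows D 3); rewrite rowK.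
  move=> /submxP[C CE].
  have D3 : D 2%N = C 0 0 *: D 0%N + C 0 1 *: D 1%N.
    by rewrite CE mulmx_sum_row !big_ord_recl big_ord0 addr0 !rowK /=; congr (_ + C 0 _ *: _); exact: val_inj.
  apply: germ_diffeomorphic_trans (opening_folded_umbrella R).
  apply: (curve_umbrella oU Ut sf f0) (nth_extra_type _ _) D3 _ => //.
  rewrite (_ : \matrix_(i < 3) _ = \matrix_(a < 3) derive1n (if a.+1 == 3 then 4 else a.+1)%N (coords A c) (set_val t0)) //.
  by apply/matrixP => -[[|[|[|//]]] hi] j; rewrite !mxE.
have regE A : centred_chart A (c t0) ->
    \rank (rows (fun i => derive1n i.+1 (coords A c) (set_val t0)) 3) = 3%N <-> wron 4 (comps w0) (set_val t0) != 0.
  move=> cA; have [U [oU Ut sf f0 nd]] := good_centred gc cA; case: cA => Au dA cA.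
  rewrite -(wron_rank oU Ut sf) (nondeg_coords lw0 Au Ut0 _).1 //.
  by apply/(lift_coords lw0 A Ut0).1; exact/coords_domP.
case: (eqVneq (wron 4 (comps w0) (set_val t0)) 0) => W; [right|left] => A cA.
  by apply: (dich A cA).2; apply/eqP => /(regE A cA); rewrite W eqxx.
by apply: (dich A cA).1; exact/regE.
Qed.

End Conclusions.

(** * Locally finite covers and small smooth functions *)

Section Cover.
Variables (R : realType) (I : set R).

(** The radius is doubled: the intervals of radius r are to cover, the cells to carry the bump
    functions. *)
Definition cell (a r : R) : set R := [set x | `|x - a| <= 2 * r].

Let ctr (n : nat) (k : int) : R := k%:~R / 2 ^+ n.
Let rad (n : nat) : R := (2 ^+ n)^-1.

Let rad_gt0 n : 0 < rad n. Proof. by rewrite invr_gt0 exprn_gt0. Qed.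

Let radS n : rad n = 2 * rad n.+1.
Proof. by rewrite /rad exprS invfM mulrA divff ?mul1r // pnatr_eq0. Qed.

Let ctr_near n t : `|t - ctr n (Num.floor (t * 2 ^+ n))| <= rad n.
Proof.
have p0 : 0 < (2 : R) ^+ n by rewrite exprn_gt0.
have E : t - ctr n (Num.floor (t * 2 ^+ n)) = (t * 2 ^+ n - (Num.floor (t * 2 ^+ n))%:~R) / 2 ^+ n.
  by rewrite mulrBl mulfK // gt_eqF.
rewrite E normrM [X in _ * X]gtr0_norm ?invr_gt0 // ler_piMl ?(ltW (rad_gt0 n)) //.
have := floor_itv (t * 2 ^+ n); rewrite intrD => /andP[h1 h2].
by rewrite ger0_norm ?subr_ge0 //; lra.
Qed.

Let rad_small e : 0 < e -> exists N, rad N < e.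
Proof.
move=> e0; exists (Num.bound e^-1); rewrite /rad invf_plt ?posrE ?exprn_gt0 //.
exact: upper_nthrootP.
Qed.

Let rad_mono n N : (n <= N)%N -> rad N <= rad n.
Proof.
by move=> nN; rewrite /rad lef_pV2 ?posrE ?exprn_gt0 // ler_weXn2l // ler1n.
Qed.

(* Dyadic cells: a cell is selected when it is fine enough and its predecessor at the
   previous scale is not. *)
Lemma locally_finite_cover (P : set R -> Prop) : open I ->
  (forall A B, A `<=` B -> P B -> P A) ->
  (forall t, I t -> exists2 e : R, 0 < e & P [set x | `|x - t| < e]) ->
  exists (a r : nat -> R) (s : set nat),
    [/\ forall i, s i -> [/\ 0 < r i, cell (a i) (r i) `<=` I & P (cell (a i) (r i))],
        forall t, I t -> exists2 i, s i & `|t - a i| <= r i &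
        forall t, I t -> exists (d : R) (N : nat), 0 < d /\ forall i x, s i ->
          `|x - t| < d -> cell (a i) (r i) x -> (i < N)%N].
Proof.
move=> oI hP lP.
pose fine n k := cell (ctr n k) (rad n) `<=` I /\ P (cell (ctr n k) (rad n)).
pose sel n k := fine n k /\ (n = 0%N \/ exists2 t, `|t - ctr n k| <= rad n &
  ~ fine n.-1 (Num.floor (t * 2 ^+ n.-1))).
have loc t : I t -> exists2 e : R, 0 < e & forall n k x, cell (ctr n k) (rad n) x ->
    `|x - t| < e -> 4 * rad n < e -> fine n k.
  move=> It; have [e1 e10 Pe1] := lP t It.
  have [e2 e20 Ie2] : exists2 e2 : R, 0 < e2 & forall x, `|x - t| < e2 -> I x.
    have /nbhs_ballP[e2 /= e20 He] : nbhs t I by apply: open_nbhs_nbhs.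
    by exists e2 => // x xt; apply: He; rewrite /ball /= distrC.
  exists (Num.min e1 e2 / 2); first by rewrite divr_gt0 // lt_min e10.
  move=> n k x cx xt rn; have H y : cell (ctr n k) (rad n) y -> `|y - t| < Num.min e1 e2.
    move=> cy; have -> : y - t = (y - ctr n k) - (x - ctr n k) + (x - t) by ring.
    have := ler_normD ((y - ctr n k) - (x - ctr n k)) (x - t).
    have := ler_normB (y - ctr n k) (x - ctr n k).
    by move: cx cy xt rn; rewrite /cell /=; lra.
  split=> [y /H|]; first by rewrite lt_min => /andP[_]; exact: Ie2.
  by apply: hP Pe1 => y /H; rewrite lt_min => /andP[].
(* Cells are numbered by the code of (n, k). An index that is no code gets a default cell and is
   kept out of the selection. *)
pose dec (i : nat) : nat * int := odflt (0%N, 0) (pickle_inv i).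
exists (fun i => ctr (dec i).1 (dec i).2), (fun i => rad (dec i).1),
  [set i | (exists x : nat * int, pickle x = i) /\ sel (dec i).1 (dec i).2].
have decK x : dec (pickle x) = x by rewrite /dec pickleK_inv.
split=> [i [_ [[]]] //|t It|t It].
- have [e e0 He] := loc t It.
  have [N rN] : exists N, 4 * rad N < e.
    by have [N HN] := rad_small (divr_gt0 e0 (ltr0n _ 4)); exists N; lra.
  pose F n := `[< fine n (Num.floor (t * 2 ^+ n)) >].
  have exF : exists n, F n.
    exists N; apply/asboolP; apply: (He _ _ t) => //; last by rewrite subrr normr0.
    by rewrite /cell /=; have := ctr_near N t; have := rad_gt0 N; lra.
  have [n /asboolP Fn minn] := find_ex_minn exF.
  exists (pickle (n, Num.floor (t * 2 ^+ n))); last by rewrite decK.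
  split; first by exists (n, Num.floor (t * 2 ^+ n)).
  rewrite decK; split=> //=; case: n Fn minn => [|n] Fn minn; [by left|right].
  exists t; first exact: ctr_near.
  by move=> Fn'; have /minn : F n by [exact/asboolP]; rewrite ltnn.
- have [e e0 He] := loc t It.
  (* A cell near [t] of scale n > N comes from a point whose cell at the previous scale is still
     within reach of [He], hence fine, so it is not selected. At the scales up to N only finitely
     many centres are near [t]. The bound e / 32 leaves room for the doubled radii and the previous
     scale. *)
  have [N rN] : exists N, rad N < e / 32.
    by apply: rad_small; rewrite divr_gt0.
  have [M HM] : exists M : nat, forall n (k : int), (n <= N)%N -> `|ctr n k - t| <= 2 + e -> (`|k| < M)%N.
    exists (Num.bound (2 ^+ N * (`|t| + 2 + e))) => n k nN ct.
    have p0 : 0 < (2 : R) ^+ n by rewrite exprn_gt0.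
    have h1 : `|k%:~R| <= 2 ^+ N * (`|t| + 2 + e) :> R.
      have -> : k%:~R = ctr n k * 2 ^+ n by rewrite divfK // gt_eqF.
      rewrite normrM [X in _ * X]gtr0_norm // mulrC.
      apply: ler_pM; [exact: ltW|exact: normr_ge0|by rewrite ler_weXn2l // ler1n|].
      have -> : ctr n k = (ctr n k - t) + t by ring.
      by have := ler_normD (ctr n k - t) t; lra.
    have h2 := archi_boundP (le_trans (normr_ge0 _) h1).
    have := le_lt_trans h1 h2; rewrite -intr_norm -abszE -pmulrn ltr_nat.
    by [].
  pose D := [set p : nat * int | (p.1 <= N)%N /\ (`|p.2| < M)%N].
  have [N' HN'] : exists N' : nat, forall p, D p -> (pickle p < N')%N.
    exists (\max_(n < N.+1) \max_(k < M) maxn (pickle (n : nat, Posz k)) (pickle (n : nat, - Posz k))).+1.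
    move=> [n k] [/= nN kM]; rewrite ltnS.
    apply: leq_trans (leq_bigmax (Ordinal (nN : (n < N.+1)%N))).
    apply: leq_trans (leq_bigmax (Ordinal kM)) => /=; rewrite leq_max.
    by case: (intP k) kM => [|l|l] kM; rewrite ?absz_nat ?abszN ?leqnn ?orbT.
  exists (e / 8), N'; split; first by rewrite divr_gt0.
  move=> i x [[p <-]]; rewrite decK => -[fn sl] xt cx; apply: HN'; move: sl fn cx.
  case: p => n k /= sl fn cx.
  have nN : (n <= N)%N.
    rewrite leqNgt; apply/negP => Nn; have rn := rad_mono (ltnW Nn).
    case: sl => [n0|[y yc]]; first by rewrite n0 in Nn.
    case: n Nn fn cx rn yc => // n Nn fn cx rn yc; apply => /=.
    have rS := radS n; apply: (He _ _ y); rewrite /cell /=.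
    + by have := ctr_near n y; have := rad_gt0 n; lra.
    + have -> : y - t = (y - ctr n.+1 k) - (x - ctr n.+1 k) + (x - t) by ring.
      have := ler_normD ((y - ctr n.+1 k) - (x - ctr n.+1 k)) (x - t).
      have := ler_normB (y - ctr n.+1 k) (x - ctr n.+1 k).
      by move: cx; rewrite /cell /=; lra.
    + by lra.
  split=> //=; apply: HM nN _.
  have -> : ctr n k - t = (x - t) - (x - ctr n k) by ring.
  have r0 : rad 0 = 1 by rewrite /rad expr0 invr1.
  have := ler_normB (x - t) (x - ctr n k); have := rad_mono (leq0n n).
  move: cx; rewrite /cell /= r0; lra.
Qed.

End Cover.

Section SmallFunction.
Variable R : realType.

Definition cell_bump (a r x : R) : R := bump ((x - a) / r).

Lemma smooth_cell_bump a r : smooth_on setT (cell_bump a r).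
Proof.
have oT : open [set: R] by exact: openT.
apply: (@smooth_on_comp1 _ _ setT setT (fun x => (x - a) / r) (@bump R)) => //; last exact: smooth_bump.
apply: (@smooth_onM _ _ _ (fun x : R => x - a)) => //; last exact: smooth_on_cst.
by apply: smooth_onB => //; [exact: smooth_on_id|exact: smooth_on_cst].
Qed.

Lemma cell_bump_ge0 a r x : 0 <= cell_bump a r x. Proof. exact: bump_ge0. Qed.

Lemma cell_bump_gt0 a r x : 0 < r -> `|x - a| <= r -> 0 < cell_bump a r x.
Proof.
move=> r0 xa; apply: bump_gt0; rewrite normrM normfV [X in _ / X]gtr0_norm // ltr_pdivrMr //; lra.
Qed.

Lemma cell_bump_out a r x : 0 < r -> ~ cell a r x -> cell_bump a r x = 0.
Proof.
rewrite /cell /= => r0 /negP; rewrite -ltNge => xa; apply: bump_out.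
by rewrite normrM normfV [X in _ / X]gtr0_norm // ler_pdivlMr // ltW.
Qed.

Lemma derive_cell_bump_out a r x k : 0 < r -> ~ cell a r x -> derive1n k (cell_bump a r) x = 0.
Proof.
move=> r0 /negP; rewrite -ltNge => xa.
rewrite (@near_derive1n _ _ _ (cst 0)); last first.
  have H : \forall y \near x, 2 * r < `|y - a|.
    have cc : `|y - a| @[y --> x] --> `|x - a|.
      by apply: (@cvg_norm _ R); apply: (@cvgB _ R) => //; exact: cvg_cst.
    by have /cvgr_gt := cc; apply.
  apply: filterS H => y ya; apply: cell_bump_out => //; apply/negP; rewrite -ltNge //.
have [_ H] := @derive1n_family R R setT (fun _ => cst 0) openT (fun n s _ => is_derive_cst (0 : R) s (1 : R)).
exact: H.
Qed.

Lemma cell_bump_bound a r k : 0 < r -> exists2 M, 0 < M & forall l x, (l <= k)%N ->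
  `|derive1n l (cell_bump a r) x| <= M.
Proof.
move=> r0; have one l : exists2 M, 0 < M & forall x, `|derive1n l (cell_bump a r) x| <= M.
  have sl := smooth_on_derive1n l openT (smooth_cell_bump a r).
  have ab : a - 2 * r <= a + 2 * r by lra.
  have cf : {within `[a - 2 * r, a + 2 * r], continuous (fun x => `|derive1n l (cell_bump a r) x|)}.
    apply: continuous_subspaceT => x; apply: (@cvg_norm _ R).
    exact: smooth_on_continuous sl I.
  have [c _ Hc] := EVT_max ab cf.
  exists (`|derive1n l (cell_bump a r) c| + 1); first by rewrite ltr_pwDr.
  move=> x; have [xa|xa] := pselect (cell a r x); last first.
    by rewrite derive_cell_bump_out // normr0 addr_ge0.
  apply: (le_trans (Hc x _)); last by rewrite lerDl.
  by move: xa; rewrite /cell /= ler_distl in_itv /=.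
elim: k => [|k [M M0 IH]].
  by have [M M0 H] := one 0%N; exists M => // l x; rewrite leqn0 => /eqP ->.
have [M' M'0 H] := one k.+1; exists (M + M'); first exact: addr_gt0.
move=> l x; rewrite leq_eqVlt => /orP[/eqP ->|]; first by apply: le_trans (H x) _; rewrite lerDr ltW.
by rewrite ltnS => /IH lk; apply: le_trans (lk x) _; rewrite lerDl ltW.
Qed.

Lemma derive1n_sum (U : set R) n (f : nat -> R -> R) k t : open U ->
  (forall i, smooth_on U (f i)) -> U t ->
  derive1n k (fun x => \sum_(i < n) f i x) t = \sum_(i < n) derive1n k (f i) t.
Proof.
move=> oU sf Ut; pose X k t := \sum_(i < n) derive1n k (f i) t.
have dX l s : U s -> is_derive s 1 (X l) (X l.+1 s).
  by move=> Us; apply: is_derive_bigsum => i; exact: is_derive_derive1n oU (sf i) Us.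
exact: (derive1n_family oU dX).2.
Qed.

Lemma derive1n_cstmul (U : set R) (c : R) (f : R -> R) k t : open U ->
  smooth_on U f -> U t -> derive1n k (fun x => c * f x) t = c * derive1n k f t.
Proof.
move=> oU sf Ut; pose X k t := c * derive1n k f t.
have dX l s : U s -> is_derive s 1 (X l) (X l.+1 s).
  by move=> Us; apply: is_derive_cstmul; exact: is_derive_derive1n oU sf Us.
exact: (derive1n_family oU dX).2.
Qed.

(** The function is a sum of bumps with coefficients eta_i / (M_i 2^(i+1)), M_i bounding the
    derivatives of the bump. At t its jet is thus at most the largest eta_i among the cells
    containing t, and [Q] holds at t for that very eta_i. *)
Lemma small_smooth (I : set R) (Q : R -> R -> Prop) (k : nat) : open I ->
  (forall eta eta' t, eta' <= eta -> Q eta t -> Q eta' t) ->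
  (forall t, I t -> exists (e eta : R), [/\ 0 < e, 0 < eta & forall s, `|s - t| < e -> Q eta s]) ->
  exists h : R -> R, [/\ smooth_on I h, forall t, I t -> 0 < h t &
    forall t, I t -> exists eta, Q eta t /\ forall l, (l <= k)%N -> `|derive1n l h t| <= eta].
Proof.
move=> oI Qd Ql.
have oT : open [set: R] by exact: openT.
pose P (A : set R) := exists2 eta : R, 0 < eta & forall s, A s -> Q eta s.
have [A B AB [eta eta0 H]|t It|a [r [s [H1 H2 H3]]]] := @locally_finite_cover R I P oI.
- by exists eta => // x /AB; exact: H.
- by have [e [eta [e0 eta0 H]]] := Ql t It; exists e => //; exists eta.
have [eta etaP] : exists eta : nat -> R, forall i, s i -> 0 < eta i /\ forall x, cell (a i) (r i) x -> Q (eta i) x.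
  suff : forall i, exists eta : R, s i -> 0 < eta /\ forall x, cell (a i) (r i) x -> Q eta x by move=> /choice[g gP]; exists g.
  move=> i; have [si|si] := pselect (s i); last by exists 0.
  by have [_ _ [e e0 He]] := H1 i si; exists e.
have [M MP] : exists M : nat -> R, forall i, s i -> 0 < M i /\
    forall l x, (l <= k)%N -> `|derive1n l (cell_bump (a i) (r i)) x| <= M i.
  suff : forall i, exists M : R, s i -> 0 < M /\ forall l x, (l <= k)%N -> `|derive1n l (cell_bump (a i) (r i)) x| <= M.
    by move=> /choice[g gP]; exists g.
  move=> i; have [si|si] := pselect (s i); last by exists 0.
  by have [r0 _ _] := H1 i si; have [m m0 Hm] := cell_bump_bound (a i) k r0; exists m.
pose c i := if `[< s i >] then eta i / M i / 2 ^+ i.+1 else 0.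
pose b i (x : R) := c i * cell_bump (a i) (r i) x.
have cs i : ~ s i -> c i = 0 by move=> si; rewrite /c asboolF.
have cgt0 i : s i -> 0 < c i.
  move=> si; rewrite /c asboolT //; have [e0 _] := etaP i si; have [m0 _] := MP i si.
  by rewrite !divr_gt0 // exprn_gt0.
have bz i x : s i -> ~ cell (a i) (r i) x -> b i x = 0.
  by move=> si nc; rewrite /b cell_bump_out ?mulr0 //; have [] := H1 i si.
have sb i : smooth_on setT (b i).
  apply: (@smooth_onM _ _ _ (cst (c i))) => //; first exact: smooth_on_cst.
  exact: smooth_cell_bump.
have [dN dNP] : exists dN : R -> R * nat, forall t, I t -> 0 < (dN t).1 /\ forall i x,
    `|x - t| < (dN t).1 -> ((dN t).2 <= i)%N -> b i x = 0.
  suff : forall t, exists dN : R * nat, I t -> 0 < dN.1 /\ forall i x, `|x - t| < dN.1 -> (dN.2 <= i)%N -> b i x = 0.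
    by move=> /choice[g gP]; exists g.
  move=> t; have [It|] := pselect (I t); last by exists (0, 0%N).
  have [d [N [d0 H]]] := H3 t It; exists (d, N) => _; split=> //= i x xt Ni.
  have [si|si] := pselect (s i); last by rewrite /b cs ?mul0r.
  apply: bz => // cx; have := H i x si xt cx; by rewrite ltnNge Ni.
(* The number of terms varies with [x]; near a given point a fixed number suffices, since the
   further bumps vanish there. *)
pose h x := \sum_(i < (dN x).2) b i x.
have sum_ext n n' x : (n <= n')%N -> (forall i, (n <= i)%N -> b i x = 0) ->
    \sum_(i < n') b i x = \sum_(i < n) b i x.
  move=> nn bi; rewrite -!(big_mkord xpredT (fun i => b i x)) (big_cat_nat _ nn) //=.
  by rewrite [X in _ + X]big_nat_cond [X in _ + X]big1 ?addr0 // => i /andP[/andP[/bi]].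
have hE t x : I t -> I x -> `|x - t| < (dN t).1 -> h x = \sum_(i < (dN t).2) b i x.
  move=> It Ix xt; have [d0 Ht] := dNP t It; have [d0' Hx] := dNP x Ix.
  have xx : `|x - x| < (dN x).1 by rewrite subrr normr0.
  case: (leqP (dN t).2 (dN x).2) => nn; first by apply: sum_ext nn _ => i; exact: Ht.
  by symmetry; apply: sum_ext (ltnW nn) _ => i; exact: Hx.
have nearh t : I t -> \forall x \near t, \sum_(i < (dN t).2) b i x = h x.
  move=> It; have [d0 Ht] := dNP t It.
  have n1 : \forall x \near t, I x by apply: open_nbhs_nbhs.
  have n2 : \forall x \near t, `|x - t| < (dN t).1.
    by apply/nbhs_ballP; exists (dN t).1 => //= x; rewrite /ball /= distrC.
  by apply: filterS2 n1 n2 => x Ix xt; rewrite (hE t x).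
have dh t l : I t -> derive1n l h t = \sum_(i < (dN t).2) c i * derive1n l (cell_bump (a i) (r i)) t.
  move=> It; rewrite -(near_derive1n l (nearh t It)) (derive1n_sum _ _ oT sb) //.
  by apply: eq_bigr => i _; exact: derive1n_cstmul oT (smooth_cell_bump _ _) _.
exists h; split.
- apply: (@smooth_on_sub _ _ _ (\bigcup_(u in [set: {t | I t}]) (I `&` ball (sval u) (dN (sval u)).1))).
    by move=> t It; exists (exist _ t It) => //; split=> //=; exact: ballxx (dNP t It).1.
  apply: smooth_on_bigcup => -[t It] /=.
  have oV : open (I `&` ball t (dN t).1) by apply: openI => //; exact: ball_open.
  apply: (@smooth_on_ext _ _ _ _ (fun x => \sum_(i < (dN t).2) b i x)) => //.
    by move=> x /set_mem[Ix xt]; rewrite (hE t x) // distrC.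
  by apply: smooth_on_sum => // i _; exact: smooth_on_sub (sb i).
- move=> t It; have [i0 si0 ti0] := H2 t It; have [d0 Ht] := dNP t It.
  have tt : `|t - t| < (dN t).1 by rewrite subrr normr0.
  have b0 : 0 < b i0 t by rewrite mulr_gt0 ?cgt0 // cell_bump_gt0 //; have [] := H1 i0 si0.
  have i0N : (i0 < (dN t).2)%N.
    by rewrite ltnNge; apply/negP => /(Ht i0 t tt) E; rewrite E ltxx in b0.
  rewrite /h (bigD1 (Ordinal i0N)) //= ltr_pwDl //; apply: sumr_ge0 => i _.
  rewrite /b mulr_ge0 ?cell_bump_ge0 //.
  by have [/cgt0/ltW|/cs ->] := pselect (s i).
- move=> t It; have [i0 si0 ti0] := H2 t It; have [d0 Ht] := dNP t It.
  have tt : `|t - t| < (dN t).1 by rewrite subrr normr0.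
  have b0 : 0 < b i0 t by rewrite mulr_gt0 ?cgt0 // cell_bump_gt0 //; have [] := H1 i0 si0.
  have i0N : (i0 < (dN t).2)%N.
    by rewrite ltnNge; apply/negP => /(Ht i0 t tt) E; rewrite E ltxx in b0.
  pose Pr (i : 'I_(dN t).2) := `[< s i /\ cell (a i) (r i) t >].
  have Pi0 : Pr (Ordinal i0N).
    by apply/asboolP; split=> //; rewrite /cell /=; have [r0 _ _] := H1 i0 si0; lra.
  case: (arg_maxP (fun i : 'I_(dN t).2 => eta i) Pi0) => j /asboolP[sj cj] jmax.
  have [ej0 Qj] := etaP j sj.
  exists (eta j); split; first exact: Qj.
  move=> l lk; rewrite dh //; apply: le_trans (ler_norm_sum _ _ _) _.
  apply: (@le_trans _ _ (\sum_(i < (dN t).2) eta j / 2 ^+ i.+1)).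
    apply: ler_sum => i _; have [[si ci]|nsi] := pselect (s i /\ cell (a i) (r i) t); last first.
      have -> : c i * derive1n l (cell_bump (a i) (r i)) t = 0.
        have [si|/cs ->] := pselect (s i); last by rewrite mul0r.
        rewrite derive_cell_bump_out ?mulr0 //; first by have [] := H1 i si.
        by move=> ci; apply: nsi.
      by rewrite normr0 divr_ge0 ?exprn_ge0 // ltW.
    have [m0 Hm] := MP i si; have [e0 _] := etaP i si.
    have p0 : 0 < (2 : R) ^+ i.+1 by rewrite exprn_gt0.
    rewrite normrM (gtr0_norm (cgt0 i si)) /c asboolT //.
    rewrite mulrAC ler_pM2r ?invr_gt0 // mulrAC ler_pdivrMr //.
    apply: (le_trans (y := eta i * M i)); first by rewrite ler_pM2l //; exact: Hm.
    by rewrite ler_pM2r //; apply: jmax; apply/asboolP.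
  rewrite -mulr_sumr ler_piMr ?(ltW ej0) //.
  have -> : forall N, \sum_(i < N) (2 ^+ i.+1)^-1 = 1 - (2 ^+ N)^-1 :> R.
    elim=> [|N IH]; first by rewrite big_ord0 expr0 invr1 subrr.
    by rewrite big_ord_recr /= IH exprS invfM; field; rewrite expf_neq0.
  by rewrite lerBlDr lerDl invr_ge0 exprn_ge0.
Qed.

End SmallFunction.

(** * Critical values *)

Section Null.
Variable R : realType.
Local Notation mu := (@lebesgue_measure R).

Definition null (A : set R) := mu.-negligible A.

Lemma nullS (A B : set R) : A `<=` B -> null B -> null A.
Proof. by move=> AB [C [mC C0 BC]]; exists C; split=> //; exact: subset_trans BC. Qed.

Lemma null0 : null set0. Proof. exact: negligible_set0. Qed.

Lemma null_of_cover (A : set R) : (forall e : R, 0 < e -> exists n (x : nat -> R) (rho : R),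
    [/\ 0 < rho, n%:R * (2 * rho) <= e &
     forall y, A y -> exists2 i, (i < n)%N & `|y - x i| <= rho]) -> null A.
Proof.
move=> H; have H' k : exists B : set R, [/\ measurable B, A `<=` B & (mu B <= (k.+1%:R^-1)%:E)%E].
  have k0 : 0 < k.+1%:R^-1 :> R by rewrite invr_gt0 ltr0n.
  have [n [x [rho [rho0 nr Hx]]]] := H _ k0.
  pose J i : set R := [set` `[x i - rho, x i + rho]].
  have mJ i : measurable (J i) by exact: measurable_itv.
  exists (\big[setU/set0]_(i < n) J i); split.
  - exact: bigsetU_measurable.
  - move=> y /Hx[i ir yx]; rewrite -bigcup_mkord; exists i => //.
    by rewrite /J /= in_itv /= -ler_distl.
  - apply: (le_trans (Boole_inequality mu (fun i _ => mJ i))).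
    have muJ i : mu (J i) = (2 * rho)%:E.
      rewrite /J lebesgue_measure_itv /= lte_fin ifT; last lra.
      by rewrite -EFinB; congr (_%:E); lra.
    rewrite (eq_bigr (fun=> (2 * rho)%:E)) => [|i _]; last exact: muJ.
    by rewrite sumEFin lee_fin sumr_const card_ord -[_ *+ n]mulr_natl.
have [B BP] := choice H'.
have mB : measurable (\bigcap_k B k) by apply: bigcapT_measurable => k; have [] := BP k.
exists (\bigcap_k B k); split=> //; last by move=> y Ay k _; have [_ /(_ y Ay)] := BP k.
apply/eqP; rewrite -measure_le0; apply/lee_addgt0Pr => e e0; rewrite add0e.
have [k ke] : exists k : nat, (k.+1%:R)^-1 < e.
  exists (Num.bound e^-1); rewrite invf_plt ?posrE ?ltr0n //.
  apply: lt_trans (archi_boundP _) _; first by rewrite invr_ge0 ltW.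
  by rewrite ltr_nat.
have [mBk _ Bk] := BP k; apply: le_trans (le_trans _ Bk) _; last by rewrite lee_fin ltW.
by apply: le_measure; rewrite ?inE // => y; apply.
Qed.

Lemma null_bigcup (T : countType) (A : T -> set R) : (forall i, null (A i)) ->
  null (\bigcup_i A i).
Proof.
move=> HA; pose F n := if @unpickle T n is Some i then A i else set0.
apply: (@nullS _ (\bigcup_n F n)).
  by move=> y [i _ Ay]; exists (pickle i) => //; rewrite /F pickleK.
apply: negligible_bigcup => n; rewrite /F; case: unpickle => [i|]; first exact: HA.
exact: null0.
Qed.

Lemma null_avoid (A : set R) : null A -> exists2 c : R, `|c| <= 1 & ~ A c.
Proof.
move=> [B [mB B0 AB]]; apply: contrapT => H.
have S : [set` `[0, 1]] `<=` B.
  move=> x; rewrite /= in_itv /= => /andP[x0 x1]; apply: AB; apply: contrapT => nA.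
  by apply: H; exists x => //; rewrite ger0_norm.
have : (mu [set` `[0%R, 1%R]%R] <= mu B)%E by apply: le_measure; rewrite ?inE //; exact: measurable_itv.
by rewrite B0 lebesgue_measure_itv /= lte_fin ltr01 -EFinB lee_fin subr0 ler10.
Qed.

Lemma null_subsingleton (A : set R) : (forall x y, A x -> A y -> x = y) -> null A.
Proof.
move=> H; have [[x Ax]|nA] := pselect (exists x, A x); last first.
  by apply: (@nullS _ (set0)); [move=> y Ay; apply: nA; exists y|exact: negligible_set0].
apply: null_of_cover => e e0; exists 1%N, (fun=> x), (e / 2); split; first exact: divr_gt0.
  by rewrite mul1r mulrC divfK // pnatr_eq0.
by move=> y Ay; exists 0%N => //; rewrite (H y x) // subrr normr0 divr_ge0 // ltW.
Qed.

Lemma lipschitz_segment (f f' : R -> R) (a b K : R) :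
  (forall x, a <= x <= b -> is_derive x 1 f (f' x) /\ `|f' x| <= K) ->
  forall x y, a <= x <= b -> a <= y <= b -> `|f x - f y| <= K * `|x - y|.
Proof.
move=> H; suff W x y : x <= y -> a <= x <= b -> a <= y <= b -> `|f x - f y| <= K * `|x - y|.
  move=> x y xab yab; case: (leP x y) => [|/ltW] xy; first exact: W.
  by rewrite distrC [`|x - y|]distrC; exact: W.
move=> xy /andP[ax xb] /andP[ay yb].
have sub z : z \in `[x, y] -> a <= z <= b.
  by rewrite in_itv /= => /andP[xz zy]; rewrite (le_trans ax xz) (le_trans zy yb).
have Hd z : z \in `]x, y[ -> is_derive z 1 f (f' z).
  move=> zxy; have z' : z \in `[x, y] by apply: subset_itv_oo_cc zxy.
  by have [] := H z (sub z z').
have Hc : {within `[x, y], continuous f}.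
  by apply: derivable_within_continuous => z /sub /H[[Hz _] _].
have [c cxy E] := MVT_segment xy Hd Hc.
rewrite distrC E normrM [`|x - y|]distrC ler_wpM2r //.
by have [] := H c (sub c cxy).
Qed.

(* Split the segment into n pieces of length L: on a piece that contains a critical
   point, psi varies by O(L^2). *)
Lemma null_critical_segment (V : set R) (psi : R -> R) (a b : R) : open V -> smooth_on V psi ->
  a < b -> [set x | a <= x <= b] `<=` V ->
  null (psi @` [set t | a <= t <= b /\ derive1n 1 psi t = 0]).
Proof.
move=> oV sp ab abV.
have [M M0 HM] : exists2 M : R, 0 < M & forall x, a <= x <= b -> `|derive1n 2 psi x| <= M.
  have s2 := smooth_on_derive1n 2 oV sp.
  have [|c _ Hc] := @EVT_max R (fun x => `|derive1n 2 psi x|) a b (ltW ab) _.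
    apply: continuous_in_subspaceT => x /set_mem; rewrite /= in_itv /= => xab.
    apply: (@cvg_norm _ R); exact: smooth_on_continuous s2 (abV _ xab).
  exists (`|derive1n 2 psi c| + 1); first by rewrite ltr_pwDr.
  by move=> x xab; apply: (le_trans (Hc x _)); rewrite ?in_itv ?lerDl.
have key t s L : a <= t <= b -> a <= s <= b -> derive1n 1 psi t = 0 -> `|s - t| <= L ->
    `|psi s - psi t| <= M * L * L.
  move=> tab sab Dt stL; have L0 : 0 <= L by apply: le_trans stL.
  have d0 k x : a <= x <= b -> is_derive x 1 (derive1n k psi) (derive1n k.+1 psi x).
    by move=> xab; exact: is_derive_derive1n oV sp (abV _ xab).
  have lip1 x y : a <= x <= b -> a <= y <= b -> `|derive1n 1 psi x - derive1n 1 psi y| <= M * `|x - y|.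
    by apply: lipschitz_segment => z zab; split; [exact: d0|exact: HM].
  have sub z : Num.min s t <= z <= Num.max s t -> a <= z <= b /\ `|z - t| <= L.
    move: stL tab sab; rewrite !ler_distl.
    by case: (leP s t) => ? /andP[? ?] /andP[? ?] /andP[? ?] /andP[? ?]; split; apply/andP; split; lra.
  have st : Num.min s t <= s <= Num.max s t by rewrite ge_min le_max lexx.
  have tt : Num.min s t <= t <= Num.max s t by rewrite ge_min le_max lexx !orbT.
  apply: (le_trans (y := M * L * `|s - t|)); last by rewrite ler_wpM2l // mulr_ge0 // ltW.
  apply: (@lipschitz_segment (derive1n 0 psi) (derive1n 1 psi) (Num.min s t) (Num.max s t)) => // z zst.
  have [zab zt] := sub z zst; split; first exact: d0.
  have := lip1 z t zab tab; rewrite Dt subr0 => /le_trans; apply.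
  by rewrite ler_wpM2l // ltW.
apply: null_of_cover => e e0.
(* With L = (b - a) / n, the n intervals of length 2 M L^2 have total length K / n. *)
pose K := 2 * M * (b - a) ^+ 2.
have K0 : 0 < K by rewrite /K; apply: mulr_gt0; [exact: mulr_gt0|rewrite exprn_gt0 // subr_gt0].
pose n := (Num.bound (K / e)).+1; pose L := (b - a) / n%:R.
have n0 : 0 < n%:R :> R by rewrite ltr0n.
have L0 : 0 < L by rewrite divr_gt0 // subr_gt0.
pose crit i t := [/\ a <= t <= b, derive1n 1 psi t = 0 & a + i%:R * L <= t <= a + i.+1%:R * L].
have [x xP] : exists x : nat -> R, forall i t, crit i t -> `|psi t - x i| <= M * L * L.
  suff : forall i, exists y : R, forall t, crit i t -> `|psi t - y| <= M * L * L.
    by move=> /choice[x xP]; exists x.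
  move=> i; have [[t [tab Dt /andP[t1 t2]]]|nt] := pselect (exists t, crit i t); last first.
    by exists 0 => t ct; exfalso; apply: nt; exists t.
  exists (psi t) => s [sab _ /andP[s1 s2]]; apply: key => //.
  have E : a + i.+1%:R * L = a + i%:R * L + L by rewrite -natr1 mulrDl mul1r addrA.
  by rewrite E in s2 t2; rewrite ler_distl; apply/andP; split; lra.
exists n, x, (M * L * L); split; first by apply: mulr_gt0 => //; exact: mulr_gt0.
  have -> : n%:R * (2 * (M * L * L)) = K / n%:R by rewrite /K /L; field; rewrite gt_eqF.
  rewrite ler_pdivrMr // mulrC -ler_pdivrMr // ltW //.
  apply: lt_trans (archi_boundP _) _; first by rewrite divr_ge0 // ltW.
  by rewrite ltr_nat.
move=> _ [t [tab Dt] <-]; pose i := `|Num.floor ((t - a) / L)|%N.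
have q0 : 0 <= (t - a) / L by rewrite divr_ge0 ?(ltW L0) //; lra.
have iE : (i%:R : R) = (Num.floor ((t - a) / L))%:~R.
  by rewrite /i pmulrn abszE ger0_norm // floor_ge0.
have := floor_itv ((t - a) / L); rewrite intrD -iE => /andP[h1 h2].
have u1 : i%:R * L <= t - a by rewrite -ler_pdivlMr.
have u2 : t - a < (i%:R + 1) * L by rewrite -ltr_pdivrMr.
have nL : n%:R * L = b - a by rewrite /L mulrC divfK // gt_eqF.
have [iltn|nlei] := ltnP i n.
  exists i => //; apply: xP; split=> //; rewrite -natr1; apply/andP; split; lra.
(* The index n is reached only at t = b, which belongs to the last piece. *)
exists n.-1 => //; apply: xP; split=> //.
have nn : (n%:R : R) * L <= i%:R * L by rewrite ler_wpM2r ?(ltW L0) // ler_nat.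
have n1 : (n.-1%:R : R) * L = n%:R * L - L by rewrite -[in RHS](prednK (ltn0Sn _ : (0 < n)%N)) -natr1 mulrDl mul1r addrK.
rewrite (ltn_predK (ltn0Sn _ : (0 < n)%N)) n1; move/andP: tab => [? ?]; apply/andP; split; lra.
Qed.

(** An open set is a countable union of segments with rational ends. *)
Lemma null_critical (V : set R) (psi : R -> R) : open V -> smooth_on V psi ->
  null (psi @` [set t | V t /\ derive1n 1 psi t = 0]).
Proof.
move=> oV sp; pose A (pq : rat * rat) := psi @` [set t | [/\ ratr pq.1 < ratr pq.2 :> R,
  [set x : R | ratr pq.1 <= x <= ratr pq.2] `<=` V, ratr pq.1 <= t <= ratr pq.2 & derive1n 1 psi t = 0]].
apply: (@nullS _ (\bigcup_pq A pq)).
  move=> _ [t [Vt Dt] <-]; have /nbhs_ballP[e /= e0 He] : nbhs t V by apply: open_nbhs_nbhs.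
  have [p] : exists q : rat, ratr q \in `](t - e), t[ by apply: rat_in_itvoo; lra.
  rewrite in_itv /= => /andP[p1 p2].
  have [q] : exists q : rat, ratr q \in `]t, (t + e)[ by apply: rat_in_itvoo; lra.
  rewrite in_itv /= => /andP[q1 q2].
  exists (p, q) => //; exists t => //; split=> //=; [lra| |by apply/andP; split; lra].
  move=> x /= /andP[px xq]; apply: He; rewrite /ball /= ltr_distl; apply/andP; split; lra.
apply: null_bigcup => -[p q]; rewrite /A /=.
have [[pq sV]|npq] := pselect (ratr p < ratr q :> R /\ [set x : R | ratr p <= x <= ratr q] `<=` V).
  by apply: nullS (null_critical_segment oV sp pq sV) => _ [t [_ _ h Dt] <-]; exists t.
apply: (@nullS _ (set0)); last exact: null0.
by move=> y [t [pq sV _ _] _]; exact: npq (conj pq sV).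
Qed.

(** A discrete set is countable: each of its points is alone in some interval with rational ends. *)
Lemma null_image_discrete (Z : set R) (chi : R -> R) :
  (forall t, Z t -> exists2 e : R, 0 < e & forall s, Z s -> `|s - t| < e -> s = t) ->
  null (chi @` Z).
Proof.
move=> HZ; pose A (pq : rat * rat) := chi @` [set t | [/\ Z t, ratr pq.1 < t < ratr pq.2 &
  forall s, Z s -> ratr pq.1 < s < ratr pq.2 -> s = t]].
apply: (@nullS _ (\bigcup_pq A pq)).
  move=> _ [t Zt <-]; have [e e0 He] := HZ t Zt.
  have [p] : exists q : rat, ratr q \in `](t - e), t[ by apply: rat_in_itvoo; lra.
  rewrite in_itv /= => /andP[p1 p2].
  have [q] : exists q : rat, ratr q \in `]t, (t + e)[ by apply: rat_in_itvoo; lra.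
  rewrite in_itv /= => /andP[q1 q2].
  exists (p, q) => //; exists t => //; split=> //=; first by apply/andP.
  move=> s Zs /andP[ps sq]; apply: He => //; rewrite ltr_distl; apply/andP; split; lra.
apply: null_bigcup => -[p q]; apply: null_subsingleton => _ _ [t [Zt tpq _] <-] [s [Zs spq Hs] <-].
by rewrite (Hs t).
Qed.

Lemma isolated_zero (V : set R) (F : R -> R) t : open V -> smooth_on V F -> V t ->
  F t = 0 -> derive1n 1 F t != 0 ->
  exists2 e : R, 0 < e & forall s, `|s - t| < e -> F s = 0 -> s = t.
Proof.
move=> oV sF Vt F0 D0; have dF := smooth_on_differentiable sF Vt.
have e0 : 0 < `|derive1n 1 F t| / 2 by rewrite divr_gt0 // normr_gt0.
have [e e1 He] := near_norm (differentiable_epsP dF e0).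
exists e => // s st Fs; have := He (s - t) st; rewrite subrK Fs F0 subr0 sub0r normrN.
have -> : 'd F t (s - t) = (s - t) * derive1n 1 F t.
  by rewrite -(deriveE _ dF) derive_dir1 ?derive1n1 ?derive1E.
rewrite normrM mulrC => h; apply/eqP; rewrite -subr_eq0 -normr_le0.
have n0 : 0 < `|derive1n 1 F t| by rewrite normr_gt0.
have h' : `|derive1n 1 F t| * (`|s - t| / 2) <= `|derive1n 1 F t| * 0 by lra.
by move: h'; rewrite ler_pM2l //; lra.
Qed.

Definition simple (F : R -> R) t := (F t != 0) || (derive1n 1 F t != 0).

(* The coefficients are chosen one at a time. The values of the last one that create
   a double zero are critical values of -G / g where g <> 0, and ratios of derivatives
   at the common zeros of G and g, which are isolated as zeros of G. *)
Lemma generic_coeffs (T : finType) (U : T -> set R) (F : T -> R -> R) (g : T -> nat -> R -> R) N :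
  (forall i, open (U i)) -> (forall i, smooth_on (U i) (F i)) ->
  (forall i s, smooth_on (U i) (g i s)) ->
  exists c : nat -> R, (forall s, `|c s| <= 1) /\
    forall i t, U i t -> (exists2 s, (s < N)%N & g i s t != 0) ->
      simple (fun x => F i x + \sum_(s < N) c s * g i s x) t.
Proof.
move=> oU sF sg; elim: N => [|N [c [c1 cP]]].
  by exists (fun=> 0); split=> [s|i t _ [s]] //; rewrite normr0 ler01.
pose G i x := F i x + \sum_(s < N) c s * g i s x.
have sG i : smooth_on (U i) (G i).
  apply: smooth_onD => //; apply: smooth_on_sum => // s _.
  by apply: (@smooth_onM _ _ _ (cst (c s))) => //; exact: smooth_on_cst.
pose V i := U i `&` g i N @^-1` [set x | x != 0].
have oV i : open (V i) by apply: open_preimage (sg i N) => //; exact: open_neq.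
have VU i : V i `<=` U i by move=> t [].
pose psi i x := - G i x / g i N x.
have spsi i : smooth_on (V i) (psi i).
  apply: smooth_on_div => //; last by move=> x [].
    by apply: smooth_onN => //; exact: smooth_on_sub (VU i) (sG i).
  exact: smooth_on_sub (VU i) (sg i N).
pose Z i := [set t | [/\ U i t, G i t = 0 & derive1n 1 (G i) t != 0]].
pose chi i x := - derive1n 1 (G i) x / derive1n 1 (g i N) x.
have [cN cN1 cNP] : exists2 cN : R, `|cN| <= 1 & ~ (\bigcup_i (psi i @` [set t | V i t /\ derive1n 1 (psi i) t = 0]) `|`
    \bigcup_i (chi i @` Z i)) cN.
  apply: null_avoid; apply: (@nullS _ (\bigcup_(b : T + T) match b with
     inl i => psi i @` [set t | V i t /\ derive1n 1 (psi i) t = 0] | inr i => chi i @` Z i end)).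
    by move=> y [[i _ Hy]|[i _ Hy]]; [exists (inl i)|exists (inr i)].
  apply: null_bigcup => -[i|i]; first exact: null_critical.
  apply: null_image_discrete => t [Ut Gt DGt].
  have [e e0 He] := isolated_zero (oU i) (sG i) Ut Gt DGt.
  by exists e => // s [_ Gs _] st; exact: He.
exists (fun s => if s == N then cN else c s); split=> [s|i t Ut [s sN gs]]; first by case: ifP.
pose c' s := if s == N then cN else c s.
have E : (fun x => F i x + \sum_(s < N.+1) c' s * g i s x) = (fun x => G i x + cN * g i N x).
  apply/funext => x; rewrite big_ord_recr /= /c' eqxx addrA; congr (_ + _ + _).
  by apply: eq_bigr => j _; rewrite ltn_eqF.
rewrite -/c' E; apply/negPn/negP; rewrite /simple negb_or !negbK => /andP[/eqP H0 /eqP H1].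
have dG : is_derive t 1 (G i) (derive1n 1 (G i) t) := is_derive_derive1n 0 (oU i) (sG i) Ut.
have dg : is_derive t 1 (g i N) (derive1n 1 (g i N) t) := is_derive_derive1n 0 (oU i) (sg i N) Ut.
have {}H1 : derive1n 1 (G i) t + cN * derive1n 1 (g i N) t = 0.
  have [_ <-] := is_deriveD dG (is_derive_cstmul cN dg).
  by rewrite -[RHS]H1 derive1n1 derive1E.
(* Where g_N vanishes, an earlier g_s does not, so a zero of G is simple by induction and a double
   zero of G + c g_N forces c = -G' / g_N'. Elsewhere c would be a critical value of -G / g_N. *)
case: (eqVneq (g i N t) 0) => [g0|gN0].
  have st : (s < N)%N.
    by rewrite ltn_neqAle -ltnS sN andbT; apply/eqP => sE; rewrite sE g0 eqxx in gs.
  have G0 : G i t = 0 by move: H0; rewrite g0 mulr0 addr0.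
  have D0 : derive1n 1 (G i) t != 0.
    have : simple (G i) t by apply: cP => //; exists s.
    by rewrite /simple G0 eqxx.
  have dg0 : derive1n 1 (g i N) t != 0.
    by apply/eqP => dg0; move: H1; rewrite dg0 mulr0 addr0 => /eqP; rewrite (negbTE D0).
  apply: cNP; right; exists i => //; exists t => //.
  by rewrite /chi; apply: (mulIf dg0); rewrite divfK //; lra.
apply: cNP; left; exists i => //; exists t; last first.
  by rewrite /psi; apply: (mulIf gN0); rewrite divfK //; lra.
split; first by [].
have dGd : differentiable (G i) t by exact: smooth_on_differentiable (sG i) Ut.
have dgd : differentiable (g i N) t by exact: smooth_on_differentiable (sg i N) Ut.
have D1 : 'D_1 (G i) t = derive1n 1 (G i) t by case: dG.
have D2 : 'D_1 (g i N) t = derive1n 1 (g i N) t by case: dg.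
have dNG : differentiable (fun x => - G i x) t by exact: differentiableN.
have DN : 'D_1 (fun x => - G i x) t = - derive1n 1 (G i) t by rewrite -D1 deriveN //; exact: diff_derivable.
have Er : 'D_1 (psi i) t = 'D_1 (fun x => - G i x) t / g i N t - - G i t * 'D_1 (g i N) t / g i N t ^+ 2.
  by apply: derive_ratio.
rewrite derive1n1 derive1E Er DN D2.
have -> : derive1n 1 (G i) t = - cN * derive1n 1 (g i N) t by lra.
have -> : G i t = - cN * g i N t by lra.
by field.
Qed.

End Null.

(** * Generic perturbations of Wronskians *)

Section GenericWronskian.
Variable R : realType.

Lemma derive1n_pow (t : R) k i s :
  derive1n i (fun s : R => (s - t) ^+ k) s = (k ^_ i)%:R * (s - t) ^+ (k - i).
Proof.
pose X i (s : R) := (k ^_ i)%:R * (s - t) ^+ (k - i).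
have dX l x : [set: R] x -> is_derive x 1 (X l) (X l.+1 x).
  move=> _; have d1 : is_derive x 1 (fun s : R => s - t) 1.
    by have := is_deriveB (is_derive_id x (1 : R)) (is_derive_cst t x (1 : R)); rewrite subr0.
  have H := is_derive_cstmul (k ^_ l)%:R (is_deriveX (k - l)%N d1).
  have E : X l = (fun y => (k ^_ l)%:R * ((fun s : R => s - t) ^+ (k - l)) y).
    apply/funext => y; rewrite /X; congr (_ * _).
    by elim: (k - l)%N => [//|n IH]; rewrite !exprS IH.
  rewrite E; apply: is_derive_eq H _; rewrite /X ffactnSr natrM -mulrA; congr (_ * _).
  by rewrite -[_ *: _]/(_ * _) mulr1 subnS.
have [_ H] := derive1n_family openT dX; rewrite -[RHS]/(X i s) -H //.
by congr (derive1n i _ s); apply/funext => y; rewrite /X ffactn0 subn0 mul1r.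
Qed.

Lemma derive1n_pow_mul (U : set R) (u : R -> R) t k i : open U -> smooth_on U u -> U t ->
  (i <= k)%N ->
  derive1n i (fun s => (s - t) ^+ k * u s) t = if i == k then k`!%:R * u t else 0.
Proof.
move=> oU su Ut ik.
have sp : smooth_on U (fun s : R => (s - t) ^+ k).
  by apply: smooth_onX => //; apply: smooth_onB => //; [exact: smooth_on_id|exact: smooth_on_cst].
rewrite (derive1n_mul i oU sp su Ut).
have E j : derive1n j (fun s : R => (s - t) ^+ k) t = if j == k then k`!%:R else 0.
  rewrite derive1n_pow subrr; case: (ltngtP j k) => jk.
  - by rewrite expr0n subn_eq0 leqNgt jk mulr0.
  - by rewrite ffact_small // mul0r.
  - by rewrite jk ffactnn subnn expr0 mulr1.
case: eqP => [->|/eqP nik]; last first.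
  apply: big1 => j _; rewrite E ltn_eqF ?mul0r ?mulr0 //.
  by apply: leq_trans (ltn_ord j) _; rewrite ltn_neqAle nik.
rewrite big_ord_recr /= big1 ?add0r => [|j _]; last by rewrite E ltn_eqF ?mul0r ?mulr0.
by rewrite E eqxx binn mul1r subnn derive1n0.
Qed.

Variables (T : finType) (U : T -> set R) (x : T -> nat -> R -> R) (h : R -> R) (m : nat).
Hypotheses (oU : forall i, open (U i)) (sx : forall i l, smooth_on (U i) (x i l)).
Hypotheses (sh : forall i, smooth_on (U i) h) (h0 : forall i t, U i t -> h t != 0).
Hypothesis x0 : forall i t, U i t -> exists2 l, (l < m)%N & x i l t != 0.

(* the index s < m * m encodes the monomial t^(s / m) and the coordinate s mod m *)
Definition pterm i s (t : R) : R := t ^+ (s %/ m) * (h t * x i (s %% m) t).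

Definition perturbed (C : nat -> nat -> R) i k t : R := x i k t + \sum_(s < m * m) C k s * pterm i s t.

Let spow (V : set R) k : open V -> smooth_on V (fun t : R => t ^+ k).
Proof. by move=> oV; apply: smooth_onX => //; exact: smooth_on_id. Qed.

Let spterm i s : smooth_on (U i) (pterm i s).
Proof. by apply: smooth_onM => //; [exact: spow|exact: smooth_onM]. Qed.

Let sperturbed C i k : smooth_on (U i) (perturbed C i k).
Proof.
apply: smooth_onD => //; apply: smooth_on_sum => // s _.
by apply: (@smooth_onM _ _ _ (cst (C k s))) => //; exact: smooth_on_cst.
Qed.

Let setcol k (y : nat -> R -> R) (phi : R -> R) b := if b == k then phi else y b.

(** The Wronskian as a linear functional of the jet of its last function. *)
Let Lam k y t (phi : R -> R) := \sum_(a < k.+1) wcof y a t * derive1n a phi t.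

Let wron_setcol k y t phi : wron k.+1 (setcol k y phi) t = Lam k y t phi.
Proof.
rewrite wron_expand /Lam; apply: eq_bigr => a _; rewrite /setcol eqxx; congr (_ * _).
by apply: wcof_ext => b bk; rewrite ltn_eqF.
Qed.

Let Lam_sum V k y t n (c : nat -> R) (f : nat -> R -> R) : open V -> V t ->
  (forall s, smooth_on V (f s)) ->
  Lam k y t (fun x => \sum_(s < n) c s * f s x) = \sum_(s < n) c s * Lam k y t (f s).
Proof.
move=> oV Vt sf; rewrite /Lam.
under eq_bigr => a _.
  rewrite (derive1n_sum n a oV _ Vt (f := fun s x => c s * f s x)); last first.
    by move=> s; apply: (@smooth_onM _ _ _ (cst (c s))) => //; exact: smooth_on_cst.
  rewrite mulr_sumr; over.
rewrite exchange_big; apply: eq_bigr => s _; rewrite mulr_sumr; apply: eq_bigr => a _.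
by rewrite (derive1n_cstmul (c s) a oV (sf s) Vt) mulrCA.
Qed.

Let LamD V k y t f g : open V -> V t -> smooth_on V f -> smooth_on V g ->
  Lam k y t (fun x => f x + g x) = Lam k y t f + Lam k y t g.
Proof.
move=> oV Vt sf sg.
have sfg (s : nat) : smooth_on V (if s == 0%N then f else g) by case: (s == 0%N).
have E : (fun x => f x + g x) = (fun x => \sum_(s < 2) (fun=> 1) s * (if (s : nat) == 0%N then f else g) x).
  by apply/funext => z; rewrite !big_ord_recl big_ord0 /= !mul1r addr0.
by rewrite E (@Lam_sum V k y t 2 (fun=> 1) (fun s : nat => if s == 0%N then f else g) oV Vt sfg) !big_ord_recl big_ord0 /= !mul1r addr0.
Qed.

(* The combinations (s - t)^j u(s) of the terms have, at s = t, a single non-zero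
   derivative up to order j, hence isolate one cofactor of the last column; the last
   two cofactors are the Wronskian of y and, up to sign, its derivative. *)
Lemma pterms_span k (y : nat -> R -> R) i t : (k < m)%N -> U i t ->
  (forall b, (b < k)%N -> smooth_on (U i) (y b)) -> (0 < k -> simple (wron k y) t)%N ->
  exists2 s, (s < m * m)%N & wron k.+1 (setcol k y (pterm i s)) t != 0.
Proof.
move=> km Ut sy sk; apply: contrapT => H.
have L0 s : (s < m * m)%N -> Lam k y t (pterm i s) = 0.
  move=> sm; apply/eqP/negPn/negP => ns; apply: H; exists s => //.
  by rewrite wron_setcol.
have [l lm xl] := x0 Ut; pose u s := h s * x i l s.
have su : smooth_on (U i) u by exact: smooth_onM.
have u0 : u t != 0 by rewrite mulf_neq0 // (h0 Ut).
have Lp j : (j < m)%N -> Lam k y t (fun s => (s - t) ^+ j * u s) = 0.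
  (* Expansion of (s - t)^j: degree e and coordinate l are encoded by the index e * m + l, which is
     below m * m because e <= j < m. *)
  move=> jm; have -> : (fun s => (s - t) ^+ j * u s) =
      (fun s => \sum_(e < j.+1) (('X - t%:P) ^+ j)`_e * pterm i (e * m + l)%N s).
    apply/funext => s; have -> : (s - t) ^+ j = (('X - t%:P) ^+ j).[s] by rewrite !hornerE.
    rewrite (@horner_coef_wide _ j.+1); last by rewrite size_exp_XsubC.
    rewrite mulr_suml; apply: eq_bigr => e _; rewrite -mulrA; congr (_ * _).
    have m0 : (0 < m)%N by apply: leq_ltn_trans lm.
    by rewrite /pterm divnMDl // divn_small // addn0 modnMDl modn_small.
  rewrite (@Lam_sum (U i) k y t j.+1 (fun e => (('X - t%:P) ^+ j)`_e) (fun e => pterm i (e * m + l)%N) (@oU i) Ut) => [|s]; last exact: spterm.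
  apply: big1 => e _; rewrite L0 ?mulr0 //.
  have em : (e < m)%N by apply: leq_trans (ltn_ord e) _.
  by apply: leq_trans (_ : e * m + m <= _)%N; rewrite ?ltn_add2l // -mulSnr leq_mul2r em orbT.
have fu0 j : j`!%:R * u t != 0 by rewrite mulf_neq0 // pnatr_eq0 -lt0n fact_gt0.
have W0 : wron k y t = 0.
  have := Lp k km; rewrite /Lam big_ord_recr /= big1 => [|a _]; last first.
    by rewrite (derive1n_pow_mul (@oU i) su Ut) ?ltn_eqF ?mulr0 //= ltnW.
  rewrite add0r (derive1n_pow_mul (@oU i) su Ut) // eqxx wcof_max => /eqP.
  by rewrite mulf_eq0 (negbTE (fu0 k)) orbF => /eqP.
case: k km sy sk Lp W0 {H L0} => [|k] km sy sk Lp W0.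
  by move: W0; rewrite /wron det_mx00 => /eqP; rewrite oner_eq0.
have := sk isT; rewrite /simple W0 eqxx /=.
have := Lp k (ltnW km); rewrite /Lam big_ord_recr /= wcof_max W0 mul0r addr0.
rewrite big_ord_recr /= big1 => [|a _]; last first.
  by rewrite (derive1n_pow_mul (@oU i) su Ut) ?ltn_eqF ?mulr0 //= ltnW.
rewrite add0r (derive1n_pow_mul (@oU i) su Ut) // eqxx wcof_pred => /eqP.
rewrite mulf_eq0 (negbTE (fu0 k)) orbF oppr_eq0 => /eqP W'.
have [_] := is_derive_wron (@oU i) sy Ut.
by rewrite derive1E => ->; rewrite W' eqxx.
Qed.

(** The coefficients of component n do not affect the Wronskians of the earlier ones, and the simple
    zeros already obtained for these are what [pterms_span] requires for component n. *)
Lemma generic_wronskian : exists C : nat -> nat -> R, (forall k s, `|C k s| <= 1) /\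
  forall k i t, (k < m)%N -> U i t -> simple (wron k.+1 (perturbed C i)) t.
Proof.
suff H n : (n <= m)%N -> exists C : nat -> nat -> R, (forall k s, `|C k s| <= 1) /\
  forall k i t, (k < n)%N -> U i t -> simple (wron k.+1 (perturbed C i)) t by exact: H.
elim: n => [|n IH] nm; first by exists (fun _ _ => 0); split=> // k s; rewrite normr0 ler01.
have [C [C1 CP]] := IH (ltnW nm).
pose F i t := wron n.+1 (setcol n (perturbed C i) (x i n)) t.
pose g i s t := wron n.+1 (setcol n (perturbed C i) (pterm i s)) t.
have sset i phi : smooth_on (U i) phi -> smooth_on (U i) (wron n.+1 (setcol n (perturbed C i) phi)).
  by move=> sphi; apply: smooth_wron => // b _; rewrite /setcol; case: ifP.
have [c [c1 cP]] := generic_coeffs (m * m) oU (fun i => sset i _ (sx i n)) (fun i s => sset i _ (spterm i s)).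
pose C' k s := if k == n then c s else C k s.
have pC' i b : b != n -> perturbed C' i b = perturbed C i b.
  by move=> bn; rewrite /perturbed /C' (negbTE bn).
exists C'; split=> [k s|k i t]; first by rewrite /C'; case: ifP.
rewrite ltnS leq_eqVlt => /orP[/eqP ->|kn] Ut; last first.
  have -> : wron k.+1 (perturbed C' i) = wron k.+1 (perturbed C i); last exact: CP.
  apply/funext => s; congr (\det _); apply/matrixP => a b; rewrite !mxE pC' //.
  by rewrite ltn_eqF // (leq_trans (ltn_ord b)).
have sk : (0 < n)%N -> simple (wron n (perturbed C i)) t.
  by move=> n0; rewrite -(prednK n0); apply: CP => //; rewrite prednK.
have [s sm gs] := pterms_span nm Ut (fun b _ => sperturbed C i b) sk.
have := cP i t Ut (ex_intro2 _ _ s sm gs); rewrite /simple.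
set G := (fun y => _ + _); suff E y : U i y -> G y = wron n.+1 (perturbed C' i) y.
  rewrite -/(G t) E // (@near_derive1n _ _ G (wron n.+1 (perturbed C' i))) //.
  by apply: filterS (open_nbhs_nbhs (conj (@oU i) Ut)) => y; exact: E.
move=> Uy; have -> : wron n.+1 (perturbed C' i) y = wron n.+1 (setcol n (perturbed C i) (perturbed C' i n)) y.
  congr (\det _); apply/matrixP => a b; rewrite !mxE /setcol; case: eqP => [->|/eqP bn] //.
  by rewrite pC'.
rewrite /G !wron_setcol /perturbed (LamD _ _ (@oU i) Uy) //; last first.
  apply: smooth_on_sum => // s' _; apply: (@smooth_onM _ _ _ (cst (C' n s'))) => //; exact: smooth_on_cst.
congr (_ + _); rewrite (Lam_sum _ _ _ (C' n) (@oU i) Uy (spterm i)).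
by apply: eq_bigr => s' _; rewrite /C' eqxx wron_setcol.
Qed.

End GenericWronskian.

(** * Jet estimates *)

Section JetBounds.
Variable R : realType.
Implicit Types (U : set R) (f g : R -> R) (t : R).

Definition jetle (r : nat) (M : R) f t := forall k, (k <= r)%N -> `|derive1n k f t| <= M.

Lemma jetleW r M M' f t : M <= M' -> jetle r M f t -> jetle r M' f t.
Proof. by move=> MM h k /h /le_trans; apply. Qed.

Lemma jetle_order r r' M f t : (r' <= r)%N -> jetle r M f t -> jetle r' M f t.
Proof. by move=> rr h k kr; apply: h; exact: leq_trans kr rr. Qed.

Lemma derive1nB U f g k t : open U -> smooth_on U f -> smooth_on U g -> U t ->
  derive1n k (fun x => f x - g x) t = derive1n k f t - derive1n k g t.
Proof.
move=> oU sf sg Ut; pose X k t := derive1n k f t - derive1n k g t.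
have dX l s : U s -> is_derive s 1 (X l) (X l.+1 s).
  by move=> Us; apply: is_deriveB; [exact: is_derive_derive1n oU sf Us|exact: is_derive_derive1n oU sg Us].
exact: (derive1n_family oU dX).2.
Qed.

Lemma jetle_mul U f g r F G t : open U -> smooth_on U f -> smooth_on U g -> U t ->
  jetle r F f t -> jetle r G g t -> jetle r (2 ^+ r * (F * G)) (fun x => f x * g x) t.
Proof.
move=> oU sf sg Ut hf hg k kr; rewrite (derive1n_mul k oU sf sg Ut).
have F0 : 0 <= F by apply: le_trans (hf 0%N _).
have G0 : 0 <= G by apply: le_trans (hg 0%N _).
apply: le_trans (ler_norm_sum _ _ _) _.
apply: (@le_trans _ _ (\sum_(i < k.+1) 'C(k, i)%:R * (F * G))).
  apply: ler_sum => i _; have ik : (i <= k)%N by rewrite -ltnS.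
  rewrite normrM ger0_norm ?ler0n // ler_wpM2l ?ler0n // normrM.
  apply: ler_pM => //; first by apply: hf; exact: leq_trans ik kr.
  by apply: hg; apply: leq_trans kr; exact: leq_subr.
rewrite -mulr_suml ler_wpM2r ?mulr_ge0 //.
have -> : \sum_(i < k.+1) 'C(k, i)%:R = 2 ^+ k :> R.
  rewrite -natrX -[2%N]/(1 + 1)%N expnDn natr_sum; apply: eq_bigr => i _.
  by rewrite !exp1n !muln1.
by rewrite ler_weXn2l // ler1n.
Qed.

(** The Leibniz rule for Z g is solved for the top derivative of Z, by induction on the order. The
    constant depends only on [mu], [M] and [r], which gives estimates uniform over all
    perturbations. *)
Lemma jetle_div (mu M : R) r : 0 < mu -> 0 <= M -> exists2 K : R, 0 < K &
  forall U (Z g : R -> R) t s, open U -> smooth_on U Z -> smooth_on U g -> U t -> mu <= `|g t| ->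
    jetle r M g t -> jetle r s (fun x => Z x * g x) t -> jetle r (K * s) Z t.
Proof.
move=> mu0 M0; elim: r => [|r [K K0 IH]].
  exists mu^-1; rewrite ?invr_gt0 // => U Z g t s oU sZ sg Ut mug _ hs k; rewrite leqn0 => /eqP ->.
  have := hs 0%N (leqnn _); rewrite !derive1n0 normrM => h.
  rewrite mulrC ler_pdivlMr //; apply: le_trans h; by rewrite ler_wpM2l.
exists (K + (1 + 2 ^+ r.+1 * (K * M)) / mu).
  by rewrite ltr_pwDl // divr_ge0 ?(ltW mu0) // addr_ge0 // !mulr_ge0 // ?exprn_ge0 // ltW.
move=> U Z g t s oU sZ sg Ut mug hM hs.
have s0 : 0 <= s by apply: le_trans (hs 0%N _).
have low : jetle r (K * s) Z t.
  by apply: (IH U Z g) => //; [exact: jetle_order hM|exact: jetle_order hs].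
have q0 : 0 <= (1 + 2 ^+ r.+1 * (K * M)) / mu * s.
  by rewrite mulr_ge0 // divr_ge0 ?(ltW mu0) // addr_ge0 // !mulr_ge0 // ?exprn_ge0 // ltW.
move=> k; rewrite leq_eqVlt => /orP[/eqP ->|]; last first.
  by rewrite ltnS => /low /le_trans; apply; rewrite mulrDl lerDl.
have := hs r.+1 (leqnn _); rewrite (derive1n_mul r.+1 oU sZ sg Ut) big_ord_recr /= binn mul1r subnn.
set S := \sum_(i < r.+1) _ => hS.
have hS' : `|S| <= 2 ^+ r.+1 * (K * M) * s.
  apply: le_trans (ler_norm_sum _ _ _) _.
  apply: (@le_trans _ _ (\sum_(i < r.+1) 'C(r.+1, i)%:R * (K * s * M))).
    apply: ler_sum => i _; have ik : (i <= r)%N by rewrite -ltnS.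
    rewrite normrM ger0_norm ?ler0n // ler_wpM2l ?ler0n // normrM.
    by apply: ler_pM => //; [exact: low|apply: hM; exact: leq_subr].
  rewrite -mulr_suml -(mulrA (2 ^+ r.+1)) [K * s * M]mulrAC; apply: ler_wpM2r.
    by apply: mulr_ge0 => //; apply: mulr_ge0 => //; exact: ltW.
  have -> : 2 ^+ r.+1 = \sum_(i < r.+2) 'C(r.+1, i)%:R :> R.
    rewrite -natrX -[2%N]/(1 + 1)%N expnDn natr_sum; apply: eq_bigr => i _.
    by rewrite !exp1n !muln1.
  by rewrite [leRHS]big_ord_recr /= lerDl ler0n.
have : `|derive1n r.+1 Z t * g t| <= (1 + 2 ^+ r.+1 * (K * M)) * s.
  have -> : derive1n r.+1 Z t * g t = (S + derive1n r.+1 Z t * g t) - S by rewrite addrC addKr.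
  apply: le_trans (ler_normB _ _) _; rewrite mulrDl mul1r; exact: lerD.
rewrite normrM => h; rewrite mulrDl; apply: ler_wpDl; first by rewrite mulr_ge0 // ltW.
rewrite mulrAC ler_pdivlMr //; apply: le_trans h; by rewrite ler_wpM2l.
Qed.

Lemma jetle_sum U n (f : nat -> R -> R) r M t : open U -> (forall i, smooth_on U (f i)) -> U t ->
  (forall i, (i < n)%N -> jetle r M (f i) t) -> jetle r (n%:R * M) (fun x => \sum_(i < n) f i x) t.
Proof.
move=> oU sf Ut h k kr; rewrite (derive1n_sum n k oU sf Ut).
apply: le_trans (ler_norm_sum _ _ _) _.
apply: (@le_trans _ _ (\sum_(i < n) M)); first by apply: ler_sum => i _; exact: h.
by rewrite sumr_const card_ord mulr_natl.
Qed.

Lemma jetle_cstmul U f (c : R) r M t : open U -> smooth_on U f -> U t -> `|c| <= 1 ->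
  jetle r M f t -> jetle r M (fun x => c * f x) t.
Proof.
move=> oU sf Ut c1 h k kr; rewrite (derive1n_cstmul c k oU sf Ut) normrM.
apply: le_trans (ler_pM _ _ c1 (h k kr)) _ => //; by rewrite mul1r.
Qed.

Lemma jet_bounded U f r t0 : open U -> smooth_on U f -> U t0 ->
  exists2 M : R, 0 < M & \forall t \near t0, jetle r M f t.
Proof.
move=> oU sf Ut0; have one k : exists2 M : R, 0 < M & \forall t \near t0, `|derive1n k f t| <= M.
  exists (`|derive1n k f t0| + 1); first by rewrite ltr_pwDr.
  have cc : `|derive1n k f t| @[t --> t0] --> `|derive1n k f t0|.
    apply: (@cvg_norm _ R); exact: smooth_on_continuous (smooth_on_derive1n k oU sf) Ut0.
  by have /cvgr_le := cc; apply; rewrite ltrDl.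
elim: r => [|r [M M0 HM]].
  have [M M0 HM] := one 0%N; exists M => //; apply: filterS HM => t Ht k.
  by rewrite leqn0 => /eqP ->.
have [M' M'0 HM'] := one r.+1; exists (M + M'); first exact: addr_gt0.
apply: filterS2 HM HM' => t Ht Ht' k; rewrite leq_eqVlt => /orP[/eqP ->|].
  by apply: le_trans Ht' _; rewrite lerDr ltW.
by rewrite ltnS => /Ht /le_trans; apply; rewrite lerDl ltW.
Qed.

(** The difference Z of the two quotients satisfies Z (v + q) = p - (u / v) q, whose right side has
    a jet of the size of those of p and q; [jetle_div] transfers this to Z. *)
Lemma close_ratio U (u v : R -> R) t0 r (e : R) : open U -> U t0 -> smooth_on U u -> smooth_on U v ->
  v t0 != 0 -> 0 < e -> exists2 s : R, 0 < s & \forall t \near t0, U t /\ forall p q,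
    smooth_on U p -> smooth_on U q -> jetle r s p t -> jetle r s q t ->
    v t + q t != 0 /\ forall k, (k <= r)%N ->
     `|derive1n k (fun x => (u x + p x) / (v x + q x)) t - derive1n k (fun x => u x / v x) t| < e.
Proof.
move=> oU Ut0 su sv v0 e0.
pose V := U `&` v @^-1` [set x | x != 0].
have oV : open V by apply: open_preimage sv => //; exact: open_neq.
have Vt0 : V t0 by [].
have VU : V `<=` U by move=> x [].
have sy : smooth_on V (fun x => u x / v x).
  by apply: smooth_on_div => [//|||x []] //; exact: smooth_on_sub VU _.
have [M1 M10 H1] := jet_bounded r oU sv Ut0.
have [M2 M20 H2] := jet_bounded r oV sy Vt0.
pose mu := `|v t0| / 2; have mu0 : 0 < mu by rewrite divr_gt0 // normr_gt0.
have H3 : \forall t \near t0, mu < `|v t|.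
  have cc : `|v t| @[t --> t0] --> `|v t0|.
    apply: (@cvg_norm _ R); exact: smooth_on_continuous sv Ut0.
  by have /cvgr_gt := cc; apply; rewrite /mu; have := normr_gt0 (v t0); rewrite v0; lra.
have H4 : \forall t \near t0, V t by apply: open_nbhs_nbhs.
have mu20 : 0 < mu / 2 by rewrite divr_gt0.
have [K K0 HK] := jetle_div r mu20 (ltW (addr_gt0 M10 ltr01)).
have L0 : 0 < K * (1 + 2 ^+ r * M2) by rewrite mulr_gt0 // addr_gt0 // mulr_gt0 // exprn_gt0.
(* The bound 1 controls the jet of v + q by M1 + 1, mu / 2 keeps the denominator away from 0, and
   the last bound makes the final error at most e / 2. *)
pose s := Num.min (Num.min 1 (mu / 2)) (e / 2 / (K * (1 + 2 ^+ r * M2))).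
have s0 : 0 < s by rewrite !lt_min ltr01 mu20 /= divr_gt0 // divr_gt0.
have s1 : s <= 1 by rewrite /s !ge_min lexx.
have s2 : s <= mu / 2 by rewrite /s !ge_min lexx orbT.
have s3 : K * (1 + 2 ^+ r * M2) * s <= e / 2.
  by rewrite mulrC -ler_pdivlMr // /s !ge_min lexx !orbT.
exists s => //; 
have H12 : \forall t \near t0, jetle r M1 v t /\ jetle r M2 (fun x => u x / v x) t by exact: filterI.
have H34 : \forall t \near t0, mu < `|v t| /\ V t by exact: filterI.
apply: filterS2 H12 H34 => t [J1 J2] [mut Vt]; split; first exact: VU.
move=> p q sp sq Jp Jq.
have qt : `|q t| <= mu / 2 by apply: le_trans (Jq 0%N _) s2.
have gt : mu / 2 <= `|v t + q t|.
  by have := ler_normB (v t + q t) (q t); rewrite addrK; lra.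
have g0 : v t + q t != 0 by rewrite -normr_gt0; exact: lt_le_trans gt.
split=> // k kr.
have svq : smooth_on U (fun x => v x + q x) by exact: smooth_onD.
pose V' := V `&` (fun x => v x + q x) @^-1` [set x | x != 0].
have oV' : open V' by apply: open_preimage (smooth_on_sub VU svq) => //; exact: open_neq.
have V't : V' t by [].
have V'V : V' `<=` V by move=> x [].
have V'U : V' `<=` U by move=> x /V'V /VU.
have sY : smooth_on V' (fun x => (u x + p x) / (v x + q x)).
  apply: smooth_on_div => [//|||x []] //; last exact: smooth_on_sub V'U svq.
  by apply: smooth_on_sub V'U _; exact: smooth_onD.
have sy' := smooth_on_sub V'V sy.
rewrite -(derive1nB k oV' sY sy' V't).
set Z := (fun x => _ - _); have sZ : smooth_on V' Z by exact: smooth_onB.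
have sg : smooth_on V' (fun x => v x + q x) := smooth_on_sub V'U svq.
have Jg : jetle r (M1 + 1) (fun x => v x + q x) t.
  move=> l lr; have -> : derive1n l (fun x => v x + q x) t = derive1n l v t + derive1n l q t.
    have := derive1nB l oU svq sq (VU _ Vt).
    have -> : (fun x => v x + q x - q x) = v by apply/funext => x; rewrite addrK.
    by move=> ->; rewrite subrK.
  apply: le_trans (ler_normD _ _) (lerD (J1 l lr) (le_trans (Jq l lr) s1)).
have Js : jetle r ((1 + 2 ^+ r * M2) * s) (fun x => Z x * (v x + q x)) t.
  have Jyq := jetle_mul oV' sy' (smooth_on_sub V'U sq) V't J2 Jq.
  move=> l lr; rewrite (@near_derive1n _ _ _ (fun x => p x - u x / v x * q x)).
    rewrite (derive1nB l oV' (smooth_on_sub V'U sp) _ V't); last first.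
      by apply: smooth_onM => //; exact: smooth_on_sub V'U sq.
    apply: le_trans (ler_normB _ _) _; rewrite mulrDl mul1r -mulrA.
    exact: lerD (Jp l lr) (Jyq l lr).
  apply: filterS (open_nbhs_nbhs (conj oV' V't)) => x [[_ /= vx] vqx]; rewrite /Z.
  by field; rewrite vx vqx.
have JZ := HK V' Z _ t _ oV' sZ sg V't gt Jg Js.
apply: le_lt_trans (JZ k kr) _; rewrite mulrA; lra.
Qed.

End JetBounds.

(** * Perturbations of projective curves *)

Section Perturb.
Variables (R : realType) (m : nat) (I : set R).
Implicit Types (C : nat -> nat -> R) (h : R -> R) (c : I -> RP R m) (v : 'rV[R]_m.+1) (t : R).

(* The vector v is multiplied by 1 + h(t) C(t), C(t) being a matrix of polynomials; the
   line spanned by the result does not depend on the choice of v. *)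
Definition psum C h (b : nat) t v : R :=
  \sum_(s < m.+1 * m.+1) C b s * (t ^+ (s %/ m.+1) * (h t * v 0 (inord (s %% m.+1)))).

Definition pvec C h t v : 'rV[R]_m.+1 := \row_k (v 0 k + psum C h k t v).

Lemma pvecE C h t v k : pvec C h t v 0 k = v 0 k + psum C h k t v.
Proof. by rewrite mxE. Qed.

Lemma pvecZ C h t (a : R) v : pvec C h t (a *: v) = a *: pvec C h t v.
Proof.
apply/rowP => k; rewrite [RHS]mxE !pvecE mulrDr [(a *: v) 0 k]mxE; congr (_ + _).
by rewrite /psum mulr_sumr; apply: eq_bigr => s _; rewrite mxE; ring.
Qed.

Definition perturb C h c : I -> RP R m :=
  fun t : I => line (pvec C h (set_val t) (vpick (sval (c t)))).

Lemma smooth_psum C h (U : set R) (w : R -> 'rV[R]_m.+1) b : open U -> smooth_on U h -> smooth_on U w ->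
  smooth_on U (fun r => psum C h b r (w r)).
Proof.
move=> oU sh sw; apply: smooth_on_sum => // s _.
apply: (@smooth_onM _ _ _ (cst (C b s))) => //; first exact: smooth_on_cst.
apply: smooth_onM => //; first by apply: smooth_onX => //; exact: smooth_on_id.
by apply: smooth_onM => //; exact: smooth_on_coord.
Qed.

Lemma smooth_pvec C h (U : set R) (w : R -> 'rV[R]_m.+1) : open U -> smooth_on U h -> smooth_on U w ->
  smooth_on U (fun r => pvec C h r (w r)).
Proof.
move=> oU sh sw; apply: smooth_on_row => // k.
apply: (@smooth_on_ext _ _ _ _ (fun r => w r 0 k + psum C h k r (w r))) => //.
  by move=> r _; rewrite pvecE.
by apply: smooth_onD => //; [exact: smooth_on_coord|exact: smooth_psum].
Qed.

Lemma perturb_lift C h c U V w : smooth_on I h -> is_lift c U w -> open V -> V `<=` U ->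
  (forall t, V t -> pvec C h t (w t) != 0) ->
  is_lift (perturb C h c) V (fun r => pvec C h r (w r)).
Proof.
move=> sh [oU UI sw H] oV VU nz; have VI : V `<=` I by move=> t /VU /UI.
split=> //.
  apply: smooth_pvec => //; [exact: smooth_on_sub VI sh|exact: smooth_on_sub VU sw].
move=> t Vt; split; first exact: nz.
have [w0 wc] := H t (VU _ Vt).
have [k k0 E] := RP_span w0 wc.
rewrite -[pvec _ _ _ (w _)]scale1r -(mulVf k0) -scalerA -pvecZ -E.
by apply: memvZ; exact: mem_line.
Qed.

(* The rows of the matrix of the orthogonal projection onto the line: global sections,
   of which at least one does not vanish at any given point. *)
Definition sect c (i : 'I_m.+1) : R -> 'rV[R]_m.+1 :=
  'valL_0 (fun t : I => let v := vpick (sval (c t)) in (v 0 i / \sum_j v 0 j ^+ 2) *: v).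

Lemma sum_sqr_gt0 v : v != 0 -> 0 < \sum_j v 0 j ^+ 2.
Proof.
move=> v0; rewrite lt_def sumr_ge0 ?andbT => [|j _]; last exact: sqr_ge0.
apply: contraNneq v0 => /eqP; rewrite psumr_eq0 => [/allP H|j _]; last exact: sqr_ge0.
apply/eqP/rowP => j; rewrite mxE; apply/eqP; rewrite -sqrf_eq0.
by apply: H; rewrite mem_index_enum.
Qed.

Lemma sect_lift c U w i r : is_lift c U w -> U r ->
  sect c i r = (w r 0 i / \sum_j w r 0 j ^+ 2) *: w r.
Proof.
move=> [_ UI _ H] Ur; have [t tr] := ex_set_val (UI _ Ur); rewrite -tr in Ur *.
have -> : sect c i (set_val t) =
    let v := vpick (sval (c t)) in (v 0 i / \sum_j v 0 j ^+ 2) *: v.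
  exact: (congr1 (fun F => F (fun t : I => let v := vpick (sval (c t)) in (v 0 i / \sum_j v 0 j ^+ 2) *: v) t) (@sigL_valL R 'rV[R]_m.+1 0 I)).
have [w0 /(RP_span w0)[k k0 ->]] := H t Ur; rewrite /= scalerA; congr (_ *: _).
have -> : \sum_j (k *: w (set_val t)) 0 j ^+ 2 = k ^+ 2 * \sum_j w (set_val t) 0 j ^+ 2.
  by rewrite mulr_sumr; apply: eq_bigr => j _; rewrite mxE exprMn.
have := sum_sqr_gt0 w0 => /lt0r_neq0; move: (\sum_j _) => S S0.
by rewrite mxE; field; rewrite S0 k0.
Qed.

Lemma smooth_sect c i : smooth_to_RP c -> smooth_on I (sect c i).
Proof.
move=> sc.
have H (t : I) : exists U, [/\ U (set_val t), U `<=` I & smooth_on U (sect c i)].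
  have [U [w [lw Ut]]] := lift_exists sc (set_valP t); exists U.
  move: (lw) => [oU UI sw H]; split=> //.
  apply: (@smooth_on_ext _ _ _ _ (fun r => (w r 0 i / \sum_j w r 0 j ^+ 2) *: w r)) => //.
    by move=> r /set_mem Ur; rewrite (sect_lift i lw Ur).
  apply: smooth_on_row => // j.
  apply: (@smooth_on_ext _ _ _ _ (fun r => (w r 0 i / \sum_j w r 0 j ^+ 2) * w r 0 j)) => //.
    by move=> r _; rewrite mxE.
  have sj l : smooth_on U (fun r => w r 0 l) by exact: smooth_on_coord.
  apply: smooth_onM => //; apply: smooth_on_div => //.
    by apply: smooth_on_sum => // l _; exact: smooth_onX.
  move=> r Ur; apply: lt0r_neq0; apply: sum_sqr_gt0.
  by have [t' E] := ex_set_val (UI _ Ur); rewrite -E in Ur *; case: (H t' Ur).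
have [U HU] := choice H.
apply: (@smooth_on_sub _ _ _ (\bigcup_t U t)).
  by move=> r Ir; have [t tr] := ex_set_val Ir; exists t => //; rewrite -tr; case: (HU t).
by apply: smooth_on_bigcup => t; case: (HU t).
Qed.

Hypothesis oI : open I.

(** The m + 1 sections are finitely many lifts whose domains cover the interval, so one family of
    coefficients can serve all of them. *)
Lemma sect_is_lift c i : smooth_to_RP c ->
  is_lift c (I `&` [set r | sect c i r 0 i != 0]) (sect c i).
Proof.
move=> sc; have ss := smooth_sect i sc.
have sub : I `&` [set r | sect c i r 0 i != 0] `<=` I by move=> r [].
split=> //.
- apply: (open_preimage oI (@open_neq R 0)); exact: smooth_on_coord.
- exact: smooth_on_sub ss.
move=> t [It st]; split; first by apply: contraNneq st => ->; rewrite mxE.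
have [U [w [lw Ut]]] := lift_exists sc It.
by rewrite (sect_lift i lw Ut); apply: memvZ; case: lw => _ _ _ H; case: (H t Ut).
Qed.

Lemma sect_cover c r : smooth_to_RP c -> I r -> exists i, sect c i r 0 i != 0.
Proof.
move=> sc Ir; have [U [w [lw Ur]]] := lift_exists sc Ir.
have w0 : w r != 0.
  by have [t E] := ex_set_val Ir; rewrite -E in Ur *; case: lw => _ _ _ H; case: (H t Ur).
have [i wi] : exists i, w r 0 i != 0.
  apply/existsP; apply: contraNT w0; rewrite negb_exists => /forallP H.
  by apply/eqP/rowP => i; rewrite mxE; apply/eqP; have := H i; rewrite negbK.
exists i; rewrite (sect_lift i lw Ur) mxE !mulf_neq0 // invr_neq0 //.
by apply: lt0r_neq0; exact: sum_sqr_gt0.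
Qed.

(** This ensures that [line] returns the line of the perturbed vector and not its default value. *)
Definition nonvanishing C h c t : Prop :=
  forall s : I, set_val s = t -> pvec C h t (vpick (sval (c s))) != 0.

Lemma nonvanishing_lift C h c U w t : is_lift c U w -> U t ->
  nonvanishing C h c t <-> pvec C h t (w t) != 0.
Proof.
move=> [_ UI _ H] Ut; have [s st] := ex_set_val (UI _ Ut); rewrite -st in Ut *.
have [w0 /(RP_span w0)[k k0 E]] := H s Ut.
have EE : (pvec C h (set_val s) (vpick (sval (c s))) != 0) = (pvec C h (set_val s) (w (set_val s)) != 0).
  by rewrite E pvecZ scaler_eq0 (negbTE k0).
by split=> [/(_ s erefl)|h0 s' /val_inj ->]; rewrite EE.
Qed.

Lemma smooth_perturb C h c : smooth_to_RP c -> smooth_on I h ->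
  (forall t, I t -> nonvanishing C h c t) -> smooth_to_RP (perturb C h c).
Proof.
move=> sc sh nz; apply: smooth_of_lifts => r Ir.
have [U [w [lw Ur]]] := lift_exists sc Ir; exists U, (fun r => pvec C h r (w r)); split=> //.
apply: perturb_lift sh (lw) _ _ _ => //; first by case: lw.
by move=> t Ut; apply/(nonvanishing_lift C h lw Ut); apply: nz; case: lw => _ UI _ _; exact: UI.
Qed.

(** The coefficients are obtained for a given [h]. Non-vanishing is left as a premise, because it
    will follow from the smallness of [h] for all coefficients bounded by 1. *)
Lemma generic_perturbation c h : smooth_to_RP c -> smooth_on I h -> (forall t, I t -> h t != 0) ->
  exists C, (forall k s, `|C k s| <= 1) /\
    ((forall t, I t -> nonvanishing C h c t) -> forall t, I t -> good (perturb C h c) t).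
Proof.
move=> sc sh h0.
pose U (i : 'I_m.+1) := I `&` [set r | sect c i r 0 i != 0].
have UI i : U i `<=` I by move=> r [].
have oU i : open (U i) by have [] := sect_is_lift i sc.
pose x (i : 'I_m.+1) l t := sect c i t 0 (inord l).
have ss i : smooth_on (U i) (sect c i) by exact: smooth_on_sub (@UI i) (smooth_sect i sc).
have sx i l : smooth_on (U i) (x i l) by exact: smooth_on_coord.
have shU i : smooth_on (U i) h by exact: smooth_on_sub sh.
have h0U i t : U i t -> h t != 0 by move=> /UI; exact: h0.
have x0 i t : U i t -> exists2 l, (l < m.+1)%N & x i l t != 0.
  by move=> [_ /= ?]; exists (nat_of_ord i) => //; rewrite /x inord_val.
have [C [C1 CP]] := generic_wronskian oU sx shU h0U x0.
exists C; split=> // nz t It.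
have [i ti] := sect_cover sc It; have Ut : U i t by [].
have lw := sect_is_lift i sc.
exists (U i), (fun r => pvec C h r (sect c i r)); split=> //.
  apply: perturb_lift sh (lw) _ _ _ => // s Us.
  by apply/(nonvanishing_lift C h lw Us); apply: nz; exact: UI Us.
have := CP m i t (ltnSn m) Ut.
have E b s : (b < m.+1)%N -> U i s -> perturbed x h m.+1 C i b s = comps (fun r => pvec C h r (sect c i r)) b s.
  by move=> bm Us; rewrite /comps pvecE /perturbed /psum inordK.
have spv := smooth_pvec C (oU i) (shU i) (ss i).
have sc' b : smooth_on (U i) (comps (fun r => pvec C h r (sect c i r)) b) by exact: smooth_on_coord.
have sp b : (b < m.+1)%N -> smooth_on (U i) (perturbed x h m.+1 C i b).
  by move=> bm; apply: smooth_on_ext (oU i) _ (sc' b) => s /set_mem Us; rewrite E.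
have [_ D] := is_derive_wron (oU i) sp Ut.
have [W W'] := wron_ext (oU i) Ut E.
by rewrite /simple /= derive1E D /nondeg W W'.
Qed.

End Perturb.

(** * Small perturbations are close *)

Section Locally.
Variable R : realType.

(** The form of condition that [small_smooth] accepts: [eta] is a threshold for the jet of [h] at t,
    uniform for t near [t0]. *)
Definition locally_small (t0 : R) (Q : R -> R -> Prop) : Prop :=
  exists2 eta : R, 0 < eta & \forall t \near t0, Q eta t.

Definition antitone (Q : R -> R -> Prop) : Prop := forall eta eta' t, eta' <= eta -> Q eta t -> Q eta' t.

Lemma locally_small_forall (T : finType) t0 (Q : T -> R -> R -> Prop) :
  (forall i, antitone (Q i)) -> (forall i, locally_small t0 (Q i)) ->
  locally_small t0 (fun eta t => forall i, Q i eta t).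
Proof.
move=> aQ lQ.
suff [eta eta0 H] : locally_small t0 (fun eta t => forall i, i \in enum T -> Q i eta t).
  by exists eta => //; apply: filterS H => t Ht i; apply: Ht; rewrite mem_enum.
elim: (enum T) => [|i s [eta eta0 H]]; first by exists 1 => //; apply: filterE.
have [eta' eta'0 H'] := lQ i; exists (Num.min eta eta'); first by rewrite lt_min eta0.
apply: filterS2 H H' => t Ht Ht' j; rewrite inE => /orP[/eqP ->|js].
  by apply: aQ Ht'; rewrite ge_min lexx orbT.
by apply: aQ (Ht j js); rewrite ge_min lexx.
Qed.

(** Bounds turn into thresholds by eta = 1 / M, so that [locally_small_forall] handles finitely many
    of them. *)
Lemma jets_bounded (T : finType) (U : set R) (f : T -> R -> R) r t0 : open U ->
  (forall i, smooth_on U (f i)) -> U t0 ->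
  exists2 M : R, 0 < M & \forall t \near t0, forall i, jetle r M (f i) t.
Proof.
move=> oU sf Ut0.
have [i eta eta' t ee J M|i|eta eta0 H] :=
    @locally_small_forall T t0 (fun i eta t => forall M, M * eta >= 1 -> 0 < M -> jetle r M (f i) t).
- move=> M1 M0; apply: J => //; apply: le_trans M1 _; exact: ler_wpM2l (ltW M0) _ _ ee.
- have [M M0 H] := jet_bounded r oU (sf i) Ut0.
  exists M^-1; first by rewrite invr_gt0.
  by apply: filterS H => t J M'; rewrite ler_pdivlMr // mul1r => MM _; exact: jetleW J.
exists eta^-1; first by rewrite invr_gt0.
apply: filterS H => t Ht i; apply: Ht; last by rewrite invr_gt0.
by rewrite mulVf // gt_eqF.
Qed.

End Locally.

Section Closeness.
Variables (R : realType) (m : nat) (I : set R).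
Implicit Types (C : nat -> nat -> R) (h : R -> R) (c : I -> RP R m) (t : R) (A : 'M[R]_m.+1).

Definition unit_coeffs C := forall k s, `|C k s| <= 1.

Definition shift C h (w : R -> 'rV[R]_m.+1) A (b : 'I_m.+1) t : R :=
  \sum_(k < m.+1) psum C h k t (w t) * A k b.

Lemma pvec_mulmx C h (w : R -> 'rV[R]_m.+1) A b t :
  (pvec C h t (w t) *m A) 0 b = (w t *m A) 0 b + shift C h w A b t.
Proof.
by rewrite !mxE /shift -big_split; apply: eq_bigr => k _; rewrite pvecE mulrDl.
Qed.

Lemma smooth_shift C h (U : set R) w A b : open U -> smooth_on U h -> smooth_on U w ->
  smooth_on U (shift C h w A b).
Proof.
move=> oU sh sw; apply: smooth_on_sum => // k _; apply: smooth_onM => //; last exact: smooth_on_cst.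
exact: smooth_psum.
Qed.

(** The shift is a sum of products of [h] with fixed functions, with coefficients of size at most 1;
    hence [D] depends neither on [C] nor on [h]. *)
Lemma shift_jets (U : set R) w A r t0 : open U -> smooth_on U w -> U t0 ->
  exists2 D : R, 0 < D & \forall t \near t0, forall C h eta b, unit_coeffs C -> smooth_on U h ->
    jetle r eta h t -> U t -> jetle r (D * eta) (shift C h w A b) t.
Proof.
move=> oU sw Ut0.
pose G (b k s : nat) t := t ^+ (s %/ m.+1) * w t 0 (inord (s %% m.+1)) * A (inord k) (inord b).
have sG b k s : smooth_on U (G b k s).
  apply: (@smooth_onM _ _ _ (fun t => t ^+ (s %/ m.+1) * w t 0 (inord (s %% m.+1)))) => //; last exact: smooth_on_cst.
  apply: smooth_onM => //; first by apply: smooth_onX => //; exact: smooth_on_id.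
  exact: smooth_on_coord.
have [M M0 H] := @jets_bounded R ('I_m.+1 * 'I_m.+1 * 'I_(m.+1 * m.+1))%type U
  (fun i => G i.1.1 i.1.2 i.2) r t0 oU (fun i => sG _ _ _) Ut0.
exists (m.+1%:R * ((m.+1 * m.+1)%N%:R * (2 ^+ r * M))).
  by rewrite !mulr_gt0 // ?ltr0n // exprn_gt0.
apply: filterS H => t Ht C h eta b C1 sh Jh Ut.
pose F k s t := C k s * (h t * G b k s t).
have sF k s : smooth_on U (F k s).
  apply: (@smooth_onM _ _ _ (cst (C k s))) => //; first exact: smooth_on_cst.
  exact: smooth_onM.
have -> : shift C h w A b = (fun t => \sum_(k < m.+1) \sum_(s < m.+1 * m.+1) F k s t).
  apply/funext => x; apply: eq_bigr => k _; rewrite /psum mulr_suml; apply: eq_bigr => s _.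
  by rewrite /F /G !inord_val; ring.
rewrite -!mulrA; apply: (@jetle_sum _ U m.+1 (fun k t => \sum_(s < m.+1 * m.+1) F k s t)) => // [k|k km].
  by apply: smooth_on_sum.
apply: (@jetle_sum _ U _ (F k)) => // s sm.
apply: (jetle_cstmul oU) => //; first exact: smooth_onM.
apply: jetleW (jetle_mul oU sh (sG b k s) Ut Jh (Ht (b, Ordinal km, Ordinal sm))).
by rewrite [M * eta]mulrC mulrA.
Qed.

(** The coordinates before and after perturbation are u_j / u_0 and (u_j + p_j) / (u_0 + p_0), with
    shifts p bounded through the jet of [h], so [close_ratio] applies. *)
Lemma close_coords c A t0 r (e : R) : open I -> smooth_to_RP c -> coords_dom A c t0 -> 0 < e ->
  locally_small t0 (fun eta t => I t /\ forall C h, unit_coeffs C -> smooth_on I h -> jetle r eta h t ->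
    [/\ nonvanishing C h c t, coords_dom A (perturb C h c) t &
        forall k, (k <= r)%N ->
          `|derive1n k (coords A (perturb C h c)) t - derive1n k (coords A c) t| < e]).
Proof.
move=> oI sc dA e0; have It0 : I t0 by case: dA => s _ <-; exact: set_valP.
have [U [w [lw Ut0]]] := lift_exists sc It0; move: (lw) => [oU UI sw _].
have v0 := (lift_coords lw A Ut0).1.1 dA.
pose u b t := (w t *m A) 0 b.
have su b : smooth_on U (u b) by apply: smooth_on_coord => //; exact: smooth_on_mulmx.
have [D D0 HD] := shift_jets A r oU sw Ut0.
have [|b|s s0 Hs] := @locally_small_forall R 'I_m.+1 t0 (fun b s t => U t /\ forall p q,
    smooth_on U p -> smooth_on U q -> jetle r s p t -> jetle r s q t ->
    u 0 t + q t != 0 /\ forall k, (k <= r)%N ->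
     `|derive1n k (fun x => (u b x + p x) / (u 0 x + q x)) t - derive1n k (fun x => u b x / u 0 x) t| < e).
- move=> b s s' t ss [Ut H]; split=> // p q sp sq Jp Jq.
  by apply: H => //; [exact: jetleW Jp|exact: jetleW Jq].
- by have [s s0 H] := close_ratio r oU Ut0 (su b) (su 0) v0 e0; exists s.
exists (s / D); first by rewrite divr_gt0.
have HW := open_nbhs_nbhs (conj (open_lift_dom lw (A := A)) (conj Ut0 v0 : (U `&` [set x | (w x *m A) 0 0 != 0]) t0)).
apply: filterS3 HD Hs HW => t JD Hs Wt; have [Ut _] := Hs 0; split; first exact: UI.
move=> C h C1 sh Jh; have shU := smooth_on_sub UI sh.
have Jb b : jetle r s (shift C h w A b) t.
  by have := JD C h _ b C1 shU Jh Ut; rewrite mulrCA divff ?mulr1 // gt_eqF.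
have sb b := smooth_shift C A b oU shU sw.
have g0 : u 0 t + shift C h w A 0 t != 0 by have [_ /(_ _ _ (sb 0) (sb 0) (Jb 0) (Jb 0))[]] := Hs 0.
pose V := U `&` [set x | (pvec C h x (w x) *m A) 0 0 != 0].
have spA b : smooth_on U (fun x => (pvec C h x (w x) *m A) 0 b).
  by apply: smooth_on_coord => //; apply: smooth_on_mulmx => //; exact: smooth_pvec.
have oV : open V by apply: (open_preimage oU (@open_neq R 0)) => //; exact: spA.
have VU : V `<=` U by move=> x [].
have Vt : V t by split=> //; rewrite /= pvec_mulmx.
have pv x : (pvec C h x (w x) *m A) 0 0 != 0 -> pvec C h x (w x) != 0.
  by apply: contraNneq => ->; rewrite mul0mx mxE.
have lp : is_lift (perturb C h c) V (fun x => pvec C h x (w x)).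
  by apply: perturb_lift sh (lw) oV VU _ => x [_]; exact: pv.
have dp : coords_dom A (perturb C h c) t by apply/(lift_coords lp A Vt).1; case: Vt.
split=> //; first by apply/(nonvanishing_lift C h lw Ut); apply: pv; case: Vt.
move=> k kr; apply/mx_normr_ltP => // i j; rewrite ord1.
have sp := smooth_lift_coords lp A; have sC := smooth_lift_coords lw A.
have oW := open_lift_dom lw (A := A); have oW' := open_lift_dom lp (A := A).
have Wt' : (V `&` [set x | (pvec C h x (w x) *m A) 0 0 != 0]) t by split=> //; case: Vt.
rewrite [X in `|X|]mxE [X in _ + X]mxE -(derive1n_coord j k oW' sp Wt') -(derive1n_coord j k oW sC Wt).
have [_ /(_ _ _ (sb (lift ord0 j)) (sb 0) (Jb _) (Jb _))[_ /(_ k kr)]] := Hs (lift ord0 j).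
congr (`|_ - _| < _); apply: near_derive1n.
  apply: filterS (open_nbhs_nbhs (conj oV Vt)) => x Vx.
  by rewrite (lift_coords lp A Vx).2 affineE !pvec_mulmx.
apply: filterS (open_nbhs_nbhs (conj oU Ut)) => x Ux.
by rewrite (lift_coords lw A Ux).2 affineE.
Qed.

End Closeness.

(** * Density in the Whitney topology *)

Section Topology.
Variables (R : realType) (I : set R) (m : nat).
Implicit Types (B O : set (smooth_curve I m)) (c g : smooth_curve I m).

Lemma whitney_basic_open B : whitney_basic B -> open B.
Proof.
move=> wB; exists [set B]; last exact: bigcup_set1.
by move=> _ ->; exact: finI_from1.
Qed.

Lemma open_whitney O c : open O -> O c -> exists (T : finType) (B : T -> set (smooth_curve I m)),
  (forall i, whitney_basic (B i) /\ B i c) /\ forall g, (forall i, B i g) -> O g.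
Proof.
move=> [D' sD' <-] [S D'S Sc]; have [D sD DS] := sD' _ D'S; rewrite -DS in Sc.
pose s : seq (set (smooth_curve I m)) := finmap.enum_fset D.
exists (seq_sub s), (fun i => ssval i); split=> [i|g Hg].
  by split; [exact: set_mem (sD (ssval i) (ssvalP i))|exact: Sc (ssval i) (ssvalP i)].
exists S => //; rewrite -DS.
by move=> B Bs; exact: (Hg (SeqSub Bs)).
Qed.

End Topology.

Lemma finite_set_seq_sub (A : set nat) : finite_set A -> exists (T : finType) (f : T -> nat), A `<=` range f.
Proof.
move=> /finite_seqP[s ->]; exists (seq_sub s), (fun i => ssval i) => j js.
by exists (SeqSub js).
Qed.

Section Density.
Variables (R : realType) (I : set R) (m : nat).
Hypothesis oI : open I.
Implicit Types (B O : set (smooth_curve I m)) (c g : smooth_curve I m).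

Lemma continuous_jet (c : I -> RP R m) A k t : smooth_to_RP c -> coords_dom A c t ->
  {for t, continuous (derive1n k (coords A c))}.
Proof.
move=> sc dA; have It : I t by case: dA => s _ <-; exact: set_valP.
have [U [w [lw Ut]]] := lift_exists sc It.
have v0 := (lift_coords lw A Ut).1.1 dA.
apply: smooth_on_continuous (smooth_on_derive1n k _ (smooth_lift_coords lw A)) _ => //.
exact: open_lift_dom lw A.
Qed.

Lemma basic_local B c : whitney_basic B -> B c ->
  exists (r : nat) (T : (I -> RP R m) -> R -> Prop),
    (forall g, (forall t, I t -> T g t) -> B g) /\
    forall r' t0, (r <= r')%N -> I t0 -> locally_small t0 (fun eta t => I t -> forall C h,
      unit_coeffs C -> smooth_on I h -> jetle r' eta h t -> T (perturb C h c) t).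
Proof.
move=> [c0 [r [K [A [e [HK fK KA e0 ->]]]]]] Bc.
exists r, (fun (g : I -> RP R m) t => forall i, K i t -> coords_dom (A i) g t /\
  forall k, (k <= r)%N -> `|derive1n k (coords (A i) g) t - derive1n k (coords (A i) c0) t| < e i).
split=> [g Hg i|r' t0 rr It0].
  split=> [t Kt|k t kr Kt]; have [d H] := Hg t ((HK i).2 _ Kt) i Kt => //; exact: H.
have [V Vt0 /finite_set_seq_sub[T [f Hf]]] := fK t0 It0.
pose Q (i : T) (k : 'I_r.+1) eta t := I t -> forall C h,
  unit_coeffs C -> smooth_on I h -> jetle r' eta h t -> K (f i) t ->
  coords_dom (A (f i)) (perturb C h c) t /\
    `|derive1n k (coords (A (f i)) (perturb C h c)) t - derive1n k (coords (A (f i)) c0) t| < e (f i).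
have aQ i k : antitone (Q i k).
  by move=> eta eta' t ee HQ It C h C1 sh Jh; apply: HQ => //; exact: jetleW Jh.
have lQ i k : locally_small t0 (Q i k).
  (* A compact set that misses [t0] misses a neighbourhood of it, where the condition is void. *)
  have [Kt0|nKt0] := pselect (K (f i) t0); last first.
    have cK : closed (K (f i)) by apply: compact_closed; [exact: Rhausdorff|exact: (HK (f i)).1].
    exists 1 => //; have := open_nbhs_nbhs (conj (closed_openC cK) nKt0 : open_nbhs t0 (~` K (f i))).
    by apply: filterS => t nK _ C h _ _ _ /nK.
  have [dA HA] := Bc (f i).
  have := HA k t0; rewrite -ltnS => /(_ (ltn_ord k) Kt0).
  (* Half of the slack at [t0] absorbs the variation of the distance from [c] to [c0], the other
     half the perturbation. *)
  set x := `|_| => xe; pose d := (e (f i) - x) / 2.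
  have d0 : 0 < d by rewrite divr_gt0 // subr_gt0.
  have [eta eta0 H] := close_coords r' oI (curve_smooth c) (dA _ Kt0) d0.
  exists eta => //.
  have H2 : \forall t \near t0, `|derive1n k (coords (A (f i)) c) t - derive1n k (coords (A (f i)) c0) t| < e (f i) - d.
    have cc : `|derive1n k (coords (A (f i)) c) t - derive1n k (coords (A (f i)) c0) t| @[t --> t0] --> x.
      apply: (@cvg_norm _ 'rV[R]_m); apply: (@cvgB _ 'rV[R]_m).
        exact: continuous_jet (curve_smooth c) (dA _ Kt0).
      exact: continuous_jet (curve_smooth c0) ((KA (f i)).2 _ Kt0).
    by have /cvgr_lt := cc; apply; rewrite /d; lra.
  apply: filterS2 H H2 => t [It H] H2 _ C h C1 sh Jh Kt.
  have kr : (k <= r')%N by apply: leq_trans rr; rewrite -ltnS.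
  have [_ dp /(_ k kr) H3] := H C h C1 sh Jh; split=> //.
  rewrite -(subrKA (derive1n k (coords (A (f i)) c) t)); apply: le_lt_trans (ler_normD _ _) _.
  by rewrite -[ltRHS](subrK d) [ltRHS]addrC; exact: ltrD H3 H2.
have [eta eta0 H] := @locally_small_forall R (T * 'I_r.+1)%type t0 _
  (fun i => aQ i.1 i.2) (fun i => lQ i.1 i.2).
exists eta => //; apply: filterS2 H Vt0 => t H Vt It C h C1 sh Jh i Kit.
have [j _ fj] := Hf i (ex_intro _ t (conj Kit Vt)); rewrite -fj in Kit *.
split; first by have [] := H (j, ord0) It C h C1 sh Jh Kit.
by move=> k kr; have [] := H (j, Ordinal (kr : (k < r.+1)%N)) It C h C1 sh Jh Kit.
Qed.

Lemma nonvanishing_local c r t0 : I t0 -> locally_small t0 (fun eta t => I t -> forall C h,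
  unit_coeffs C -> smooth_on I h -> jetle r eta h t -> nonvanishing C h c t).
Proof.
move=> It0; have [s st] := ex_set_val It0; have [A [_ dA _]] := centred_chart_exists (c s).
have dA0 : coords_dom A c t0 by rewrite -st; exact/coords_domP.
have [eta eta0 H] := close_coords r oI (curve_smooth c) dA0 (@ltr01 R).
exists eta => //; apply: filterS H => t [_ H] _ C h C1 sh Jh.
by have [] := H C h C1 sh Jh.
Qed.

(** Closeness to [c] and non-vanishing both become thresholds on the jet of [h]. A positive [h]
    below all of them is fixed by [small_smooth]; only then are the coefficients chosen, and none of
    their possible values can leave the neighbourhood. *)
Lemma good_dense : dense [set c : smooth_curve I m | forall t, I t -> good c t].
Proof.
move=> O [c Oc] oO; have [T [B [HB BO]]] := open_whitney oO Oc.
have [r Hr] := choice (fun i => basic_local (HB i).1 (HB i).2).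
have [P HP] := choice Hr.
pose rm := (\max_i r i)%N.
(* [None] stands for the non-vanishing of the perturbed vectors, [Some i] for the basic
   neighbourhood i. *)
pose Pm (i : option T) C h t := if i is Some i then P i (perturb C h c) t else nonvanishing C h c t.
pose Q (i : option T) (eta t : R) := I t -> forall C h,
  unit_coeffs C -> smooth_on I h -> jetle rm eta h t -> Pm i C h t.
have aQ i : antitone (Q i).
  by move=> eta eta' t ee HQ It C h C1 sh Jh; apply: HQ => //; exact: jetleW Jh.
have lQ t0 i : I t0 -> locally_small t0 (Q i).
  move=> It0; case: i => [i|]; last exact: nonvanishing_local.
  by have [_] := HP i; apply => //; exact: leq_bigmax.
have [eta eta' t ee HQ i|t It|h [sh h0 hJ]] := @small_smooth R I (fun eta t => forall i, Q i eta t) rm oI.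
- exact: aQ ee (HQ i).
- have [eta eta0 /nbhs_normP[e e0 H]] := locally_small_forall aQ (fun i => lQ t i It).
  by exists e, eta; split=> // s st; apply: H; rewrite /ball_ /= distrC.
have [C [C1 HC]] := generic_perturbation oI (curve_smooth c) sh (fun t It => lt0r_neq0 (h0 t It)).
have PT i t : I t -> Pm i C h t.
  by move=> It; have [eta [HQ J]] := hJ t It; exact: (HQ i It C h C1 sh).
have nz t (It : I t) := PT None t It.
exists (SmoothCurve (smooth_perturb (curve_smooth c) sh nz)); split; last exact: HC nz.
by apply: BO => i; have [H _] := HP i; apply: H => t It; exact: (PT (Some i)).
Qed.

End Density.

(** * Openness in the Whitney topology *)

Lemma continuous_bigop (R : realType) (V : topologicalType) (x : V) (op : R -> R -> R) (idx : R)
    (T : Type) (s : seq T) (f : T -> V -> R) :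
  (forall g h : V -> R, {for x, continuous g} -> {for x, continuous h} ->
     {for x, continuous (fun y => op (g y) (h y))}) ->
  (forall i, {for x, continuous (f i)}) ->
  {for x, continuous (fun y => \big[op/idx]_(i <- s) f i y)}.
Proof.
move=> cop cf; elim: s => [|i s IH].
  have -> : (fun y => \big[op/idx]_(i <- [::]) f i y) = cst idx.
    by apply/funext => y; rewrite big_nil.
  exact: cst_continuous.
have -> : (fun y => \big[op/idx]_(j <- i :: s) f j y) = (fun y => op (f i y) (\big[op/idx]_(j <- s) f j y)).
  by apply/funext => y; rewrite big_cons.
exact: cop.
Qed.

Lemma det_neq0_stable (R : realType) k (M0 : 'M[R]_k) : \det M0 != 0 ->
  exists2 e : R, 0 < e & forall M : 'M[R]_k, (forall i j, `|M i j - M0 i j| < e) -> \det M != 0.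
Proof.
move=> d0; have cdet : {for M0, continuous (fun M : 'M[R]_k => \det M)}.
  apply: continuous_bigop => [g h|s]; first exact: continuousD.
  apply: continuousM; first exact: cst_continuous.
  apply: continuous_bigop => [g h|i]; first exact: continuousM.
  exact: coord_continuous.
have /nbhs_normP[e /= e0 H] : \forall M \near M0, \det M != 0.
  have cc : `|\det M| @[M --> M0] --> `|\det M0| by exact: cvg_norm cdet.
  have /cvgr_gt := cc => /(_ 0); rewrite normr_gt0 => /(_ d0).
  by apply: filterS => M; rewrite normr_gt0.
exists e => // M HM; apply: H; rewrite /ball_ /=; apply/mx_normr_ltP => // i j.
by rewrite !mxE distrC.
Qed.

Section Openness.
Variables (R : realType) (I : set R).

(** [sigma] chooses the orders of derivation: the identity gives the Wronskian, and sending the last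
    index k - 1 to k gives its derivative. *)
Definition jet_mx k (sigma : nat -> nat) (f : R -> 'rV[R]_k) t : 'M[R]_k :=
  \matrix_(a < k, b < k) derive1n (sigma a).+1 f t 0 b.

Lemma jet_mxE k sigma f t a b : @jet_mx k sigma f t a b = derive1n (sigma a).+1 f t 0 b.
Proof. by rewrite mxE. Qed.

Lemma nondeg_jet k (U : set R) (f : R -> 'rV[R]_k) t : open U -> smooth_on U f -> U t ->
  nondeg k (fun b => derive1 (affj f b)) t =
  (\det (jet_mx id f t) != 0) || (\det (jet_mx (fun a => if a.+1 == k then k else a) f t) != 0).
Proof.
move=> oU sf Ut.
have E sigma : \matrix_(a < k, b < k) derive1n (sigma (nat_of_ord a)) (derive1 (affj f b)) t = jet_mx sigma f t.
  apply/matrixP => a b; rewrite jet_mxE mxE affjE -(derive1n_coord b _ oU sf Ut).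
  by rewrite derive1Sn.
by rewrite /nondeg /wron /wron' (E id) (E (fun a => if a.+1 == k then k else a)).
Qed.

Lemma good_coords k (c : I -> RP R k.+1) A t : smooth_to_RP c -> A \in unitmx -> coords_dom A c t ->
  good c t <-> nondeg k.+1 (fun b => derive1 (affj (coords A c) b)) t.
Proof.
move=> sc Au dA; have It : I t by case: dA => s _ <-; exact: set_valP.
split=> [[U [w [lw Ut]]]|nd].
  by rewrite (nondeg_coords lw Au Ut ((lift_coords lw A Ut).1.1 dA)).2.
have [U [w [lw Ut]]] := lift_exists sc It; exists U, w; split=> //.
by rewrite (nondeg_coords lw Au Ut ((lift_coords lw A Ut).1.1 dA)).2.
Qed.

Lemma coords_smooth k (c : I -> RP R k) A t : smooth_to_RP c -> coords_dom A c t ->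
  exists U, [/\ open U, U t, U `<=` coords_dom A c & smooth_on U (coords A c)].
Proof.
move=> sc dA; have It : I t by case: dA => s _ <-; exact: set_valP.
have [U [w [lw Ut]]] := lift_exists sc It.
exists (U `&` [set r | (w r *m A) 0 0 != 0]); split.
- exact: open_lift_dom lw A.
- by split=> //; exact: (lift_coords lw A Ut).1.1.
- by move=> x [Ux wx]; apply/(lift_coords lw A Ux).1.
- exact: smooth_lift_coords lw A.
Qed.

Section Stability.
Variables (k : nat).
Implicit Types (c g : smooth_curve I k.+1) (A : 'M[R]_k.+2).

(** In dimension k + 1 the last row of [wron'] has order k + 2 in the coordinates. Closeness is
    tested in one chart, as in the basic sets of the topology. *)
Definition stable c A (e : R) (S : set R) : Prop :=
  [/\ A \in unitmx, 0 < e, S `<=` coords_dom A c &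
    forall t g, S t -> coords_dom A g t ->
      (forall l, (l <= k.+2)%N -> `|derive1n l (coords A g) t - derive1n l (coords A c) t| < e) -> good g t].

Lemma jet_det_stable (sigma : nat -> nat) c A t0 : (forall a, (a < k.+1)%N -> (sigma a <= k.+1)%N) ->
  coords_dom A c t0 -> \det (jet_mx sigma (coords A c) t0) != 0 ->
  exists2 e : R, 0 < e & \forall t \near t0, forall g : smooth_curve I k.+1,
    (forall l, (l <= k.+2)%N -> `|derive1n l (coords A g) t - derive1n l (coords A c) t| < e) ->
    \det (jet_mx sigma (coords A g) t) != 0.
Proof.
move=> hs dA /det_neq0_stable[e e0 He].
exists (e / 2); first by rewrite divr_gt0.
have H0 (l : 'I_k.+3) : \forall t \near t0, `|derive1n l (coords A c) t - derive1n l (coords A c) t0| < e / 2.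
  have := @continuous_jet R I _ c A l t0 (curve_smooth c) dA; move=> /cvgr_dist_lt /(_ (e / 2)).
  rewrite divr_gt0 // => /(_ isT); apply: filterS => t; by rewrite distrC.
have H : \forall t \near t0, forall l : 'I_k.+3, `|derive1n l (coords A c) t - derive1n l (coords A c) t0| < e / 2.
  exact: (filter_forall _ H0).
apply: filterS H => t Ht g Hg; apply: He => a b; rewrite !jet_mxE.
have sa : ((sigma a).+1 < k.+3)%N by rewrite !ltnS hs.
have H1 := Ht (Ordinal sa); have H2 := Hg (sigma a).+1 sa.
have [E1 E2] : `|derive1n (sigma a).+1 (coords A c) t 0 b - derive1n (sigma a).+1 (coords A c) t0 0 b| < e / 2 /\
    `|derive1n (sigma a).+1 (coords A g) t 0 b - derive1n (sigma a).+1 (coords A c) t 0 b| < e / 2.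
  split; [apply: le_lt_trans H1|apply: le_lt_trans H2].
    by apply: le_trans (mx_normr_entry _ 0 b); rewrite !mxE.
  by apply: le_trans (mx_normr_entry _ 0 b); rewrite !mxE.
rewrite -(subrKA (derive1n (sigma a).+1 (coords A c) t 0 b)).
apply: le_lt_trans (ler_normD _ _) _; rewrite [ltRHS]splitr; exact: ltrD E2 E1.
Qed.

(** One of the two determinants is non-zero at [t0]; it stays so for nearby t and for all curves
    with a nearby jet, which are then good by the same determinant. *)
Lemma stable_local c t0 : I t0 -> good c t0 ->
  exists2 d : R, 0 < d & exists A e, stable c A e [set x | `|x - t0| < d].
Proof.
move=> It0 gc; have [s st] := ex_set_val It0; have [A [Au dA0 _]] := centred_chart_exists (c s).
have dA : coords_dom A c t0 by rewrite -st; exact/coords_domP.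
have [U [oU Ut sU sf]] := coords_smooth (curve_smooth c) dA.
have [e e0 H] : exists2 e : R, 0 < e & \forall t \near t0, forall g : smooth_curve I k.+1,
    coords_dom A g t ->
    (forall l, (l <= k.+2)%N -> `|derive1n l (coords A g) t - derive1n l (coords A c) t| < e) -> good g t.
  have := (good_coords (curve_smooth c) Au dA).1 gc; rewrite (nondeg_jet oU sf Ut) => /orP[]W.
    have [a ak|e e0 H] := jet_det_stable _ dA W; first exact: ltnW.
    exists e => //; apply: filterS H => t H g dg Hg; apply/(good_coords (curve_smooth g) Au dg).
    have [V [oV Vt _ sg]] := coords_smooth (curve_smooth g) dg.
    by rewrite (nondeg_jet oV sg Vt); apply/orP; left; exact: H Hg.
  have [a ak|e e0 H] := jet_det_stable _ dA W; first by case: ifP => // _; exact: ltnW.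
  exists e => //; apply: filterS H => t H g dg Hg; apply/(good_coords (curve_smooth g) Au dg).
  have [V [oV Vt _ sg]] := coords_smooth (curve_smooth g) dg.
  by rewrite (nondeg_jet oV sg Vt); apply/orP; right; exact: H Hg.
have HU : \forall t \near t0, coords_dom A c t by apply: filterS (open_nbhs_nbhs (conj oU Ut)).
have /nbhs_normP[d /= d0 Hd] : \forall t \near t0, (forall g : smooth_curve I k.+1, coords_dom A g t ->
    (forall l, (l <= k.+2)%N -> `|derive1n l (coords A g) t - derive1n l (coords A c) t| < e) -> good g t) /\
    coords_dom A c t by exact: filterI.
have dd x : `|x - t0| < d -> ball_ Num.norm t0 d x by rewrite /ball_ /= distrC.
exists d => //; exists A, e; split=> // [x /dd /Hd[]//|t g /dd /Hd[H' _]]; exact: H'.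
Qed.

Hypothesis oI : open I.

Lemma good_open : open [set c : smooth_curve I k.+1 | forall t, I t -> good c t].
Proof.
rewrite openE => c gc.
have [X Y XY [A [e [Au e0 dA HA]]]|t It|a [r [s [H1 H2 H3]]]] :=
    @locally_finite_cover R I (fun S => exists A e, stable c A e S) oI.
- by exists A, e; split=> // [x /XY /dA|t g /XY]; [|exact: HA].
- exact: stable_local (gc t It).
(* The intervals of radius r already cover, and lie in the cells on which stability holds. Indices
   outside [s] give the empty set, with a default chart and bound below. *)
pose K i := [set x : R | s i /\ `|x - a i| <= r i].
have /choice[Ae HAe] : forall i, exists Ae : 'M[R]_k.+2 * R,
    [/\ Ae.1 \in unitmx, 0 < Ae.2 & s i -> stable c Ae.1 Ae.2 (cell (a i) (r i))].
  move=> i; have [si|nsi] := pselect (s i); last by exists (1%:M, 1); rewrite unitmx1.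
  by have [_ _ [A [e st]]] := H1 i si; exists (A, e); case: (st).
have Kcell i : K i `<=` cell (a i) (r i).
  by move=> x [si xa]; have [r0 _ _] := H1 i si; rewrite /cell /=; lra.
have Ks i t : K i t -> s i by case.
pose B := [set g : smooth_curve I k.+1 | forall i, K i `<=` coords_dom (Ae i).1 g /\
  forall l t, (l <= k.+2)%N -> K i t ->
    `|derive1n l (coords (Ae i).1 g) t - derive1n l (coords (Ae i).1 c) t| < (Ae i).2].
have Kc i : K i `<=` coords_dom (Ae i).1 c.
  by move=> t Kt; have [_ _ /(_ (Ks i t Kt))[_ _ + _]] := HAe i; apply; exact: Kcell.
have oB : open B.
  apply: whitney_basic_open; exists c, k.+2, K, (fun i => (Ae i).1), (fun i => (Ae i).2); split=> //.
  - move=> i; split.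
      have [si|nsi] := pselect (s i); last first.
        have -> : K i = set0 by apply/seteqP; split=> x [].
        exact: compact0.
      have -> : K i = `[a i - r i, a i + r i]%classic; last exact: segment_compact.
      by apply/seteqP; split=> x; rewrite /K /= in_itv /= -ler_distl // => -[].
    by move=> t Kt; have [_ + _] := H1 i (Ks i t Kt); apply; exact: Kcell.
  - move=> t It; have [d [N [d0 HN]]] := H3 t It.
    exists [set x | `|x - t| < d].
      by apply/nbhs_normP; exists d => // x; rewrite /ball_ /= distrC.
    apply: (@sub_finite_set _ _ `I_N) => // i [x [Kx xd]].
    exact: HN (Ks i x Kx) xd (Kcell i x Kx).
  - by move=> i; split=> //; have [] := HAe i.
  - by move=> i; have [] := HAe i.
have Bc : B c by move=> i; split=> // l t _ _; rewrite subrr normr0; have [] := HAe i.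
apply: filterS (open_nbhs_nbhs (conj oB Bc)) => g Bg t It.
have [i si ti] := H2 t It; have Kt : K i t by [].
have [Kg Hg] := Bg i; have [_ _ /(_ si)[_ _ _ +]] := HAe i; apply.
- exact: Kcell Kt.
- exact: Kg.
by move=> l lk; exact: Hg.
Qed.

End Stability.
End Openness.

(** * Genericity of good curves *)

Lemma generic_good (R : realType) (I : set R) k (P : set (smooth_curve I k.+1)) : open I ->
  (forall c : smooth_curve I k.+1, (forall t : I, good c (set_val t)) -> P c) -> generic P.
Proof.
move=> oI HP; exists [set c : smooth_curve I k.+1 | forall t, I t -> good c t]; split.
- exact: good_open.
- exact: good_dense.
by move=> c gc; apply: HP => t; apply: gc; exact: set_valP.
Qed.

Theorem theorem2p6 (R : realType) (I : set R)
    (I_open : open I) (I_itv : is_interval I) :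
  generic (fun c : smooth_curve I 3 =>
    forall t0 : I, finite_type c t0 /\
      (tan_diffeomorphic c t0 (@cuspidal_edge R 3) \/
       tan_diffeomorphic c t0 (@folded_umbrella R)))
  /\
  (forall N : nat, (4 <= N + 1)%N ->
   generic (fun c : smooth_curve I (N + 1)%N =>
    forall t0 : I, finite_type c t0 /\
      tan_diffeomorphic c t0 (@cuspidal_edge R (N + 1)%N))).
Proof.
split=> [|N]; first apply: generic_good => // c gc t0.
  by split; [exact: good_finite_type|exact: good_space_curve].
rewrite addn1; case: N => [|[|[|n]]] // _; apply: generic_good => // c gc t0.
by split; [exact: good_finite_type|exact: good_cuspidal_edge].
Qed.
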